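(* Let $M$ be a normal metric contact pair manifold with structure $(\alpha_1,\alpha_2,\phi,g)$, where $(\alpha_1,\alpha_2)$ is a contact pair of type $(m,n)$ with $m\ge 1$, $n\ge 0$ and $\phi$ is decomposable. Suppose that $(M,g)$ is complete and locally symmetric. Then either the universal covering space of $M$ is a Calabi-Eckmann manifold $S^{2m+1}(1)\times S^{2n+1}(1)$ and $M$ is compact, or the universal covering space of $M$ is $S^{2m+1}(1)\times\mathbb{R}$.
   Context: Contact pair: a pair of 1-forms $(\alpha_1,\alpha_2)$ on a manifold $M$ is a contact pair of type $(m,n)$ if $\alpha_1\wedge(d\alpha_1)^m\wedge\alpha_2\wedge(d\alpha_2)^n$ is a volume form, $(d\alpha_1)^{m+1}=0$ and $(d\alpha_2)^{n+1}=0$ (so $\dim M=2m+2n+2$). By convention $m\ge1$, $n\ge0$. The convention $d\alpha(X,Y)=\frac12\big(X\alpha(Y)-Y\alpha(X)-\alpha([X,Y])\big)$ is used. Characteristic foliations: the subbundles $\{X:\alpha_i(X)=0,\ d\alpha_i(X,Y)=0\ \forall Y\}$, $i=1,2$, are integrable; the corresponding foliations are denoted $\mathcal F_1$ and $\mathcal F_2$. Reeb vector fields: $Z_1,Z_2$ are the unique vector fields with $\alpha_i(Z_j)=\delta_{ij}$ and $i_{Z_i}d\alpha_j=0$ for all $i,j\in\{1,2\}$. Contact pair structure: a triple $(\alpha_1,\alpha_2,\phi)$ with $(\alpha_1,\alpha_2)$ a contact pair and $\phi$ a $(1,1)$-tensor field with $\phi^2=-\mathrm{Id}+\alpha_1\otimes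 Z_1+\alpha_2\otimes Z_2$ and $\phi Z_1=\phi Z_2=0$. The endomorphism $\phi$ is decomposable if $\phi(T\mathcal F_i)\subset T\mathcal F_i$ for $i=1,2$. Normality: $(\alpha_1,\alpha_2,\phi)$ is normal if $[\phi,\phi](X,Y)+2d\alpha_1(X,Y)Z_1+2d\alpha_2(X,Y)Z_2=0$ for all $X,Y$, where $[\phi,\phi](X,Y)=\phi^2[X,Y]+[\phi X,\phi Y]-\phi[\phi X,Y]-\phi[X,\phi Y]$ is the Nijenhuis tensor. Metric contact pair: a four-tuple $(\alpha_1,\alpha_2,\phi,g)$ where $(\alpha_1,\alpha_2,\phi)$ is a contact pair structure and $g$ is a Riemannian metric with $g(X,\phi Y)=(d\alpha_1+d\alpha_2)(X,Y)$ and $g(X,Z_i)=\alpha_i(X)$, $i=1,2$, for all $X,Y$. It is normal if $(\alpha_1,\alpha_2,\phi)$ is normal. $S^{k}(1)$ is the $k$-sphere with its metric of constant curvature $+1$; products carry the product metric. The universal covering carries the metric lifted from $g$, and ''is'' means ''is isometric to''. Manifolds are connected. Locally symmetric means $\nabla R=0$. *)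

(* Defs.v *)
From HB Require Import structures.
From mathcomp Require Import all_boot all_order all_algebra all_fingroup.
From mathcomp Require Import all_classical all_reals all_analysis.
From mathcomp Require Import ring.

Set Implicit Arguments.
Unset Strict Implicit.
Unset Printing Implicit Defensive.

Import Order.TTheory GRing.Theory Num.Theory.
Import numFieldNormedType.Exports.

Local Open Scope classical_set_scope.
Local Open Scope ring_scope.

Section Cinfinity.
Context {R : realType} {V : normedModType R}.
Implicit Types (U : set V) (f g : V -> R).

(* All directional derivatives up to order k exist and are continuous on the
   open set U; this is C^k regularity when V is finite-dimensional. *)
Fixpoint Ck (k : nat) U f : Prop :=
  if k is k'.+1 then
    [/\ forall x, U x -> {for x, continuous f},
        forall v x, U x -> derivable f x v
      & forall v, Ck k' U ('D_v f)]
  else forall x, U x -> {for x, continuous f}.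

Definition Coo U f := forall k, Ck k U f.

Definition Coo_at (x : V) f := exists U, [/\ open U, U x & Coo U f].

Lemma Ck_cont k U f : Ck k U f -> forall x, U x -> {for x, continuous f}.
Proof. by case: k => [|k] // []. Qed.

Lemma CkS k U f : Ck k.+1 U f -> Ck k U f.
Proof.
elim: k f => [|k IH] f; first by case.
by move=> [? ? Df]; split=> // v; apply: IH.
Qed.

Lemma Ck_sub k U U' f : U' `<=` U -> Ck k U f -> Ck k U' f.
Proof.
move=> UU'; elim: k f => [|k IH] f /=; first by move=> cf x /UU' /cf.
by move=> [cf df Df]; split=> [x /UU' /cf //|v x /UU' /df//|v]; apply: IH.
Qed.

Lemma Ck_eq k U f g : open U -> (forall x, U x -> f x = g x) ->
  Ck k U f -> Ck k U g.
Proof.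
move=> oU; elim: k f g => [|k IH] f g fg.
  move=> cf x Ux; have nfg : \forall y \near x, f y = g y.
    by apply: filterS (open_nbhs_nbhs (conj oU Ux)) => y /fg.
  rewrite /prop_for /continuous_at -(fg _ Ux).
  apply: cvg_trans (cf x Ux); apply: near_eq_cvg.
  exact: nfg.
move=> Cf; have nfg x : U x -> \forall y \near x, f y = g y.
  by move=> Ux; apply: filterS (open_nbhs_nbhs (conj oU Ux)) => y /fg.
case: (Cf) => cf df Df; split=> [x Ux|v x Ux|v].
- rewrite /prop_for /continuous_at -(fg _ Ux).
  apply: cvg_trans (cf x Ux); apply: near_eq_cvg; exact: nfg.
- by apply: near_eq_derivable (df v x Ux); exact: nfg.
- apply: IH (Df v) => x Ux; apply: near_eq_derive; exact: nfg.
Qed.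

Lemma Ck_cst k U c : Ck k U (cst c : V -> R).
Proof.
elim: k c => [|k IH] c /=; first by move=> x _; exact: cvg_cst.
split=> [x _|v x _|v]; [exact: cvg_cst|exact: derivable_cst|].
have -> : 'D_v (cst c : V -> R) = cst 0 by apply/funext => x; rewrite derive_cst.
exact: IH.
Qed.

Lemma CkD k U f g : open U -> Ck k U f -> Ck k U g -> Ck k U (f + g).
Proof.
move=> oU; elim: k f g => [|k IH] f g.
  by move=> cf cg x Ux; apply: cvgD; [exact: cf|exact: cg].
move=> [cf df Df] [cg dg Dg]; split=> [x Ux|v x Ux|v].
- by apply: cvgD; [exact: cf|exact: cg].
- by apply: derivableD; [exact: df|exact: dg].
- apply: Ck_eq (IH _ _ (Df v) (Dg v)) => // x Ux.
  by rewrite deriveD; [|exact: df|exact: dg].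
Qed.

Lemma CkM k U f g : open U -> Ck k U f -> Ck k U g -> Ck k U (f * g).
Proof.
move=> oU; elim: k f g => [|k IH] f g.
  by move=> cf cg x Ux; apply: cvgM; [exact: cf|exact: cg].
move=> Cf Cg; case: (Cf) => cf df Df; case: (Cg) => cg dg Dg.
split=> [x Ux|v x Ux|v].
- by apply: cvgM; [exact: cf|exact: cg].
- by apply: derivableM; [exact: df|exact: dg].
- apply: Ck_eq (CkD oU (IH _ _ (CkS Cf) (Dg v)) (IH _ _ (CkS Cg) (Df v))) => //.
  by move=> x Ux; rewrite deriveM; [|exact: df|exact: dg].
Qed.

Lemma Coo_at_cst c x : Coo_at x (cst c : V -> R).
Proof. by exists setT; split=> [||k]; [exact: openT| |exact: Ck_cst]. Qed.

Lemma Coo_at_op (op : (V -> R) -> (V -> R) -> (V -> R)) :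
  (forall k U f g, open U -> Ck k U f -> Ck k U g -> Ck k U (op f g)) ->
  forall x f g, Coo_at x f -> Coo_at x g -> Coo_at x (op f g).
Proof.
move=> H x f g [U [oU Ux Cf]] [W [oW Wx Cg]].
have oUW : open (U `&` W) by exact: openI.
exists (U `&` W); split=> // k; apply: H => //.
  by apply: Ck_sub (Cf k) => y [].
by apply: Ck_sub (Cg k) => y [].
Qed.

Lemma Coo_atD x f g : Coo_at x f -> Coo_at x g -> Coo_at x (f + g).
Proof. exact: (Coo_at_op CkD). Qed.

Lemma Coo_atM x f g : Coo_at x f -> Coo_at x g -> Coo_at x (f * g).
Proof. exact: (Coo_at_op CkM). Qed.

Lemma Coo_at_near x f g : Coo_at x f -> (\forall y \near x, f y = g y) ->
  Coo_at x g.
Proof.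
move=> [U [oU Ux Cf]] nfg; have : nbhs x (fun y => f y = g y) := nfg.
rewrite nbhsE => -[W [oW Wx] fg].
have oUW : open (U `&` W) by exact: openI.
exists (U `&` W); split=> // k; apply: (@Ck_eq _ _ f) => //.
  by move=> y [_ /fg].
by apply: Ck_sub (Cf k) => y [].
Qed.

Lemma Coo_at_derivable x f v : Coo_at x f -> derivable f x v.
Proof. by move=> [U [_ Ux /(_ 1%N)[_ df _]]]; exact: df. Qed.

End Cinfinity.

(* A space with a structure sheaf of smooth functions: [smooth_at p f] says
   that f is smooth on a neighbourhood of p.  A smooth manifold is such a
   space that is Hausdorff, second countable and locally isomorphic to R^d
   with its sheaf of C^oo functions (see [is_manifold]); this is the same
   data as a maximal smooth atlas. *)
Record smoothSpace (R : realType) := SmoothSpace {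
  space_sort :> topologicalType;
  smooth_at : space_sort -> set (space_sort -> R);
  smooth_at_near : forall p f g, smooth_at p f ->
    (\forall q \near p, f q = g q) -> smooth_at p g;
  smooth_at_cst : forall p c, smooth_at p (cst c);
  smooth_atD : forall p f g,
    smooth_at p f -> smooth_at p g -> smooth_at p (f + g);
  smooth_atM : forall p f g,
    smooth_at p f -> smooth_at p g -> smooth_at p (f * g)
}.
Arguments smooth_at {R} s p f.

Definition smoothV (R : realType) (V : normedModType R) : smoothSpace R :=
  @SmoothSpace R V (@Coo_at R V)
    (fun p f g => @Coo_at_near R V p f g) (fun p c => @Coo_at_cst R V c p)
    (@Coo_atD R V) (@Coo_atM R V).

(* The smooth structure induced on a subset A of a normed space: the local
   restrictions of smooth functions of V.  On an embedded submanifold it is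
   the submanifold structure. *)
Section Embedded.
Context {R : realType} {V : normedModType R} (A : set V).

Definition embedded_smooth_at (p : set_type A) (f : set_type A -> R) : Prop :=
  exists2 F : V -> R, Coo_at (set_val p) F
                    & \forall q \near p, f q = F (set_val q).

Lemma embedded_near p f g : embedded_smooth_at p f ->
  (\forall q \near p, f q = g q) -> embedded_smooth_at p g.
Proof.
move=> [F sF fF] fg; exists F => //.
by apply: filterS2 fF fg => q <- <-.
Qed.

Lemma embedded_cst p c : embedded_smooth_at p (cst c).
Proof. by exists (cst c); [exact: Coo_at_cst|exact: filterE]. Qed.

Lemma embeddedD p f g : embedded_smooth_at p f -> embedded_smooth_at p g ->
  embedded_smooth_at p (f + g).
Proof.
move=> [F sF fF] [G sG gG]; exists (F + G); first exact: Coo_atD.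
by apply: filterS2 fF gG => q; rewrite !fctE => -> ->.
Qed.

Lemma embeddedM p f g : embedded_smooth_at p f -> embedded_smooth_at p g ->
  embedded_smooth_at p (f * g).
Proof.
move=> [F sF fF] [G sG gG]; exists (F * G); first exact: Coo_atM.
by apply: filterS2 fF gG => q; rewrite !fctE => -> ->.
Qed.

Definition embedded : smoothSpace R :=
  @SmoothSpace R (set_type A) embedded_smooth_at
    embedded_near embedded_cst embeddedD embeddedM.

End Embedded.

Section SmoothFunctions.
Context {R : realType} (M : smoothSpace R).

Definition smooth_pred : {pred M -> R} :=
  mem [set f : M -> R | forall p, smooth_at M p f].

Lemma smooth_subring : subring_closed smooth_pred.
Proof.
split.
- by rewrite inE => p; exact: smooth_at_cst.
- move=> f g; rewrite !inE => sf sg p; apply: smooth_atD => //.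
  have -> : - g = cst (-1) * g by apply/funext => x; rewrite !fctE mulN1r.
  by apply: smooth_atM => //; exact: smooth_at_cst.
- by move=> f g; rewrite !inE => sf sg p; exact: smooth_atM.
Qed.

Lemma smooth_submod : submod_closed smooth_pred.
Proof.
split; first by rewrite inE => p; exact: smooth_at_cst.
move=> a f g; rewrite !inE => sf sg p; apply: smooth_atD => //.
have -> : a *: f = cst a * f by apply/funext => x; rewrite !fctE.
by apply: smooth_atM => //; exact: smooth_at_cst.
Qed.


Record smoothFun := SmoothFun {
  smoothFun_val :> M -> R; smoothFunP : smoothFun_val \in smooth_pred }.

HB.instance Definition _ := [isSub for smoothFun_val].
HB.instance Definition _ := [Choice of smoothFun by <:].
HB.instance Definition _ := GRing.SubChoice_isSubComPzRing.Build
  (M -> R) smooth_pred smoothFun smooth_subring.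
HB.instance Definition _ := GRing.SubZmodule_isSubLmodule.Build
  R (M -> R) smooth_pred smoothFun smooth_submod.

Lemma smooth_inP (f : M -> R) :
  (forall p, smooth_at M p f) -> f \in smooth_pred.
Proof. by move=> ?; rewrite inE. Qed.

Lemma smoothFun_at (f : smoothFun) p : smooth_at M p f.
Proof. by case: f => f /=; rewrite inE. Qed.

Lemma smoothFun_eqP (f g : smoothFun) : f =1 g -> f = g.
Proof. by move=> fg; apply/val_inj/funext. Qed.

End SmoothFunctions.

Section Tangent.
Context {R : realType} (M : smoothSpace R).
Notation C := (smoothFun M).

Definition tangent_pred (p : M) : {pred C -> R} :=
  mem [set v : C -> R |
    (forall (a : R) (f g : C), v (a *: f + g) = a * v f + v g) /\
    (forall f g : C, v (f * g) = v f * g p + f p * v g)].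

Lemma tangent_submod p : submod_closed (tangent_pred p).
Proof.
split.
  by rewrite inE; split=> *; rewrite /= ?(mulr0, mul0r, addr0).
move=> a u v; rewrite !inE => -[uL uM] [vL vM].
split=> [b f g|f g]; rewrite !fctE /GRing.scale /=.
  by rewrite uL vL; ring.
by rewrite uM vM; ring.
Qed.

(* the tangent space at p: derivations at p of the algebra of smooth
   functions *)
Record tangent (p : M) := Tangent {
  tangent_val :> C -> R; tangentP : tangent_val \in tangent_pred p }.

HB.instance Definition _ p := [isSub for @tangent_val p].
HB.instance Definition _ p := [Choice of tangent p by <:].
HB.instance Definition _ p := GRing.SubChoice_isSubZmodule.Build
  (C -> R) (tangent_pred p) (tangent p) (GRing.submod_closedB (tangent_submod p)).
HB.instance Definition _ p := GRing.SubZmodule_isSubLmodule.Build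
  R (C -> R) (tangent_pred p) (tangent p) (tangent_submod p).

Lemma tangent_linear p (v : tangent p) (a : R) (f g : C) :
  v (a *: f + g) = a * v f + v g.
Proof. by case: v => v /=; rewrite inE => -[]. Qed.

Lemma tangent_leibniz p (v : tangent p) (f g : C) :
  v (f * g) = v f * g p + f p * v g.
Proof. by case: v => v /=; rewrite inE => -[]. Qed.

Definition vfield_pred : {pred C -> C^o} :=
  mem [set X : C -> C^o |
    (forall (a : R) (f g : C), (X (a *: f + g) : C) = a *: (X f : C) + X g) /\
    (forall f g : C, (X (f * g) : C) = (X f : C) * g + f * X g)].

Lemma vfield_submod : submod_closed vfield_pred.
Proof.
split.
  rewrite inE; split=> * /=.
    by rewrite scaler0 addr0.
  by rewrite mul0r mulr0 addr0.
move=> h X Y; rewrite !inE => -[XL XM] [YL YM].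
split=> [b f g|f g]; rewrite !fctE /=; apply: smoothFun_eqP => p.
  by rewrite XL YL /GRing.scale /= !fctE /GRing.scale /=; ring.
by rewrite XM YM /GRing.scale /= !fctE; ring.
Qed.

(* smooth vector fields, as derivations of the algebra of smooth functions;
   they form a module over that algebra *)
Record vfield := VField {
  vfield_val :> C -> C;
  vfieldP : (vfield_val : C -> C^o) \in vfield_pred }.

HB.instance Definition _ := [isSub of vfield for vfield_val : vfield -> C -> C^o].
HB.instance Definition _ := [Choice of vfield by <:].
HB.instance Definition _ := GRing.SubChoice_isSubZmodule.Build
  (C -> C^o) vfield_pred vfield (GRing.submod_closedB vfield_submod).
HB.instance Definition _ := GRing.SubZmodule_isSubLmodule.Build
  C (C -> C^o) vfield_pred vfield vfield_submod.

Lemma vfield_linear (X : vfield) (a : R) (f g : C) :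
  X (a *: f + g) = a *: X f + X g.
Proof. by case: X => X /=; rewrite inE => -[]. Qed.

Lemma vfield_leibniz (X : vfield) (f g : C) : X (f * g) = X f * g + f * X g.
Proof. by case: X => X /=; rewrite inE => -[]. Qed.

Lemma vfield_at_subproof (X : vfield) p :
  (fun f : C => X f p) \in tangent_pred p.
Proof.
rewrite inE; split=> [a f g|f g].
  by rewrite vfield_linear.
by rewrite vfield_leibniz.
Qed.

Definition vfield_at (X : vfield) p : tangent p :=
  Tangent (vfield_at_subproof X p).

Lemma lie_subproof (X Y : vfield) :
  ((fun f : C => X (Y f) - Y (X f)) : C -> C^o) \in vfield_pred.
Proof.
have D (Z : vfield) (f g : C) : Z (f + g) = Z f + Z g.
  by rewrite -[f in LHS]scale1r vfield_linear scale1r.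
rewrite inE; split=> [a f g|f g].
  rewrite !vfield_linear scalerBr; apply: smoothFun_eqP => p.
  by rewrite /= !fctE /=; ring.
rewrite !vfield_leibniz !D !vfield_leibniz; apply: smoothFun_eqP => p.
by rewrite /= !fctE /=; ring.
Qed.

Definition lie (X Y : vfield) : vfield := VField (lie_subproof X Y).

Record oneform := OneForm {
  oneform_at : forall p, {linear tangent p -> R^o};
  oneform_smooth : forall X : vfield,
    (fun p => oneform_at p (vfield_at X p) : R) \in @smooth_pred R M }.

Definition oneform_app (a : oneform) (X : vfield) : C :=
  SmoothFun (oneform_smooth a X).

Record tensor11 := Tensor11 {
  tensor11_at : forall p, {linear tangent p -> tangent p};
  tensor11_smooth : forall (X : vfield) (f : C),
    (fun p => tensor11_at p (vfield_at X p) f) \in @smooth_pred R M }.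

Lemma tensor11_subproof (phi : tensor11) (X : vfield) :
  ((fun f => SmoothFun (tensor11_smooth phi X f)) : C -> C^o) \in vfield_pred.
Proof.
rewrite inE; split=> [a f g|f g]; apply: smoothFun_eqP => p /=.
  exact: tangent_linear.
exact: tangent_leibniz.
Qed.

Definition tensor11_app (phi : tensor11) (X : vfield) : vfield :=
  VField (tensor11_subproof phi X).

Definition dext (a : oneform) (X Y : vfield) : C :=
  (2^-1 : R) *: (X (oneform_app a Y) - Y (oneform_app a X)
                 - oneform_app a (lie X Y)).

(* differential forms of degree k, evaluated on vector fields; the wedge
   product is normalised as goes with the factor 1/2 in [dext] *)
Definition form (k : nat) := ('I_k -> vfield) -> C.

Definition wedge k l (w : form k) (t : form l) : form (k + l) := fun X =>
  ((k + l)`!%:R^-1 : R) *: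
    \sum_(s : 'S_(k + l)) ((-1) ^+ s : R) *:
      (w (fun i => X (s (lshift l i))) * t (fun j => X (s (rshift k j)))).

Definition form1 (a : oneform) : form 1 := fun X => oneform_app a (X ord0).

Definition form2 (a : oneform) : form 2 := fun X => dext a (X ord0) (X ord_max).

Fixpoint dpow (a : oneform) (k : nat) : form (k * 2) :=
  if k is k'.+1 then wedge (form2 a) (@dpow a k') else fun=> 1.
Arguments dpow a k : clear implicits.

Definition nowhere_zero k (w : form k) := forall p, exists X, w X p != 0.

(* On a manifold of dimension 2m+2n+2 the first form has top degree, so being
   nowhere zero makes it a volume form. *)
Definition contact_pair (m n : nat) (a1 a2 : oneform) : Prop :=
  [/\ nowhere_zero (wedge (wedge (wedge (form1 a1) (dpow a1 m)) (form1 a2))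
                          (dpow a2 n)),
      forall X, dpow a1 m.+1 X = 0
    & forall X, dpow a2 n.+1 X = 0].

Definition reeb_fields (a1 a2 : oneform) (Z1 Z2 : vfield) : Prop :=
  [/\ oneform_app a1 Z1 = 1 /\ oneform_app a1 Z2 = 0,
      oneform_app a2 Z1 = 0 /\ oneform_app a2 Z2 = 1,
      forall Y, dext a1 Z1 Y = 0 /\ dext a1 Z2 Y = 0
    & forall Y, dext a2 Z1 Y = 0 /\ dext a2 Z2 Y = 0].

(* tangent space at p of the characteristic foliation of a; by tensoriality
   [dext a X Y p] only depends on the values of X and Y at p *)
Definition charac (a : oneform) (p : M) : set (tangent p) :=
  [set v | oneform_at a p v = 0 /\
     forall X Y, vfield_at X p = v -> dext a X Y p = 0].

Definition decomposable (a1 a2 : oneform) (phi : tensor11) : Prop :=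
  forall p (v : tangent p),
    (charac a1 v -> charac a1 (tensor11_at phi p v)) /\
    (charac a2 v -> charac a2 (tensor11_at phi p v)).

Definition contact_pair_structure (m n : nat) (a1 a2 : oneform)
    (Z1 Z2 : vfield) (phi : tensor11) : Prop :=
  [/\ contact_pair m n a1 a2,
      reeb_fields a1 a2 Z1 Z2,
      forall X, tensor11_app phi (tensor11_app phi X) =
        - X + oneform_app a1 X *: Z1 + oneform_app a2 X *: Z2
    & tensor11_app phi Z1 = 0 /\ tensor11_app phi Z2 = 0].

Definition nijenhuis (phi : tensor11) (X Y : vfield) : vfield :=
  let P := tensor11_app phi in
  P (P (lie X Y)) + lie (P X) (P Y) - P (lie (P X) Y) - P (lie X (P Y)).

Definition normal_structure (a1 a2 : oneform) (Z1 Z2 : vfield)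
    (phi : tensor11) : Prop :=
  forall X Y, nijenhuis phi X Y + (dext a1 X Y *+ 2) *: Z1
                                + (dext a2 X Y *+ 2) *: Z2 = 0.

Definition bilinear_field := forall p : M, tangent p -> tangent p -> R.

Record riemannian := Riemannian {
  riem_at :> bilinear_field;
  riem_linear : forall p (a : R) (u v w : tangent p),
    riem_at (a *: u + v) w = a * riem_at u w + riem_at v w;
  riem_sym : forall p (u v : tangent p), riem_at u v = riem_at v u;
  riem_pos : forall p (u : tangent p), u != 0 -> 0 < riem_at u u;
  riem_smooth : forall X Y : vfield,
    (fun p => riem_at (vfield_at X p) (vfield_at Y p)) \in @smooth_pred R M }.

Definition riem_app (g : riemannian) (X Y : vfield) : C :=
  SmoothFun (riem_smooth g X Y).

Definition metric_contact_pair (m n : nat) (a1 a2 : oneform)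
    (Z1 Z2 : vfield) (phi : tensor11) (g : riemannian) : Prop :=
  [/\ contact_pair_structure m n a1 a2 Z1 Z2 phi,
      forall X Y, riem_app g X (tensor11_app phi Y) = dext a1 X Y + dext a2 X Y
    & forall X, riem_app g X Z1 = oneform_app a1 X /\
                riem_app g X Z2 = oneform_app a2 X].

Definition levi_civita (g : riemannian) (D : vfield -> vfield -> vfield) :=
  [/\ forall (f : C) (X Y Z : vfield), D (f *: X + Y) Z = f *: D X Z + D Y Z,
      forall X Y Z, D X (Y + Z) = D X Y + D X Z,
      forall (f : C) (X Y : vfield), D X (f *: Y) = X f *: Y + f *: D X Y,
      forall X Y, D X Y - D Y X = lie X Y
    & forall X Y Z : vfield,
        X (riem_app g Y Z) = riem_app g (D X Y) Z + riem_app g Y (D X Z)].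

Definition curvature (D : vfield -> vfield -> vfield) (X Y Z : vfield) :=
  D X (D Y Z) - D Y (D X Z) - D (lie X Y) Z.

Definition locally_symmetric (g : riemannian) : Prop :=
  exists2 D, levi_civita g D & forall W X Y Z,
    D W (curvature D X Y Z) - curvature D (D W X) Y Z
      - curvature D X (D W Y) Z - curvature D X Y (D W Z) = 0.

End Tangent.

Arguments vfield_at {R M} X p.
Arguments tangent {R} M p.
Arguments riem_at {R M} r p u v.

Section Maps.
Context {R : realType}.
Implicit Types M N S : smoothSpace R.

Definition smooth_on M N (U : set M) (F : M -> N) : Prop :=
  forall p, U p -> {for p, continuous F} /\
    forall f, smooth_at N (F p) f -> smooth_at M p (f \o F).

Record smoothMap M N := SmoothMap {
  smoothMap_val :> M -> N; smoothMapP : smooth_on setT smoothMap_val }.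

Lemma pullback_subproof M N (F : smoothMap M N) (f : smoothFun N) :
  (f \o F) \in @smooth_pred R M.
Proof.
apply: smooth_inP => p; apply: (smoothMapP F I).2; exact: smoothFun_at.
Qed.

Definition pullback M N (F : smoothMap M N) (f : smoothFun N) : smoothFun M :=
  SmoothFun (pullback_subproof F f).

Lemma tmap_subproof M N (F : smoothMap M N) p (v : tangent M p) :
  (fun f => v (pullback F f)) \in tangent_pred (F p).
Proof.
rewrite inE; split=> [a f g|f g].
  rewrite -tangent_linear; congr (v _); exact: smoothFun_eqP.
rewrite -[f (F p)]/(pullback F f p) -[g (F p)]/(pullback F g p).
rewrite -tangent_leibniz; congr (v _); exact: smoothFun_eqP.
Qed.

Definition tmap M N (F : smoothMap M N) p (v : tangent M p) : tangent N (F p) :=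
  Tangent (tmap_subproof F v).

Definition is_chart d M (U : set M) (x : M -> 'rV[R]_d) (y : 'rV[R]_d -> M) :=
  [/\ open U /\ open (x @` U),
      forall p, U p -> y (x p) = p,
      forall p, U p -> {for p, continuous x},
      forall q, (x @` U) q -> {for q, continuous y}
    & forall p f, U p -> smooth_at M p f <-> Coo_at (x p) (f \o y)].

Definition is_manifold d M : Prop :=
  [/\ hausdorff_space M, @second_countable M
    & forall p : M, exists U x y, U p /\ @is_chart d M U x y].

Definition is_connected M := [set: M] !=set0 /\ connected [set: M].

Lemma dir_subproof (V : normedModType R) (x v : V) :
  (fun f : smoothFun (smoothV V) => 'D_v (f : V -> R) x)
    \in tangent_pred (x : smoothV V).
Proof.
have H (f : smoothFun (smoothV V)) : derivable (f : V -> R) x v.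
  by apply: Coo_at_derivable; exact: (smoothFun_at f).
rewrite inE; split=> [a f g|f g].
  have E : 'D_v (a *: (f : V -> R) + (g : V -> R)) x =
           a *: 'D_v (f : V -> R) x + 'D_v (g : V -> R) x.
    by rewrite deriveD; [rewrite deriveZ|exact: derivableZ|].
  exact: E.
have E : 'D_v ((f : V -> R) * (g : V -> R)) x =
         f x *: 'D_v (g : V -> R) x + g x *: 'D_v (f : V -> R) x.
  by rewrite deriveM.
by rewrite addrC [X in _ + X]mulrC; exact: E.
Qed.

Definition dir (V : normedModType R) (x v : V) : tangent (smoothV V) x :=
  Tangent (dir_subproof x v).

Definition curve M := smoothMap (smoothV R^o) M.

Definition velocity M (c : curve M) (t : R) : tangent M (c t) :=
  tmap c (dir (t : R^o) 1).

Definition curve_length M (g : riemannian M) (c : curve M) : R :=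
  \int[lebesgue_measure]_(t in `[0, 1]%classic)
     Num.sqrt (riem_at g (c t) (velocity c t) (velocity c t)).

(* Curves need not be regular, so corners may be slowed down: the infimum is
   the same as over piecewise smooth curves. *)
Definition riem_dist M (g : riemannian M) (p q : M) : R :=
  inf [set l | exists2 c : curve M,
         (c 0 = p /\ c 1 = q) & l = curve_length g c].

Definition is_complete M (g : riemannian M) : Prop :=
  forall u : nat -> M,
    (forall e, 0 < e -> exists k, forall i j, (k <= i)%N -> (k <= j)%N ->
       riem_dist g (u i) (u j) < e) ->
    exists p, (fun i => riem_dist g (u i) p) @ \oo --> (0 : R).

(* equality of metric tensors under a diffeomorphism; g and h are arbitrary
   fields of bilinear forms, so that model metrics need no positivity proof *)
Definition isometric M N (g : bilinear_field M) (h : bilinear_field N) : Prop :=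
  exists (F : smoothMap M N) (G : smoothMap N M),
    [/\ cancel F G, cancel G F
      & forall p (u v : tangent M p), h (F p) (tmap F u) (tmap F v) = g p u v].

Definition simply_connected (T : topologicalType) : Prop :=
  (forall x y : T, exists c : R -> T,
     [/\ {within `[0, 1], continuous c}, c 0 = x & c 1 = y]) /\
  (forall c : R -> T, {within `[0, 1], continuous c} -> c 0 = c 1 ->
     exists H : R * R -> T,
       [/\ {within `[0, 1] `*` `[0, 1], continuous H},
           forall t, `[0, 1]%classic t -> H (0, t) = c t /\ H (1, t) = c 0
         & forall s, `[0, 1]%classic s -> H (s, 0) = c 0 /\ H (s, 1) = c 0]).

(* smooth covering maps: every point has a neighbourhood U whose preimage is
   a disjoint union of open sheets V i, with smooth inverse s i : U -> V i *)
Definition is_covering N M (pi : smoothMap N M) : Prop :=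
  (forall x, exists z, pi z = x) /\
  forall x : M, exists (U : set M) (I : Type) (V : I -> set N) (s : I -> M -> N),
    [/\ open U /\ U x,
        pi @^-1` U = \bigcup_i V i,
        forall i j, V i `&` V j !=set0 -> i = j,
        forall i, open (V i)
      & forall i, [/\ smooth_on U (s i),
          forall y, U y -> V i (s i y) /\ pi (s i y) = y
        & forall z, V i z -> s i (pi z) = z]].

(* some (equivalently, every) simply connected covering of M, with the lifted
   metric, is isometric to (S, h) *)
Definition universal_covering_is d M (g : riemannian M)
    S (h : bilinear_field S) : Prop :=
  exists (N : smoothSpace R) (gN : riemannian N) (pi : smoothMap N M),
    [/\ is_manifold d N /\ is_connected N,
        simply_connected N,
        is_covering pi,
        forall p (u v : tangent N p),
          riem_at gN p u v = riem_at g (pi p) (tmap pi u) (tmap pi v)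
      & isometric gN h].

End Maps.

Section Models.
Context {R : realType}.

Lemma Coo_at_linear (V : normedModType R) (F : V -> R) :
  (forall h v y, F (h *: v + y) = h * F v + F y) -> continuous F ->
  forall x, Coo_at x F.
Proof.
move=> lF cF x; exists setT; split=> [||k]; [exact: openT| |] => //.
case: k => [|k]; first by move=> y _; exact: cF.
have dF v y : is_derive y v F (F v).
  have E : (fun h : R => h^-1 *: ((F \o shift y) (h *: v) - F y))
           @ 0^' --> F v.
    apply: (@cvg_trans _ (cst (F v) @ (0 : R)^')); last exact: cvg_cst.
    apply: near_eq_cvg; apply: filterS (nbhs_dnbhs_neq (0 : R)) => h h0 /=.
    have -> : F (h *: v + y) - F y = h *: F v by rewrite lF addrK.
    by rewrite scalerA mulVf // scale1r.
  apply: DeriveDef; first by apply/cvg_ex; exists (F v).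
  exact: cvg_lim E.
split=> [y _|v y _|v]; [exact: cF|exact: ex_derive|].
have -> : 'D_v F = cst (F v) by apply/funext => y; exact: derive_val.
exact: Ck_cst.
Qed.

Section Euclidean.
Context {k : nat} (A : set 'rV[R]_k).

Lemma coord_subproof (i : 'I_k) :
  (fun p : embedded A => (set_val p : 'rV[R]_k) 0 i)
    \in @smooth_pred R (embedded A).
Proof.
apply: smooth_inP => p; exists (fun x : 'rV[R]_k => x 0 i); last exact: filterE.
apply: Coo_at_linear; [by move=> h v y; rewrite !mxE|exact: coord_continuous].
Qed.

Definition coord_fun i : smoothFun (embedded A) := SmoothFun (coord_subproof i).

(* the metric induced by the Euclidean one: u (coord_fun i) is the i-th
   component of the tangent vector u in R^k *)
Definition induced_metric : bilinear_field (embedded A) :=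
  fun p u v => \sum_(i < k) u (coord_fun i) * v (coord_fun i).

End Euclidean.

Section Product.
Context {V W : normedModType R} (A : set V) (B : set W).
Notation AB := (embedded (A `*` B)).

Lemma Ck_fst n (U : set V) (F : V -> R) :
  Ck n U F -> Ck n (fst @^-1` U) ((fun x : V * W => F x.1) : V * W -> R).
Proof.
elim: n F => [|n IH] F.
  by move=> cF x Ux; apply: continuous_comp; [exact: cvg_fst|exact: cF].
move=> [cF dF DF]; split=> [x Ux|v x Ux|v].
- by apply: continuous_comp; [exact: cvg_fst|exact: cF].
- exact: (dF v.1 x.1 Ux).
- exact: (IH _ (DF v.1)).
Qed.

Lemma Ck_snd n (U : set W) (F : W -> R) :
  Ck n U F -> Ck n (snd @^-1` U) ((fun x : V * W => F x.2) : V * W -> R).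
Proof.
elim: n F => [|n IH] F.
  by move=> cF x Ux; apply: continuous_comp; [exact: cvg_snd|exact: cF].
move=> [cF dF DF]; split=> [x Ux|v x Ux|v].
- by apply: continuous_comp; [exact: cvg_snd|exact: cF].
- exact: (dF v.2 x.2 Ux).
- exact: (IH _ (DF v.2)).
Qed.

Definition fst_fun (p : AB) : embedded A :=
  SigSub (mem_set (set_valP p).1).

Definition snd_fun (p : AB) : embedded B :=
  SigSub (mem_set (set_valP p).2).

Lemma fst_smooth : smooth_on setT fst_fun.
Proof.
move=> p _; have cp : {for p, continuous fst_fun}.
  apply: continuous_comp_initial => q.
  apply: (@continuous_comp _ _ _ (set_val : AB -> V * W) fst).
    exact: initial_continuous.
  exact: cvg_fst.
split=> // f [F [U [oU Up CF]] fF]; exists (fun x => F x.1).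
  exists (fst @^-1` U); split=> // [|k]; last exact: Ck_fst.
  by apply: open_comp => // x _; exact: cvg_fst.
exact: cp fF.
Qed.

Lemma snd_smooth : smooth_on setT snd_fun.
Proof.
move=> p _; have cp : {for p, continuous snd_fun}.
  apply: continuous_comp_initial => q.
  apply: (@continuous_comp _ _ _ (set_val : AB -> V * W) snd).
    exact: initial_continuous.
  exact: cvg_snd.
split=> // f [F [U [oU Up CF]] fF]; exists (fun x => F x.2).
  exists (snd @^-1` U); split=> // [|k]; last exact: Ck_snd.
  by apply: open_comp => // x _; exact: cvg_snd.
exact: cp fF.
Qed.

Definition fst_map : smoothMap AB (embedded A) := SmoothMap fst_smooth.
Definition snd_map : smoothMap AB (embedded B) := SmoothMap snd_smooth.

Definition prod_metric (g : bilinear_field (embedded A))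
    (h : bilinear_field (embedded B)) : bilinear_field AB :=
  fun p u v => g (fst_map p) (tmap fst_map u) (tmap fst_map v)
             + h (snd_map p) (tmap snd_map u) (tmap snd_map v).

End Product.

Definition unit_sphere (k : nat) : set 'rV[R]_k.+1 :=
  [set x | \sum_(i < k.+1) x 0 i ^+ 2 = 1].

Arguments unit_sphere k : clear implicits.

Definition sphere_metric k : bilinear_field (embedded (unit_sphere k)) :=
  @induced_metric k.+1 (unit_sphere k).

Definition line_metric : bilinear_field (embedded [set: 'rV[R]_1]) :=
  @induced_metric 1 [set: 'rV[R]_1].

End Models.
Arguments unit_sphere R k : clear implicits.
Arguments sphere_metric R k : clear implicits.
Arguments line_metric R : clear implicits.

(* Main.v *)
Require Import Defs.
From HB Require Import structures.
From mathcomp Require Import all_boot all_order all_algebra all_fingroup.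
From mathcomp Require Import all_classical all_reals all_analysis.
From mathcomp Require Import ring lra zify.

Set Implicit Arguments.
Unset Strict Implicit.
Unset Printing Implicit Defensive.

Import Order.TTheory GRing.Theory Num.Theory.
Import numFieldNormedType.Exports.

Local Open Scope classical_set_scope.
Local Open Scope ring_scope.

(** Let phi_i X = - nabla_X Z_i.  Normality makes the Reeb fields Z_1, Z_2
    Killing, so d alpha_i (X, Y) = g (X, phi_i Y) and phi = phi_1 + phi_2; the
    vanishing of (d alpha_1)^(m+1) and (d alpha_2)^(n+1) bounds the ranks, and
    decomposability then gives phi_1 phi_2 = phi_2 phi_1 = 0.  The tensor
    g (R (X, Z_i) Y, W) is invariant under phi because nabla R = 0, and on the
    horizontal distribution, where phi^2 = - 1, an invariant tensor of odd degree
    vanishes.  This determines R (X, Z_i), hence nabla phi_i: the projections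
    P_i = alpha_i Z_i - phi_i^2 are parallel, of ranks 2m+1 and 2n+1, and R acts
    on each factor with constant curvature 1.

    Hence the connection (f, h, Y) |-> (X f - g (P_1 X, Y), X h - g (P_2 X, Y),
    nabla_X Y + f P_1 X + h P_2 X) is flat.  Orthonormal parallel sections have
    functions f, h that embed M locally and isometrically in a product of two
    spheres, any two such embeddings differing by a rigid motion; for n = 0 the
    second sphere is replaced by a primitive of alpha_2.  Completeness lets one
    continue the inverse of such an embedding along rays in stereographic
    charts, and the continuations glue to a Riemannian covering of M by the
    simply connected model. *)

(** * Smooth functions on R^N *)

Section Lines.
Context {R : realType}.
Implicit Types V W : normedModType R.

(** The flat connection is modelled on the ambient space of a sphere: a linear function restricted
    to S^k has a value f and a gradient Y with nabla_X Y = - f X, so parallel sections recover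
    ambient coordinates; each factor contributes one such block. Decomposability acts through
    dimensions: the characteristic spaces K_i = ker alpha_i ∩ ker phi_i meet in 0 by the formula for
    phi^2, and the rank bounds make them complementary; phi preserves K_1 and equals phi_2 there,
    whence phi_1 phi_2 = 0. The continuation avoids geodesics: image curves of rays are Lipschitz,
    completeness gives a limit for the distance, and a bump function with bounded differential turns
    this into a limit for the topology. An affine isometry is determined by its germ on a spanning
    set, so continuations are unique, and the connected overlaps of two stereographic charts take
    the place of a monodromy argument. The line enters for n = 0 because a circle is not simply
    connected; both cases run through one abstract [model]. *)

Lemma is_derive_line V W (f : V -> W) (x v : V) (t : R) :
  derivable f (t *: v + x) v ->
  is_derive t (1 : R) (fun s : R => f (s *: v + x)) ('D_v f (t *: v + x)).
Proof.
move=> df; have E : (fun h : R => h^-1 *: (((fun s : R => f (s *: v + x)) \o shift t) (h *: (1 : R)) - f (t *: v + x)))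
   = (fun h : R => h^-1 *: ((f \o shift (t *: v + x)) (h *: v) - f (t *: v + x))).
  by apply/funext => h /=; rewrite [h *: 1]mulr1 scalerDl addrA.
by apply: DeriveDef; [rewrite /derivable E | rewrite /derive E].
Qed.

Lemma MVT_is_derive (f df : R -> R) (a b : R) : a <= b ->
  (forall t, a <= t <= b -> is_derive t (1 : R) f (df t)) ->
  exists2 c, a <= c <= b & f b - f a = df c * (b - a).
Proof.
move=> ab H; have [||c] := @MVT_segment R f df a b ab.
- by move=> x; rewrite in_itv /= => /andP[/ltW ax /ltW xb]; apply: H; rewrite ax xb.
- apply: derivable_within_continuous => x; rewrite in_itv /= => xab.
  by have [] := H _ xab.
- by rewrite in_itv /= => cab E; exists c.
Qed.

Lemma MVT_norm (f df : R -> R) (a b K : R) : a <= b ->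
  (forall t, a <= t <= b -> is_derive t (1 : R) f (df t)) ->
  (forall t, a <= t <= b -> `|df t| <= K) ->
  `|f b - f a| <= K * (b - a).
Proof.
move=> ab H HK; have [c cab ->] := MVT_is_derive ab H.
by rewrite normrM (ger0_norm (_ : 0 <= b - a)) ?subr_ge0 // ler_wpM2r ?subr_ge0 ?HK.
Qed.

Lemma derive0_cst (f : R -> R) (a b : R) : a <= b ->
  (forall t, a <= t <= b -> is_derive t (1 : R) f 0) -> f b = f a.
Proof.
move=> ab H; apply/eqP; rewrite -subr_eq0 -normr_le0 -(mul0r (b - a)).
by apply: MVT_norm ab H _ => *; rewrite normr0.
Qed.

Lemma MVT_line V (f : V -> R) (x v : V) :
  (forall t : R, 0 <= t <= 1 -> derivable f (t *: v + x) v) ->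
  exists2 c : R, 0 <= c <= 1 & f (v + x) - f x = 'D_v f (c *: v + x).
Proof.
move=> df; have [|c c01] := @MVT_is_derive (fun t => f (t *: v + x)) (fun t => 'D_v f (t *: v + x)) 0 1 ler01.
  by move=> t t01; apply: is_derive_line; exact: df.
by rewrite scale1r scale0r add0r subr0 mulr1 => E; exists c.
Qed.

End Lines.

(** * Row vectors with the sup norm and increments along coordinates *)

Section RowSpace.
Context {R : realType}.
Implicit Types (N : nat).

Definition ebase {N} (j : 'I_N) : 'rV[R]_N := delta_mx 0 j.

Lemma row_normP N (x : 'rV[R]_N) (e : R) : 0 <= e ->
  (forall j, `|x 0 j| <= e) -> `|x| <= e.
Proof.
move=> e0 H; rewrite /Num.Def.normr /= mx_normrE; apply: bigmax_le => // -[i j] _ /=.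
by rewrite ord1.
Qed.

Lemma row_coord_le N (x : 'rV[R]_N) j : `|x 0 j| <= `|x|.
Proof.
rewrite {2}/Num.Def.normr /= mx_normrE.
by apply: (le_trans _ (le_bigmax _ _ (0, j))).
Qed.

Lemma row_cvgP N T (F : set_system T) (FF : Filter F) (g : T -> 'rV[R]_N) (l : 'rV[R]_N) :
  (forall j, (fun x => g x 0 j) @ F --> l 0 j) -> g @ F --> l.
Proof.
move=> H; apply/cvgrPdist_le => e e0.
have : \forall x \near F, forall j, `|l 0 j - g x 0 j| <= e.
  apply: filter_forall => j; move/cvgrPdist_le: (H j); exact.
apply: filterS => x Hx; apply: row_normP => [|j]; first exact: ltW.
by rewrite !mxE.
Qed.

Lemma row_coord_cvg N T (F : set_system T) (FF : Filter F) (g : T -> 'rV[R]_N) (l : 'rV[R]_N) j :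
  g @ F --> l -> (fun x => g x 0 j) @ F --> l 0 j.
Proof.
by move=> H; apply: (@continuous_cvg _ _ _ _ _ _ (fun M : 'rV[R]_N => M 0 j)); [exact: coord_continuous|].
Qed.

(* Passing from y to x one coordinate at a time. *)
Lemma increment_partials N (f : 'rV[R]_N -> R) (y x : 'rV[R]_N) :
  (forall z j, `|z - y| <= `|x - y| -> derivable f z (ebase j)) ->
  exists2 xi : 'I_N -> 'rV[R]_N, forall j, `|xi j - y| <= `|x - y|
    & f x - f y = \sum_j (x 0 j - y 0 j) * 'D_(ebase j) f (xi j).
Proof.
move=> df.
pose p k : 'rV[R]_N := \row_j (if (j < k)%N then x 0 j else y 0 j).
have pj (j : 'I_N) : p j.+1 = (x 0 j - y 0 j) *: ebase j + p j.
  apply/rowP => i; rewrite !mxE eqxx /= ltnS leq_eqVlt.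
  case: (ltngtP i j) => ij; rewrite /= ?(negbTE (ord_neq _)) //.
  - by rewrite (_ : (i == j) = false) ?mulr0 ?add0r ?orbT // -val_eqE ltn_eqF.
  - by rewrite (_ : (i == j) = false) ?mulr0 ?add0r // -val_eqE gtn_eqF.
  - by rewrite (ord_inj ij) eqxx mulr1 subrK.
have near_p (j : 'I_N) (t : R) : 0 <= t <= 1 ->
   `|t *: ((x 0 j - y 0 j) *: ebase j) + p j - y| <= `|x - y|.
  move=> /andP[t0 t1]; apply: row_normP => // i; rewrite !mxE eqxx /=.
  have := row_coord_le (x - y) i; rewrite !mxE => Hi.
  case: (eqVneq i j) => [->|ij].
    rewrite ltnn mulr1 addrK normrM (ger0_norm t0).
    have := row_coord_le (x - y) j; rewrite !mxE => Hj.
    by apply: le_trans Hj; rewrite ler_piMl.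
  rewrite !mulr0 add0r; case: ifP => // _; by rewrite subrr normr0.
have /choice[xi Hxi] : forall j : 'I_N, exists z, `|z - y| <= `|x - y| /\
    f (p j.+1) - f (p j) = (x 0 j - y 0 j) * 'D_(ebase j) f z.
  move=> j.
  (* Derivability along a multiple of a basis vector follows by rescaling the increment; the
     multiple 0 is treated apart because the rescaling divides by it. *)
  have dl z : `|z - y| <= `|x - y| ->
      is_derive z ((x 0 j - y 0 j) *: ebase j) f ((x 0 j - y 0 j) * 'D_(ebase j) f z).
    move=> zy; have [d1 d2] : is_derive z (ebase j) f ('D_(ebase j) f z).
      by apply: derivableP; exact: df.
    set a := (_ - _); have [->|a0] := eqVneq a 0.
      by rewrite scale0r mul0r; exact: is_derive0.
    have E : (fun h : R => h^-1 *: ((f \o shift z) (h *: (a *: ebase j)) - f z)) =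
       (fun h : R => a * h^-1 * ((f \o shift z) (h *: ebase j) - f z)) \o ( *%R a).
      apply/funext => h /=; rewrite !scalerA (mulrC h a); congr (_ * _).
      have [->|h0] := eqVneq h 0; first by rewrite mulr0 invr0 mulr0.
      by rewrite invfM mulrA mulfV ?mul1r.
    have C : (fun h : R => h^-1 *: ((f \o shift z) (h *: (a *: ebase j)) - f z)) @ 0^'
        --> a *: 'D_(ebase j) f z.
      rewrite E; apply: cvg_comp; last first.
        under eq_fun do rewrite -mulrA; exact: (cvgM (cvg_cst a) (d1 : _ --> _)).
      move=> A /= [e e0 He]; exists (e / `|a|) => /=; first by rewrite divr_gt0 ?normr_gt0.
      move=> h /= hd h0; apply: He; last by rewrite /= mulf_neq0.
      rewrite /= sub0r normrN normrM mulrC -ltr_pdivlMr ?normr_gt0 //.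
      by move: hd; rewrite /ball_ /= sub0r normrN.
    apply: DeriveDef; last exact: (cvg_lim _ C).
    by apply/cvg_ex; eexists; exact: C.
  have [|c c01] := @MVT_line R _ f (p j) ((x 0 j - y 0 j) *: ebase j).
    by move=> t t01; have [] := dl _ (near_p j t t01).
  rewrite -pj => ->; exists (c *: ((x 0 j - y 0 j) *: ebase j) + p j).
  split; first exact: near_p.
  by have /(dl _)[] := near_p j c c01.
exists xi; first by move=> j; have [] := Hxi j.
transitivity (f (p N) - f (p 0%N)).
  by congr (f _ - f _); apply/rowP => i; rewrite !mxE ?ltn_ord.
rewrite -(@telescope_sumr _ 0 N (fun k => f (p k))) // big_mkord.
by apply: eq_bigr => j _; have [] := Hxi j.
Qed.

End RowSpace.

(** * The chain rule in finite and infinite order *)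

Section ChainRule.
Context {R : realType}.
Implicit Types V W : normedModType R.

Lemma cvg_sumr T (F : set_system T) (FF : Filter F) V (I : Type) (r : seq I)
    (f : I -> T -> V) (l : I -> V) :
  (forall i, f i @ F --> l i) ->
  (fun x => \sum_(i <- r) f i x) @ F --> \sum_(i <- r) l i.
Proof.
move=> H; elim: r => [|i r IH].
  by under eq_fun do rewrite big_nil; rewrite big_nil; exact: cvg_cst.
under eq_fun do rewrite big_cons; rewrite big_cons; exact: cvgD.
Qed.

Lemma derivable_line_cvg V W (f : V -> W) x v : derivable f x v ->
  (fun h : R => f (h *: v + x)) @ (0 : R) --> f x.
Proof.
move=> /derivable1P/derivable1_diffP/differentiable_continuous.
by rewrite /prop_for /continuous_at /= scale0r add0r.
Qed.

(** [increment_partials] writes the increment of [f] with partials at intermediate points. These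
    points tend to [g x], where the partials are continuous, so it suffices that each coordinate of
    [g] is derivable along [v]. *)
Lemma is_derive_rowcomp V N (g : V -> 'rV[R]_N) (f : 'rV[R]_N -> R) (x v : V) :
  (forall j, derivable (fun y => g y 0 j) x v) ->
  (\forall z \near g x, forall j, derivable f z (ebase j)) ->
  (forall j, {for g x, continuous ('D_(ebase j) f)}) ->
  is_derive x v (f \o g)
    (\sum_j 'D_v (fun y => g y 0 j) x * 'D_(ebase j) f (g x)).
Proof.
move=> dg df cf.
have gcvg : (fun h : R => g (h *: v + x)) @ (0 : R) --> g x.
  by apply: row_cvgP => j; apply: (@derivable_line_cvg _ _ (fun y => g y 0 j)); exact: dg.
have [r /= r0 Hr] : exists2 r : R, 0 < r & forall z, `|z - g x| < r ->
    forall j, derivable f z (ebase j).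
  move: df => /= /nbhs_ballP[r /= r0 Hr]; exists r => // z zr; apply: Hr.
  by rewrite -ball_normE /= distrC.
have /choice[xi Hxi] : forall h : R, exists xi : 'I_N -> 'rV[R]_N,
    `|g (h *: v + x) - g x| < r ->
    (forall j, `|xi j - g x| <= `|g (h *: v + x) - g x|) /\
    f (g (h *: v + x)) - f (g x) =
      \sum_j (g (h *: v + x) 0 j - g x 0 j) * 'D_(ebase j) f (xi j).
  move=> h; case: (pselect (`|g (h *: v + x) - g x| < r)) => hr; last first.
    by exists (fun=> 0).
  have [|xi H1 H2] := @increment_partials R N f (g x) (g (h *: v + x)).
    by move=> z j zr; apply: Hr; exact: le_lt_trans hr.
  by exists xi.
have near_r : \forall h \near (0 : R), `|g (h *: v + x) - g x| < r.
  move/cvgrPdist_lt: gcvg => /(_ r r0); apply: filterS => h.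
  by rewrite distrC.
have xicvg j : (fun h => xi h j) @ (0 : R) --> g x.
  apply/cvgrPdist_le => e e0; move/cvgrPdist_le: gcvg => /(_ e e0).
  apply: filterS2 near_r => h hr; rewrite distrC => H.
  rewrite distrC; apply: le_trans H; by have [] := Hxi h hr.
have C : (fun h : R => h^-1 *: (((f \o g) \o shift x) (h *: v) - (f \o g) x)) @ 0^' -->
    \sum_j 'D_v (fun y => g y 0 j) x * 'D_(ebase j) f (g x).
  apply: (@cvg_trans _ ((fun h : R => \sum_j
     (h^-1 *: (((fun y => g y 0 j) \o shift x) (h *: v) - g x 0 j)) *
      'D_(ebase j) f (xi h j)) @ 0^')).
    apply: near_eq_cvg; apply: (@cvg_within _ (nbhs (0 : R))).
    apply: filterS near_r => h hr /=.
    have [_ ->] := Hxi h hr; rewrite scaler_sumr; apply: eq_bigr => j _.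
    by rewrite /= scalerAl.
  apply: cvg_sumr => j; apply: cvgM; first exact: (dg j : _ --> _).
  apply: (@cvg_comp _ _ _ (fun h => xi h j) ('D_(ebase j) f) _ (nbhs (g x))); last exact: cf.
  by apply: cvg_trans (xicvg j); apply: cvg_app; exact: cvg_within.
apply: DeriveDef; last exact: (cvg_lim _ C).
by apply/cvg_ex; eexists; exact: C.
Qed.

Lemma Ck_sum k V (U : set V) I (r : seq I) (f : I -> V -> R) : open U ->
  (forall i, Ck k U (f i)) -> Ck k U (fun x => \sum_(i <- r) f i x).
Proof.
move=> oU H; elim: r => [|i r IH].
  by under eq_fun do rewrite big_nil; exact: Ck_cst.
by under eq_fun do rewrite big_cons; exact: (CkD oU (H i) IH).
Qed.

(** Every directional derivative of the composite is a finite sum of products of derivatives of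
    coordinates of [g] with partials of [f] composed with [g], so induction on the order applies. *)
Lemma Ck_rowcomp k V N (U : set V) (W : set 'rV[R]_N) (g : V -> 'rV[R]_N) f :
  open U -> open W -> (forall x, U x -> W (g x)) ->
  (forall j, Ck k U (fun x => g x 0 j)) -> Ck k W f -> Ck k U (f \o g).
Proof.
move=> oU oW gUW; elim: k f g gUW => [|k IH] f g gUW.
  move=> cg cf x Ux; apply: continuous_comp; last exact: cf _ (gUW _ Ux).
  by apply: row_cvgP => j; exact: cg.
move=> Cg Cf; case: (Cf) => cf df Df.
have D v x : U x -> is_derive x v (f \o g)
   (\sum_j 'D_v (fun y => g y 0 j) x * 'D_(ebase j) f (g x)).
  move=> Ux; apply: is_derive_rowcomp.
  - by move=> j; have [_ + _] := Cg j; exact.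
  - apply: filterS (open_nbhs_nbhs (conj oW (gUW _ Ux))) => z Wz j; exact: df.
  - by move=> j; apply: (Ck_cont (Df (ebase j))); exact: gUW.
split.
- move=> x Ux; apply: continuous_comp; last exact: cf _ (gUW _ Ux).
  by apply: row_cvgP => j; have [+ _ _] := Cg j; exact.
- by move=> v x Ux; have [] := D v x Ux.
- move=> v; apply: (@Ck_eq _ _ k U (fun x => \sum_j 'D_v (fun y => g y 0 j) x * 'D_(ebase j) f (g x))) => //.
    by move=> x Ux; have [_ ->] := D v x Ux.
  apply: Ck_sum => // j; apply: (@CkM _ _ k U ('D_v (fun y => g y 0 j)) ('D_(ebase j) f \o g)) => //.
    by have [_ _ +] := Cg j; exact.
  by apply: IH => // [i|]; [apply: CkS; exact: Cg|exact: Df].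
Qed.

Lemma Ck_linear_comp k V W (U : set W) (L : V -> W) f :
  (forall h x y, L (h *: x + y) = h *: L x + L y) -> continuous L ->
  Ck k U f -> Ck k (L @^-1` U) (f \o L).
Proof.
move=> lL cL; elim: k f => [|k IH] f.
  by move=> cf x Ux; apply: continuous_comp; [exact: cL|exact: cf].
move=> [cf df Df].
have E v x : (fun h : R => h^-1 *: (((f \o L) \o shift x) (h *: v) - (f \o L) x)) =
   (fun h : R => h^-1 *: ((f \o shift (L x)) (h *: L v) - f (L x))).
  by apply/funext => h /=; rewrite lL.
split.
- by move=> x Ux; apply: continuous_comp; [exact: cL|exact: cf].
- by move=> v x Ux; rewrite /derivable E; exact: df.
- move=> v; rewrite (_ : 'D_v (f \o L) = 'D_(L v) f \o L); first by apply: IH; exact: Df.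
  by apply/funext => x; rewrite /derive E.
Qed.

(** The case N = 1 of [Ck_rowcomp], transported along the linear coordinate from ['rV[R]_1] to the
    line. *)
Lemma Ck_comp1 k V (U : set V) (W : set R) (g : V -> R) (f : R -> R) :
  open U -> open W -> (forall x, U x -> W (g x)) ->
  Ck k U g -> Ck k (W : set R^o) (f : R^o -> R) -> Ck k U (f \o g).
Proof.
move=> oU oW gUW Cg Cf.
have c00 : continuous (fun x : 'rV[R]_1 => x 0 0 : R^o) by exact: coord_continuous.
have l00 (h : R) (x y : 'rV[R]_1) : ((h *: x + y) 0 0 : R^o) = h *: (x 0 0 : R^o) + y 0 0.
  by rewrite !mxE.
have Cf' := Ck_linear_comp l00 c00 Cf.
have := @Ck_rowcomp k V 1 U ((fun x : 'rV[R]_1 => x 0 0) @^-1` W) (fun x => const_mx (g x)) (fun x : 'rV[R]_1 => f (x 0 0)).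
rewrite (_ : _ \o _ = f \o g); last by apply/funext => x /=; rewrite mxE.
apply => //.
- by apply: open_comp oW => x _; exact: coord_continuous.
- by move=> x /gUW; rewrite /= mxE.
- by move=> j; rewrite (_ : (fun x => _) = g) //; apply/funext => x; rewrite mxE.
Qed.

End ChainRule.

(** * Stability properties of smooth germs *)

Section SmoothGerms.
Context {R : realType}.
Implicit Types V W : normedModType R.

Lemma Coo_at_continuous V (f : V -> R) x : Coo_at x f -> {for x, continuous f}.
Proof. by move=> [U [_ Ux /(_ 0%N)]]; exact. Qed.

Lemma Coo_at_nbhs V (f : V -> R) x : Coo_at x f -> \forall y \near x, Coo_at y f.
Proof.
move=> [U [oU Ux CU]]; apply: filterS (open_nbhs_nbhs (conj oU Ux)) => y Uy.
by exists U.
Qed.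

Lemma Coo_at_derive V (f : V -> R) x v : Coo_at x f -> Coo_at x ('D_v f).
Proof.
move=> [U [oU Ux CU]]; exists U; split=> // k.
by have [_ _ +] := CU k.+1; exact.
Qed.

Lemma open_preimage_on V W (B : set V) (C : set W) (g : V -> W) :
  open B -> open C -> (forall x, B x -> {for x, continuous g}) ->
  open (B `&` g @^-1` C).
Proof.
move=> oB oC cg; rewrite openE => y [By Cy].
apply: filterI; first exact: open_nbhs_nbhs.
by apply: (cg _ By); exact: open_nbhs_nbhs.
Qed.

Lemma Coo_at_rowcomp V N (g : V -> 'rV[R]_N) f x :
  (forall j, Coo_at x (fun y => g y 0 j)) -> Coo_at (g x) f ->
  Coo_at x (f \o g).
Proof.
move=> /choice[U HU] [W [oW Wx CW]].
have : nbhs x (fun y => forall j, U j y).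
  by apply: filter_forall => j; have [oU Ux _] := HU j; exact: open_nbhs_nbhs.
rewrite nbhsE => -[B [oB Bx] BU].
have CB k j : Ck k B (fun y => g y 0 j).
  by apply: (@Ck_sub _ _ k (U j)) => [y /BU//|]; have [_ _] := HU j; exact.
have cg y : B y -> {for y, continuous g}.
  by move=> By; apply: row_cvgP => j; exact: (CB 0%N j).
have oBW := open_preimage_on oB oW cg.
exists (B `&` g @^-1` W); split => // k.
apply: (@Ck_rowcomp _ k _ _ _ W) => //; first by move=> y [].
by move=> j; apply: Ck_sub (CB k j) => y [].
Qed.

Lemma Coo_at_comp1 V (g : V -> R) (f : R -> R) x :
  Coo_at x g -> Coo_at (g x : R^o) (f : R^o -> R) -> Coo_at x (f \o g).
Proof.
move=> [U [oU Ux CU]] [W [oW Wx CW]].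
have oUW : open (U `&` g @^-1` W).
  by apply: open_preimage_on => // y Uy; exact: (CU 0%N).
exists (U `&` g @^-1` W); split=> // k.
apply: (@Ck_comp1 _ k _ _ W) => //; first by move=> y [].
by apply: Ck_sub (CU k) => y [].
Qed.

Lemma Coo_at_linear_comp V W (L : V -> W) f x :
  (forall h x y, L (h *: x + y) = h *: L x + L y) -> continuous L ->
  Coo_at (L x) f -> Coo_at x (f \o L).
Proof.
move=> lL cL [U [oU Ux CU]]; exists (L @^-1` U); split=> //.
  by apply: open_comp oU => y _; exact: cL.
by move=> k; exact: Ck_linear_comp.
Qed.

Lemma Coo_at_coord N (x : 'rV[R]_N) j : Coo_at x (fun y : 'rV[R]_N => y 0 j).
Proof.
by apply: Coo_at_linear => [h v y|]; [rewrite !mxE|exact: coord_continuous].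
Qed.

Lemma Coo_at_id (x : R) : Coo_at (x : R^o) (id : R^o -> R).
Proof. by apply: Coo_at_linear => // y; exact: cvg_id. Qed.

Lemma Coo_at_sum V (I : Type) (r : seq I) (f : I -> V -> R) x :
  (forall i, Coo_at x (f i)) -> Coo_at x (fun y => \sum_(i <- r) f i y).
Proof.
move=> H; elim: r => [|i r IH].
  by under eq_fun do rewrite big_nil; exact: Coo_at_cst.
by under eq_fun do rewrite big_cons; exact: (Coo_atD (H i) IH).
Qed.

Lemma Coo_atN V (f : V -> R) x : Coo_at x f -> Coo_at x (fun y => - f y).
Proof.
move=> Cf; rewrite (_ : (fun y => _) = cst (-1) * f).
  by apply: Coo_atM => //; exact: Coo_at_cst.
by apply/funext => y; rewrite !fctE mulN1r.
Qed.

Lemma Coo_atB V (f g : V -> R) x : Coo_at x f -> Coo_at x g ->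
  Coo_at x (fun y => f y - g y).
Proof. by move=> Cf Cg; exact: (Coo_atD Cf (Coo_atN Cg)). Qed.

(** Derivatives stay in the linear span of the family, so order k for all members gives order k + 1
    for all members at once. Applied to the functions [flat n]. *)
Lemma Coo_closed V (U : set V) (I : Type) (P : I -> V -> R) : open U ->
  (forall i x, U x -> {for x, continuous (P i)}) ->
  (forall i v x, U x -> derivable (P i) x v) ->
  (forall i v, exists2 s : seq (R * I), True &
     forall x, U x -> 'D_v (P i) x = \sum_(a <- s) a.1 * P a.2 x) ->
  forall i, Coo U (P i).
Proof.
move=> oU cP dP DP i k; elim: k i => [|k IH] i; first exact: cP.
split=> [x|v x|v]; [exact: cP|exact: dP|].
have [s _ Ds] := DP i v.
apply: (@Ck_eq _ _ k U (fun x => \sum_(a <- s) a.1 * P a.2 x)) => //.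
  by move=> x Ux; rewrite Ds.
by apply: Ck_sum => // a; exact: (CkM oU (Ck_cst _ _ a.1) (IH a.2)).
Qed.

Lemma Ro_derive (f : R -> R) (x v : R) (df : R) : is_derive x (1 : R) f df ->
  is_derive (x : R^o) (v : R^o) (f : R^o -> R) (v * df).
Proof.
move=> [d1 d2]; have dd : differentiable f x by exact/derivable1_diffP.
apply: DeriveDef; first exact: diff_derivable.
rewrite deriveE // -d2 deriveE //= -{1}[v]mulr1 -[v * 1]/(v *: (1 : R)) linearZ //.
Qed.

Lemma Coo_at_invR (x : R) : x != 0 -> Coo_at (x : R^o) (@GRing.inv R : R^o -> R).
Proof.
move=> x0; have o0 : open [set y : R^o | y != 0] := @open_neq R 0.
exists [set y : R^o | y != 0]; split=> //.
have D (y v : R) : y != 0 -> is_derive (y : R^o) (v : R^o) (@GRing.inv R : R^o -> R) (- v * (y^-1 * y^-1)).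
  move=> y0; have d1 : is_derive y (1 : R) (@GRing.inv R) (- (y^-1 * y^-1)).
    apply: (is_derive_eq (@is_deriveV R id y 1 1 y0 (is_derive_id _ _))).
    by rewrite /GRing.scale /= mulr1 expr2 invfM.
  by rewrite mulNr -mulrN; exact: Ro_derive.
elim=> [|k IH]; first by move=> y /= y0; exact: inv_continuous.
split=> [y y0|v y y0|v]; [exact: inv_continuous|by have [] := D y v y0|].
apply: (@Ck_eq _ _ k _ (cst (- v) * ((@GRing.inv R : R^o -> R) * (@GRing.inv R : R^o -> R)))) => //.
  by move=> y y0; have [_ ->] := D y v y0.
exact: (CkM o0 (Ck_cst _ _ (- v)) (CkM o0 IH IH)).
Qed.

Lemma Coo_atV V (f : V -> R) x : Coo_at x f -> f x != 0 ->
  Coo_at x (fun y => (f y)^-1).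
Proof. by move=> Cf fx; apply: Coo_at_comp1 Cf _; exact: Coo_at_invR. Qed.

End SmoothGerms.

(** * Smooth cutoff functions *)

Section Bump.
Context {R : realType}.

(* The functions t^-n exp(-1/t) on t > 0, extended by 0, span a space of
   functions stable under derivation. *)
Definition flat (n : nat) (t : R) : R :=
  if 0 < t then t ^- n * expR (- t^-1) else 0.

Lemma flat_ge0 n t : 0 <= flat n t.
Proof.
rewrite /flat; case: ifP => // t0.
by rewrite mulr_ge0 ?expR_ge0 // invr_ge0 exprn_ge0 // ltW.
Qed.

Lemma flat_gt0 n t : 0 < t -> 0 < flat n t.
Proof.
by move=> t0; rewrite /flat t0 mulr_gt0 ?expR_gt0 // invr_gt0 exprn_gt0.
Qed.

Lemma flat_le0 n t : t <= 0 -> flat n t = 0.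
Proof. by rewrite /flat leNgt => /negbTE ->. Qed.

(** From exp(s) >= (s/N)^N with s = 1/t and N = n + 1. The linear bound gives the derivative 0 at
    the origin for every [flat n]. *)
Lemma flat_bound n t : flat n t <= n.+1%:R ^+ n.+1 * `|t|.
Proof.
rewrite /flat; case: ifP => [t0|_]; last by rewrite mulr_ge0 ?exprn_ge0.
rewrite (gtr0_norm t0) expRN ler_pdivrMr ?expR_gt0 //.
set N : R := n.+1%:R; have N0 : 0 < N by rewrite ltr0n.
have E : expR t^-1 = expR (t^-1 / N) ^+ n.+1.
  by rewrite -expRM_natl mulrC divfK // gt_eqF.
have L : (t^-1 / N) ^+ n.+1 <= expR t^-1.
  rewrite E lerXn2r ?nnegrE ?expR_ge0 //.
    by rewrite mulr_ge0 // invr_ge0 ltW.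
  by apply: le_trans (expR_ge1Dx _); rewrite lerDr ler01.
apply: le_trans (_ : _ <= N ^+ n.+1 * t * (t^-1 / N) ^+ n.+1) _; last first.
  by rewrite ler_pM2l // mulr_gt0 // exprn_gt0.
rewrite le_eqVlt; apply/orP; left; apply/eqP.
have Ne : N ^+ n.+1 != 0 by rewrite expf_neq0 // gt_eqF.
rewrite expr_div_n exprVn; move: (N ^+ n.+1) Ne => a Ne; rewrite exprS; field.
by rewrite Ne expf_neq0 gt_eqF.
Qed.

Lemma flat_derive n t :
  is_derive t (1 : R) (flat n) (flat n.+2 t - n%:R * flat n.+1 t).
Proof.
case: (ltrgtP t 0) => [t0|t0|->].
- rewrite !flat_le0 ?ltW // mulr0 subr0.
  apply: (near_eq_is_derive _ (is_derive_cst (0 : R) t 1)).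
  by near=> y; rewrite flat_le0 // ltW //; near: y; exact: lt_nbhsl.
- have d0 : is_derive t (1 : R) (fun y : R => y ^- n * expR (- y^-1))
     (flat n.+2 t - n%:R * flat n.+1 t).
    have tn : t != 0 by rewrite gt_eqF.
    have d1 : is_derive t (1 : R) (fun y : R => y^-1) (- (t ^- 2)).
      apply: (is_derive_eq (@is_deriveV R id t 1 1 tn (is_derive_id _ _))).
      by rewrite scaler1.
    have d2 : is_derive t (1 : R) (fun y : R => (y^-1) ^+ n) (n%:R * t^-1 ^+ n.-1 * (- (t ^- 2))).
      have dX : is_derive (t^-1) (1 : R) (fun y : R => y ^+ n) (n%:R * t^-1 ^+ n.-1).
        by apply: DeriveDef; [exact: exprn_derivable|rewrite exp_derive /GRing.scale /= mulr1].
      exact: (@is_derive1_comp R (fun y : R => y ^+ n) (fun y : R => y^-1) t _ _ dX d1).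
    have d3 : is_derive t (1 : R) (fun y : R => expR (- y^-1)) (expR (- t^-1) * (t ^- 2)).
      by apply: is_derive_eq; rewrite opprK.
    rewrite (_ : (fun y : R => y ^- n * _) = (fun y => (y^-1) ^+ n) * (fun y => expR (- y^-1))); last first.
      by apply/funext => y; rewrite !fctE exprVn.
    apply: (is_derive_eq (is_deriveM d2 d3)).
    rewrite /GRing.scale /= /flat t0 !exprVn; case: n {d2} => [|n] /=.
      by rewrite !mul0r mulr0 subr0 addr0 expr0 invr1 mul1r mulrC.
    rewrite !exprS; field; by rewrite tn expf_eq0 (negbTE tn) andbF.
  apply: near_eq_is_derive d0; near=> y; rewrite /flat ifT //.
  by near: y; exact: lt_nbhsr.
- rewrite !flat_le0 ?lexx // mulr0 subr0.
  have C : (fun h : R => h^-1 *: ((flat n \o shift 0) (h *: (1 : R)) - flat n 0)) @ 0^' --> (0 : R).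
    have L : (fun h : R => n.+2%:R ^+ n.+2 * `|h|) @ (0 : R)^' --> n.+2%:R ^+ n.+2 * `|0 : R|.
      apply: cvgM; first exact: cvg_cst.
      by apply: cvg_norm; exact: cvg_within.
    rewrite normr0 mulr0 in L.
    (* For h > 0 the difference quotient of [flat n] at 0 is [flat n.+1 h], which [flat_bound]
       squeezes to 0. *)
    apply: (squeeze_cvgr _ (cvg_cst 0) L).
    apply: filterS (nbhs_dnbhs_neq (0 : R)) => h h0 /=.
    rewrite addr0 [h *: 1]mulr1 (flat_le0 _ (lexx _)) subr0.
    suff -> : h^-1 *: flat n h = flat n.+1 h by rewrite flat_ge0 flat_bound.
    rewrite /flat /GRing.scale /=; case: ifP => h1; last by rewrite mulr0.
    by rewrite mulrA exprS invfM.
  apply: DeriveDef; last exact: (cvg_lim _ C).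
  by apply/cvg_ex; eexists; exact: C.
Unshelve. all: by end_near. Qed.

Lemma Coo_at_flat n (t : R) : Coo_at (t : R^o) (flat n : R^o -> R).
Proof.
exists setT; split=> //; first exact: openT.
apply: (@Coo_closed R R^o setT nat flat) => //; first exact: openT.
- move=> i x _; have [d _] := flat_derive i x.
  by apply: differentiable_continuous; exact/derivable1_diffP.
- by move=> i v x _; have [] := Ro_derive v (flat_derive i x).
- move=> i v; exists [:: (v, i.+2); (- (v * i%:R), i.+1)] => // x _.
  have [_ ->] := Ro_derive v (flat_derive i x).
  by rewrite big_cons big_seq1 /= mulrBr mulNr mulrA.
Qed.

Definition smoothstep (t : R) : R := flat 0 t / (flat 0 t + flat 0 (1 - t)).

Lemma smoothstep_den t : 0 < flat 0 t + flat 0 (1 - t).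
Proof.
have [t0|t0] := ltP 0 t; first by rewrite ltr_pwDl ?flat_gt0 ?flat_ge0.
by rewrite ltr_wpDl ?flat_ge0 // flat_gt0 // subr_gt0 (le_lt_trans t0).
Qed.

Lemma smoothstep_le0 t : t <= 0 -> smoothstep t = 0.
Proof. by move=> t0; rewrite /smoothstep flat_le0 // mul0r. Qed.

Lemma smoothstep_ge1 t : 1 <= t -> smoothstep t = 1.
Proof.
move=> t1; rewrite /smoothstep (flat_le0 _ (_ : 1 - t <= 0)) ?subr_le0 //.
by rewrite addr0 divff // gt_eqF // flat_gt0 // (lt_le_trans ltr01).
Qed.

Lemma Coo_at_smoothstep (t : R) : Coo_at (t : R^o) (smoothstep : R^o -> R).
Proof.
have C1 : Coo_at (t : R^o) (flat 0 : R^o -> R) by exact: Coo_at_flat.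
have C2 : Coo_at (t : R^o) ((fun s => flat 0 (1 - s)) : R^o -> R).
  apply: (@Coo_at_comp1 R R^o (fun s : R^o => 1 - s) (flat 0)); last exact: Coo_at_flat.
  by apply: Coo_atB; [exact: Coo_at_cst|exact: Coo_at_id].
apply: (Coo_atM C1); apply: Coo_atV; first exact: (Coo_atD C1 C2).
by rewrite gt_eqF // smoothstep_den.
Qed.

Definition sqnorm {N} (x : 'rV[R]_N) : R := \sum_j x 0 j ^+ 2.

Lemma Coo_at_sqnorm N (x : 'rV[R]_N) : Coo_at x (@sqnorm N).
Proof.
apply: (@Coo_at_sum R 'rV[R]_N _ _ (fun j (y : 'rV[R]_N) => y 0 j ^+ 2)) => j.
by rewrite (_ : (fun y => _) = (fun y : 'rV[R]_N => y 0 j) * (fun y : 'rV[R]_N => y 0 j)) //;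
  apply: Coo_atM; exact: Coo_at_coord.
Qed.

Lemma coord_le_sqnorm N (x : 'rV[R]_N) j : x 0 j ^+ 2 <= sqnorm x.
Proof.
by rewrite /sqnorm (bigD1 j) //= lerDl sumr_ge0 // => i _; rewrite sqr_ge0.
Qed.

Lemma norm_lt_sqnorm N (x : 'rV[R]_N) (e : R) : 0 <= e -> sqnorm x <= e ^+ 2 -> `|x| <= e.
Proof.
move=> e0 H; apply: row_normP => // j; rewrite -ler_sqr ?nnegrE //.
by rewrite real_normK ?num_real // (le_trans (coord_le_sqnorm x j)).
Qed.

(** The Euclidean square norm is smooth, unlike the sup norm of row vectors. The value is 1 where
    [sqnorm (x - c)] is at most r^2/2 and 0 from r^2 on. *)
Definition sbump {N} (c : 'rV[R]_N) (r : R) (x : 'rV[R]_N) : R :=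
  smoothstep (2 - 2 * sqnorm (x - c) / r ^+ 2).

Lemma Coo_at_sbump N (c : 'rV[R]_N) (r : R) x : Coo_at x (sbump c r).
Proof.
apply: (@Coo_at_comp1 R _ (fun x : 'rV[R]_N => 2 - 2 * sqnorm (x - c) / r ^+ 2) smoothstep); last exact: Coo_at_smoothstep.
apply: Coo_atB; first exact: Coo_at_cst.
apply: (@Coo_atM _ _ _ (fun x : 'rV[R]_N => 2 * sqnorm (x - c)) (cst (r ^+ 2)^-1)); last exact: Coo_at_cst.
apply: (@Coo_atM _ _ _ (cst 2) (fun x : 'rV[R]_N => sqnorm (x - c))); first exact: Coo_at_cst.
apply: (@Coo_at_rowcomp R _ _ (fun x : 'rV[R]_N => x - c) (@sqnorm N)); last exact: Coo_at_sqnorm.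
move=> j; under eq_fun do rewrite !mxE.
by apply: Coo_atB; [exact: Coo_at_coord|exact: Coo_at_cst].
Qed.

Lemma sbump_near N (c : 'rV[R]_N) (r : R) : 0 < r -> \forall x \near c, sbump c r x = 1.
Proof.
move=> r0; have Cc : {for c, continuous (fun x : 'rV[R]_N => sqnorm (x - c))}.
  apply: Coo_at_continuous.
  apply: (@Coo_at_rowcomp R _ _ (fun x : 'rV[R]_N => x - c) (@sqnorm N)); last exact: Coo_at_sqnorm.
  move=> j; under eq_fun do rewrite !mxE.
  by apply: Coo_atB; [exact: Coo_at_coord|exact: Coo_at_cst].
have S0 : sqnorm (c - c) = 0 by rewrite subrr /sqnorm big1 // => j _; rewrite mxE expr0n.
have : \forall x \near c, sqnorm (x - c) < r ^+ 2 / 2.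
  move/cvgrPdist_lt: Cc => /(_ (r ^+ 2 / 2)); rewrite divr_gt0 ?exprn_gt0 // => /(_ isT).
  by apply: filterS => x; rewrite S0 sub0r normrN; apply: le_lt_trans; exact: ler_norm.
apply: filterS => x /ltW H; rewrite /sbump smoothstep_ge1 //.
have : 2 * sqnorm (x - c) / r ^+ 2 <= 1.
  by rewrite ler_pdivrMr ?exprn_gt0 // mul1r mulrC -ler_pdivlMr.
by lra.
Qed.

Lemma sbump_out N (c : 'rV[R]_N) (r : R) x : 0 < r -> r < `|x - c| -> sbump c r x = 0.
Proof.
move=> r0 H; rewrite /sbump smoothstep_le0 // subr_le0 ler_pdivlMr ?exprn_gt0 //.
rewrite ler_pM2l //; have [//|L] := leP (r ^+ 2) (sqnorm (x - c)).
by move: H; rewrite ltNge norm_lt_sqnorm // ltW.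
Qed.

End Bump.

(** * Linear differential equations and flat systems *)

Section Primitive.
Context {R : realType}.

Definition clamp (t : R) : R := Num.max 0 (Num.min 1 t).

Lemma clamp_itv t : 0 <= clamp t <= 1.
Proof. by rewrite /clamp le_max lexx /= ge_max ler01 ge_min lexx. Qed.

Lemma clamp_id t : 0 <= t <= 1 -> clamp t = t.
Proof. by move=> /andP[t0 t1]; rewrite /clamp (min_idPr t1) (max_idPr t0). Qed.

Lemma clamp_continuous : continuous clamp.
Proof.
by move=> t; apply: continuous_max; [exact: cvg_cst|apply: continuous_min; [exact: cvg_cst|exact: cvg_id]].
Qed.

(* The integral of f from 0, with f extended from [0, 1] by constants. *)
Definition prim (f : R -> R) (x : R) : R :=
  \int[lebesgue_measure]_(t in `[-1, x]%classic) f (clamp t)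
  - \int[lebesgue_measure]_(t in `[-1, 0]%classic) f (clamp t).

Lemma prim0 f : prim f 0 = 0.
Proof. exact: subrr. Qed.

Lemma prim_derive (f : R -> R) : (forall t : R, 0 <= t <= 1 -> {for t, continuous f}) ->
  forall t : R, 0 <= t <= 1 -> is_derive t (1 : R) (prim f) (f t).
Proof.
move=> cf t t01.
have cg : continuous (f \o clamp).
  move=> s; apply: continuous_comp; first exact: clamp_continuous.
  by apply: cf; exact: clamp_itv.
have tm1 : -1 < t by case/andP: t01 => t0 _; rewrite (lt_le_trans _ t0) // ltrN10.
(* Integrating from -1 makes every point of [0, 1] interior, so that the derivative is two-sided
   even at the end points. *)
have [||||d1 d2] := @continuous_FTC1_closed R (f \o clamp) (-1) t (t + 1).
- by rewrite ltrDl ltr01.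
- apply: continuous_compact_integrable; first exact: segment_compact.
  by apply: continuous_subspaceT.
- exact: tm1.
- exact: cg.
have dF : is_derive t (1 : R) (fun x => \int[lebesgue_measure]_(t in `[-1, x]%classic) f (clamp t)) (f t).
  by apply: DeriveDef; [exact: d1|rewrite -derive1E d2 /= clamp_id].
have := is_deriveB dF (is_derive_cst (\int[lebesgue_measure]_(t in `[-1, 0]%classic) f (clamp t)) t (1 : R)).
by rewrite subr0.
Qed.

Lemma prim_cst0 (t : R) : 0 <= t <= 1 -> prim (cst 0) t = 0.
Proof.
move=> /andP[t0 t1]; apply: (etrans _ (prim0 (cst 0))).
apply: (@derive0_cst R (prim (cst 0)) 0 t t0) => s /andP[s0 st].
by apply: (@prim_derive (cst 0)) => [r _|]; [exact: cvg_cst|rewrite s0 (le_trans st)].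
Qed.

Lemma prim_dist (f g : R -> R) K :
  (forall t : R, 0 <= t <= 1 -> {for t, continuous f}) ->
  (forall t : R, 0 <= t <= 1 -> {for t, continuous g}) ->
  (forall t : R, 0 <= t <= 1 -> `|f t - g t| <= K) ->
  forall t : R, 0 <= t <= 1 -> `|prim f t - prim g t| <= K.
Proof.
move=> cf cg fgK t /andP[t0 t1].
have K0 : 0 <= K by apply: le_trans (fgK 0 _); rewrite // lexx ler01.
have := @MVT_norm R (prim f - prim g) (f - g) 0 t K t0.
rewrite !fctE !prim0 !subr0 => H; apply: le_trans (H _ _) _ => //.
- move=> s /andP[s0 st]; have s01 : 0 <= s <= 1 by rewrite s0 (le_trans st).
  by apply: is_deriveB; apply: prim_derive.
- by move=> s /andP[s0 st]; apply: fgK; rewrite s0 (le_trans st).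
- by rewrite ler_piMr.
Qed.

Lemma derivable_continuous1 (f : R -> R) (t df : R) :
  is_derive t (1 : R) f df -> {for t, continuous f}.
Proof.
by move=> [d _]; apply: differentiable_continuous; exact/derivable1_diffP.
Qed.

(** The intervals of centre [u n] and radius 2 C / 2^n are nested; the supremum of their left ends
    lies in all of them and is a limit with an explicit rate. *)
Lemma geometric_limit (u : nat -> R) (C : R) : (forall n, `|u n.+1 - u n| <= C * 2^-1 ^+ n) ->
  exists l, forall n, `|u n - l| <= 2 * C * 2^-1 ^+ n.
Proof.
move=> H; pose c n := 2 * C * 2^-1 ^+ n.
have c0 n : 0 <= c n.
  rewrite /c -mulrA mulr_ge0 //; exact: le_trans (H n).
have cS n : c n = c n.+1 + C * 2^-1 ^+ n by rewrite /c exprS; field.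
have am n m : (n <= m)%N -> u n - c n <= u m - c m.
  elim: m => [|m IH]; first by rewrite leqn0 => /eqP ->.
  rewrite leq_eqVlt ltnS => /orP[/eqP -> //|/IH h]; apply: le_trans h _.
  have /ler_normlP[h _] := H m; rewrite (cS m).
  move: h; set D := C * _; lra.
have bm n m : (n <= m)%N -> u m + c m <= u n + c n.
  elim: m => [|m IH]; first by rewrite leqn0 => /eqP ->.
  rewrite leq_eqVlt ltnS => /orP[/eqP -> //|/IH h]; apply: le_trans h.
  have /ler_normlP[_ h] := H m; rewrite (cS m).
  move: h; set D := C * _; lra.
have ab n m : u n - c n <= u m + c m.
  have [nm|/ltnW mn] := leqP n m.
    by apply: le_trans (am _ _ nm) _; rewrite lerD2l; have := c0 m; lra.
  by apply: le_trans (bm _ _ mn); rewrite lerD2l; have := c0 n; lra.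
pose S := range (fun n => u n - c n).
have hS : has_sup S.
  split; first by exists (u 0%N - c 0%N), 0%N.
  by exists (u 0%N + c 0%N) => _ [n _ <-].
exists (sup S) => n.
have h1 : u n - c n <= sup S by apply: ub_le_sup; [have [] := hS|exists n].
have h2 : sup S <= u n + c n.
  by apply: ge_sup; [have [] := hS|move=> _ [k _ <-]].
by rewrite ler_norml; apply/andP; split; rewrite -/(c n); lra.
Qed.

Lemma mulmx_row_bound N (y : 'rV[R]_N) (B : 'M[R]_N) (kap : R) :
  (forall a b, `|B a b| <= kap) -> forall k, `|(y *m B) 0 k| <= `|y| * (N%:R * kap).
Proof.
move=> HB k; rewrite mxE; apply: le_trans (ler_norm_sum _ _ _) _.
have -> : `|y| * (N%:R * kap) = \sum_(i < N) `|y| * kap.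
  by rewrite sumr_const card_ord -mulr_natl; ring.
apply: ler_sum => i _; rewrite normrM ler_pM ?normr_ge0 //.
exact: row_coord_le.
Qed.

(** On an interval of length 1 with Lipschitz constant 1/2, the mean value theorem bounds the
    maximum of |e| by half of itself plus [rho]; no exponential factor is involved. *)
Lemma small_gronwall N (e de : R -> 'rV[R]_N) (rho : R) : e 0 = 0 ->
  (forall (t : R) k, 0 <= t <= 1 -> is_derive t (1 : R) (fun s => e s 0 k) (de t 0 k)) ->
  (forall (t : R) k, 0 <= t <= 1 -> `|de t 0 k| <= 2^-1 * `|e t| + rho) ->
  0 <= rho ->
  forall t : R, 0 <= t <= 1 -> `|e t| <= 2 * rho.
Proof.
move=> e0 De He rho0.
have ce t : 0 <= t <= 1 -> {for t, continuous e}.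
  by move=> t01; apply: row_cvgP => k; exact: derivable_continuous1 (De t k t01).
have [||c c01 Hc] := @EVT_max R (fun t => `|e t|) 0 1.
- exact: ler01.
- apply: continuous_in_subspaceT => t /set_mem /=; rewrite in_itv /= => t01.
  by apply: (@continuous_comp _ _ _ e (@Num.norm _ _)); [exact: ce|exact: norm_continuous].
rewrite in_itv /= in c01.
have m k : `|e c 0 k| <= 2^-1 * `|e c| + rho.
  case/andP: (c01) => c0 c1.
  have := @MVT_norm R (fun s => e s 0 k) (fun s => de s 0 k) 0 c (2^-1 * `|e c| + rho) c0.
  rewrite e0 mxE !subr0 => H; apply: le_trans (H _ _) _.
  - by move=> t /andP[t0 tc]; apply: De; rewrite t0 (le_trans tc).
  - move=> t /andP[t0 tc]; have t01 : 0 <= t <= 1 by rewrite t0 (le_trans tc).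
    apply: le_trans (He t k t01) _; rewrite lerD2r ler_pM2l ?invr_gt0 //.
    by apply: Hc; rewrite in_itv.
  - by rewrite ler_piMr // addr_ge0 // mulr_ge0.
have : `|e c| <= 2^-1 * `|e c| + rho.
  by apply: row_normP m; rewrite addr_ge0 // mulr_ge0.
move=> h t t01; apply: (@le_trans _ _ `|e c|); first by apply: Hc; rewrite in_itv.
by move: (`|e c|) h => x; lra.
Qed.

Section LinearODE.
Variables (N : nat) (B : R -> 'M[R]_N) (kap : R).
Hypothesis cB : forall (t : R) a b, 0 <= t <= 1 -> {for t, continuous (fun s => B s a b)}.
Hypothesis bB : forall (t : R) a b, 0 <= t <= 1 -> `|B t a b| <= kap.
Hypothesis kapN : N%:R * kap <= 2^-1.

Let rhs (y : R -> 'rV[R]_N) k t : R := (y t *m B t) 0 k.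

Let rhs_cont y k : (forall t : R, 0 <= t <= 1 -> {for t, continuous y}) ->
  forall t : R, 0 <= t <= 1 -> {for t, continuous (rhs y k)}.
Proof.
move=> cy t t01; rewrite /rhs /prop_for /continuous_at.
under eq_fun do rewrite mxE; rewrite mxE; apply: cvg_sumr => i.
apply: cvgM; last exact: cB.
by apply: row_coord_cvg; exact: cy.
Qed.

Let rhs_dist y z k t : 0 <= t <= 1 -> `|rhs y k t - rhs z k t| <= 2^-1 * `|y t - z t|.
Proof.
move=> t01; have -> : rhs y k t - rhs z k t = ((y t - z t) *m B t) 0 k.
  by rewrite /rhs mulmxBl !mxE.
apply: le_trans (mulmx_row_bound (y t - z t) (fun a b => bB a b t01) k) _.
by rewrite mulrC ler_wpM2r.
Qed.

Fixpoint picard (u0 : 'rV[R]_N) n : R -> 'rV[R]_N :=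
  if n is n'.+1 then fun t => \row_k (u0 0 k + prim (rhs (picard u0 n') k) t)
  else cst u0.

Lemma picard_continuous u0 n t : 0 <= t <= 1 -> {for t, continuous (picard u0 n)}.
Proof.
elim: n t => [|n IH] t t01; first exact: cvg_cst.
apply: row_cvgP => k /=; under eq_fun do rewrite mxE; rewrite mxE.
apply: cvgD; first exact: cvg_cst.
by apply: (derivable_continuous1 (prim_derive (rhs_cont IH) t01)).
Qed.

Lemma picard_step u0 n t : 0 <= t <= 1 ->
  `|picard u0 n.+1 t - picard u0 n t| <= `|u0| * 2^-1 ^+ n.
Proof.
elim: n t => [|n IH] t t01.
  rewrite expr0 mulr1; apply: row_normP => // k; rewrite !mxE addrC addKr.
  have -> : prim (rhs (picard u0 0) k) t = prim (rhs (picard u0 0) k) t - prim (cst 0) t.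
    by rewrite prim_cst0 ?subr0.
  apply: prim_dist t01.
  - by apply: rhs_cont; exact: (@picard_continuous u0 0).
  - by move=> *; exact: cvg_cst.
  - move=> s s01; rewrite subr0.
    apply: le_trans (mulmx_row_bound u0 (fun a b => bB a b s01) k) _.
    by rewrite ler_piMr // (le_trans kapN) // invf_le1 // ler1n.
apply: row_normP => [|k]; first by rewrite mulr_ge0 // exprn_ge0.
rewrite [picard u0 n.+2]/= [in X in _ - X]/= !mxE opprD addrACA subrr add0r.
apply: (prim_dist _ _ _ t01) => [||s s01].
- by apply: rhs_cont => s s01; exact: (@picard_continuous u0 n.+1).
- by apply: rhs_cont => s s01; exact: picard_continuous.
- apply: le_trans (rhs_dist (picard u0 n.+1) _ _ s01) _; rewrite exprS mulrCA.
  by rewrite ler_pM2l ?invr_gt0 //; exact: IH.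
Qed.

(** The bound 1/2 on [N%:R * kap] makes each Picard step halve distances, so the iterates converge
    geometrically on all of [0, 1]. Applications reach the bound by shrinking the domain. *)
Lemma linear_ode u0 : exists y : R -> 'rV[R]_N, y 0 = u0 /\
  forall (t : R) k, 0 <= t <= 1 -> is_derive t (1 : R) (fun s => y s 0 k) ((y t *m B t) 0 k).
Proof.
have /choice[y Hy] : forall t, exists yt : 'rV[R]_N, 0 <= t <= 1 ->
    forall n, `|picard u0 n t - yt| <= 2 * `|u0| * 2^-1 ^+ n.
  move=> t; case: (boolP (0 <= t <= 1)) => t01; last by exists 0.
  have /choice[l Hl] : forall k, exists l, forall n, `|picard u0 n t 0 k - l| <= 2 * `|u0| * 2^-1 ^+ n.
    move=> k; apply: geometric_limit => n; apply: le_trans (picard_step u0 n t01).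
    by have := row_coord_le (picard u0 n.+1 t - picard u0 n t) k; rewrite !mxE.
  exists (\row_k l k) => _ n; apply: row_normP => [|k].
    by rewrite mulr_ge0 ?exprn_ge0 // mulr_ge0.
  by rewrite !mxE.
have small (e : R) : 0 < e -> exists n, 2 * `|u0| * 2^-1 ^+ n < e.
  move=> e0; have : (fun n => 2 * `|u0| * 2^-1 ^+ n) @ \oo --> (0 : R).
    have L : (fun n => 2 * `|u0| * 2^-1 ^+ n) @ \oo --> 2 * `|u0| * (0 : R).
      apply: cvgM; first exact: cvg_cst.
      by apply: cvg_expr; rewrite ger0_norm // invf_lt1 // ltr1n.
    by rewrite mulr0 in L.
  move/cvgrPdist_lt => /(_ e e0) [n _ /(_ n (leqnn n))] /=.
  rewrite sub0r normrN => h; exists n; exact: le_lt_trans (ler_norm _) h.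
(* y is only controlled on [0, 1], so the limit is extended by constants. *)
pose z t := y (clamp t).
have Hz t n : 0 <= t <= 1 -> `|picard u0 n t - z t| <= 2 * `|u0| * 2^-1 ^+ n.
  by move=> t01; rewrite /z clamp_id //; exact: Hy.
have cz : continuous z.
  move=> t; apply/cvgrPdist_lt => e e0.
  have [n Hn] := small (e / 3) (divr_gt0 e0 (ltr0n _ 3)).
  have cp : {for t, continuous (picard u0 n \o clamp)}.
    apply: continuous_comp; first exact: clamp_continuous.
    by apply: picard_continuous; exact: clamp_itv.
  move/cvgrPdist_lt: cp => /(_ (e / 3) (divr_gt0 e0 (ltr0n _ 3))).
  apply: filterS => s /= Hs.
  have h1 := Hy _ (clamp_itv t) n; have h2 := Hy _ (clamp_itv s) n.
  rewrite /z (_ : y (clamp t) - y (clamp s) = (picard u0 n (clamp t) - picard u0 n (clamp s))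
    - (picard u0 n (clamp t) - y (clamp t)) + (picard u0 n (clamp s) - y (clamp s))); last first.
    by apply/rowP => j; rewrite !mxE; ring.
  apply: le_lt_trans (ler_normD _ _) _.
  apply: le_lt_trans (lerD (ler_normB _ _) (lexx _)) _.
  by lra.
have fixz t k : 0 <= t <= 1 -> z t 0 k = u0 0 k + prim (rhs z k) t.
  move=> t01; apply/eqP; rewrite -subr_eq0 -normr_le0; apply/ler_addgt0Pl => e e0.
  rewrite addr0; have [n Hn] := small e e0; apply: le_trans (ltW Hn).
  rewrite (_ : z t 0 k - _ = - (picard u0 n.+1 t - z t) 0 k
     + (prim (rhs (picard u0 n) k) t - prim (rhs z k) t)); last by rewrite !mxE; ring.
  apply: le_trans (ler_normD _ _) _; rewrite normrN.
  have h1 : `|(picard u0 n.+1 t - z t) 0 k| <= 2^-1 * (2 * `|u0| * 2^-1 ^+ n).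
    apply: le_trans (row_coord_le _ _) _; apply: le_trans (Hz t n.+1 t01) _.
    by rewrite exprS mulrCA.
  have h2 : `|prim (rhs (picard u0 n) k) t - prim (rhs z k) t| <= 2^-1 * (2 * `|u0| * 2^-1 ^+ n).
    apply: (prim_dist _ _ _ t01) => [||s s01].
    - by apply: rhs_cont => s s01; exact: picard_continuous.
    - by apply: rhs_cont => s s01; exact: cz.
    - apply: le_trans (rhs_dist _ _ _ s01) _.
      by rewrite ler_pM2l ?invr_gt0 //; exact: Hz.
  by move: h1 h2; lra.
(* [z] is constant outside [0, 1] and may have corners at the end points; the integral expression
   agrees with it on [0, 1] and is derivable from both sides there. *)
exists (fun t => \row_k (u0 0 k + prim (rhs z k) t)); split.
  by apply/rowP => k; rewrite !mxE prim0 addr0.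
move=> t k t01; under eq_fun do rewrite mxE.
rewrite (_ : \row_k0 _ = z t); last by apply/rowP => j; rewrite !mxE fixz.
have d := prim_derive (@rhs_cont z k (fun s _ => cz s)) t01.
apply: (is_derive_eq (is_deriveD (is_derive_cst (u0 0 k) _ _) d)).
by rewrite add0r.
Qed.
End LinearODE.

End Primitive.

(** * Differentiation under the integral and Hadamard's lemma *)

Section Hadamard.
Context {R : realType}.

Lemma is_derive_est (V : normedModType R) (f : V -> R) (x v : V) (l : R) :
  (forall e : R, 0 < e -> \forall s \near (0 : R), `|f (s *: v + x) - f x - s * l| <= e * `|s|) ->
  is_derive x v f l.
Proof.
move=> H; have C : (fun h : R => h^-1 *: ((f \o shift x) (h *: v) - f x)) @ 0^' --> l.
  apply/cvgrPdist_le => e e0; have := H e e0; move=> /(@cvg_within _ (nbhs (0 : R)) _ (fun y => y != 0)).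
  apply: filterS2 (nbhs_dnbhs_neq (0 : R)) => s s0 /= Hs.
  rewrite (_ : l - _ = - s^-1 * (f (s *: v + x) - f x - s * l)); last first.
    by rewrite /GRing.scale /=; field.
  by rewrite normrM normrN normfV mulrC ler_pdivrMr ?normr_gt0.
apply: DeriveDef; last exact: (cvg_lim _ C).
by apply/cvg_ex; eexists; exact: C.
Qed.

Lemma is_derive_sumr (V : normedModType R) (I : Type) (r : seq I)
    (F : I -> V -> R) (dF : I -> R) (x v : V) :
  (forall i, is_derive x v (F i) (dF i)) ->
  is_derive x v (fun y => \sum_(i <- r) F i y) (\sum_(i <- r) dF i).
Proof.
move=> H; elim: r => [|i r IH].
  by under eq_fun do rewrite big_nil; rewrite big_nil; exact: is_derive_cst.
by under eq_fun do rewrite big_cons; rewrite big_cons; exact: (is_deriveD (H i) IH).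
Qed.

Lemma is_derive_coord N (x v : 'rV[R]_N) j : is_derive x v (fun y : 'rV[R]_N => y 0 j) (v 0 j).
Proof.
apply: is_derive_est => e e0; apply: filterE => s.
by rewrite !mxE addrK subrr normr0 mulr_ge0 // ltW.
Qed.

Lemma is_derive_row N (f : 'rV[R]_N -> R) x v : Coo_at x f ->
  is_derive x v f (\sum_j v 0 j * 'D_(ebase j) f x).
Proof.
move=> Cf; have := @is_derive_rowcomp R 'rV[R]_N N id f x v.
rewrite (eq_bigr (fun j => v 0 j * 'D_(ebase j) f x)); last first.
  by move=> j _; have [_ ->] := is_derive_coord x v j.
apply.
- by move=> j; have [] := is_derive_coord x v j.
- apply: filterS (Coo_at_nbhs Cf) => z Cz j; exact: Coo_at_derivable.
- by move=> j; apply: Coo_at_continuous; exact: Coo_at_derive.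
Qed.

Lemma is_derive_scale N (f : 'rV[R]_N -> R) x v a : Coo_at x f ->
  is_derive x (a *: v) f (a * 'D_v f x).
Proof.
move=> Cf; apply: (is_derive_eq (is_derive_row (a *: v) Cf)).
have [_ ->] := is_derive_row v Cf; rewrite mulr_sumr; apply: eq_bigr => j _.
by rewrite !mxE mulrA.
Qed.

Lemma segment_norm N (x : 'rV[R]_N) (t : R) : 0 <= t <= 1 -> `|t *: x| <= `|x|.
Proof.
by move=> /andP[t0 t1]; rewrite normrZ (ger0_norm t0) ler_piMl.
Qed.

Lemma unif_segment N (g : 'rV[R]_N -> R) x (e : R) :
  (forall t : R, 0 <= t <= 1 -> {for t *: x, continuous g}) -> 0 < e ->
  \forall y \near x, forall t : R, 0 <= t <= 1 -> `|g (t *: y) - g (t *: x)| <= e.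
Proof.
move=> cg e0.
have /compact_near_coveringP /(_ _ (nbhs x) (fun y t => `|g (t *: y) - g (t *: x)| <= e)) H
  := @segment_compact R 0 1.
have {}H : \forall y \near x, `[0, 1]%classic `<=` (fun t => `|g (t *: y) - g (t *: x)| <= e).
  apply: H => t /= ; rewrite in_itv /= => t01.
  have c2 : (fun p : R * 'rV[R]_N => g (p.1 *: p.2)) @ (t, x) --> g (t *: x).
    apply: (@continuous_comp _ _ _ (fun p : R * 'rV[R]_N => p.1 *: p.2) g (t, x)); last exact: cg.
    exact: (@scale_continuous R 'rV[R]_N (t, x)).
  have c1 : (fun p : R * 'rV[R]_N => g (p.1 *: x)) @ (t, x) --> g (t *: x).
    apply: (@continuous_comp _ _ _ (fun p : R * 'rV[R]_N => p.1 *: x) g (t, x)); last exact: cg.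
    by apply: cvgZr_tmp; exact: cvg_fst.
  have C : (fun p : R * 'rV[R]_N => g (p.1 *: p.2) - g (p.1 *: x)) @ (t, x) --> (0 : R).
    by have H := cvgB c2 c1; rewrite subrr in H; exact: H.
  move/cvgrPdist_le: C => /(_ e e0).
  by apply: filterS => p; rewrite sub0r normrN.
by apply: filterS H => y Hy t t01; apply: Hy; rewrite /= in_itv.
Qed.

Lemma near0_line (V : normedModType R) (P : set V) (x v : V) : (\forall y \near x, P y) ->
  \forall s \near (0 : R), forall c : R, 0 <= c <= 1 -> P ((c * s) *: v + x).
Proof.
move=> /nbhs_ballP[r /= r0 Hr].
have [->|v0] := eqVneq v 0.
  apply: filterE => s c _; rewrite scaler0 add0r; apply: Hr; exact: ballxx.
have rv : 0 < r / `|v| by rewrite divr_gt0 // normr_gt0.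
exists (r / `|v|) => //= s; rewrite /ball_ /= sub0r normrN => sr c /andP[c0 c1].
apply: Hr; rewrite -ball_normE /= distrC addrK normrZ normrM (ger0_norm c0).
rewrite -ltr_pdivlMr ?normr_gt0 //; apply: le_lt_trans sr.
by rewrite ler_piMl.
Qed.

(** The integral of t^j f(t x) over [0, 1]. A derivation in x raises the exponent by one, so the
    weights t^j keep the family closed under derivation. *)
Definition moment N (f : 'rV[R]_N -> R) (j : nat) (x : 'rV[R]_N) : R :=
  prim (fun t => t ^+ j * f (t *: x)) 1.

Section Moment.
Variables (N : nat) (r : R).
Let U : set 'rV[R]_N := [set x | `|x| < r].

Lemma open_norm_lt : open U.
Proof.
have -> : U = (@Num.norm _ _) @^-1` [set y : R | y < r] by [].
by apply: open_comp; [move=> x _; exact: norm_continuous|exact: open_lt].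
Qed.

Let U_seg x (t : R) : U x -> 0 <= t <= 1 -> U (t *: x).
Proof. by move=> Ux t01; apply: le_lt_trans (segment_norm x t01) Ux. Qed.

Let cont_integrand f j x : (forall y, U y -> {for y, continuous f}) -> U x ->
  forall t : R, 0 <= t <= 1 -> {for t, continuous (fun t : R => t ^+ j * f (t *: x))}.
Proof.
move=> cf Ux t t01; apply: cvgM; first exact: exprn_continuous.
apply: (@continuous_comp _ _ _ (fun t : R => t *: x) f).
  by apply: cvgZr_tmp; exact: cvg_id.
by apply: cf; exact: U_seg.
Qed.

Lemma moment_continuous f j : (forall y, U y -> {for y, continuous f}) ->
  forall x, U x -> {for x, continuous (moment f j)}.
Proof.
move=> cf x Ux; apply/(@cvgrPdist_le _ _ _ (nbhs x)) => e e0.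
have := @unif_segment N f x e (fun t t01 => cf _ (U_seg Ux t01)) e0.
apply: filterS2 (open_nbhs_nbhs (conj open_norm_lt Ux)) => y Uy Hy.
apply: (@prim_dist R _ _ e); [exact: cont_integrand|exact: cont_integrand| |by rewrite ler01 lexx].
move=> t t01; rewrite -mulrBr normrM distrC; case/andP: (t01) => t0 t1.
apply: le_trans (Hy t t01); rewrite ler_piMl // ger0_norm ?exprn_ge0 //.
by rewrite exprn_ile1.
Qed.

Lemma moment_derive f j x v : Coo U f -> U x ->
  is_derive x v (moment f j) (moment ('D_v f) j.+1 x).
Proof.
move=> Cf Ux.
have cf y : U y -> {for y, continuous f} by exact: (Cf 0%N).
have cd y : U y -> {for y, continuous ('D_v f)}.
  by have [_ _ /(_ v)] := Cf 1%N; apply.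
have df y : U y -> derivable f y v by have [_ + _] := Cf 1%N; exact.
apply: is_derive_est => e e0.
have := @unif_segment N ('D_v f) x e (fun t t01 => cd _ (U_seg Ux t01)) e0.
move=> /(near0_line v); apply: filterS2 (near0_line v (open_nbhs_nbhs (conj open_norm_lt Ux))).
move=> s Us Hs.
have Ux' : U (s *: v + x) by have := Us 1; rewrite mul1r; apply; rewrite ler01 lexx.
(* The first-order expansion of the integrand at [s *: v + x]; its integral is the expected
   expansion of the moment, so it remains to bound the integrands pointwise. *)
pose F t := t ^+ j * f (t *: x) + s * (t ^+ j.+1 * 'D_v f (t *: x)).
have cF (t : R) : 0 <= t <= 1 -> {for t, continuous F}.
  move=> t01; have c1 := @cont_integrand f j x cf Ux t t01.
  have c2 := @cont_integrand ('D_v f) j.+1 x cd Ux t t01.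
  by apply: cvgD; [exact: c1|apply: cvgM; [exact: cvg_cst|exact: c2]].
have E : prim F 1 = moment f j x + s * moment ('D_v f) j.+1 x.
  pose G t := prim (fun t => t ^+ j * f (t *: x)) t + s * prim (fun t => t ^+ j.+1 * 'D_v f (t *: x)) t.
  have : (prim F - G) 1 = (prim F - G) 0.
    apply: derive0_cst => [|t t01]; first exact: ler01.
    rewrite -(subrr (F t)); apply: is_deriveB; first exact: prim_derive.
    apply: is_deriveD; first exact: (prim_derive (@cont_integrand f j x cf Ux) t01).
    have d := prim_derive (@cont_integrand ('D_v f) j.+1 x cd Ux) t01.
    exact: (is_deriveZ s d).
  rewrite !fctE /G !prim0 mulr0 addr0 subrr => /eqP; rewrite subr_eq0 => /eqP ->.
  by [].
rewrite -addrA -opprD -E; apply: (@prim_dist R _ _ (e * `|s|)) => //.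
- exact: cont_integrand.
- move=> t t01; have Cy c : 0 <= c <= 1 -> Coo_at (c *: ((s * t) *: v) + t *: x) f.
    move=> c01; rewrite (_ : c *: _ + _ = t *: ((c * s) *: v + x)); last first.
      by rewrite scalerDr !scalerA; congr (_ *: _ + _); ring.
    by exists U; split => //; [exact: open_norm_lt|exact: (U_seg (Us c c01) t01)].
  have [|c c01 Hc] := @MVT_line R _ f (t *: x) ((s * t) *: v).
    by move=> c c01; have [] := is_derive_scale v (s * t) (Cy c c01).
  have Es : t *: (s *: v + x) = (s * t) *: v + t *: x by rewrite scalerDr scalerA mulrC.
  have [_ Ed] := is_derive_scale v (s * t) (Cy c c01); rewrite Ed in Hc.
  have Ec : c *: ((s * t) *: v) + t *: x = t *: ((c * s) *: v + x).
    by rewrite scalerDr !scalerA; congr (_ *: _ + _); ring.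
  rewrite Ec in Hc; rewrite Es /F opprD addrA -mulrBr Hc.
  rewrite (_ : _ - _ = s * t ^+ j.+1 * ('D_v f (t *: ((c * s) *: v + x)) - 'D_v f (t *: x))); last first.
    by rewrite exprS; ring.
  case/andP: (t01) => t0 t1; rewrite normrM mulrC normrM; apply: ler_pM => //.
  - exact: Hs.
  - by rewrite ler_piMr // ger0_norm ?exprn_ge0 // exprn_ile1.
- by rewrite ler01 lexx.
Qed.

Lemma moment_Coo f j : Coo U f -> Coo U (moment f j).
Proof.
move=> Cf k; elim: k f j Cf => [|k IH] f j Cf.
  by apply: moment_continuous; exact: (Cf 0%N).
split=> [|v x Ux|v].
- by apply: moment_continuous; exact: (Cf 0%N).
- by have [] := moment_derive j v Cf Ux.
- apply: (@Ck_eq _ _ k U (moment ('D_v f) j.+1)); first exact: open_norm_lt.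
    by move=> x Ux; have [_ ->] := moment_derive j v Cf Ux.
  by apply: IH => i; have [_ _ +] := Cf i.+1; exact.
Qed.

End Moment.

(** The factors are the integrals of the partials along the segment from 0, smooth by [moment_Coo].
    Through this factorisation an abstract derivation becomes a combination of partial
    derivatives. *)
Lemma hadamard0 N (f : 'rV[R]_N -> R) : Coo_at 0 f ->
  exists2 h : 'I_N -> 'rV[R]_N -> R, forall i, Coo_at 0 (h i) /\ h i 0 = 'D_(ebase i) f 0
    & \forall x \near (0 : 'rV[R]_N), f x = f 0 + \sum_i x 0 i * h i x.
Proof.
move=> [V [oV V0 CV]].
have [r r0 rV] : exists2 r : R, 0 < r & [set x : 'rV[R]_N | `|x| < r] `<=` V.
  have /nbhs_ballP[r /= r0 Hr] : nbhs (0 : 'rV[R]_N) V by exact: open_nbhs_nbhs.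
  by exists r => // x xr; apply: Hr; rewrite -ball_normE /= sub0r normrN.
set U := [set x : 'rV[R]_N | `|x| < r] in rV.
have Cf : Coo U f by move=> k; exact: Ck_sub (CV k).
have oU : open U by exact: open_norm_lt.
have U0 : U 0 by rewrite /U /= normr0.
have CD i : Coo U ('D_(ebase i) f) by move=> k; have [_ _ +] := Cf k.+1; exact.
have cD i y : U y -> {for y, continuous ('D_(ebase i) f)} by exact: (CD i 0%N).
have U_seg x (t : R) : U x -> 0 <= t <= 1 -> U (t *: x).
  by move=> Ux t01; apply: le_lt_trans (segment_norm x t01) Ux.
have ci x i (t : R) : U x -> 0 <= t <= 1 -> {for t, continuous (fun t : R => t ^+ 0 * 'D_(ebase i) f (t *: x))}.
  move=> Ux t01; apply: cvgM; first exact: exprn_continuous.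
  apply: (@continuous_comp _ _ _ (fun t : R => t *: x) ('D_(ebase i) f) t); last by apply: cD; exact: U_seg.
  by apply: cvgZr_tmp; exact: cvg_id.
exists (fun i => moment ('D_(ebase i) f) 0).
  move=> i; split; first by exists U; split=> //; exact: moment_Coo.
  rewrite /moment; have : (prim (fun t : R => t ^+ 0 * 'D_(ebase i) f (t *: 0)) - (fun t : R => 'D_(ebase i) f 0 * t)) 1
    = (prim (fun t : R => t ^+ 0 * 'D_(ebase i) f (t *: 0)) - (fun t : R => 'D_(ebase i) f 0 * t)) 0.
    apply: derive0_cst => [|t t01]; first exact: ler01.
    have d := prim_derive (fun t t01 => ci 0 i t U0 t01) t01.
    have d2 : is_derive t (1 : R) (fun t : R => 'D_(ebase i) f 0 * t) ('D_(ebase i) f 0).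
      apply: (is_derive_eq (is_deriveZ ('D_(ebase i) f 0) (is_derive_id t (1 : R)))).
      by rewrite /GRing.scale /= mulr1.
    apply: (is_derive_eq (is_deriveB d d2)).
    by rewrite expr0 mul1r scaler0 subrr.
  by rewrite !fctE prim0 mulr1 mulr0 subrr => /eqP; rewrite subr_eq0 => /eqP.
apply: filterS (open_nbhs_nbhs (conj oU U0)) => x Ux.
pose G t := \sum_i x 0 i * prim (fun t => t ^+ 0 * 'D_(ebase i) f (t *: x)) t.
pose F (t : R) := f (t *: x).
have : (F - G) 1 = (F - G) 0.
  apply: derive0_cst => [|t t01]; first exact: ler01.
  have Ct : Coo_at (t *: x) f by exists U; split=> //; exact: U_seg.
  have d1 : is_derive t (1 : R) F (\sum_i x 0 i * 'D_(ebase i) f (t *: x)).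
    have [d dE] := is_derive_row x Ct.
    have := @is_derive_line R _ _ f 0 x t; rewrite addr0 dE => /(_ d).
    by rewrite /F; under eq_fun do rewrite addr0.
  have d2 : is_derive t (1 : R) G (\sum_i x 0 i * 'D_(ebase i) f (t *: x)).
    apply: (@is_derive_sumr R _ _ (fun i t => x 0 i * prim (fun t => t ^+ 0 * 'D_(ebase i) f (t *: x)) t)) => i.
    have d := prim_derive (fun t t01 => ci x i t Ux t01) t01.
    by apply: (is_derive_eq (is_deriveZ (x 0 i) d)); rewrite expr0 mul1r.
  by apply: (is_derive_eq (is_deriveB d1 d2)); rewrite subrr.
rewrite !fctE /F /G scale1r scale0r => /eqP; rewrite subr_eq addrAC.
rewrite (eq_bigr (fun=> 0) (F1 := fun i => x 0 i * prim _ 0)); last by move=> i _; rewrite prim0 mulr0.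
by rewrite big1_eq subr0 => /eqP.
Qed.

Lemma hadamard N (f : 'rV[R]_N -> R) c : Coo_at c f ->
  exists2 h : 'I_N -> 'rV[R]_N -> R, forall i, Coo_at c (h i) /\ h i c = 'D_(ebase i) f c
    & \forall x \near c, f x = f c + \sum_i (x 0 i - c 0 i) * h i x.
Proof.
move=> Cf.
have Csh (g : 'rV[R]_N -> R) (a b : 'rV[R]_N) : Coo_at (b + a) g -> Coo_at b (fun x => g (x + a)).
  move=> Cg; apply: (@Coo_at_rowcomp R _ _ (fun x => x + a) g) => // j.
  under eq_fun do rewrite mxE.
  by apply: (Coo_atD (Coo_at_coord b j)); exact: Coo_at_cst.
have [|h Hh Hf] := @hadamard0 N (fun x => f (x + c)); first by apply: Csh; rewrite add0r.
exists (fun i x => h i (x - c)) => [i|].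
  have [H1 H2] := Hh i; split; first by apply: Csh; rewrite subrr.
  rewrite subrr H2 /derive; set F1 := (X in lim (X @ _)); set F2 := (X in _ = lim (X @ _)).
  suff -> : F1 = F2 by [].
  by apply/funext => t; rewrite /F1 /F2 /= addr0 add0r.
have : \forall x \near c, f (x - c + c) = f (0 + c) + \sum_i (x - c) 0 i * h i (x - c).
  have C : (fun x : 'rV[R]_N => x - c) @ c --> (0 : 'rV[R]_N).
    apply: (@row_cvgP _ _ _ (nbhs c)) => j; under eq_fun do rewrite !mxE.
    have C : {for c, continuous (fun x : 'rV[R]_N => x 0 j - c 0 j)}.
      by apply: Coo_at_continuous; apply: Coo_atB; [exact: Coo_at_coord|exact: Coo_at_cst].
    by rewrite /prop_for /continuous_at subrr in C; rewrite mxE.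
  exact: (C _ Hf).
apply: filterS => x; rewrite subrK add0r => ->; congr (_ + _).
by apply: eq_bigr => i _; rewrite !mxE.
Qed.

End Hadamard.

(** * Parallel sections of a flat connection on a ball *)

Section FlatSystem.
Context {R : realType}.
Variables (d N : nat) (A : 'I_d -> 'rV[R]_d -> 'M[R]_N).

(** The connection form contracted with [v], acting on row vectors from the right: [u] is parallel
    when its derivative along [v] is [u x *m conn v x]. *)
Definition conn (v x : 'rV[R]_d) : 'M[R]_N := \sum_i v 0 i *: A i x.
Definition dconn (u v x : 'rV[R]_d) : 'M[R]_N :=
  \matrix_(a, b) 'D_u (fun y => conn v y a b) x.

Lemma connE v x a b : conn v x a b = \sum_i v 0 i * A i x a b.
Proof. by rewrite /conn summxE; apply: eq_bigr => i _; rewrite mxE. Qed.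

Variable r : R.
Hypothesis r_gt0 : 0 < r.
Let U : set 'rV[R]_d := [set x | `|x| < r].
Let oU : open U. Proof. exact: open_norm_lt. Qed.
Let U_seg x (t : R) : U x -> 0 <= t <= 1 -> U (t *: x).
Proof. by move=> Ux t01; apply: le_lt_trans (segment_norm x t01) Ux. Qed.

Hypothesis smA : forall i a b, Coo U (fun x => A i x a b).
Hypothesis flatA : forall x u v, U x ->
  conn u x *m conn v x + dconn u v x = conn v x *m conn u x + dconn v u x.

Lemma conn_Coo v a b : Coo U (fun x => conn v x a b).
Proof.
move=> k; under eq_fun do rewrite connE.
apply: Ck_sum => // i; exact: (CkM oU (Ck_cst _ _ (v 0 i)) (smA i a b k)).
Qed.

Let conn_at v a b x : U x -> Coo_at x (fun x => conn v x a b).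
Proof. by move=> Ux; exists U; split => //; exact: conn_Coo. Qed.

(* The ray solution from 0 to z is y' = y conn_z(t z). *)
Let B (z : 'rV[R]_d) (t : R) : 'M[R]_N := conn z (t *: z).
Let G v x : 'M[R]_N := conn v x + dconn v x x.

Let cont_ray (f : 'rV[R]_d -> R) z : (forall x, U x -> Coo_at x f) -> U z ->
  forall t : R, 0 <= t <= 1 -> {for t, continuous (fun t : R => f (t *: z))}.
Proof.
move=> cf Uz t t01; apply: (@continuous_comp _ _ _ (fun t : R => t *: z) f t).
  by apply: cvgZr_tmp; exact: cvg_id.
by apply: Coo_at_continuous; apply: cf; exact: U_seg.
Qed.

Let ray_derive (f : 'rV[R]_d -> R) z (t : R) : (forall x, U x -> Coo_at x f) -> U z ->
  0 <= t <= 1 -> is_derive t (1 : R) (fun t : R => f (t *: z)) ('D_z f (t *: z)).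
Proof.
move=> cf Uz t01; have := @is_derive_line R _ _ f 0 z t.
rewrite addr0; under eq_fun do rewrite addr0; apply.
by apply: Coo_at_derivable; apply: cf; exact: U_seg.
Qed.

Lemma dconnE u w x a b : U x ->
  dconn u w x a b = \sum_i w 0 i * 'D_u (fun y => A i y a b) x.
Proof.
move=> Ux; rewrite mxE; under eq_fun do rewrite connE.
have D i : is_derive x u (fun y => w 0 i * A i y a b) (w 0 i * 'D_u (fun y => A i y a b) x).
  have dd : is_derive x u (fun y => A i y a b) ('D_u (fun y => A i y a b) x).
    by apply: derivableP; apply: Coo_at_derivable; exists U.
  exact: (is_deriveZ (w 0 i) dd).
by have [_ ->] := is_derive_sumr (index_enum 'I_d) D.
Qed.

Let Gentry v x a b : U x ->
  G v x a b = conn v x a b + \sum_i x 0 i * 'D_v (fun y => A i y a b) x.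
Proof. by move=> Ux; rewrite [G v x a b]mxE dconnE. Qed.

Let Gentry_at v a b x : U x -> Coo_at x (fun x => G v x a b).
Proof.
move=> Ux; apply: (@Coo_at_near _ _ _ (fun y => conn v y a b +
   \sum_i y 0 i * 'D_v (fun y => A i y a b) y)); last first.
  by apply: filterS (open_nbhs_nbhs (conj oU Ux)) => y Uy; rewrite Gentry.
apply: Coo_atD; first exact: conn_at.
apply: Coo_at_sum => i; apply: Coo_atM; first exact: Coo_at_coord.
by apply: Coo_at_derive; exists U.
Qed.

Let G_scale s v x a b : U x -> G (s *: v) x a b = s * G v x a b.
Proof.
move=> Ux; rewrite !Gentry // !connE mulrDr !mulr_sumr; congr (_ + _); apply: eq_bigr => i _.
  by rewrite mxE mulrA.
have CA : Coo_at x (fun y => A i y a b) by exists U.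
by have [_ ->] := is_derive_scale v s CA; rewrite mulrCA.
Qed.

Lemma is_derive_dilate M (f : 'rV[R]_M -> R) z v (t : R) : Coo_at (t *: z) f ->
  is_derive z v (fun z => f (t *: z)) (t * 'D_v f (t *: z)).
Proof.
move=> Cf; have [d1 d2] := is_derive_scale v t Cf.
have E : (fun h : R => h^-1 *: (((fun z => f (t *: z)) \o shift z) (h *: v) - f (t *: z))) =
   (fun h : R => h^-1 *: ((f \o shift (t *: z)) (h *: (t *: v)) - f (t *: z))).
  by apply/funext => h /=; rewrite (scalerDr t) !scalerA (mulrC t h).
by apply: DeriveDef; [rewrite /derivable E|rewrite /derive E].
Qed.

Let B_derive z v (t : R) a b : U z -> 0 <= t <= 1 ->
  is_derive z v (fun z => B z t a b) (G v (t *: z) a b).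
Proof.
move=> Uz t01; rewrite /B; under eq_fun do rewrite connE.
rewrite Gentry ?connE -?big_split /=; last exact: U_seg.
apply: (@is_derive_sumr R 'rV[R]_d _ _ (fun i (z : 'rV[R]_d) => z 0 i * A i (t *: z) a b)) => i.
have CA : Coo_at (t *: z) (fun y => A i y a b) by exists U; split=> //; exact: U_seg.
apply: (is_derive_eq (is_deriveM (is_derive_coord z v i) (is_derive_dilate v CA))).
by rewrite /GRing.scale /= !mxE; ring.
Qed.

Variable kap : R.
Hypothesis bA : forall i x a b, U x -> `|A i x a b| <= kap.
Hypothesis kapN : N%:R * (d%:R * r * kap) <= 2^-1.

Let B_bound z (t : R) a b : U z -> 0 <= t <= 1 -> `|B z t a b| <= d%:R * r * kap.
Proof.
move=> Uz t01; rewrite /B connE; apply: le_trans (ler_norm_sum _ _ _) _.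
have -> : d%:R * r * kap = \sum_(i < d) r * kap.
  by rewrite sumr_const card_ord -mulr_natl; ring.
apply: ler_sum => i _; rewrite normrM ler_pM ?normr_ge0 //.
  by apply: le_trans (row_coord_le _ _) _; exact: ltW.
by apply: bA; exact: U_seg.
Qed.

Lemma bounded01 (I : finType) (f : I -> R -> R) :
  (forall i (t : R), 0 <= t <= 1 -> {for t, continuous (f i)}) ->
  exists2 K : R, 0 <= K & forall i (t : R), 0 <= t <= 1 -> `|f i t| <= K.
Proof.
move=> cf; have /choice[k Hk] : forall i, exists k : R, forall t : R, 0 <= t <= 1 -> `|f i t| <= k.
  move=> i; have [||c _ Hc] := @EVT_max R (fun t => `|f i t|) 0 1; first exact: ler01.
    apply: continuous_in_subspaceT => t /set_mem /=; rewrite in_itv /= => t01.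
    by apply: (@continuous_comp _ _ _ (f i) (@Num.norm _ _)); [exact: cf|exact: norm_continuous].
  by exists `|f i c| => t t01; apply: Hc; rewrite in_itv.
have k0 i : 0 <= k i by apply: le_trans (Hk i 0 _); rewrite // lexx ler01.
exists (\sum_i k i); first exact: sumr_ge0.
move=> i t t01; apply: le_trans (Hk i t t01) _.
by rewrite (bigD1 i) //= lerDl sumr_ge0.
Qed.

(** Solving along the rays from 0 settles the radial direction. For the others, the solutions on
    neighbouring rays are compared with a first-order prediction; the error satisfies a linear
    equation with small right-hand side, to which [small_gronwall] applies. *)
Lemma flat_solution u0 : exists u : 'rV[R]_d -> 'rV[R]_N, [/\ u 0 = u0, forall x, U x -> `|u x| <= 2 * `|u0| &
  forall x v k, U x -> is_derive x v (fun y => u y 0 k) ((u x *m conn v x) 0 k)].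
Proof.
have cB z (t : R) a b : U z -> 0 <= t <= 1 -> {for t, continuous (fun s => B z s a b)}.
  by move=> Uz t01; apply: (@cont_ray (fun x => conn z x a b) z _ Uz t t01) => x Ux; exact: conn_at.
have /choice[y Hy] : forall z, exists y : R -> 'rV[R]_N, U z -> y 0 = u0 /\
    forall (t : R) k, 0 <= t <= 1 -> is_derive t (1 : R) (fun s => y s 0 k) ((y t *m B z t) 0 k).
  move=> z; case: (pselect (U z)) => Uz; last by exists (cst 0).
  have [y Hy] := @linear_ode R N (B z) (d%:R * r * kap) (fun t a b => @cB z t a b Uz) (fun t a b => @B_bound z t a b Uz) kapN u0.
  by exists y.
have rB z (t : R) (x : 'rV[R]_N) k : U z -> 0 <= t <= 1 -> `|(x *m B z t) 0 k| <= 2^-1 * `|x|.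
  move=> Uz t01; apply: le_trans (mulmx_row_bound x (fun a b => @B_bound z t a b Uz t01) k) _.
  by rewrite mulrC ler_wpM2r.
have yu z (t : R) : U z -> 0 <= t <= 1 -> `|y z t - u0| <= `|u0|.
  move=> Uz t01; have [y0 Dy] := Hy z Uz.
  have -> : `|u0| = 2 * (2^-1 * `|u0|) by field.
  apply: (@small_gronwall R N (fun t => y z t - u0) (fun t => y z t *m B z t)) => //.
  - by rewrite y0 subrr.
  - move=> s k s01; under eq_fun do rewrite mxE.
    apply: (is_derive_eq (is_deriveD (Dy s k s01) (is_derive_cst ((- u0) 0 k) s (1 : R)))).
    by rewrite addr0.
  - move=> s k s01; apply: le_trans (rB z s (y z s) k Uz s01) _.
    rewrite -mulrDr ler_pM2l ?invr_gt0 // -{1}(subrK u0 (y z s)).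
    exact: ler_normD.
have y2 z (t : R) : U z -> 0 <= t <= 1 -> `|y z t| <= 2 * `|u0|.
  move=> Uz t01; rewrite -(subrK u0 (y z t)); apply: le_trans (ler_normD _ _) _.
  by have := yu z t Uz t01; lra.
exists (fun z => y z 1); split.
- have U0 : U 0 by rewrite /U /= normr0.
  have [y0 Dy] := Hy 0 U0; rewrite -y0; apply/rowP => k.
  apply: (@derive0_cst R (fun s => y 0 s 0 k) 0 1) => [|s s01]; first exact: ler01.
  apply: (is_derive_eq (Dy s k s01)); rewrite /B (_ : conn 0 _ = 0) ?mulmx0 ?mxE //.
  by rewrite /conn big1 // => i _; rewrite mxE scale0r.
- by move=> z Uz; apply: y2 => //; rewrite ler01 lexx.
move=> z v k Uz.
(* The prediction: a parallel [u] would give y z t = u(t z), whose derivative in z along v is this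
   expression. *)
pose w (t : R) := t *: (y z t *m conn v (t *: z)).
have [y0 Dy] := Hy z Uz.
have Dw (t : R) j : 0 <= t <= 1 ->
    is_derive t (1 : R) (fun t => w t 0 j) ((w t *m B z t + y z t *m G v (t *: z)) 0 j).
  move=> t01; have Utz := U_seg Uz t01.
  have d1 : is_derive t (1 : R) (fun t => (y z t *m conn v (t *: z)) 0 j)
     ((y z t *m B z t *m conn v (t *: z) + y z t *m dconn z v (t *: z)) 0 j).
    under eq_fun do rewrite mxE.
    rewrite [X in is_derive _ _ _ X]mxE [(_ *m conn _ _) 0 j]mxE [(_ *m dconn _ _ _) 0 j]mxE -big_split /=.
    apply: (@is_derive_sumr R R _ _ (fun a (t : R) => y z t 0 a * conn v (t *: z) a j)) => a.
    have dc := @ray_derive (fun x => conn v x a j) z t (fun x Ux => @conn_at v a j x Ux) Uz t01.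
    apply: (is_derive_eq (is_deriveM (Dy t a t01) dc)).
    by rewrite /GRing.scale /= [dconn _ _ _ _ _]mxE; ring.
  rewrite /w; under eq_fun do rewrite mxE.
  apply: (is_derive_eq (is_deriveM (is_derive_id t (1 : R)) d1)).
  have -> : G v (t *: z) = conn v (t *: z) + t *: dconn v z (t *: z).
    apply/matrixP => a b; rewrite Gentry // [RHS]mxE; congr (_ + _).
    rewrite mxE dconnE // mulr_sumr; apply: eq_bigr => i _.
    by rewrite !mxE mulrA.
  (* Flatness enters here: it turns the derivative of [w] into the ray equation linearised in
     [z]. *)
  have F := flatA z v Utz.
  have E : y z t *m B z t *m conn v (t *: z) + y z t *m dconn z v (t *: z) =
      y z t *m conn v (t *: z) *m B z t + y z t *m dconn v z (t *: z).
    by rewrite -!mulmxA -!mulmxDr /B F.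
  rewrite E /w -scalemxAl mulmxDr -scalemxAr /GRing.scale /= !mulr1.
  move: (y z t *m conn v (t *: z) *m B z t) (y z t *m dconn v z (t *: z)) (y z t *m conn v (t *: z)) => a1 a2 a3.
  by rewrite !mxE; ring.
have cw (j : 'I_N) (t : R) : 0 <= t <= 1 -> {for t, continuous (fun t => w t 0 j)}.
  by move=> t01; exact: derivable_continuous1 (Dw t j t01).
have [W W0 HW] := @bounded01 _ (fun (j : 'I_N) t => w t 0 j) cw.
have cG (ab : 'I_N * 'I_N) (t : R) : 0 <= t <= 1 ->
    {for t, continuous (fun t : R => G v (t *: z) ab.1 ab.2)}.
  by move=> t01; apply: (@cont_ray (fun x => G v x ab.1 ab.2)) => // x Ux; exact: Gentry_at.
have [K K0 HK] := @bounded01 _ (fun (ab : 'I_N * 'I_N) t => G v (t *: z) ab.1 ab.2) cG.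
apply: is_derive_est => e e0.
set n : R := N%:R; have n0 : 0 <= n by rewrite ler0n.
set Y := 2 * `|u0|; have Y0 : 0 <= Y by rewrite mulr_ge0.
(* [e1] and the bound on |s| below make each of the two error terms at most e/4 times |s|;
   [small_gronwall] doubles their sum. *)
pose e1 := Num.min 1 (e / (4 * (Y * n + 1))).
have den1 : 0 < 4 * (Y * n + 1) by rewrite mulr_gt0 // ltr_wpDl // mulr_ge0.
have den2 : 0 < 4 * (W * n * (K + 1) + 1) by rewrite mulr_gt0 // ltr_wpDl // !mulr_ge0 // addr_ge0.
have e10 : 0 < e1 by rewrite lt_min ltr01 divr_gt0.
have unif : \forall x \near z, forall ab : 'I_N * 'I_N, forall t : R, 0 <= t <= 1 ->
    `|G v (t *: x) ab.1 ab.2 - G v (t *: z) ab.1 ab.2| <= e1.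
  pose P (ab : 'I_N * 'I_N) (x : 'rV[R]_d) := forall t : R, 0 <= t <= 1 ->
    `|G v (t *: x) ab.1 ab.2 - G v (t *: z) ab.1 ab.2| <= e1.
  apply: (@filter_forall _ _ P (nbhs z)) => ab.
  apply: (@unif_segment R d (fun x => G v x ab.1 ab.2)) => // t t01.
  by apply: Coo_at_continuous; apply: Gentry_at; exact: U_seg.
have smalls : \forall s \near (0 : R), `|s| <= e / (4 * (W * n * (K + 1) + 1)).
  exists (e / (4 * (W * n * (K + 1) + 1))) => /=; first by rewrite divr_gt0.
  by move=> s /=; rewrite sub0r normrN => /ltW.
apply: filterS3 (near0_line v unif) (near0_line v (open_nbhs_nbhs (conj oU Uz))) smalls => s Hs Us ss.
set z' := s *: v + z.
have Uz' : U z' by have := Us 1; rewrite mul1r; apply; rewrite ler01 lexx.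
have [y0' Dy'] := Hy z' Uz'.
have HB (t : R) a b : 0 <= t <= 1 -> exists2 g : R, `|g - G v (t *: z) a b| <= e1 &
    B z' t a b - B z t a b = s * g.
  move=> t01; have Uc c : 0 <= c <= 1 -> U (c *: (s *: v) + z).
    by move=> c01; rewrite scalerA; exact: Us.
  have [|c c01 Hc] := @MVT_line R _ (fun x => B x t a b) z (s *: v).
    by move=> c c01; have [] := B_derive (s *: v) a b (Uc c c01) t01.
  exists (G v (t *: ((c * s) *: v + z)) a b); first exact: (Hs c c01 (a, b) t t01).
  rewrite Hc; have [_ ->] := B_derive (s *: v) a b (Uc c c01) t01.
  by rewrite G_scale ?scalerA //; apply: U_seg t01; rewrite -scalerA; exact: Uc.
pose E (t : R) := y z' t - y z t - s *: w t.
pose M1 (t : R) := B z' t - B z t - s *: G v (t *: z).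
pose M2 (t : R) := B z' t - B z t.
pose dE (t : R) := E t *m B z' t + y z t *m M1 t + s *: (w t *m M2 t).
have dEE t : dE t = y z' t *m B z' t - y z t *m B z t - s *: (w t *m B z t + y z t *m G v (t *: z)).
  rewrite /dE /E /M1 /M2 !mulmxBl !mulmxBr -!scalemxAl -!scalemxAr scalerBr scalerDr.
  move: (y z' t *m B z' t) (y z t *m B z' t) (s *: (w t *m B z' t)) (y z t *m B z t).
  move: (s *: (y z t *m G v (t *: z))) (s *: (w t *m B z t)) => b1 b2 b3 b4 b5 b6.
  by apply/rowP => j; rewrite !mxE; ring.
pose rho := Y * (n * (e1 * `|s|)) + `|s| * (W * (n * ((K + 1) * `|s|))).
have rho0 : 0 <= rho.
  by rewrite addr_ge0 // !mulr_ge0 // ?addr_ge0 // ltW.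
have e11 : e1 <= 1 by rewrite ge_min lexx.
have Ebound : `|E 1| <= 2 * rho.
  apply: (@small_gronwall R N E dE rho _ _ _ rho0); last by rewrite ler01 lexx.
  - by rewrite /E y0 y0' /w scale0r scaler0 subr0 subrr.
  - move=> t j t01; rewrite dEE.
    have dd := is_deriveB (is_deriveB (Dy' t j t01) (Dy t j t01)) (is_deriveZ s (Dw t j t01)).
    have -> : (fun t0 : R => E t0 0 j) =
       (fun t0 : R => y z' t0 0 j) - (fun t0 : R => y z t0 0 j) - (s \*: (fun t0 : R => w t0 0 j)).
      apply/funext => t0; rewrite !fctE /= /E.
      by move: (w t0) (y z t0) (y z' t0) => w1 w2 w3; rewrite !mxE.
    apply: (is_derive_eq dd); move: (y z' t *m _) (y z t *m B z t) (w t *m B z t + _) => c1 c2 c3.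
    by rewrite !mxE.
  - move=> t j t01; rewrite /dE.
    have b1 := rB z' t (E t) j Uz' t01.
    have b2 : `|(y z t *m M1 t) 0 j| <= Y * (n * (e1 * `|s|)).
      apply: le_trans (mulmx_row_bound (y z t) (kap := e1 * `|s|) _ j) _.
        move=> a b; have [g g1 g2] := HB t a b t01.
        have -> : M1 t a b = B z' t a b - B z t a b - s * G v (t *: z) a b.
          by rewrite /M1; move: (B z' t) (B z t) (G v _) => X1 X2 X3; rewrite !mxE.
        by rewrite g2 -mulrBr normrM mulrC ler_wpM2r.
      apply: ler_wpM2r; last exact: y2.
      by rewrite !mulr_ge0 // ltW.
    have b3 : `|(w t *m M2 t) 0 j| <= W * (n * ((K + 1) * `|s|)).
      apply: le_trans (mulmx_row_bound (w t) (kap := (K + 1) * `|s|) _ j) _.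
        move=> a b; have [g g1 g2] := HB t a b t01.
        have -> : M2 t a b = B z' t a b - B z t a b.
          by rewrite /M2; move: (B z' t) (B z t) => X1 X2; rewrite !mxE.
        rewrite g2 normrM mulrC ler_wpM2r // -(subrK (G v (t *: z) a b) g) addrC.
        by apply: le_trans (ler_normD _ _) _; rewrite lerD ?(HK (a, b)) // (le_trans g1).
      apply: ler_wpM2r; first by rewrite !mulr_ge0 // addr_ge0.
      by apply: row_normP => // i; exact: HW.
    move: b1 b2 b3; move: (E t *m _) (y z t *m M1 t) (w t *m M2 t) => X1 X2 X3 b1 b2 b3.
    rewrite !mxE.
    apply: le_trans (ler_normD _ _) _; rewrite /rho addrA lerD //; last first.
      by rewrite normrM ler_wpM2l.
    by apply: le_trans (ler_normD _ _) _; rewrite lerD.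
have -> : y (s *: v + z) 1 0 k - y z 1 0 k - s * (y z 1 *m conn v z) 0 k = E 1 0 k.
  rewrite /E /w !scale1r; move: (y z 1) (y _ 1) (y z 1 *m _) => w1 w2 w3.
  by rewrite !mxE.
apply: le_trans (row_coord_le _ _) _; apply: le_trans Ebound _.
have h1 : Y * n * e1 <= e / 4.
  apply: le_trans (_ : (Y * n + 1) * (e / (4 * (Y * n + 1))) <= _).
    by apply: ler_pM => //; [rewrite mulr_ge0|exact: ltW|rewrite lerDl|rewrite ge_min lexx orbT].
  rewrite le_eqVlt; apply/orP; left; apply/eqP; field.
  by rewrite gt_eqF // ltr_wpDl // mulr_ge0.
have h2 : W * n * (K + 1) * `|s| <= e / 4.
  apply: le_trans (_ : (W * n * (K + 1) + 1) * (e / (4 * (W * n * (K + 1) + 1))) <= _).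
    by apply: ler_pM => //; [rewrite !mulr_ge0 // addr_ge0|rewrite lerDl].
  rewrite le_eqVlt; apply/orP; left; apply/eqP; field.
  by rewrite gt_eqF // ltr_wpDl // !mulr_ge0 // addr_ge0.
have -> : 2 * rho = 2 * (Y * n * e1 + W * n * (K + 1) * `|s|) * `|s| by rewrite /rho; ring.
by rewrite ler_wpM2r //; lra.
Qed.

(** Bootstrapping: boundedness of [u] bounds its derivatives, hence [u] is continuous, and each
    derivative is a combination of entries of [u] with smooth coefficients. *)
Lemma flat_smooth (u : 'rV[R]_d -> 'rV[R]_N) (C : R) :
  (forall x, U x -> `|u x| <= C) ->
  (forall x v k, U x -> is_derive x v (fun y => u y 0 k) ((u x *m conn v x) 0 k)) ->
  forall k, Coo U (fun y => u y 0 k).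
Proof.
move=> uC Du.
have U0 : U 0 by rewrite /U /= normr0.
have C0 : 0 <= C by apply: le_trans (uC 0 U0).
have cu k x : U x -> {for x, continuous (fun y => u y 0 k)}.
  move=> Ux; apply/(@cvgrPdist_le _ _ _ (nbhs x)) => e e0.
  have /nbhs_ballP[q /= q0 Hq] : nbhs x U by exact: open_nbhs_nbhs.
  pose K := d%:R * (C * (N%:R * kap)).
  have K0 : 0 <= K.
    have [d0|d0] := posnP d.
      by rewrite /K (_ : (d%:R : R) = 0) ?mul0r //; have := d0; move=> ->.
    rewrite !mulr_ge0 //; apply: le_trans (bA (Ordinal d0) k k U0) => //.
  have eK : 0 < e / (K + 1) by rewrite divr_gt0 // ltr_wpDl.
  apply: filterS2 (nbhsx_ballx x q q0) (nbhsx_ballx x _ eK) => y yq yK.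
  have yq' : `|y - x| < q by move: yq; rewrite -ball_normE /= distrC.
  have yK' : `|y - x| < e / (K + 1) by move: yK; rewrite -ball_normE /= distrC.
  have inU z : `|z - x| <= `|y - x| -> U z.
    by move=> zx; apply: Hq; rewrite -ball_normE /= distrC (le_lt_trans zx).
  have [|xi Hxi E] := @increment_partials R d (fun y => u y 0 k) x y.
    by move=> z j /inU Uz; have [] := Du z (ebase j) k Uz.
  rewrite distrC E; apply: le_trans (ler_norm_sum _ _ _) _.
  apply: le_trans (_ : \sum_(j < d) `|y - x| * (C * (N%:R * kap)) <= _).
    apply: ler_sum => j _; rewrite normrM; apply: ler_pM => //.
      by have := row_coord_le (y - x) j; rewrite !mxE.
    have Uxi := inU _ (Hxi j); have [_ ->] := Du (xi j) (ebase j) k Uxi.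
    apply: le_trans (mulmx_row_bound (u (xi j)) (kap := kap) _ k) _.
      move=> a b; rewrite connE (bigD1 j) //= big1 ?addr0; last first.
        by move=> i ij; rewrite /ebase mxE eqxx (negbTE ij) mul0r.
      by rewrite /ebase mxE !eqxx mul1r; exact: bA.
    apply: ler_wpM2r (uC _ Uxi); rewrite mulr_ge0 //.
    by apply: le_trans (bA j k k U0).
  rewrite sumr_const card_ord -mulr_natl.
  rewrite [X in X <= _](_ : _ = `|y - x| * K); last by rewrite /K; ring.
  apply: le_trans (_ : e / (K + 1) * (K + 1) <= _).
    by apply: ler_pM => //; [exact: ltW|rewrite lerDl].
  by rewrite divfK // gt_eqF // ltr_wpDl.
move=> k n; elim: n k => [|n IH] k; first exact: cu.
split=> [x|v x Ux|v]; [exact: cu|by have [] := Du x v k Ux|].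
apply: (@Ck_eq _ _ n U (fun x => \sum_a u x 0 a * conn v x a k)) => //.
  by move=> x Ux; have [_ ->] := Du x v k Ux; rewrite mxE.
by apply: Ck_sum => // a; exact: (CkM oU (IH a) (conn_Coo v a k n)).
Qed.
End FlatSystem.

(** * Spheres and simple connectedness *)

Section Hats.
Context {R : realType}.
Implicit Type k : nat.

Definition dot {k} (x y : 'rV[R]_k) : R := \sum_i x 0 i * y 0 i.

Lemma dotC k (x y : 'rV[R]_k) : dot x y = dot y x.
Proof. by apply: eq_bigr => i _; rewrite mulrC. Qed.
Lemma dotDl k (x y z : 'rV[R]_k) : dot (x + y) z = dot x z + dot y z.
Proof. by rewrite -big_split; apply: eq_bigr => i _; rewrite mxE mulrDl. Qed.
Lemma dotZl k a (x y : 'rV[R]_k) : dot (a *: x) y = a * dot x y.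
Proof. by rewrite /dot mulr_sumr; apply: eq_bigr => i _; rewrite mxE mulrA. Qed.
Lemma dotDr k (x y z : 'rV[R]_k) : dot x (y + z) = dot x y + dot x z.
Proof. by rewrite dotC dotDl !(dotC _ x). Qed.
Lemma dotZr k a (x y : 'rV[R]_k) : dot x (a *: y) = a * dot x y.
Proof. by rewrite dotC dotZl dotC. Qed.
Lemma dotNl k (x y : 'rV[R]_k) : dot (- x) y = - dot x y.
Proof. by rewrite -scaleN1r dotZl mulN1r. Qed.
Lemma dotNr k (x y : 'rV[R]_k) : dot x (- y) = - dot x y.
Proof. by rewrite dotC dotNl dotC. Qed.
Lemma dot0r k (x : 'rV[R]_k) : dot x 0 = 0.
Proof. by rewrite -(scale0r 0) dotZr mul0r. Qed.
Lemma dotE k (x : 'rV[R]_k) : dot x x = sqnorm x.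
Proof. by apply: eq_bigr => i _; rewrite expr2. Qed.
Lemma dot_ge0 k (x : 'rV[R]_k) : 0 <= dot x x.
Proof. by rewrite sumr_ge0 // => i _; rewrite -expr2 sqr_ge0. Qed.
Lemma dot_eq0 k (x : 'rV[R]_k) : dot x x = 0 -> x = 0.
Proof.
move=> H; apply/rowP => i; rewrite mxE; apply/eqP; rewrite -sqrf_eq0.
rewrite eq_le sqr_ge0 andbT -H dotE; exact: coord_le_sqnorm.
Qed.
Lemma dot_sum k I (r : seq I) (f : I -> 'rV[R]_k) y :
  dot y (\sum_(i <- r) f i) = \sum_(i <- r) dot y (f i).
Proof. by elim/big_rec2: _ => [|i a b _ <-]; rewrite ?dot0r ?dotDr. Qed.

(* A finite union of proper subspaces does not contain the moment curve. *)
Lemma avoid_subspaces k (s : seq 'rV[R]_k) : all (fun v => v != 0) s ->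
  exists q : 'rV[R]_k, all (fun v => dot v q != 0) s.
Proof.
move=> s0; pose pol (v : 'rV[R]_k) : {poly R} := \poly_(i < k) (if insub i is Some j then v 0 j else 0).
have pol0 v : v != 0 -> pol v != 0.
  apply: contraNneq => E; apply/eqP/rowP => j; rewrite mxE.
  have := congr1 (fun p : {poly R} => p`_j) E.
  by rewrite coef0 coef_poly ltn_ord insubT // => ?; rewrite (_ : Sub _ _ = j) //; apply: val_inj.
pose Q := \prod_(v <- s) pol v.
have Q0 : Q != 0.
  by rewrite /Q prodf_seq_neq0; apply: sub_all s0 => v; exact: pol0.
have [t Qt] : exists t : R, Q.[t] != 0.
  pose rs := [seq (i%:R : R) | i <- iota 0 (size Q)].
  have /allPn[t _ tr] : ~~ all (root Q) rs.
    apply/negP => ar; have := max_poly_roots Q0 ar.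
    rewrite map_inj_uniq ?iota_uniq; last by move=> i j /eqP; rewrite eqr_nat => /eqP.
    by rewrite size_map size_iota ltnn => /(_ isT).
  by exists t.
exists (\row_i t ^+ i); apply/allP => v vs.
have Ev : (pol v).[t] = dot v (\row_i t ^+ i).
  rewrite /pol horner_poly; apply: eq_bigr => i _; rewrite mxE insubT // => ?.
  by rewrite (_ : Sub _ _ = i) //; apply: val_inj.
rewrite -Ev; apply: contraNneq Qt => E; rewrite /Q horner_prod.
by rewrite (big_rem v) //= E mul0r.
Qed.

End Hats.

Section Pasting.
Context {R : realType} {V : normedModType R} {T : topologicalType}.

Lemma continuous_pasting (a : T -> R) (f g : T -> V) : continuous a ->
  continuous f -> continuous g -> (forall p, a p = 0 -> f p = g p) ->
  continuous (fun p => if a p <= 0 then f p else g p).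
Proof.
move=> ca cf cg fg p; apply/cvgrPdist_le => e e0.
have /(@cvgrPdist_le _ _ _ (nbhs p)) /(_ e e0) cf' := cf p.
have /(@cvgrPdist_le _ _ _ (nbhs p)) /(_ e e0) cg' := cg p.
case: (ltrgtP (a p) 0) => ap.
- have N : nbhs (a p) [set x : R | x < 0] by exact: (open_nbhs_nbhs (conj (@open_lt R 0) ap)).
  have {}N : \forall q \near p, a q < 0 by exact: (ca p _ N).
  move: N.
  by apply: filterS2 cf' => q fq /ltW ->.
- have N : nbhs (a p) [set x : R | 0 < x] by exact: (open_nbhs_nbhs (conj (@open_gt R 0) ap)).
  have {}N : \forall q \near p, 0 < a q by exact: (ca p _ N).
  move: N.
  by apply: filterS2 cg' => q gq aq; rewrite (leNgt (a q)) aq.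
- by apply: filterS2 cf' cg' => q fq gq; case: ifP => // _; rewrite (fg p ap).
Qed.

End Pasting.

(** * Simple connectedness of subsets of normed spaces *)

Section SimplyConnectedSets.
Context {R : realType}.
Implicit Types V W : normedModType R.

(* Paths and homotopies are extended by constants outside the unit interval. *)
Definition sc_set V (A : set V) : Prop :=
  (forall x y, A x -> A y -> exists c : R -> V,
     [/\ continuous c, forall t, A (c t), c 0 = x & c 1 = y]) /\
  (forall c : R -> V, continuous c -> (forall t, A (c t)) -> c 0 = c 1 ->
     exists H : R * R -> V, [/\ continuous H, forall p, A (H p),
       forall t, 0 <= t <= 1 -> H (0, t) = c t /\ H (1, t) = c 0
       & forall s, 0 <= s <= 1 -> H (s, 0) = c 0 /\ H (s, 1) = c 0]).

Section RowBlocks.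
Variables (N1 N2 : nat) (T : topologicalType).

Lemma lsubmx_continuous : continuous (fun x : 'rV[R]_(N1 + N2) => lsubmx x).
Proof.
move=> x; apply: (@row_cvgP _ _ _ (nbhs x)) => j; under eq_fun do rewrite mxE; rewrite mxE.
exact: coord_continuous.
Qed.

Lemma rsubmx_continuous : continuous (fun x : 'rV[R]_(N1 + N2) => rsubmx x).
Proof.
move=> x; apply: (@row_cvgP _ _ _ (nbhs x)) => j; under eq_fun do rewrite mxE; rewrite mxE.
exact: coord_continuous.
Qed.

Lemma row_mx_continuous (f : T -> 'rV[R]_N1) (h : T -> 'rV[R]_N2) :
  continuous f -> continuous h -> continuous (fun t => row_mx (f t) (h t)).
Proof.
move=> cf ch t; apply: (@row_cvgP _ _ _ (nbhs t)) => j; rewrite -(splitK j) /unsplit.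
case: (fintype.split j) => i.
  by under eq_fun do rewrite row_mxEl; rewrite row_mxEl; apply: row_coord_cvg; exact: cf.
by under eq_fun do rewrite row_mxEr; rewrite row_mxEr; apply: row_coord_cvg; exact: ch.
Qed.

Definition block_set (A : set 'rV[R]_N1) (B : set 'rV[R]_N2) : set 'rV[R]_(N1 + N2) :=
  [set x | A (lsubmx x) /\ B (rsubmx x)].

End RowBlocks.

Lemma sc_block_set N1 N2 (A : set 'rV[R]_N1) (B : set 'rV[R]_N2) :
  sc_set A -> sc_set B -> sc_set (block_set A B).
Proof.
move=> [pA hA] [pB hB]; split.
  move=> x y [/= Ax Bx] [/= Ay By].
  have [c [cc cA c0 c1]] := pA _ _ Ax Ay; have [d [cd dB d0 d1]] := pB _ _ Bx By.
  exists (fun t => row_mx (c t) (d t)); split; rewrite ?c0 ?c1 ?d0 ?d1 ?hsubmxK //.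
  - exact: row_mx_continuous.
  - by move=> t; split; rewrite /= ?row_mxKl ?row_mxKr.
move=> e ce eAB e01.
have [||H [cH HA H0 H1]] := hA (fun t => lsubmx (e t)) _ (fun t => (eAB t).1).
- by move=> t; apply: (@continuous_comp _ _ _ e _ t); [exact: ce|exact: lsubmx_continuous].
- by rewrite e01.
have [||K [cK KB K0 K1]] := hB (fun t => rsubmx (e t)) _ (fun t => (eAB t).2).
- by move=> t; apply: (@continuous_comp _ _ _ e _ t); [exact: ce|exact: rsubmx_continuous].
- by rewrite e01.
exists (fun p => row_mx (H p) (K p)); split=> //.
- exact: row_mx_continuous.
- by move=> t; split; rewrite /= ?row_mxKl ?row_mxKr.
- by move=> t t01; rewrite (H0 t t01).1 (H0 t t01).2 (K0 t t01).1 (K0 t t01).2 !hsubmxK.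
- by move=> t t01; rewrite (H1 t t01).1 (H1 t t01).2 (K1 t t01).1 (K1 t t01).2 !hsubmxK.
Qed.

Lemma sc_setT V : sc_set [set: V].
Proof.
have cl (T : topologicalType) (a : T -> R) (f g : T -> V) : continuous a -> continuous f -> continuous g ->
    continuous (fun p => (1 - a p) *: f p + a p *: g p).
  move=> ca cf cg p; apply: cvgD.
    by apply: cvgZ; [apply: cvgB; [exact: cvg_cst|exact: ca]|exact: cf].
  by apply: cvgZ; [exact: ca|exact: cg].
split.
  move=> x y _ _; exists (fun t => (1 - t) *: x + t *: y); split=> //.
  - by apply: cl => t; [exact: cvg_id|exact: cvg_cst|exact: cvg_cst].
  - by rewrite subr0 scale1r scale0r addr0.
  - by rewrite subrr scale1r scale0r add0r.
move=> c cc _ c01; exists (fun p => (1 - p.1) *: c p.2 + p.1 *: c 0); split=> //.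
- apply: (cl (R * R)%type fst (c \o snd) (fun=> c 0)) => p; first exact: cvg_fst.
    by apply: continuous_comp; [exact: cvg_snd|exact: cc].
  exact: cvg_cst.
- by move=> t _ /=; rewrite subr0 subrr !scale1r !scale0r addr0 add0r.
- by move=> t _ /=; rewrite -c01 -scalerDl subrK scale1r.
Qed.

Lemma set_val_inj (T : Type) (A : set T) (x y : set_type A) : set_val x = set_val y -> x = y.
Proof. by case: x y => [x Ax] [y Ay] E; apply: val_inj. Qed.

Lemma sc_simply_connected V (A : set V) : sc_set A -> @simply_connected R (set_type A).
Proof.
move=> [pA hA].
have lift (T : topologicalType) (f : T -> V) (fA : forall t, A (f t)) : continuous f ->
    continuous (fun t => SigSub (mem_set (fA t)) : set_type A).
  by move=> cf; apply: continuous_comp_initial.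
split.
  move=> x y; have [c [cc cA c0 c1]] := pA _ _ (set_valP x) (set_valP y).
  exists (fun t => SigSub (mem_set (cA t))); split.
  - by apply: continuous_subspaceT; exact: lift.
  - by apply: set_val_inj; exact: c0.
  - by apply: set_val_inj; exact: c1.
move=> c cc c01.
(* The loop is only continuous within [0, 1]; composing it with [clamp] makes it continuous on the
   whole line. *)
have ccl : continuous (fun t => set_val (c (clamp t)) : V).
  move=> t; apply: (@continuous_comp _ _ _ (c \o clamp) set_val); last exact: initial_continuous.
  move=> B nB; have t01 : `[0, 1]%classic (clamp t) by rewrite /= in_itv /= clamp_itv.
  have B1 : within `[0, 1]%classic (nbhs (clamp t)) (c @^-1` B).
    by move/subspace_continuousP: cc => /(_ _ t01 B nB).
  have N : nbhs (t : R) [set s | `[0, 1]%classic (clamp s) -> B (c (clamp s))] := @clamp_continuous R t _ B1.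
  change (nbhs (t : R) [set s | B (c (clamp s))]); apply: filterS N => s /=; apply; rewrite /= in_itv /=; exact: clamp_itv.
have [|H [cH HA H0 H1]] := hA _ ccl (fun t => set_valP (c (clamp t))).
  by rewrite !clamp_id ?lexx ?ler01 ?c01.
exists (fun p => SigSub (mem_set (HA p))); split.
- by apply: continuous_subspaceT; exact: lift.
- move=> t; rewrite /= in_itv /= => t01; split; apply: set_val_inj.
    by apply: (etrans (H0 t t01).1); rewrite clamp_id.
  by apply: (etrans (H0 t t01).2); rewrite clamp_id // lexx ler01.
- move=> t; rewrite /= in_itv /= => t01; split; apply: set_val_inj.
    by apply: (etrans (H1 t t01).1); rewrite clamp_id // lexx ler01.
  by apply: (etrans (H1 t t01).2); rewrite clamp_id // lexx ler01.
Qed.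

End SimplyConnectedSets.

(** * Stereographic projection and simple connectedness of spheres *)

Section SphereTopology.
Context {R : realType}.

Lemma continuous_dot (T : topologicalType) k (f h : T -> 'rV[R]_k) :
  continuous f -> continuous h -> continuous (fun t => dot (f t) (h t)).
Proof.
move=> cf ch t; rewrite /dot; apply: (@cvg_sumr R T (nbhs t) _ R^o) => i.
apply: cvgM; apply: row_coord_cvg; [exact: cf|exact: ch].
Qed.

Lemma sphereE k (x : 'rV[R]_k.+1) : unit_sphere R k x <-> dot x x = 1.
Proof. by rewrite dotE. Qed.

Definition unitv {k} (v : 'rV[R]_k) := (Num.sqrt (dot v v))^-1 *: v.

Lemma dot_gt0 k (v : 'rV[R]_k) : v != 0 -> 0 < dot v v.
Proof.
by move=> v0; rewrite lt_def dot_ge0 andbT; apply: contra v0 => /eqP/dot_eq0 ->.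
Qed.

Lemma unitv_sphere k (v : 'rV[R]_k.+1) : v != 0 -> unit_sphere R k (unitv v).
Proof.
move=> /dot_gt0 v0; apply/sphereE; rewrite /unitv dotZl dotZr mulrA -invfM -expr2 sqr_sqrtr ?ltW //.
by rewrite mulVf // gt_eqF.
Qed.

Lemma unitv_id k (v : 'rV[R]_k) : dot v v = 1 -> unitv v = v.
Proof. by move=> v1; rewrite /unitv v1 sqrtr1 invr1 scale1r. Qed.

Lemma continuous_unitv (T : topologicalType) k (f : T -> 'rV[R]_k) :
  continuous f -> (forall t, f t != 0) -> continuous (fun t => unitv (f t)).
Proof.
move=> cf f0 t; apply: cvgZ; last exact: cf.
apply: cvgV; first by rewrite gt_eqF // sqrtr_gt0 dot_gt0.
by apply: continuous_comp; [exact: continuous_dot|exact: sqrt_continuous].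
Qed.

Lemma orthogonal_vector k (x y : 'rV[R]_k) : (2 < k)%N ->
  exists v : 'rV[R]_k, [/\ v != 0, dot v x = 0 & dot v y = 0].
Proof.
move=> k2; pose A := col_mx x y.
have K0 : kermx A^T != 0.
  rewrite -mxrank_eq0 mxrank_ker mxrank_tr -lt0n subn_gt0 (leq_ltn_trans (rank_leq_row A)) //.
have [i vi] : exists i, row i (kermx A^T) != 0.
  apply/existsP; rewrite -negb_forall; apply: contra K0 => /forallP H.
  by apply/eqP/row_matrixP => i; rewrite row0; apply/eqP/H.
have E : row i (kermx A^T) *m A^T = 0 by rewrite -row_mul mulmx_ker row0.
exists (row i (kermx A^T)); split=> //; move: (row i _) E => w.
  by rewrite tr_col_mx mul_mx_row -row_mx0 => /eq_row_mx[/matrixP/(_ 0 0) + _]; rewrite !mxE => <-; apply: eq_bigr => j _; rewrite mxE.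
by rewrite tr_col_mx mul_mx_row -row_mx0 => /eq_row_mx[_ /matrixP/(_ 0 0)]; rewrite !mxE => <-; apply: eq_bigr => j _; rewrite mxE.
Qed.

(** Stereographic projection from the unit vector [q] onto the hyperplane orthogonal to [q], kept
    inside the ambient space; [costereo] is its inverse. *)
Definition stereo {k} (q x : 'rV[R]_k) := (1 - dot x q)^-1 *: (x - dot x q *: q).
Definition costereo {k} (q w : 'rV[R]_k) := (dot w w + 1)^-1 *: (2 *: w + (dot w w - 1) *: q).

Lemma dot1_gt0 k (w : 'rV[R]_k) : 0 < dot w w + 1.
Proof. by rewrite ltr_wpDl ?dot_ge0. Qed.

Lemma stereo_orth k (q x : 'rV[R]_k) : dot q q = 1 -> dot (stereo q x) q = 0.
Proof. by move=> q1; rewrite /stereo dotZl dotDl dotNl dotZl q1 mulr1 subrr mulr0. Qed.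

Lemma costereo_sphere k (q w : 'rV[R]_k) : dot q q = 1 -> dot w q = 0 ->
  dot (costereo q w) (costereo q w) = 1.
Proof.
move=> q1 wq; rewrite /costereo dotZl dotZr !(dotDl, dotDr, dotZl, dotZr) (dotC q w) wq q1.
have := dot1_gt0 w; move: (dot w w) => s s0; field; exact: lt0r_neq0.
Qed.

Lemma stereoK k (q x : 'rV[R]_k) : dot q q = 1 -> dot x x = 1 -> dot x q != 1 ->
  costereo q (stereo q x) = x.
Proof.
move=> q1 x1 xq; have a1 : 1 - dot x q != 0 by rewrite subr_eq0 eq_sym.
have E : dot (stereo q x) (stereo q x) = (1 + dot x q) / (1 - dot x q).
  rewrite /stereo dotZl dotZr !(dotDl, dotDr, dotNl, dotNr, dotZl, dotZr) (dotC q x) x1 q1.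
  by field.
have e1 : (dot (stereo q x) (stereo q x) + 1) = 2 / (1 - dot x q) by rewrite E; field.
have e2 : (dot (stereo q x) (stereo q x) - 1) = 2 * dot x q / (1 - dot x q) by rewrite E; field.
rewrite /costereo e1 e2 /stereo; move: (dot x q) a1 => a a1.
by apply/rowP => i; rewrite !mxE; field.
Qed.

Lemma continuous_stereo (T : topologicalType) k (q : 'rV[R]_k) (f : T -> 'rV[R]_k) :
  continuous f -> (forall t, dot (f t) q != 1) -> continuous (fun t => stereo q (f t)).
Proof.
move=> cf fq t; have cq : continuous (fun t => dot (f t) q).
  by apply: continuous_dot => // u; exact: cvg_cst.
apply: cvgZ.
  apply: cvgV; first by rewrite subr_eq0 eq_sym fq.
  by apply: cvgB; [exact: cvg_cst|exact: cq].
by apply: cvgB; [exact: cf|apply: cvgZ; [exact: cq|exact: cvg_cst]].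
Qed.

Lemma continuous_costereo (T : topologicalType) k (q : 'rV[R]_k) (f : T -> 'rV[R]_k) :
  continuous f -> continuous (fun t => costereo q (f t)).
Proof.
move=> cf t; have cq : continuous (fun t => dot (f t) (f t)) by exact: continuous_dot.
apply: cvgZ.
  apply: cvgV; first by rewrite gt_eqF ?dot1_gt0.
  by apply: cvgD; [exact: cq|exact: cvg_cst].
apply: cvgD; first by apply: cvgZ; [exact: cvg_cst|exact: cf].
by apply: cvgZ; [apply: cvgB; [exact: cq|exact: cvg_cst]|exact: cvg_cst].
Qed.

Section Loops.
Variable k : nat.
Hypothesis k2 : (2 <= k)%N.
Notation V := 'rV[R]_k.+1.

(** A detour in a direction orthogonal to both points keeps the path away from the origin even when
    the points are antipodal; it is then normalised. *)
Lemma sphere_path (x y : V) : unit_sphere R k x -> unit_sphere R k y ->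
  exists c : R -> V, [/\ continuous c, forall t, unit_sphere R k (c t), c 0 = x & c 1 = y].
Proof.
move=> /sphereE x1 /sphereE y1; have [v [v0 vx vy]] := orthogonal_vector x y (k2 : (2 < k.+1)%N).
pose f (t : R) : V := (1 - t) ^+ 2 *: x + t ^+ 2 *: y + (t * (1 - t)) *: v.
have f0 t : f t != 0.
  apply/eqP => ft; have := congr1 (dot v) ft.
  rewrite /f !dotDr !dotZr vx vy !mulr0 !add0r dot0r => /eqP; rewrite mulf_eq0 (gt_eqF (dot_gt0 v0)) orbF.
  rewrite mulf_eq0 => /orP[|]; rewrite ?subr_eq0 => /eqP t0; move: ft; rewrite /f.
    rewrite t0 subr0 expr1n expr0n !mul0r !scale0r !addr0 scale1r => x0.
    by move: x1; rewrite x0 dot0r => /esym/eqP; rewrite oner_eq0.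
  rewrite -t0 subrr expr1n expr0n !mulr0 !scale0r addr0 add0r scale1r => y0.
  by move: y1; rewrite y0 dot0r => /esym/eqP; rewrite oner_eq0.
have cZ (a : R -> R) (w : V) : continuous a -> continuous (fun t => a t *: w).
  by move=> ca t; apply: cvgZ; [exact: ca|exact: cvg_cst].
have c1 : continuous (fun t : R => 1 - t) by move=> t; apply: cvgB; [exact: cvg_cst|exact: cvg_id].
exists (fun t => unitv (f t)); split.
- apply: continuous_unitv => // t; apply: cvgD; first apply: cvgD.
  + by apply: (cZ (fun t => (1 - t) ^+ 2)) => s; apply: cvgM; exact: c1.
  + by apply: (cZ (fun t => t ^+ 2)) => s; apply: cvgM; exact: cvg_id.
  + by apply: (cZ (fun t => t * (1 - t))) => s; apply: cvgM; [exact: cvg_id|exact: c1].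
- by move=> t; exact: unitv_sphere.
- by rewrite /f subr0 expr1n expr0n !mul0r !scale0r !addr0 scale1r unitv_id.
- by rewrite /f subrr expr1n expr0n !mulr0 !scale0r addr0 add0r scale1r unitv_id.
Qed.

(** A Lebesgue number for the condition that nearby points of the loop have positive inner product,
    by compactness of [0, 1]. *)
Lemma loop_steps (c : R -> V) : continuous c -> (forall t, unit_sphere R k (c t)) ->
  exists n : nat, forall t u : R, 0 <= t <= 1 -> `|t - u| < n.+1%:R^-1 -> 0 < dot (c t) (c u).
Proof.
move=> cc cS.
have /compact_near_coveringP /(_ _ \oo (fun n t => forall u : R, `|t - u| < n.+1%:R^-1 -> 0 < dot (c t) (c u))) H
  := @segment_compact R 0 1.
have [|n _ Hn] := H _.
  move=> t _; have cd : continuous (fun p : R * R => dot (c p.1) (c p.2)).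
    apply: continuous_dot => p.
      by apply: (@continuous_comp _ _ _ fst c); [exact: cvg_fst|exact: cc].
    by apply: (@continuous_comp _ _ _ snd c); [exact: cvg_snd|exact: cc].
  have dtt : dot (c t) (c t) = 1 by apply/sphereE; exact: cS.
  have N : nbhs (dot (c t) (c t)) [set x : R | 0 < x].
    by apply: open_nbhs_nbhs; split; [exact: open_gt|rewrite /= dtt].
  have [[A B] /= [nA nB] AB] := cd (t, t) _ N.
  have [e /= e0 He] : nbhs_ball (t : R) (A `&` B) by apply/nbhs_ballP; exact: filterI.
  have e2 : 0 < e / 2 by rewrite divr_gt0.
  have nE : \forall n \near \oo, (n.+1%:R^-1 : R) < e / 2.
    exact: (near_infty_natSinv_lt (PosNum e2)).
  exists (ball t (e / 2), [set n | (n.+1%:R^-1 : R) < e / 2]).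
    by split; [exact: nbhsx_ballx|exact: nE].
  move=> [s m] /= [ts ms] u su.
  have As : A s.
    by apply: (He s _).1; move: ts; rewrite -!ball_normE /= => ts; apply: lt_trans ts _; lra.
  have Bu : B u.
    apply: (He u _).2; move: ts; rewrite -!ball_normE /= => ts.
    apply: le_lt_trans (ler_distD s t u) _; by rewrite [X in _ < X]splitr ltrD // (lt_trans su).
  by have := AB (s, u) (conj As Bu).
exists n => t u t01; apply: (Hn n (leqnn n) t).
by rewrite /= in_itv.
Qed.

(** A loop may fill the sphere, so it is first deformed to the radial projection of a polygon. That
    lies in finitely many planes, misses some point [q], and is contracted in the stereographic
    chart at [q]. *)
Lemma sc_sphere : sc_set (unit_sphere R k).
Proof.
split; first exact: sphere_path.
move=> c0 cc0 cS0 c01.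
pose c t := c0 (clamp t).
have cc : continuous c by move=> t; apply: continuous_comp; [exact: clamp_continuous|exact: cc0].
have cS t : dot (c t) (c t) = 1 by apply/sphereE; exact: cS0.
have [n Hn] := loop_steps cc (fun t => cS0 (clamp t)).
pose N : R := n.+1%:R; have N0 : 0 < N by rewrite ltr0n.
(* Tent functions on the grid i/(n+1) with i = 0, ..., n+1; [cn] is the polygon through these points
   of the loop, with the same end points. *)
pose lam (i : 'I_n.+2) (t : R) : R := Num.max 0 (1 - `|N * t - i%:R|).
have lam0 i t : 0 <= lam i t by rewrite le_max lexx.
have lamP i t : 0 < lam i t -> `|t - i%:R / N| < N^-1.
  rewrite lt_max ltxx /= subr_gt0 => H; rewrite -(ltr_pM2l N0) mulfV ?gt_eqF //.
  by rewrite -{1}(gtr0_norm N0) -normrM mulrBr (mulrCA N) mulfV ?gt_eqF // mulr1.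
pose cn t : V := \sum_i lam i (clamp t) *: c (i%:R / N).
have ccn : continuous cn.
  move=> t; apply: cvg_sumr => i; apply: cvgZ; last exact: cvg_cst.
  apply: (@continuous_comp _ _ _ clamp (lam i)); first exact: clamp_continuous.
  apply: continuous_max; first exact: cvg_cst.
  apply: cvgB; first exact: cvg_cst.
  apply: cvg_norm; apply: cvgB; last exact: cvg_cst.
  by apply: cvgM; [exact: cvg_cst|exact: cvg_id].
have idx t : exists i : 'I_n.+2, 0 < lam i (clamp t) /\ forall j : 'I_n.+2, 0 < lam j (clamp t) -> (j : nat) = i \/ (j : nat) = i.+1.
  have /andP[u0 u1] := clamp_itv t; move: (clamp t) u0 u1 => u u0 u1.
  have Nu0 : 0 <= N * u by rewrite mulr_ge0 // ltW.
  have /andP[i1 i2] := truncn_itv Nu0; set i := Num.truncn (N * u) in i1 i2.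
  have ilt : (i < n.+2)%N.
    rewrite ltnS -(ler_nat R); apply: le_trans i1 _.
    by rewrite -[X in _ <= X]mulr1 ler_pM2l.
  exists (Ordinal ilt); split.
    by rewrite lt_max ltxx /= subr_gt0 ger0_norm ?subr_ge0 // ltrBlDl -natr1 in i2 *.
  move=> j; rewrite lt_max ltxx /= subr_gt0 ltr_norml => /andP[j1 j2].
  have a1 : (j : nat)%:R < (i.+2%:R : R) by move: j1 i2; rewrite -!natr1; lra.
  have a2 : (i%:R : R) < (j : nat).+1%:R by move: j2 i1; rewrite -!natr1; lra.
  move: a1 a2; rewrite !ltr_nat !ltnS => h1 h2.
  by move: h1; rewrite leq_eqVlt => /orP[/eqP|h1]; [right|left; apply/eqP; rewrite eqn_leq h2 andbT -ltnS].
have cpos t : 0 < dot (c t) (cn t).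
  have [i [i0 _]] := idx t; rewrite /cn dot_sum (bigD1 i) //= ltr_pwDl //.
    rewrite dotZr mulr_gt0 // -[c t]/(c0 (clamp t)) -(clamp_id (clamp_itv t)) -/(c (clamp t)).
    by apply: Hn; [exact: clamp_itv|exact: lamP].
  apply: sumr_ge0 => j _; rewrite dotZr; have := lam0 j (clamp t); rewrite le_eqVlt => /orP[/eqP <-|j0].
    by rewrite mul0r.
  rewrite mulr_ge0 ?lam0 // ltW // -[c t]/(c0 (clamp t)) -(clamp_id (clamp_itv t)) -/(c (clamp t)).
  by apply: Hn; [exact: clamp_itv|exact: lamP].
have cn0 t : cn t != 0.
  by apply/eqP => E; have := cpos t; rewrite E dot0r ltxx.
(* [v i] is orthogonal to both ends of a segment, hence to its radial projection; a unit vector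
   orthogonal to none of the [v i] is not on the projected polygon. *)
have /choice[v Hv] : forall i : nat, exists v : V, [/\ v != 0, dot v (c (i%:R / N)) = 0 & dot v (c (i.+1%:R / N)) = 0].
  by move=> i; exact: orthogonal_vector.
have [|q0 Hq0] := @avoid_subspaces R _ [seq v i | i <- iota 0 n.+2].
  by apply/allP => w /mapP[i _ ->]; have [] := Hv i.
have vq0 (i : 'I_n.+2) : dot (v i) q0 != 0.
  by move/allP: Hq0 => /(_ (v i)); apply; apply: map_f; rewrite mem_iota /= ltn_ord.
have q00 : q0 != 0 by apply: contraNneq (vq0 ord0) => ->; rewrite dot0r.
pose q := unitv q0; have q1 : dot q q = 1 by apply/sphereE; exact: unitv_sphere.
have vq (i : 'I_n.+2) : dot (v i) q != 0.
  by rewrite /q /unitv dotZr mulf_neq0 // invr_neq0 // gt_eqF // sqrtr_gt0 dot_gt0.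
pose e t := unitv (cn t).
have ce : continuous e by exact: continuous_unitv.
have e1 t : dot (e t) (e t) = 1 by apply/sphereE; exact: unitv_sphere.
have eq1 t : dot (e t) q != 1.
  apply/eqP => H; have [i [i0 Hi]] := idx t.
  have : e t = q.
    apply/eqP; rewrite -subr_eq0; apply/eqP/dot_eq0.
    by rewrite !(dotDl, dotDr, dotNl, dotNr) e1 q1 (dotC q) H; lra.
  move=> E; move/eqP: (vq i); apply; rewrite -E /e /unitv dotZr.
  suff -> : dot (v i) (cn t) = 0 by rewrite mulr0.
  rewrite /cn dot_sum big1 // => j _.
  rewrite dotZr; have := lam0 j (clamp t); rewrite le_eqVlt => /orP[/eqP <-|/Hi]; first by rewrite mul0r.
  by have [_ h1 h2] := Hv i; case=> ->; rewrite ?h1 ?h2 mulr0.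
have cn_end t (i : 'I_n.+2) : N * clamp t = i%:R -> c t = c (i%:R / N) -> cn t = c t.
  move=> Nt ct; have l1 : lam i (clamp t) = 1.
    by rewrite /lam Nt subrr normr0 subr0; apply/max_idPr.
  rewrite /cn (bigD1 i) //= l1 scale1r big1 ?addr0 -?ct // => j ji.
  rewrite /lam Nt (_ : Num.max _ _ = 0) ?scale0r //; apply/max_idPl; rewrite subr_le0.
  have [ij|ji'] := leqP i j.
    rewrite distrC -natrB // ger0_norm // ler1n subn_gt0 ltn_neqAle ij andbT.
    by rewrite eq_sym; exact: ji.
  by rewrite -natrB 1?ltnW // ger0_norm // ler1n subn_gt0.
have cl0 : clamp (0 : R) = 0 by rewrite clamp_id // lexx ler01.
have cl1 : clamp (1 : R) = 1 by rewrite clamp_id // lexx ler01.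
have ct0 : c 0 = c0 0 by rewrite /c cl0.
have ct1 : c 1 = c0 0 by rewrite /c cl1.
have cn0e : cn 0 = c0 0 by rewrite (@cn_end 0 ord0) ?cl0 ?mulr0 ?mul0r.
have cn1e : cn 1 = c0 0 by rewrite (@cn_end 1 ord_max) ?cl1 ?mulr1 //= divff ?gt_eqF.
have c0S : dot (c0 0) (c0 0) = 1 by rewrite -ct0.
have ee0 : e 0 = c0 0 by rewrite /e cn0e unitv_id.
have ee1 : e 1 = c0 0 by rewrite /e cn1e unitv_id.
have c0q : dot (c0 0) q != 1 by rewrite -ee0.
(* First half of the homotopy: normalised straight lines from the loop to the polygon. Second half:
   straight lines to the base point in the stereographic chart. *)
pose s1 (p : R * R) := clamp (2 * p.1); pose s2 (p : R * R) := clamp (2 * p.1 - 1).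
have cs1 : continuous s1.
  move=> p; apply: (@continuous_comp _ _ _ (fun p : R * R => 2 * p.1) clamp); last exact: clamp_continuous.
  by apply: cvgM; [exact: cvg_cst|exact: cvg_fst].
have cs2 : continuous s2.
  move=> p; apply: (@continuous_comp _ _ _ (fun p : R * R => 2 * p.1 - 1) clamp); last exact: clamp_continuous.
  by apply: cvgB; [apply: cvgM; [exact: cvg_cst|exact: cvg_fst]|exact: cvg_cst].
have csnd (f : R -> V) : continuous f -> continuous (fun p : R * R => f p.2).
  by move=> cf p; apply: (@continuous_comp _ _ _ snd f); [exact: cvg_snd|exact: cf].
have ccomb (s : R * R -> R) (f h : R * R -> V) : continuous s -> continuous f -> continuous h ->
    continuous (fun p => (1 - s p) *: f p + s p *: h p).
  move=> cs cf ch p; apply: cvgD; apply: cvgZ; [|exact: cf|exact: cs|exact: ch].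
  by apply: cvgB; [exact: cvg_cst|exact: cs].
pose f1 (p : R * R) : V := (1 - s1 p) *: c p.2 + s1 p *: cn p.2.
have f10 p : f1 p != 0.
  have /andP[a b] : 0 <= s1 p <= 1 by exact: clamp_itv.
  apply/eqP => E; have : dot (c p.2) (f1 p) = 0 by rewrite E dot0r.
  rewrite /f1 dotDr !dotZr cS mulr1 => H; have := cpos p.2; move: a b H.
  move: (s1 p) (dot _ _) => s z s0 s1' H z0; have : 0 <= s * z by rewrite mulr_ge0 // ltW.
  move=> sz; have s11 : s = 1 by lra.
  by move: H; rewrite s11; lra.
pose H1 p := unitv (f1 p).
pose w0 := stereo q (c0 0).
pose f2 (p : R * R) : V := (1 - s2 p) *: stereo q (e p.2) + s2 p *: w0.
have f2q p : dot (f2 p) q = 0.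
  by rewrite /f2 dotDl (dotZl (1 - s2 p)) (dotZl (s2 p)) /w0 !stereo_orth // !mulr0 addr0.
pose H2 p := costereo q (f2 p).
exists (fun p => if p.1 - 2^-1 <= 0 then H1 p else H2 p); split.
- apply: continuous_pasting.
  + by move=> p; apply: cvgB; [exact: cvg_fst|exact: cvg_cst].
  + by apply: continuous_unitv => //; apply: ccomb => //; exact: csnd.
  + apply: continuous_costereo; apply: ccomb => //; last by move=> p; exact: cvg_cst.
    by apply: (csnd (fun t => stereo q (e t))); exact: continuous_stereo.
  + move=> p /eqP; rewrite subr_eq0 => /eqP p1.
    rewrite /H1 /H2 /f1 /f2 /s1 /s2 p1 mulfV // subrr cl0 cl1 subrr subr0 !scale1r !scale0r add0r addr0.
    by rewrite stereoK.
- move=> p; case: ifP => _; apply/sphereE; last exact: costereo_sphere.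
  by apply/sphereE; exact: unitv_sphere.
- move=> t t01 /=; have h : (0 - 2^-1 : R) <= 0 by rewrite sub0r oppr_le0 invr_ge0.
  have h' : ((1 - 2^-1 : R) <= 0) = false by apply/negbTE; rewrite -ltNge subr_gt0 invf_lt1 // ltr1n.
  rewrite h h' /H1 /H2 /f1 /f2 /s1 /s2 /= mulr0 cl0 subr0 scale1r scale0r addr0 unitv_id //; split.
    by rewrite /c clamp_id.
  rewrite mulr1 (_ : 2 - 1 = 1 :> R); last by lra.
  by rewrite cl1 subrr scale0r add0r scale1r /w0 stereoK.
- have ends p (w : V) : c p.2 = c0 0 -> cn p.2 = c0 0 -> (if p.1 - 2^-1 <= 0 then H1 p else H2 p) = c0 0.
    move=> cp cnp; case: ifP => _.
      by rewrite /H1 /f1 cp cnp -scalerDl subrK scale1r unitv_id.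
    by rewrite /H2 /f2 /e cnp unitv_id // /w0 -scalerDl subrK scale1r stereoK.
  by move=> s s01; split; exact: ends.
Qed.

End Loops.
End SphereTopology.

(** * The inverse function theorem *)

Section Inverse.
Context {R : realType}.
Variable N : nat.
Implicit Types (x y z : 'rV[R]_N).

Lemma geometric_small (C e : R) : 0 < e -> exists n, C * 2^-1 ^+ n < e.
Proof.
move=> e0; have : (fun n => C * 2^-1 ^+ n) @ \oo --> (0 : R).
  have L : (fun n => C * 2^-1 ^+ n) @ \oo --> C * (0 : R).
    apply: cvgM; first exact: cvg_cst.
    by apply: cvg_expr; rewrite ger0_norm // invf_lt1 // ltr1n.
  by rewrite mulr0 in L.
move/cvgrPdist_lt => /(_ e e0) [n _ /(_ n (leqnn n))] /=.
rewrite sub0r normrN => h; exists n; exact: le_lt_trans (ler_norm _) h.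
Qed.

(* f is a perturbation of the identity: a contraction on a small ball. *)
Lemma near_identity_inverse (f : 'rV[R]_N -> 'rV[R]_N) (r : R) : 0 < r ->
  f 0 = 0 ->
  (forall x y, `|x| <= r -> `|y| <= r -> `|(x - f x) - (y - f y)| <= 2^-1 * `|x - y|) ->
  exists h : 'rV[R]_N -> 'rV[R]_N, forall y, `|y| < r / 2 ->
    [/\ `|h y| < r, f (h y) = y & forall x, `|x| <= r -> f x = y -> x = h y].
Proof.
move=> r0 f0 Hf.
have uniq_inv x x' : `|x| <= r -> `|x'| <= r -> f x = f x' -> x = x'.
  move=> xr xr' E; have := Hf x x' xr xr'.
  rewrite E (_ : _ - _ - _ = x - x'); last by apply/rowP => j; rewrite !mxE; ring.
  by move=> H; apply/eqP; rewrite -subr_eq0 -normr_le0; lra.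
suff /choice[h Hh] : forall y, exists x, `|y| < r / 2 -> `|x| < r /\ f x = y.
  exists h => y yr; have [h1 h2] := Hh y yr; split => // x xr E.
  by apply: uniq_inv => //; [exact: ltW|rewrite h2].
move=> y; case: (pselect (`|y| < r / 2)) => yr; last by exists 0.
pose U : set 'rV[R]_N := [set x | `|x| <= r].
(* The fixed points of [F] are the solutions of f x = y, and [F] is a contraction of the closed
   ball. *)
pose F x := y + (x - f x).
have FU x : `|x| <= r -> `|F x| < r.
  move=> xr; rewrite /F; apply: le_lt_trans (ler_normD _ _) _.
  have := Hf x 0 xr; rewrite normr0 f0 subr0 subr0 => /(_ (ltW r0)); rewrite subr0; lra.
have UF : set_fun U U F by move=> x Ux; exact: ltW (FU x Ux).
have FF x x' : U x -> U x' -> `|F x - F x'| <= 2^-1 * `|x - x'|.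
  by move=> Ux Ux'; rewrite /F opprD addrACA subrr add0r; exact: Hf.
pose u n := iter n F 0.
have uU n : U (u n).
  elim: n => [|n IH]; first by rewrite /U /= normr0 ltW.
  exact: UF.
have u_step n : `|u n.+1 - u n| <= `|F 0| * 2^-1 ^+ n.
  elim: n => [|n IH]; first by rewrite /u /= subr0 expr0 mulr1.
  apply: le_trans (FF (u n.+1) (u n) (uU _) (uU _)) _.
  by rewrite exprS mulrCA ler_pM2l ?invr_gt0.
have [x Hx] : exists x : 'rV[R]_N, forall n, `|u n - x| <= 2 * `|F 0| * 2^-1 ^+ n.
  have /choice[l Hl] : forall k, exists l, forall n, `|u n 0 k - l| <= 2 * `|F 0| * 2^-1 ^+ n.
    move=> k; apply: geometric_limit => n; apply: le_trans (u_step n).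
    by have := row_coord_le (u n.+1 - u n) k; rewrite !mxE.
  exists (\row_k l k) => n; apply: row_normP => [|k].
    by rewrite mulr_ge0 ?exprn_ge0 // mulr_ge0.
  by rewrite !mxE.
have Ux : U x.
  rewrite /U /=; apply/ler_addgt0Pl => e e0; have [n Hn] := geometric_small (2 * `|F 0|) e0.
  rewrite -(subrK (u n) x); apply: le_trans (ler_normD _ _) _; rewrite distrC.
  by rewrite lerD //; [exact: le_trans (Hx n) (ltW Hn)|exact: uU].
have Ex : x = F x.
  apply/eqP; rewrite -subr_eq0 -normr_le0; apply/ler_addgt0Pl => e e0; rewrite addr0.
  have [n Hn] := geometric_small (2 * (2 * `|F 0|)) e0.
  rewrite (_ : x - F x = - (u n.+1 - x) + (F (u n) - F x)); last by rewrite opprB addrA subrK.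
  apply: le_trans (ler_normD _ _) _; rewrite normrN.
  have h1 := Hx n.+1; have h2 := Hx n; have h3 := FF (u n) x (uU n) Ux.
  by rewrite exprS in h1; move: h1 h2 h3 Hn; set q := 2^-1 ^+ n; lra.
exists x => _; have Ex' := Ex.
split; first by rewrite Ex'; exact: FU.
move: Ex'; rewrite /F addrCA => /eqP.
by rewrite -subr_eq0 opprD addrA subrr add0r opprB subr_eq0 => /eqP.
Qed.

End Inverse.

Section SmoothMatrices.
Context {R : realType}.
Implicit Type V : normedModType R.

Lemma Coo_at_prod V (I : Type) (r : seq I) (f : I -> V -> R) x :
  (forall i, Coo_at x (f i)) -> Coo_at x (fun y => \prod_(i <- r) f i y).
Proof.
move=> H; elim: r => [|i r IH].
  by under eq_fun do rewrite big_nil; exact: Coo_at_cst.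
by under eq_fun do rewrite big_cons; exact: (Coo_atM (H i) IH).
Qed.

Lemma Coo_at_det V n (A : V -> 'M[R]_n) x : (forall i j, Coo_at x (fun y => A y i j)) ->
  Coo_at x (fun y => \det (A y)).
Proof.
move=> H; apply: Coo_at_sum => s.
apply: (@Coo_atM _ _ _ (cst ((-1) ^+ s))); first exact: Coo_at_cst.
by apply: Coo_at_prod => i; exact: H.
Qed.

(** The cofactor formula, valid near [x] because the determinant stays nonzero there. *)
Lemma Coo_at_invmx V n (A : V -> 'M[R]_n) x : (forall i j, Coo_at x (fun y => A y i j)) ->
  A x \in unitmx -> forall i j, Coo_at x (fun y => invmx (A y) i j).
Proof.
move=> H Ax i j; have Cd := Coo_at_det H.
have d0 : \det (A x) != 0 by rewrite -unitfE -unitmxE.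
have nz : \forall y \near x, \det (A y) != 0.
  have /= := Coo_at_continuous Cd; rewrite /prop_for /continuous_at => C.
  exact: (C _ (open_nbhs_nbhs (conj (@open_neq R 0) d0))).
apply: (@Coo_at_near _ _ _ (fun y => (\det (A y))^-1 * ((-1) ^+ (j + i) * \det (row' j (col' i (A y)))))).
  apply: Coo_atM; first exact: Coo_atV.
  apply: (@Coo_atM _ _ _ (cst ((-1) ^+ (j + i)))); first exact: Coo_at_cst.
  apply: Coo_at_det => a b; under eq_fun do rewrite !mxE; exact: H.
apply: filterS nz => y y0; rewrite /invmx unitmxE unitfE y0 mxE mxE /cofactor.
by [].
Qed.

Lemma Coo_at_Ck V k (U : set V) (f : V -> R) : open U -> (forall x, U x -> Coo_at x f) -> Ck k U f.
Proof.
move=> oU; elim: k f => [|k IH] f H; first by move=> x /H/Coo_at_continuous.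
split=> [x /H/Coo_at_continuous //|v x /H Cx|v]; first exact: Coo_at_derivable.
by apply: IH => x /H Cx; exact: Coo_at_derive.
Qed.

End SmoothMatrices.

(** * The inverse function theorem for smooth maps of R^N *)

Section InverseFunction.
Context {R : realType}.
Variable N : nat.
Implicit Types (x y z : 'rV[R]_N).

Definition jac (f : 'rV[R]_N -> 'rV[R]_N) x : 'M[R]_N :=
  \matrix_(i, j) 'D_(ebase i) (fun y => f y 0 j) x.

Lemma inverse_function0 (f : 'rV[R]_N -> 'rV[R]_N) :
  f 0 = 0 -> (forall j, Coo_at 0 (fun x => f x 0 j)) -> jac f 0 = 1%:M ->
  exists r rho : R, exists h : 'rV[R]_N -> 'rV[R]_N, [/\ 0 < r, 0 < rho,
   forall y, `|y| < rho -> [/\ `|h y| < r, f (h y) = y & forall j, Coo_at y (fun y => h y 0 j)],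
   forall x j, `|x| < r -> Coo_at x (fun x => f x 0 j)
   & forall x, `|x| < r -> `|f x| < rho -> h (f x) = x].
Proof.
move=> f0 Cf J1.
(* If all Jacobian entries are within [eps] of the identity, the N errors of a row-column product
   add up to at most 1/2; N + 1 covers the case N = 0. *)
pose eps : R := (2 * (N%:R + 1))^-1.
have eps0 : 0 < eps by rewrite invr_gt0 mulr_gt0 // ltr_wpDl.
have N0 : (0 : R) <= N%:R by rewrite ler0n.
have near_jac : \forall x \near (0 : 'rV[R]_N), (forall j, Coo_at x (fun x => f x 0 j)) /\
   (jac f x \in unitmx) /\ forall i j, `|jac f x i j - (i == j)%:R| <= eps.
  have n1 : \forall x \near (0 : 'rV[R]_N), forall j, Coo_at x (fun x => f x 0 j).
    apply: (@filter_forall _ _ (fun j x => Coo_at x (fun x => f x 0 j)) (nbhs (0 : 'rV[R]_N))) => j.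
    exact: (Coo_at_nbhs (Cf j)).
  have CJ i j : Coo_at 0 (fun x => jac f x i j).
    under eq_fun do rewrite mxE; exact: Coo_at_derive.
  have n2 : \forall x \near (0 : 'rV[R]_N), jac f x \in unitmx.
    have Cd := Coo_at_continuous (Coo_at_det CJ); rewrite /prop_for /continuous_at J1 det1 in Cd.
    have N1 : \forall x \near (0 : 'rV[R]_N), \det (jac f x) != 0.
      exact: (Cd _ (open_nbhs_nbhs (conj (@open_neq R 0) (oner_neq0 R)))).
    by apply: filterS N1 => x; rewrite /= unitmxE unitfE.
  have n3 : \forall x \near (0 : 'rV[R]_N), forall i j, `|jac f x i j - (i == j)%:R| <= eps.
    apply: (@filter_forall _ _ (fun i x => forall j, `|jac f x i j - (i == j)%:R| <= eps) (nbhs (0 : 'rV[R]_N))) => i.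
    apply: (@filter_forall _ _ (fun j x => `|jac f x i j - (i == j)%:R| <= eps) (nbhs (0 : 'rV[R]_N))) => j.
    have := Coo_at_continuous (CJ i j) => /(@cvgrPdist_le _ _ _ (nbhs (0 : 'rV[R]_N))) /(_ eps eps0).
    by apply: filterS => x; rewrite J1 [1%:M i j]mxE distrC.
  by apply: filterS3 n1 n2 n3.
have [q q0 Hq] : exists2 q : R, 0 < q & forall x, `|x| < q -> (forall j, Coo_at x (fun x => f x 0 j)) /\
   (jac f x \in unitmx) /\ forall i j, `|jac f x i j - (i == j)%:R| <= eps.
  have /nbhs_ballP[q /= q0 Hq] := near_jac; exists q => // x xq; apply: Hq.
  by rewrite -ball_normE /= sub0r normrN.
(* For two points of norm at most r the intermediate points of the increment formula have norm at
   most 3 r, below q. *)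
pose r := q / 4; have r0 : 0 < r by rewrite divr_gt0.
have inc x y j : `|x| <= r -> `|y| <= r -> exists2 xi : 'I_N -> 'rV[R]_N,
    forall i, `|xi i - y| <= `|x - y| /\ `|xi i| < q
    & f x 0 j - f y 0 j = \sum_i (x 0 i - y 0 i) * jac f (xi i) i j.
  move=> xr yr; have inq z : `|z - y| <= `|x - y| -> `|z| < q.
    move=> H; rewrite -(subrK y z); apply: le_lt_trans (ler_normD _ _) _.
    have := ler_normB x y; rewrite /r in xr yr; move: H q0; lra.
  have [|xi H E] := @increment_partials R N (fun x => f x 0 j) y x.
    by move=> z i /inq/Hq[Cz _]; exact: Coo_at_derivable.
  exists xi; first by move=> i; split=> //; apply: inq.
  by rewrite E; apply: eq_bigr => i _; rewrite [jac _ _ _ _]mxE.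
have ctr x y : `|x| <= r -> `|y| <= r -> `|(x - f x) - (y - f y)| <= 2^-1 * `|x - y|.
  move=> xr yr; apply: row_normP => [|j]; first by rewrite mulr_ge0.
  have [xi Hxi E] := inc x y j xr yr; rewrite !mxE.
  have -> : x 0 j - f x 0 j - (y 0 j - f y 0 j) =
      - \sum_i (x 0 i - y 0 i) * (jac f (xi i) i j - (i == j)%:R).
    rewrite (eq_bigr (fun i => (x 0 i - y 0 i) * jac f (xi i) i j - (x 0 i - y 0 i) * (i == j)%:R)); last first.
      by move=> i _; rewrite mulrBr.
    rewrite sumrB -E (bigD1 j) //= eqxx mulr1 big1 ?addr0; last by move=> i /negbTE ->; rewrite mulr0.
    by ring.
  rewrite normrN; apply: le_trans (ler_norm_sum _ _ _) _.
  apply: le_trans (_ : \sum_(i < N) `|x - y| * eps <= _).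
    apply: ler_sum => i _; rewrite normrM; apply: ler_pM => //.
      by have := row_coord_le (x - y) i; rewrite !mxE.
    by have [_ /Hq[_ [_ H]]] := Hxi i; exact: H.
  rewrite sumr_const card_ord -(mulr_natl (`|x - y| * eps)) mulrCA mulrC ler_wpM2r // /eps.
  rewrite ler_pdivrMr ?mulr_gt0 // ?ltr_wpDl // mulrA mulVf // mul1r lerDl.
  by [].
have [h Hh] := near_identity_inverse r0 f0 ctr.
pose rho := r / 2; have rho0 : 0 < rho by rewrite divr_gt0.
have hlip y y' : `|y| < rho -> `|y'| < rho -> `|h y - h y'| <= 2 * `|y - y'|.
  move=> yr yr'; have [h1 h2 _] := Hh y yr; have [h1' h2' _] := Hh y' yr'.
  have := ctr (h y) (h y') (ltW h1) (ltW h1'); rewrite h2 h2' => H.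
  have : `|h y - h y'| <= `|h y - y - (h y' - y')| + `|y - y'|.
    apply: le_trans (ler_normD _ _); rewrite le_eqVlt; apply/orP; left; apply/eqP; congr (`|_|).
    by apply/rowP => j; rewrite !mxE; ring.
  move: H; lra.
have oB : open [set y : 'rV[R]_N | `|y| < rho] by exact: open_norm_lt.
have hcont y : `|y| < rho -> {for y, continuous h}.
  move=> yr; apply/(@cvgrPdist_le _ _ _ (nbhs y)) => e e0.
  have e2 : 0 < e / 2 by rewrite divr_gt0.
  apply: filterS2 (nbhsx_ballx y _ e2) (open_nbhs_nbhs (conj oB yr)) => z; rewrite -ball_normE /= => yz zr.
  by apply: le_trans (hlip y z yr zr) _; move: yz; lra.
have hder y v j : `|y| < rho -> is_derive y v (fun y => h y 0 j) ((v *m invmx (jac f (h y))) 0 j).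
  move=> yr; have [h1 h2 _] := Hh y yr; set x := h y in h1 h2 *.
  have xq : `|x| < q by apply: lt_trans h1 _; rewrite /r; move: q0; lra.
  have [Cx [Ux _]] := Hq x xq; set K := jac f x in Ux *.
  pose Kb := \sum_i \sum_j `|invmx K i j|.
  have KbP a b : `|invmx K a b| <= Kb.
    rewrite /Kb (bigD1 a) //= (bigD1 b) //= -addrA lerDl addr_ge0 //; apply: sumr_ge0 => // i _.
    by apply: sumr_ge0.
  have Kb0 : 0 <= Kb by apply: sumr_ge0 => i _; apply: sumr_ge0.
  apply: is_derive_est => e e0.
  pose C := 2 * `|v| * (N%:R * (N%:R * Kb)).
  have C0 : 0 <= C by rewrite !mulr_ge0.
  pose e1 := e / (C + 1); have e10 : 0 < e1 by rewrite divr_gt0 // ltr_wpDl.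
  have CJ a b : Coo_at x (fun x => jac f x a b).
    under eq_fun do rewrite mxE; exact: Coo_at_derive.
  have nK : \forall z \near x, forall a b, `|K a b - jac f z a b| <= e1.
    apply: (@filter_forall _ _ (fun a z => forall b, `|K a b - jac f z a b| <= e1) (nbhs x)) => a.
    apply: (@filter_forall _ _ (fun b z => `|K a b - jac f z a b| <= e1) (nbhs x)) => b.
    by have /(@cvgrPdist_le _ _ _ (nbhs x)) := Coo_at_continuous (CJ a b); apply.
  have [q1 /= q10 Hq1] : exists2 q1 : R, 0 < q1 & forall z, `|z - x| < q1 -> forall a b, `|K a b - jac f z a b| <= e1.
    have /nbhs_ballP[q1 /= q10 Hq1] := nK; exists q1 => // z zx; apply: Hq1.
    by rewrite -ball_normE /= distrC.
  have v1 : 0 < 2 * (`|v| + 1) by rewrite mulr_gt0 // ltr_wpDl.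
  have nB : \forall s \near (0 : R), `|s *: v + y| < rho.
    have := near0_line v (open_nbhs_nbhs (conj oB yr)).
    by apply: filterS => s /(_ 1); rewrite mul1r; apply; rewrite ler01 lexx.
  have ns : \forall s \near (0 : R), `|s| < q1 / (2 * (`|v| + 1)).
    exists (q1 / (2 * (`|v| + 1))) => /=; first by rewrite divr_gt0.
    by move=> s /=; rewrite sub0r normrN.
  apply: filterS2 nB ns => s sB ss.
  have [g1 g2 _] := Hh _ sB; set x' := h (s *: v + y) in g1 g2 *.
  have dx : `|x' - x| <= 2 * (`|s| * `|v|).
    by apply: le_trans (hlip _ _ sB yr) _; rewrite addrK normrZ.
  have dxq : `|x' - x| < q1.
    apply: le_lt_trans dx _; apply: le_lt_trans (_ : `|s| * (2 * (`|v| + 1)) < _); last by rewrite -ltr_pdivlMr.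
    by rewrite mulrCA ler_wpM2l // ler_wpM2l // lerDl.
  have /choice[xi Hxi] : forall b, exists xi : 'I_N -> 'rV[R]_N, (forall i, `|xi i - x| <= `|x' - x|) /\
     (s *: v) 0 b = \sum_i (x' - x) 0 i * jac f (xi i) i b.
    move=> b; have [xi H E] := inc x' x b (ltW g1) (ltW h1); exists xi; split; first by move=> i; have [] := H i.
    have -> : (s *: v) 0 b = f x' 0 b - f x 0 b by rewrite g2 h2 [X in _ = X - _]mxE addrK.
    by rewrite E; apply: eq_bigr => i _; rewrite [(x' - x) 0 i]mxE [(- x) 0 i]mxE.
  (* The partials at the intermediate points form a matrix for which the increment formula is exact;
     it tends to the Jacobian [K] as s tends to 0, which gives the derivative of [h]. *)
  pose Kt : 'M[R]_N := \matrix_(i, b) jac f (xi b i) i b.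
  have EK : (x' - x) *m Kt = s *: v.
    by apply/rowP => b; rewrite (Hxi b).2 mxE; apply: eq_bigr => i _; rewrite [Kt _ _]mxE.
  have E : x' - x - s *: (v *m invmx K) = ((x' - x) *m (K - Kt)) *m invmx K.
    by rewrite mulmxBr EK mulmxBl mulmxK // scalemxAl.
  have -> : x' 0 j - x 0 j - s * (v *m invmx K) 0 j = (x' - x - s *: (v *m invmx K)) 0 j.
    by move: (v *m _) => w; rewrite !mxE.
  rewrite E; apply: le_trans (mulmx_row_bound _ KbP j) _.
  have b1 : `|(x' - x) *m (K - Kt)| <= `|x' - x| * (N%:R * e1).
    apply: row_normP => [|b]; first by apply: mulr_ge0 => //; apply: mulr_ge0 => //; exact: ltW.
    apply: mulmx_row_bound => a c; rewrite [(K - Kt) a c]mxE [(- Kt) a c]mxE [Kt a c]mxE.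
    by apply: Hq1; apply: le_lt_trans dxq; exact: (Hxi c).1.
  apply: le_trans (ler_wpM2r _ b1) _; first by rewrite mulr_ge0.
  apply: le_trans (_ : 2 * (`|s| * `|v|) * (N%:R * e1) * (N%:R * Kb) <= _).
    by rewrite ler_wpM2r ?mulr_ge0 // ler_wpM2r // mulr_ge0 // ltW.
  rewrite (_ : _ * _ = C * e1 * `|s|); last by rewrite /C; ring.
  rewrite ler_wpM2r // /e1 mulrA ler_pdivrMr ?ltr_wpDl // mulrC ler_wpM2l ?lerDl //; exact: ltW.
have hCk k j : Ck k [set y : 'rV[R]_N | `|y| < rho] (fun y => h y 0 j).
  elim: k j => [|k IH] j.
    move=> y yr; apply: (@continuous_comp _ _ _ h (fun z : 'rV[R]_N => z 0 j)); first exact: hcont.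
    exact: coord_continuous.
  split=> [y yr|v y yr|v].
  - apply: (@continuous_comp _ _ _ h (fun z : 'rV[R]_N => z 0 j)); first exact: hcont.
    exact: coord_continuous.
  - by have [] := hder y v j yr.
  (* The derivative of [h] is a smooth function composed with [h] itself, so the induction
     hypothesis on the order of [h] suffices. *)
  - apply: (@Ck_eq _ _ k _ ((fun x => (v *m invmx (jac f x)) 0 j) \o h)) => //.
      by move=> y yr; have [_ ->] := hder y v j yr.
    pose W := [set x : 'rV[R]_N | `|x| < r].
    have oW : open W by exact: open_norm_lt.
    apply: (@Ck_rowcomp _ k _ _ _ W) => //; first by move=> y /Hh[].
    under eq_fun do rewrite mxE.
    apply: Ck_sum => // i; apply: (@CkM _ _ k W (cst (v 0 i)) (fun x => invmx (jac f x) i j)) => //; first exact: Ck_cst.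
    apply: Coo_at_Ck => // x xr; have xq : `|x| < q by move: xr q0; rewrite /W /= /r; lra.
    have [Cx [Ux _]] := Hq x xq; apply: Coo_at_invmx => // a b; under eq_fun do rewrite mxE.
    by apply: Coo_at_derive; exact: Cx.
exists r, rho, h; split=> //.
- move=> y yr; have [h1 h2 _] := Hh y yr; split=> // j.
  by exists [set y : 'rV[R]_N | `|y| < rho]; split.
- move=> x j xr; have xq : `|x| < q by move: xr q0; rewrite /r; lra.
  by have [Cx _] := Hq x xq.
- by move=> x xr fr; have [_ _ H] := Hh _ fr; rewrite -(H x (ltW xr)).
Qed.

(** Reduction to [inverse_function0] by translating and multiplying with the inverse Jacobian [K].
    The open set [O] also confines x to a ball, so that [h] is a two-sided inverse on it. *)
Lemma inverse_function (f : 'rV[R]_N -> 'rV[R]_N) c (W : set 'rV[R]_N) :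
  (forall j, Coo_at c (fun x => f x 0 j)) -> jac f c \in unitmx -> nbhs c W ->
  exists rho : R, exists h : 'rV[R]_N -> 'rV[R]_N, exists O : set 'rV[R]_N,
   [/\ 0 < rho, open O /\ O c, O `<=` W,
   forall y, `|y - f c| < rho -> [/\ O (h y), f (h y) = y & forall j, Coo_at y (fun y => h y 0 j)]
   & forall x, O x -> `|f x - f c| < rho /\ h (f x) = x].
Proof.
move=> Cf Uc nW; set K := invmx (jac f c).
pose f' x := (f (x + c) - f c) *m K.
have sh0 (a x : 'rV[R]_N) j : Coo_at x (fun x : 'rV[R]_N => (x + a) 0 j).
  by under eq_fun do rewrite mxE; apply: Coo_atD; [exact: Coo_at_coord|exact: Coo_at_cst].
have sh (F : 'rV[R]_N -> R) (a x : 'rV[R]_N) : Coo_at (x + a) F -> Coo_at x (fun x => F (x + a)).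
  by move=> CF; apply: (@Coo_at_rowcomp R _ _ (fun x => x + a) F).
have mulC (F : 'rV[R]_N -> 'rV[R]_N) (L : 'M[R]_N) x : (forall j, Coo_at x (fun x => F x 0 j)) ->
    forall j, Coo_at x (fun x => (F x *m L) 0 j).
  move=> CF j; under eq_fun do rewrite mxE; apply: Coo_at_sum => i.
  apply: (@Coo_atM _ _ _ (fun x => F x 0 i) (cst (L i j))); [exact: CF|exact: Coo_at_cst].
have subC (F : 'rV[R]_N -> 'rV[R]_N) a x : (forall j, Coo_at x (fun x => F x 0 j)) ->
    forall j, Coo_at x (fun x => (F x - a) 0 j).
  move=> CF j; under eq_fun do rewrite !mxE.
  by apply: Coo_atB; [exact: CF|exact: Coo_at_cst].
have Cf' j : Coo_at 0 (fun x => f' x 0 j).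
  apply: mulC; apply: (subC (fun x => f (x + c))) => i; apply: (sh (fun x => f x 0 i)); rewrite add0r; exact: Cf.
have f'0 : f' 0 = 0 by rewrite /f' add0r subrr mul0mx.
have J1 : jac f' 0 = 1%:M.
  rewrite -(mulmxV Uc); apply/matrixP => i j; rewrite !mxE -/K.
  have dk k : is_derive (0 : 'rV[R]_N) (ebase i) (fun x => (f (x + c) - f c) 0 k) (jac f c i k).
    have E : (fun h : R => h^-1 *: (((fun x : 'rV[R]_N => (f (x + c) - f c) 0 k) \o shift 0) (h *: ebase i) - (f (0 + c) - f c) 0 k))
       = (fun h : R => h^-1 *: (((fun x => f x 0 k) \o shift c) (h *: ebase i) - f c 0 k)).
      by apply/funext => h /=; rewrite addr0 add0r subrr [_ 0 k]mxE [(- f c) 0 k]mxE [(0 : 'rV__) 0 k]mxE subr0.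
    rewrite mxE; apply: DeriveDef; last by rewrite /derive E.
    have : derivable (fun x => f x 0 k) c (ebase i) by exact: Coo_at_derivable.
    by rewrite /derivable -E.
  have [_ ->] : is_derive (0 : 'rV[R]_N) (ebase i) (fun y => f' y 0 j) (\sum_k jac f c i k * K k j).
    under eq_fun do rewrite mxE; apply: is_derive_sumr => k.
    rewrite mulrC; under eq_fun do rewrite mulrC.
    exact: (is_deriveZ _ (dk k)).
  by [].
have [r [rho [h [r0 rho0 H1 H2 H3]]]] := inverse_function0 f'0 Cf' J1.
have [q q0 Hq] : exists2 q : R, 0 < q & forall x, `|x - c| < q -> W x.
  move: nW => /nbhs_ballP[q /= q0 Hq]; exists q => // x xq; apply: Hq.
  by rewrite -ball_normE /= distrC.
have h0 : h 0 = 0 by rewrite -f'0 H3 // ?normr0 ?f'0 ?normr0.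
have hc : {for 0, continuous h}.
  have [|_ _ Ch] := H1 0; first by rewrite normr0.
  apply: (@row_cvgP _ _ _ (nbhs (0 : 'rV[R]_N))) => j; exact: (Coo_at_continuous (Ch j)).
have [s s0 Hs] : exists2 s : R, 0 < s <= rho & forall y, `|y| < s -> `|h y| < Num.min q r.
  have m0 : 0 < Num.min q r by rewrite lt_min q0 r0.
  have := hc; rewrite /prop_for /continuous_at h0 => /(@cvgrPdist_lt _ _ _ (nbhs (0 : 'rV[R]_N))) /(_ _ m0).
  move=> /nbhs_ballP[s /= s0 Hs]; exists (Num.min s rho).
    by rewrite lt_min s0 rho0 ge_min lexx orbT.
  move=> y; rewrite lt_min => /andP[ys _]; have := Hs y; rewrite -ball_normE /= sub0r normrN sub0r normrN.
  by apply.
move: s0 => /andP[s0 srho].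
pose kap := \sum_i \sum_j `|K i j|.
have KbP a b : `|K a b| <= kap.
  rewrite /kap (bigD1 a) //= (bigD1 b) //= -addrA lerDl addr_ge0 //; apply: sumr_ge0 => // i _.
  by apply: sumr_ge0.
have kap0 : 0 <= kap by apply: sumr_ge0 => i _; apply: sumr_ge0.
pose m := N%:R * kap + 1; have m0 : 0 < m by rewrite ltr_wpDl // mulr_ge0.
have fcont x : `|x - c| < r -> {for x, continuous f}.
  move=> xr; apply: (@row_cvgP _ _ _ (nbhs x)) => j; apply: Coo_at_continuous.
  have C' : forall j, Coo_at (x - c) (fun z => f' z 0 j) by move=> i; exact: H2.
  have := mulC f' (jac f c) (x - c) C' j => C2.
  have -> : (fun z => f z 0 j) = (fun z => (f' (z - c) *m jac f c) 0 j) + cst (f c 0 j).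
    apply/funext => z; rewrite fctE /f' subrK mulmxKV //; move: (f z) => fz; rewrite !mxE /=; ring.
  apply: Coo_atD; last exact: Coo_at_cst.
  exact: (sh (fun z => (f' z *m jac f c) 0 j) (- c)).
have mulK y : `|y| < s / m -> `|y *m K| < s.
  move=> ys; apply: le_lt_trans (_ : `|y| * m < s); last by rewrite -ltr_pdivlMr.
  apply: row_normP => [|k]; first by rewrite mulr_ge0 // ltW.
  apply: le_trans (mulmx_row_bound _ KbP k) _; rewrite ler_wpM2l // /m lerDl //.
pose O : set 'rV[R]_N := [set x | `|x - c| < Num.min q r] `&` f @^-1` [set y | `|y - f c| < s / m].
exists (s / m), (fun y => h ((y - f c) *m K) + c), O; split.
- by rewrite divr_gt0.
- split.
    have oB (T : 'rV[R]_N) (e : R) : open [set y : 'rV[R]_N | `|y - T| < e].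
      rewrite (_ : [set y : 'rV[R]_N | `|y - T| < e] = ball T e); first exact: ball_open.
      by apply/seteqP; split=> y /=; rewrite -ball_normE /= distrC.
    apply: open_preimage_on => // x /=; rewrite lt_min => /andP[_ xr]; exact: fcont.
  by split; rewrite /= subrr normr0 ?lt_min ?q0 ?r0 // divr_gt0.
- by move=> x [/=]; rewrite lt_min => /andP[xq _] _; exact: Hq.
- move=> y ys; have yK := mulK _ ys; have [g1 g2 g3] := H1 _ (lt_le_trans yK srho).
  have E : f (h ((y - f c) *m K) + c) = y.
    move: g2; rewrite /f' => /(congr1 (mulmx^~ (jac f c))); rewrite !mulmxKV // => /eqP.
    by rewrite subr_eq subrK => /eqP.
  split=> //; first by split; rewrite /= ?E // addrK; exact: Hs.
  move=> j; under eq_fun do rewrite mxE; apply: Coo_atD; last exact: Coo_at_cst.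
  apply: (@Coo_at_rowcomp R _ _ (fun y => (y - f c) *m K) (fun z => h z 0 j)); last exact: g3.
  by apply: mulC; apply: subC => i; exact: Coo_at_coord.
- move=> x [/=]; rewrite lt_min => /andP[xq xr] fx; split=> //.
  have := H3 (x - c) xr; rewrite /f' subrK => -> //; first by rewrite subrK.
  exact: lt_le_trans (mulK _ fx) srho.
Qed.

End InverseFunction.

(** * Tensor calculus of normal metric contact pairs *)

Section VectorFields.
Context {R : realType} {M : smoothSpace R}.
Implicit Types (X Y Z W : vfield M) (f : smoothFun M).

Lemma smooth_addE f h p : (f + h : smoothFun M) p = f p + h p. Proof. by []. Qed.
Lemma smooth_oppE f p : (- f : smoothFun M) p = - f p. Proof. by []. Qed.
Lemma smooth_mulE f h p : (f * h : smoothFun M) p = f p * h p. Proof. by []. Qed.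
Lemma smooth_scaleE (c : R) f p : (c *: f : smoothFun M) p = c * f p. Proof. by []. Qed.
Definition smoothE := (smooth_addE, smooth_oppE, smooth_mulE, smooth_scaleE).

Lemma vfieldD X Y f : (X + Y : vfield M) f = X f + Y f. Proof. by []. Qed.
Lemma vfieldZ h X f : (h *: X : vfield M) f = h * X f. Proof. by []. Qed.
Lemma vfield0 f : (0 : vfield M) f = 0. Proof. by []. Qed.

Lemma vfield_eqP X Y : (forall f p, X f p = Y f p) -> X = Y.
Proof. by move=> H; apply/val_inj/funext => f; apply: smoothFun_eqP => p; exact: H. Qed.

Lemma vfield_addr X f h : X (f + h) = X f + X h.
Proof. by rewrite -[f in LHS]scale1r vfield_linear scale1r. Qed.

Lemma vfield_scale X (a : R) f : X (a *: f) = a *: X f.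
Proof.
have X0 : X 0 = 0 by apply: (addrI (X 0)); rewrite addr0 -vfield_addr addr0.
by rewrite -[a *: f]addr0 vfield_linear X0 addr0.
Qed.

Lemma vfield_opp X f : X (- f) = - X f.
Proof. by rewrite -scaleN1r vfield_scale scaleN1r. Qed.

Lemma vfield_one X : X 1 = 0.
Proof.
have := vfield_leibniz X 1 1; rewrite !mulr1 mul1r => /eqP.
by rewrite -subr_eq0 opprD addrA subrr add0r oppr_eq0 => /eqP.
Qed.

Lemma vfield_zero X : X 0 = 0.
Proof. by rewrite -(scale0r (1 : smoothFun M)) vfield_scale !scale0r. Qed.

Lemma vfield_atD X Y p : vfield_at (X + Y) p = vfield_at X p + vfield_at Y p.
Proof. exact/val_inj/funext. Qed.
Lemma vfield_atZ f X p : vfield_at (f *: X) p = f p *: vfield_at X p.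
Proof. exact/val_inj/funext. Qed.
Lemma vfield_at0 p : vfield_at (0 : vfield M) p = 0.
Proof. exact/val_inj/funext. Qed.

Lemma lie_addl X Y Z : lie (X + Y) Z = lie X Z + lie Y Z.
Proof.
apply: vfield_eqP => f p; rewrite /= !fctE /= vfield_addr /= !fctE /=; ring.
Qed.
Lemma lie_skew X Y : lie Y X = - lie X Y.
Proof. by apply: vfield_eqP => f p; rewrite /= !fctE /=; ring. Qed.
Lemma lie0 X : lie 0 X = 0.
Proof. by apply: vfield_eqP => f p; rewrite /= vfield_zero !fctE subrr. Qed.

Lemma jacobi X Y Z : lie X (lie Y Z) = lie (lie X Y) Z + lie Y (lie X Z).
Proof.
apply: vfield_eqP => f p; rewrite /= !vfield_addr !vfield_opp /= !fctE /=.
by ring.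
Qed.

Section Tensors.
Variables (a : oneform M) (phi : tensor11 M) (g : riemannian M).

Lemma oneformD X Y : oneform_app a (X + Y) = oneform_app a X + oneform_app a Y.
Proof. by apply: smoothFun_eqP => p /=; rewrite vfield_atD linearD. Qed.
Lemma oneformZ f X : oneform_app a (f *: X) = f * oneform_app a X.
Proof. by apply: smoothFun_eqP => p /=; rewrite vfield_atZ linearZ. Qed.

Lemma tensorD X Y : tensor11_app phi (X + Y) = tensor11_app phi X + tensor11_app phi Y.
Proof. by apply: vfield_eqP => f p /=; rewrite vfield_atD linearD. Qed.
Lemma tensorZ h X : tensor11_app phi (h *: X) = h *: tensor11_app phi X.
Proof. by apply: vfield_eqP => f p /=; rewrite vfield_atZ linearZ. Qed.
Lemma tensorN X : tensor11_app phi (- X) = - tensor11_app phi X.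
Proof. by rewrite -scaleN1r tensorZ scaleN1r. Qed.
Lemma tensor0 : tensor11_app phi 0 = 0.
Proof. by rewrite -(scale0r (0 : vfield M)) tensorZ !scale0r. Qed.

Definition gpr p X Y : R := riem_app g X Y p.

Lemma gpC p X Y : gpr p X Y = gpr p Y X.
Proof. exact: riem_sym. Qed.
Lemma gpDl p X Y Z : gpr p (X + Y) Z = gpr p X Z + gpr p Y Z.
Proof.
by rewrite /gpr /= vfield_atD -[vfield_at X p]scale1r riem_linear mul1r scale1r.
Qed.
Lemma gpZl p f X Y : gpr p (f *: X) Y = f p * gpr p X Y.
Proof.
rewrite /gpr /= vfield_atZ -[X in riem_at g p X]addr0 riem_linear.
have -> : riem_at g p 0 (vfield_at Y p) = 0.
  apply: (addrI (riem_at g p 0 (vfield_at Y p))).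
  by rewrite addr0 -[X in X + _]mul1r -riem_linear scale1r addr0.
by rewrite addr0.
Qed.
Lemma gpDr p X Y Z : gpr p X (Y + Z) = gpr p X Y + gpr p X Z.
Proof. by rewrite gpC gpDl !(gpC p _ X). Qed.
Lemma gpZr p f X Y : gpr p X (f *: Y) = f p * gpr p X Y.
Proof. by rewrite gpC gpZl gpC. Qed.
Lemma gpNl p X Y : gpr p (- X) Y = - gpr p X Y.
Proof. by rewrite -scaleN1r gpZl /= mulN1r. Qed.
Lemma gpNr p X Y : gpr p X (- Y) = - gpr p X Y.
Proof. by rewrite gpC gpNl gpC. Qed.
Lemma gp0l p X : gpr p 0 X = 0.
Proof. by rewrite -(scale0r (0 : vfield M)) gpZl mul0r. Qed.
Lemma gp0r p X : gpr p X 0 = 0.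
Proof. by rewrite gpC gp0l. Qed.

(** Positivity of the metric applied to the difference. It reduces identities of vector fields to
    scalar identities within reach of [ring] and [lra]. *)
Lemma gp_inj X Y : (forall p W, gpr p X W = gpr p Y W) -> X = Y.
Proof.
move=> H; apply/eqP; rewrite -subr_eq0; apply/eqP; apply: vfield_eqP => f p.
have [Z0|/(riem_pos g)] := eqVneq (vfield_at (X - Y) p) 0.
  by have := congr1 (fun v : tangent M p => v f) Z0.
rewrite -[riem_at _ _ _ _]/(gpr p (X - Y) (X - Y)).
by rewrite gpDl gpNl H subrr ltxx.
Qed.

Definition gpE := (gpDl, gpDr, gpNl, gpNr, gpZl, gpZr, gp0l, gp0r).

Section LeviCivita.
Variable D : vfield M -> vfield M -> vfield M.
Hypothesis LC : levi_civita g D.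
Local Notation Rm := (curvature D).

Lemma DDl X Y Z : D (X + Y) Z = D X Z + D Y Z.
Proof. by have [H _ _ _ _] := LC; have := H 1 X Y Z; rewrite !scale1r. Qed.
Lemma D0l Z : D 0 Z = 0.
Proof. by apply: (addrI (D 0 Z)); rewrite addr0 -DDl addr0. Qed.
Lemma DZl f X Z : D (f *: X) Z = f *: D X Z.
Proof. by have [H _ _ _ _] := LC; have := H f X 0 Z; rewrite D0l !addr0. Qed.
Lemma DNl X Z : D (- X) Z = - D X Z.
Proof. by rewrite -scaleN1r DZl scaleN1r. Qed.
Lemma DDr X Y Z : D X (Y + Z) = D X Y + D X Z.
Proof. by have [_ H _ _ _] := LC. Qed.
Lemma DZr X f Y : D X (f *: Y) = X f *: Y + f *: D X Y.
Proof. by have [_ _ H _ _] := LC. Qed.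
Lemma D0r X : D X 0 = 0.
Proof. by apply: (addrI (D X 0)); rewrite addr0 -DDr addr0. Qed.
Lemma DNr X Y : D X (- Y) = - D X Y.
Proof. by apply: (addrI (D X Y)); rewrite -DDr !subrr D0r. Qed.
Lemma torsion X Y : lie X Y = D X Y - D Y X.
Proof. by have [_ _ _ H _] := LC. Qed.
Lemma metricD p X Y Z : X (riem_app g Y Z) p = gpr p (D X Y) Z + gpr p Y (D X Z).
Proof. by have [_ _ _ _ H] := LC; rewrite H. Qed.

Definition DE := (DDl, DNl, DZl, D0l, DDr, DNr, D0r).

Lemma Rm_skew X Y Z : Rm Y X Z = - Rm X Y Z.
Proof.
apply: gp_inj => p W; rewrite /curvature (lie_skew X Y) !DE !gpE; ring.
Qed.
Lemma Rm_addr X Y Z Z' : Rm X Y (Z + Z') = Rm X Y Z + Rm X Y Z'.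
Proof. by apply: gp_inj => p W; rewrite /curvature !DE !gpE; ring. Qed.
Lemma Rm_oppr X Y Z : Rm X Y (- Z) = - Rm X Y Z.
Proof. by apply: gp_inj => p W; rewrite /curvature !DE !gpE; ring. Qed.
Lemma Rm_scaler X Y f Z : Rm X Y (f *: Z) = f *: Rm X Y Z.
Proof.
apply: gp_inj => p W; rewrite /curvature !(DZr, DDr) !gpE.
by rewrite /= !fctE /=; ring.
Qed.
Lemma Rm_addl X X' Y Z : Rm (X + X') Y Z = Rm X Y Z + Rm X' Y Z.
Proof. by apply: gp_inj => p W; rewrite /curvature lie_addl !DE !gpE; ring. Qed.
Lemma Rm_scalel f X Y Z : Rm (f *: X) Y Z = f *: Rm X Y Z.
Proof.
apply: gp_inj => p W; rewrite /curvature !torsion !(DZr, DE) !gpE; ring.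
Qed.
Lemma Rm_scalem X f Y Z : Rm X (f *: Y) Z = f *: Rm X Y Z.
Proof. by rewrite (Rm_skew (f *: Y) X Z) Rm_scalel (Rm_skew X Y) scalerN opprK. Qed.

Lemma Rm_oppl X Y Z : Rm (- X) Y Z = - Rm X Y Z.
Proof. by rewrite -(scaleN1r X) Rm_scalel scaleN1r. Qed.
Lemma Rm_oppm X Y Z : Rm X (- Y) Z = - Rm X Y Z.
Proof. by rewrite -(scaleN1r Y) Rm_scalem scaleN1r. Qed.

Lemma bianchi X Y Z : Rm X Y Z + Rm Y Z X + Rm Z X Y = 0.
Proof.
have J := jacobi X Y Z.
have J' : lie X (lie Y Z) - lie (lie X Y) Z - lie Y (lie X Z) = 0.
  by rewrite J addrAC addrK subrr.
apply: gp_inj => p W; rewrite gp0l -(gp0l p W) -J' /curvature.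
by rewrite !torsion !DE !gpE; ring.
Qed.

Definition curv4 p X Y Z W := gpr p (Rm X Y Z) W.

Lemma R4_skew12 p X Y Z W : curv4 p Y X Z W = - curv4 p X Y Z W.
Proof. by rewrite /curv4 Rm_skew gpNl. Qed.

Lemma R4_skew34 p X Y Z W : curv4 p X Y W Z = - curv4 p X Y Z W.
Proof.
have E (A B : vfield M) : A (B (riem_app g Z W)) p = gpr p (D A (D B Z)) W + gpr p (D B Z) (D A W)
   + gpr p (D A Z) (D B W) + gpr p Z (D A (D B W)).
  have -> : B (riem_app g Z W) = riem_app g (D B Z) W + riem_app g Z (D B W).
    by have [_ _ _ _ ->] := LC.
  by rewrite vfield_addr /= !fctE !metricD; ring.
have L : lie X Y (riem_app g Z W) p = gpr p (D (lie X Y) Z) W + gpr p Z (D (lie X Y) W).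
  exact: metricD.
rewrite /= !fctE /= in L; have E1 := E X Y; have E2 := E Y X.
rewrite E1 E2 in L; rewrite /curv4 /curvature (gpC p _ Z) !gpE.
move: L; lra.
Qed.

Lemma R4_bianchi p X Y Z W : curv4 p X Y Z W + curv4 p Y Z X W + curv4 p Z X Y W = 0.
Proof. by rewrite /curv4 -!gpDl bianchi gp0l. Qed.

Lemma R4_pair p X Y Z W : curv4 p X Y Z W = curv4 p Z W X Y.
Proof.
have b1 := R4_bianchi p X Y Z W; have b2 := R4_bianchi p Y Z W X.
have b3 := R4_bianchi p Z W X Y; have b4 := R4_bianchi p W X Y Z.
have := R4_skew34 p X Y Z W; have := R4_skew34 p Y Z X W.
have := R4_skew34 p Z W X Y; have := R4_skew34 p W X Y Z.
have := R4_skew12 p Z X W Y; have := R4_skew34 p Z X Y W.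
have := R4_skew12 p W Y X Z; have := R4_skew34 p W Y Z X.
lra.
Qed.

End LeviCivita.
End Tensors.
End VectorFields.

(** * Reeb fields are Killing; curvature identities for Killing fields *)

Section MetricContactPair.
Context {R : realType} {M : smoothSpace R}.
Variables (a1 a2 : oneform M) (Z1 Z2 : vfield M) (phi : tensor11 M) (g : riemannian M).
Variable D : vfield M -> vfield M -> vfield M.
Hypothesis LC : levi_civita g D.
Implicit Types (X Y Z W : vfield M).
Local Notation P := (tensor11_app phi).
Local Notation Rm := (curvature D).
Local Notation gp := (gpr g).
Local Notation R4 := (curv4 g D).

Hypothesis reeb : reeb_fields a1 a2 Z1 Z2.
Hypothesis phi2 : forall X, P (P X) = - X + oneform_app a1 X *: Z1 + oneform_app a2 X *: Z2.
Hypothesis phiZ : P Z1 = 0 /\ P Z2 = 0.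
Hypothesis normal : normal_structure a1 a2 Z1 Z2 phi.
Hypothesis compat : forall X Y, riem_app g X (P Y) = dext a1 X Y + dext a2 X Y.
Hypothesis dual : forall X, riem_app g X Z1 = oneform_app a1 X /\ riem_app g X Z2 = oneform_app a2 X.
Hypothesis lsym : forall W X Y Z,
  D W (Rm X Y Z) - Rm (D W X) Y Z - Rm X (D W Y) Z - Rm X Y (D W Z) = 0.

Let a1E X p : oneform_app a1 X p = gp p X Z1.
Proof. by rewrite /gp (dual X).1. Qed.
Let a2E X p : oneform_app a2 X p = gp p X Z2.
Proof. by rewrite /gp (dual X).2. Qed.

Lemma reeb_orthonormal p : [/\ gp p Z1 Z1 = 1, gp p Z1 Z2 = 0, gp p Z2 Z1 = 0 & gp p Z2 Z2 = 1].
Proof.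
have [[h1 h2] [h3 h4] _ _] := reeb.
by rewrite -!a1E -!a2E h1 h2 h3 h4.
Qed.

Lemma oneform_phi X : oneform_app a1 (P X) = 0 /\ oneform_app a2 (P X) = 0.
Proof.
have [[h1 h2] [h3 h4] _ _] := reeb; have [p1 p2] := phiZ.
have E : oneform_app a1 (P X) *: Z1 + oneform_app a2 (P X) *: Z2 = 0.
  have e1 := phi2 (P X); rewrite (phi2 X) !tensorD tensorN !tensorZ p1 p2 !scaler0 !addr0 in e1.
  apply: (addrI (- P X)); rewrite addr0 addrA; exact: (esym e1).
have z0 (a : oneform M) : oneform_app a 0 = 0.
  by rewrite -(scale0r (0 : vfield M)) oneformZ mul0r.
split.
  have := congr1 (oneform_app a1) E.
  by rewrite z0 oneformD !oneformZ h1 h2 mulr1 mulr0 addr0.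
have := congr1 (oneform_app a2) E.
by rewrite z0 oneformD !oneformZ h3 h4 mulr1 mulr0 add0r.
Qed.

Section OneReeb.
Variable Z : vfield M.
Hypothesis PZ : P Z = 0.
Hypothesis dZ : forall Y, dext a1 Z Y = 0 /\ dext a2 Z Y = 0.
Hypothesis cZ : forall X, X (oneform_app a1 Z) = 0 /\ X (oneform_app a2 Z) = 0.

Lemma reeb_invariant (a : oneform M) Y : (forall Y, dext a Z Y = 0) ->
  (forall X, X (oneform_app a Z) = 0) ->
  Z (oneform_app a Y) = oneform_app a (lie Z Y).
Proof.
move=> dz cz; have := dz Y; rewrite /dext cz subr0 => /(congr1 (fun f : smoothFun M => (2 : R) *: f)).
by rewrite scalerA mulfV // scale1r scaler0 => /eqP; rewrite subr_eq0 => /eqP.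
Qed.

(** Normality with first argument [Z] gives the identity after one application of phi. Both sides
    are horizontal, where phi^2 = -1, so a second application removes it. *)
Lemma reeb_lie_phi Y : lie Z (P Y) = P (lie Z Y).
Proof.
have N : P (P (lie Z Y)) = P (lie Z (P Y)).
  have := normal Z Y; rewrite /nijenhuis (dZ Y).1 (dZ Y).2 PZ !lie0 tensor0 !mul0rn !scale0r !addr0 subr0.
  by move/eqP; rewrite subr_eq0 => /eqP.
have i1 := reeb_invariant (P Y) (fun Y => (dZ Y).1) (fun X => (cZ X).1).
have i2 := reeb_invariant (P Y) (fun Y => (dZ Y).2) (fun X => (cZ X).2).
rewrite (oneform_phi Y).1 (oneform_phi Y).2 !vfield_zero in i1 i2.
have := congr1 P N; rewrite !phi2 -i1 -i2 (oneform_phi _).1 (oneform_phi _).2 !scale0r !addr0.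
by move/oppr_inj.
Qed.

(** The Lie derivative along [Z] commutes with d and annihilates [a]; concretely this is the Jacobi
    identity. *)
Lemma reeb_lie_dext (a : oneform M) X Y : (forall Y, dext a Z Y = 0) ->
  (forall X, X (oneform_app a Z) = 0) ->
  Z (dext a X Y) = dext a (lie Z X) Y + dext a X (lie Z Y).
Proof.
move=> dz cz; have I := fun Y => reeb_invariant Y dz cz.
apply: smoothFun_eqP => p; rewrite /dext vfield_scale !vfield_addr !vfield_opp.
have J := congr1 (oneform_app a) (jacobi Z X Y); rewrite oneformD in J.
rewrite I J.
have E1 : Z (X (oneform_app a Y)) p = lie Z X (oneform_app a Y) p + X (oneform_app a (lie Z Y)) p.
  by rewrite -I /= !fctE; ring.
have E2 : Z (Y (oneform_app a X)) p = lie Z Y (oneform_app a X) p + Y (oneform_app a (lie Z X)) p.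
  by rewrite -I /= !fctE; ring.
move: E1 E2; clear J; move: (lie Z X) (lie Z Y) => A B E1 E2.
by rewrite !smoothE E1 E2; ring.
Qed.

Hypothesis lieZZ : lie Z Z1 = 0 /\ lie Z Z2 = 0.

(** The expression is the Lie derivative of g along [Z]. It vanishes on images of phi, since Z
    preserves phi and both d alpha_i, and on the Reeb fields, since Z preserves both alpha_i; these
    vectors span. *)
Lemma reeb_killing p X Y : gp p (D X Z) Y + gp p (D Y Z) X = 0.
Proof.
pose h Y := gp p (D X Z) Y + gp p (D Y Z) X.
have hE Y' : h Y' = Z (riem_app g X Y') p - gp p (lie Z X) Y' - gp p X (lie Z Y').
  rewrite /h (metricD LC) !(torsion LC) !gpE (gpC g p _ X); ring.
have hP Y' : h (P Y') = 0.
  rewrite hE reeb_lie_phi compat /gp !compat vfield_addr.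
  rewrite (@reeb_lie_dext a1 X Y' (fun Y => (dZ Y).1) (fun X => (cZ X).1)).
  rewrite (@reeb_lie_dext a2 X Y' (fun Y => (dZ Y).2) (fun X => (cZ X).2)).
  by rewrite /= !fctE; ring.
have h1 : h Z1 = 0.
  rewrite hE lieZZ.1 gp0r (dual X).1 (reeb_invariant X (fun Y => (dZ Y).1) (fun X => (cZ X).1)).
  by rewrite /gp (dual _).1 subr0 subrr.
have h2 : h Z2 = 0.
  rewrite hE lieZZ.2 gp0r (dual X).2 (reeb_invariant X (fun Y => (dZ Y).2) (fun X => (cZ X).2)).
  by rewrite /gp (dual _).2 subr0 subrr.
have hL A B : h (A + B) = h A + h B by rewrite /h (DDl LC) !gpE; ring.
have hN A : h (- A) = - h A by rewrite /h (DNl LC) !gpE; ring.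
have hZ f A : h (f *: A) = f p * h A by rewrite /h (DZl LC) !gpE; ring.
have EY : Y = - P (P Y) + oneform_app a1 Y *: Z1 + oneform_app a2 Y *: Z2.
  by apply: (@gp_inj _ _ g) => q W; rewrite phi2 !gpE; ring.
by rewrite -/(h Y) EY !hL hN !hZ hP h1 h2 oppr0 !mulr0 !addr0.
Qed.

End OneReeb.

Lemma curvatureE X Y Z : Rm X Y Z = D X (D Y Z) - D Y (D X Z) - D (lie X Y) Z.
Proof. by []. Qed.

Local Opaque curvature.

Section KillingField.
Variable Z : vfield M.
Hypothesis killing : forall p X Y, gp p (D X Z) Y + gp p (D Y Z) X = 0.
Let psi X := - D X Z.

(** Kostant's formula for the second derivative [b] of a Killing field. The difference [c] between
    [b] and the curvature term is symmetric in its first two arguments and skew in its last two,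
    hence 0. *)
Lemma kostant X Y : D X (psi Y) = psi (D X Y) - Rm X Z Y.
Proof.
apply: (@gp_inj _ _ g) => p W; rewrite /psi (DNr LC) !gpE.
pose b X Y W := gp p (D X (D Y Z)) W - gp p (D (D X Y) Z) W.
have b_skew X' Y' W' : b X' Y' W' = - b X' W' Y'.
  have K1 : riem_app g (D Y' Z) W' + riem_app g (D W' Z) Y' = 0.
    by apply: smoothFun_eqP => q; rewrite /= !fctE; exact: killing.
  have := congr1 (fun f : smoothFun M => X' f p) K1.
  rewrite /= vfield_zero vfield_addr /= !fctE !(metricD LC).
  have k1 := killing p (D X' Y') W'; have k2 := killing p (D X' W') Y'.
  rewrite /b; move: k1 k2; rewrite !(gpC g p (D (D X' _) Z)).
  move=> k1 k2; rewrite [X in _ = X -> _](_ : _ = 0 :> R) //; lra.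
have b_curv X' Y' W' : b X' Y' W' - b Y' X' W' = R4 p X' Y' Z W'.
  by rewrite /b /curv4 !curvatureE (torsion LC) !(DE LC) !gpE; ring.
pose c X Y W := b X Y W - R4 p X Z Y W.
have c_skew X' Y' W' : c X' Y' W' = - c X' W' Y'.
  by rewrite /c b_skew (R4_skew34 LC p X' Z W' Y'); ring.
have c_sym X' Y' W' : c X' Y' W' = c Y' X' W'.
  rewrite /c; have := b_curv X' Y' W'.
  have := R4_bianchi LC p Z X' Y' W'; have := R4_skew12 LC p X' Z Y' W'.
  have := R4_skew12 LC p Y' Z X' W'; lra.
have c0 : c X Y W = 0.
  have e1 := c_sym X Y W; have e2 := c_skew Y X W; have e3 := c_sym Y W X.
  have e4 := c_skew W Y X; have e5 := c_sym W X Y; have e6 := c_skew X W Y.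
  lra.
by move: c0; rewrite /c /b /curv4 curvatureE !gpE; lra.
Qed.

(** The skew second derivative of psi is the commutator of the curvature with psi. By Kostant's
    formula it is also a derivative of R( . , Z), where nabla R = 0 leaves only the derivatives of
    [Z]. Equality says that psi acts on R as a derivation with result 0. *)
Lemma curvature_invariant p W X Y V :
  R4 p W X (psi Y) V - gp p (psi (Rm W X Y)) V + R4 p (psi W) X Y V + R4 p W (psi X) Y V = 0.
Proof.
have K A B : D A (D B Z) = D (D A B) Z + Rm A Z B.
  have := kostant A B; rewrite /psi (DNr LC) => /(congr1 -%R).
  by rewrite opprK opprB opprK addrC.
have [RR RRE] : exists RR, forall A B, RR A B = Rm B (D A Z) Y by eexists.
have E A B : D A (Rm B Z Y) - Rm (D A B) Z Y - Rm B Z (D A Y) = RR A B.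
  rewrite RRE; have := lsym A B Z Y; move/eqP; rewrite subr_eq0 => /eqP <-.
  exact: subKr.
have k A B : Rm A Z B = D A (D B Z) - D (D A B) Z by rewrite K addrC addKr.
have E1 := E W X; rewrite !k (DDr LC) (DNr LC) in E1.
have {}E1 := congr1 (fun V' => gp p V' V) E1; rewrite /= !gpE in E1.
have E2 := E X W; rewrite !k (DDr LC) (DNr LC) in E2.
have {}E2 := congr1 (fun V' => gp p V' V) E2; rewrite /= !gpE in E2.
have Q : R4 p W X (psi Y) V - gp p (psi (Rm W X Y)) V =
   - (gp p (D W (D X (D Y Z))) V - gp p (D X (D W (D Y Z))) V - gp p (D (lie W X) (D Y Z)) V)
   + (gp p (D (D W (D X Y)) Z) V - gp p (D (D X (D W Y)) Z) V - gp p (D (D (lie W X) Y) Z) V).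
  rewrite /curv4 /psi (Rm_oppr LC) !curvatureE !(DE LC) !gpE; ring.
rewrite (torsion LC) !(DE LC) !gpE in Q.
have eL : Rm (psi W) X Y = RR W X by rewrite RRE (Rm_oppl LC) (Rm_skew LC (D W Z) X).
have eR : Rm W (psi X) Y = - RR X W by rewrite RRE (Rm_oppm LC).
have -> : R4 p (psi W) X Y V = gp p (RR W X) V by rewrite /curv4 eL.
have -> : R4 p W (psi X) Y V = - gp p (RR X W) V by rewrite /curv4 eR gpNl.
rewrite /psi gpNl in Q *; move: Q; lra.
Qed.

End KillingField.

End MetricContactPair.

Local Opaque curvature.

(** * Curvature and parallelism of one factor of the splitting *)

Section Factor.
Context {R : realType} {M : smoothSpace R}.
Variables (g : riemannian M) (D : vfield M -> vfield M -> vfield M).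
Hypothesis LC : levi_civita g D.
Implicit Types (X Y Z W : vfield M).
Local Notation Rm := (curvature D).
Local Notation gp := (gpr g).
Local Notation R4 := (curv4 g D).
Hypothesis lsym : forall W X Y Z,
  D W (Rm X Y Z) - Rm (D W X) Y Z - Rm X (D W Y) Z - Rm X Y (D W Z) = 0.

Definition rotop Z X : vfield M := - D X Z.

Lemma rotopD Z X Y : rotop Z (X + Y) = rotop Z X + rotop Z Y.
Proof. by rewrite /rotop (DDl LC) opprD. Qed.
Lemma rotopZ Z f X : rotop Z (f *: X) = f *: rotop Z X.
Proof. by rewrite /rotop (DZl LC) scalerN. Qed.
Lemma rotopN Z X : rotop Z (- X) = - rotop Z X.
Proof. by rewrite /rotop (DNl LC). Qed.

Definition factor_proj Z X : vfield M := riem_app g X Z *: Z - rotop Z (rotop Z X).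

Variables Z Z' : vfield M.
Hypothesis killing : forall p X Y, gp p (D X Z) Y + gp p (D Y Z) X = 0.
Hypothesis killing' : forall p X Y, gp p (D X Z') Y + gp p (D Y Z') X = 0.
Hypothesis orthonormal : forall p, [/\ gp p Z Z = 1, gp p Z Z' = 0 & gp p Z' Z' = 1].
Hypothesis rot_reeb : [/\ rotop Z Z = 0, rotop Z Z' = 0, rotop Z' Z = 0 & rotop Z' Z' = 0].
Hypothesis cross : forall X, rotop Z (rotop Z' X) = 0 /\ rotop Z' (rotop Z X) = 0.
Let P X := rotop Z X + rotop Z' X.
Hypothesis PP : forall X, P (P X) = - X + riem_app g X Z *: Z + riem_app g X Z' *: Z'.

Let gp_rot p X Y : gp p (rotop Z X) Y = - gp p X (rotop Z Y).
Proof. by have := killing p X Y; rewrite /rotop !gpE (gpC g p X); lra. Qed.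
Let gp_rot' p X Y : gp p (rotop Z' X) Y = - gp p X (rotop Z' Y).
Proof. by have := killing' p X Y; rewrite /rotop !gpE (gpC g p X); lra. Qed.

Let alpha_rot p X : gp p (rotop Z X) Z = 0 /\ gp p (rotop Z X) Z' = 0.
Proof. by have [r1 r2 _ _] := rot_reeb; rewrite !gp_rot r1 r2 !gp0r oppr0. Qed.

Let rot_rot X : rotop Z (rotop Z X) + rotop Z' (rotop Z' X) = - X + riem_app g X Z *: Z + riem_app g X Z' *: Z'.
Proof. by rewrite -PP /P !rotopD (cross _).1 (cross _).2 addr0 add0r. Qed.

Let rot3 X : rotop Z (rotop Z (rotop Z X)) = - rotop Z X.
Proof.
have := congr1 (rotop Z) (rot_rot X); have [r1 r2 _ _] := rot_reeb.
by rewrite !rotopD (cross _).1 rotopN !rotopZ r1 r2 !scaler0 !addr0.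
Qed.

Let T p X Y W : R := R4 p X Z Y W.

Let T_skew p X Y W : T p X W Y = - T p X Y W.
Proof. exact: R4_skew34. Qed.
Let T_cyc p X Y W : T p X Y W + T p Y W X + T p W X Y = 0.
Proof.
have := R4_pair LC p X Z Y W; have := R4_pair LC p Y Z W X.
by have := R4_pair LC p W Z X Y; have := R4_bianchi LC p X Y W Z; rewrite /T; lra.
Qed.
Let T_addm p X Y Y' W : T p X (Y + Y') W = T p X Y W + T p X Y' W.
Proof. by rewrite /T /curv4 (Rm_addr LC) gpDl. Qed.
Let T_scalem p X f Y W : T p X (f *: Y) W = f p * T p X Y W.
Proof. by rewrite /T /curv4 (Rm_scaler LC) gpZl. Qed.
Let T_oppm p X Y W : T p X (- Y) W = - T p X Y W.
Proof. by rewrite -scaleN1r T_scalem /= mulN1r. Qed.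
Let T_addr p X Y W W' : T p X Y (W + W') = T p X Y W + T p X Y W'.
Proof. by rewrite /T /curv4 gpDr. Qed.
Let T_scaler p X Y f W : T p X Y (f *: W) = f p * T p X Y W.
Proof. by rewrite /T /curv4 gpZr. Qed.
Let T_addl p X X' Y W : T p (X + X') Y W = T p X Y W + T p X' Y W.
Proof. by rewrite /T /curv4 (Rm_addl LC) gpDl. Qed.
Let T_scalel p f X Y W : T p (f *: X) Y W = f p * T p X Y W.
Proof. by rewrite /T /curv4 (Rm_scalel LC) gpZl. Qed.
Let T_oppl p X Y W : T p (- X) Y W = - T p X Y W.
Proof. by rewrite -scaleN1r T_scalel /= mulN1r. Qed.

(** The sum of the invariance under both rotations; [Z] itself, in the second slot of the curvature,
    is annihilated by both. *)
Let T_inv p X Y W : T p (P X) Y W + T p X (P Y) W + T p X Y (P W) = 0.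
Proof.
have e1 := curvature_invariant LC lsym killing p X Z Y W.
have e2 := curvature_invariant LC lsym killing' p X Z Y W.
have [r1 r2 r3 r4] := rot_reeb.
rewrite /= -!/(rotop _ _) r1 (gp_rot p (Rm X Z Y)) in e1.
rewrite /= -!/(rotop _ _) r3 (gp_rot' p (Rm X Z Y)) in e2.
have z : R4 p X 0 Y W = 0.
  by rewrite /curv4 -(scale0r (0 : vfield M)) (Rm_scalem LC) scale0r gp0l.
rewrite z in e1 e2; rewrite /P T_addm T_addl T_addr /T.
by move: e1 e2; rewrite /curv4; lra.
Qed.

(* On the horizontal distribution P^2 = -1, so an invariant tensor of odd
   degree vanishes. *)
Let T_horizontal p X Y W : P (P X) = - X -> P (P Y) = - Y -> P (P W) = - W ->
  T p X Y W = 0.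
Proof.
(* The three invariance identities with one argument rotated form a linear system whose solution is
   T(PA, PB, C) = T(A, B, C)/2; used twice it gives T = T/4. *)
have half A B C : P (P A) = - A -> P (P B) = - B -> P (P C) = - C ->
    T p (P A) (P B) C = 2^-1 * T p A B C.
  move=> hA hB hC; have e1 := T_inv p (P A) B C; have e2 := T_inv p A (P B) C.
  have e3 := T_inv p A B (P C); rewrite hA T_oppl in e1; rewrite hB T_oppm in e2.
  have cN : T p A B (- C) = - T p A B C by rewrite -scaleN1r T_scaler /= mulN1r.
  rewrite hC cN in e3; lra.
have PN A : P (- A) = - P A by rewrite /P !rotopN opprD.
move=> hX hY hW; have h1 := half X Y W hX hY hW.
have := half (P X) (P Y) W; rewrite hX hY !PN => /(_ erefl erefl hW).
rewrite T_oppl T_oppm h1; lra.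
Qed.

Let T_Z p Y W : T p Z Y W = 0.
Proof. by have := R4_skew12 LC p Z Z Y W; rewrite /T; lra. Qed.

Let T_mid p X A W : rotop Z A = 0 -> T p X A W = gp p (rotop Z (D X A)) W.
Proof.
move=> rA; have := kostant LC killing X A; rewrite /= -!/(rotop _ _) rA (D0r LC) => /esym/eqP.
by rewrite subr_eq0 => /eqP ->.
Qed.

Let T_mid_Z p X W : T p X Z W = - gp p (rotop Z (rotop Z X)) W.
Proof.
have [r1 _ _ _] := rot_reeb; rewrite T_mid //.
have -> : D X Z = - rotop Z X by rewrite /rotop opprK.
by rewrite rotopN gpNl.
Qed.

Let T_mid_Z' p X W : T p X Z' W = 0.
Proof.
have [_ r2 _ _] := rot_reeb; rewrite T_mid //.
have -> : D X Z' = - rotop Z' X by rewrite /rotop opprK.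
by rewrite rotopN (cross X).1 oppr0 gp0l.
Qed.

Let T_Z' p Y W : T p Z' Y W = 0.
Proof.
have := T_cyc p Z' Y W; rewrite T_mid_Z' (T_skew p Y Z' W) T_mid_Z'; lra.
Qed.

Let hor X := - P (P X).
Let hor_dec X : X = hor X + riem_app g X Z *: Z + riem_app g X Z' *: Z'.
Proof.
by apply: (@gp_inj _ _ g) => q W; rewrite /hor PP !gpE; ring.
Qed.

Let hor_hor X : P (P (hor X)) = - hor X.
Proof.
have a0 W : riem_app g (P W) Z = 0 /\ riem_app g (P W) Z' = 0.
  have [_ _ r1 r2] := rot_reeb; have h := alpha_rot.
  by split; apply: smoothFun_eqP => p; rewrite -[LHS]/(gp p (P W) _) /P gpDl gp_rot' ?r1 ?r2 ?gp0r oppr0 addr0 ?(h p W).1 ?(h p W).2.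
have b0 : riem_app g (hor X) Z = 0 /\ riem_app g (hor X) Z' = 0.
  have [h1 h2] := a0 (P X).
  split; apply: smoothFun_eqP => p; rewrite -[LHS]/(gp p (hor X) _) /hor gpNl.
    by rewrite /gp h1 oppr0.
  by rewrite /gp h2 oppr0.
by rewrite PP b0.1 b0.2 !scale0r !addr0.
Qed.

(** Splitting every argument into its horizontal part and its Reeb components leaves only the terms
    with [Z] in the third or fourth slot, and these follow from Kostant's formula because the
    rotation kills [Z]. *)
Lemma T_formula p X Y W : R4 p X Z Y W =
  - gp p Y Z * gp p (rotop Z (rotop Z X)) W + gp p W Z * gp p (rotop Z (rotop Z X)) Y.
Proof.
rewrite -/(T p X Y W) [in LHS](hor_dec Y) !T_addm !T_scalem T_mid_Z T_mid_Z'.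
have -> : T p X (hor Y) W = gp p W Z * gp p (rotop Z (rotop Z X)) Y.
  rewrite [in LHS](hor_dec W) !T_addr !T_scaler.
  have -> : T p X (hor Y) (hor W) = 0.
    rewrite (hor_dec X) !T_addl !T_scalel T_Z T_Z' (T_horizontal p (hor_hor X) (hor_hor Y) (hor_hor W)).
    by rewrite !mulr0 !addr0.
  rewrite T_skew T_mid_Z (T_skew p X Z' (hor Y)) T_mid_Z'.
  rewrite [in RHS](hor_dec Y) 2!gpDr 2!gpZr.
  have a := alpha_rot p (rotop Z X); rewrite a.1 a.2.
  by rewrite -/(gp p W Z); ring.
by rewrite -/(gp p Y Z); ring.
Qed.

Lemma D_rot p X Y W : gp p (D X (rotop Z Y)) W = gp p (rotop Z (D X Y)) W
  + gp p Y Z * gp p (rotop Z (rotop Z X)) W - gp p W Z * gp p (rotop Z (rotop Z X)) Y.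
Proof.
have := congr1 (fun V => gp p V W) (kostant LC killing X Y); rewrite /= -!/(rotop _ _) => ->.
by rewrite gpDl gpNl -/(R4 p X Z Y W) T_formula; ring.
Qed.

(** The derivatives of alpha and [Z] cancel against those of the squared rotation, given by [D_rot],
    because the cube of the rotation is its negative. *)
Lemma D_factor_proj X Y : D X (factor_proj Z Y) = factor_proj Z (D X Y).
Proof.
apply: (@gp_inj _ _ g) => p W; rewrite /factor_proj (DDr LC) (DZr LC) (DNr LC) !gpE !D_rot.
rewrite !(gp_rot p (D X _)) -/(gp p (D X Y) Z).
have -> : X (riem_app g Y Z) p = gp p (D X Y) Z - gp p Y (rotop Z X).
  by rewrite (metricD LC) /rotop gpNr; ring.
rewrite (alpha_rot p Y).1 (D_rot p X Y (rotop Z W)) (alpha_rot p W).1.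
have e1 : gp p (rotop Z (rotop Z X)) (rotop Z W) = gp p (rotop Z X) W.
  by rewrite -[LHS]opprK -gp_rot rot3 gpNl opprK.
have e2 : gp p (rotop Z (rotop Z X)) (rotop Z Y) = gp p (rotop Z X) Y.
  by rewrite -[LHS]opprK -gp_rot rot3 gpNl opprK.
have e3 : gp p (D X Z) W = - gp p (rotop Z X) W by rewrite /rotop gpNl opprK.
have e4 : gp p (D (rotop Z (D X Y)) Z) W = gp p (rotop Z (D X Y)) (rotop Z W).
  by rewrite -[RHS]opprK -gp_rot [rotop Z (rotop Z _)]/rotop gpNl opprK.
rewrite e1 e2 e3 e4 (gpC g p Y (rotop Z X)) (gpC g p W Z) -/(gp p Y Z); ring.
Qed.

Let rr p A B : gp p (rotop Z (rotop Z A)) B = gp p (rotop Z (rotop Z B)) A.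
Proof. by rewrite (gp_rot p (rotop Z A)) (gp_rot p (rotop Z B)) gpC. Qed.

Lemma gp_projl p X Y :
  gp p (factor_proj Z X) Y = gp p X Z * gp p Z Y - gp p (rotop Z (rotop Z X)) Y.
Proof. by rewrite /factor_proj gpDl gpZl gpNl. Qed.

Lemma factor_proj_sym p X Y : gp p (factor_proj Z X) Y = gp p X (factor_proj Z Y).
Proof.
by rewrite (gpC g p X) !gp_projl (rr p X Y) (gpC g p Z X) (gpC g p Z Y); ring.
Qed.

Lemma factor_proj_idem X : factor_proj Z (factor_proj Z X) = factor_proj Z X.
Proof.
have [r1 _ _ _] := rot_reeb.
have e1 : rotop Z (factor_proj Z X) = rotop Z X.
  by rewrite /factor_proj rotopD rotopZ r1 scaler0 add0r rotopN rot3 opprK.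
have e2 : riem_app g (factor_proj Z X) Z = riem_app g X Z.
  apply: smoothFun_eqP => p; rewrite -[LHS]/(gp p (factor_proj Z X) Z) gp_projl.
  have [q1 _ _] := orthonormal p.
  by rewrite q1 (alpha_rot p (rotop Z X)).1 mulr1 subr0.
by rewrite {1}/factor_proj e1 e2.
Qed.

(** [T_formula] and pair symmetry settle curvature applied to [Z]. Differentiating that case with
    nabla R = 0 settles images of the rotation, and the projection is built from these two kinds of
    vectors. *)
Lemma curvature_factor Y W X :
  Rm Y W (factor_proj Z X) = riem_app g W (factor_proj Z X) *: factor_proj Z Y
                           - riem_app g Y (factor_proj Z X) *: factor_proj Z W.
Proof.
have E1 A B : Rm A B Z = riem_app g B Z *: factor_proj Z A - riem_app g A Z *: factor_proj Z B.
  apply: (@gp_inj _ _ g) => p V; rewrite -[LHS]/(R4 p A B Z V) (R4_pair LC) (R4_skew12 LC) T_formula.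
  by rewrite gpDl gpNl !gpZl !gp_projl -!/(gp p _ Z) (rr p V A) (rr p V B); ring.
have E2 A : Rm Y W (rotop Z A) = riem_app g W (rotop Z A) *: factor_proj Z Y
                           - riem_app g Y (rotop Z A) *: factor_proj Z W.
  have [Q QE] : exists Q, Q = Rm Y W (D A Z) by eexists.
  have := lsym A Y W Z; rewrite !E1 (DDr LC) (DNr LC) !(DZr LC) !D_factor_proj -QE => L.
  rewrite {1}/rotop (Rm_oppr LC) -QE; apply: (@gp_inj _ _ g) => p V.
  have := congr1 (fun V' => gp p V' V) L; rewrite /rotop.
  move: (factor_proj Z Y) (factor_proj Z W) (factor_proj Z (D A Y)) (factor_proj Z (D A W)) => B1 B2 B3 B4.
  rewrite /= !(gpDl, gpNl, gpZl, gp0l) !(metricD LC) -!/(gp p _ _) !gpNr; lra.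
have w A : riem_app g A (factor_proj Z X) = riem_app g X Z * riem_app g A Z - riem_app g A (rotop Z (rotop Z X)).
  by apply: smoothFun_eqP => p; rewrite -[LHS]/(gp p A (factor_proj Z X)) gpC gp_projl (gpC g p Z A) (gpC g p (rotop _ _) A).
rewrite !w {1}/factor_proj (Rm_addr LC) (Rm_scaler LC) (Rm_oppr LC) E1 E2.
apply: (@gp_inj _ _ g) => p V.
move: (factor_proj Z Y) (factor_proj Z W) => B1 B2.
by rewrite !(gpDl, gpNl, gpZl) !smoothE; ring.
Qed.

End Factor.

Local Transparent curvature.

(** * Local calculus on manifolds *)

Lemma near_comp (T U : topologicalType) (f : T -> U) (x : T) (P : set U) :
  {for x, continuous f} -> nbhs (f x) P -> \forall z \near x, P (f z).
Proof. by move=> cf nP; exact: cf _ nP. Qed.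

Lemma compact_sup_ball {R : realType} d (c : 'rV[R]_d) (r : R) : compact [set z : 'rV[R]_d | `|z - c| <= r].
Proof.
have -> : [set z : 'rV[R]_d | `|z - c| <= r] =
    [set z : 'rV[R]_d | 0 <= r /\ forall i, [set t | c 0 i - r <= t <= c 0 i + r] (z 0 i)].
  apply/seteqP; split=> z /=.
    move=> H; split=> [|i]; first exact: le_trans H.
    have := le_trans (row_coord_le (z - c) i) H; rewrite !mxE ler_norml; lra.
  by move=> [r0 H]; apply: row_normP => // i; have := H i; rewrite !mxE ler_norml; lra.
have [r0|r0] := leP 0 r; last first.
  rewrite (_ : mkset _ = set0); first exact: compact0.
  by apply/seteqP; split=> z //= [].
rewrite (_ : mkset _ = [set z : 'rV[R]_d | forall i, [set t | c 0 i - r <= t <= c 0 i + r] (z 0 i)]); last first.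
  by apply/seteqP; split=> z //= [].
apply: (@rV_compact _ _ (fun i => [set t : R | c 0 i - r <= t <= c 0 i + r])) => i; rewrite (_ : mkset _ = `[c 0 i - r, c 0 i + r]%classic); first exact: segment_compact.
by apply/seteqP; split=> t /=; rewrite in_itv.
Qed.

(** * Bump functions, extension of germs and derivations *)

Section Manifold.
Context {R : realType} {M : smoothSpace R} {d : nat}.
Hypothesis hM : is_manifold d M.
Implicit Types (p q : M) (U W : set M).

Lemma manifold_chart p : exists U x y, U p /\ @is_chart R d M U x y.
Proof. by case: hM. Qed.

Lemma smooth_at_continuous p f : smooth_at M p f -> {for p, continuous f}.
Proof.
have [U [x [y [Up [[oU oxU] yx cx cy sm]]]]] := manifold_chart p.
move=> /(sm p f Up) Cf.
have cfyx : {for p, continuous ((f \o y) \o x)}.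
  by apply: continuous_comp; [exact: cx|exact: Coo_at_continuous].
rewrite /prop_for /continuous_at /= (yx p Up) in cfyx.
apply: cvg_trans cfyx; apply: near_eq_cvg.
by apply: filterS (open_nbhs_nbhs (conj oU Up)) => q /yx /= ->.
Qed.

Lemma smooth_at_nbhs p f : smooth_at M p f -> \forall q \near p, smooth_at M q f.
Proof.
have [U [x [y [Up [[oU oxU] yx cx cy sm]]]]] := manifold_chart p.
move=> /(sm p f Up)/Coo_at_nbhs C.
have := cx p Up _ C; apply: filterS2 (open_nbhs_nbhs (conj oU Up)) => q Uq.
by move=> /(sm q f Uq).
Qed.

Lemma smooth_at_rowcomp p N (F : M -> 'rV[R]_N) (Phi : 'rV[R]_N -> R) :
  (forall k, smooth_at M p (fun q => F q 0 k)) -> Coo_at (F p) Phi ->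
  smooth_at M p (Phi \o F).
Proof.
have [U [x [y [Up [[oU oxU] yx cx cy sm]]]]] := manifold_chart p.
move=> sF CP; apply/(sm p _ Up); apply: (@Coo_at_rowcomp R _ _ (F \o y) Phi).
  by move=> k; apply/(sm p (fun q => F q 0 k) Up).
by rewrite /= yx.
Qed.

(** Extension by 0 is smooth because the image of a closed coordinate ball is compact, hence closed
    in the Hausdorff space M. The explicit form [sbump] on the chart is kept for the Lipschitz
    estimate of [lipschitz_bump]. *)
Lemma chart_bump p U W (x : M -> 'rV[R]_d) y : is_chart W x y -> W p -> open U -> U p ->
  exists r : R, exists rho : smoothFun M, [/\ 0 < r,
    forall z, `|z - x p| <= 2 * r -> (x @` W) z /\ U (y z),
    forall q, W q -> rho q = sbump (x p) r (x q)
    & forall q, (exists2 z, `|z - x p| <= 2 * r & q = y z) \/ \forall z \near q, rho z = 0].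
Proof.
move=> [[oW oxW] yx cx cy sm] Wp oU Up.
have xWp : (x @` W) (x p) by exists p.
have nU : \forall z \near x p, (x @` W) z /\ U (y z).
  have nyU : nbhs (y (x p)) U by rewrite yx //; exact: open_nbhs_nbhs.
  by apply: filterI; [exact: open_nbhs_nbhs|exact: (cy _ xWp _ nyU)].
have [r r0 Hr0] : exists2 r : R, 0 < r & forall z, `|z - x p| <= 2 * r -> (x @` W) z /\ U (y z).
  have /nbhs_ballP[e /= e0 He] := nU; exists (e / 4); first by rewrite divr_gt0.
  move=> z ze; apply: He; rewrite -ball_normE /= distrC; move: ze e0; lra.
pose K := [set z | `|z - x p| <= 2 * r].
have cK : closed (y @` K).
  have [hausM _ _] := hM; apply: compact_closed => //.
  apply: continuous_compact; last exact: compact_sup_ball.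
  apply: continuous_in_subspaceT => z; rewrite inE => /Hr0[zW _]; exact: cy.
pose f (q : M) : R := if pselect (W q) then sbump (x p) r (x q) else 0.
have fW q : W q -> f q = sbump (x p) r (x q) by rewrite /f; case: pselect.
have f0 q : ~ (y @` K) q -> \forall z \near q, f z = 0.
  move=> nq; have oK : open (~` (y @` K)) by exact: closed_openC.
  apply: filterS (open_nbhs_nbhs (conj oK nq)) => z nz; rewrite /f; case: pselect => // Wz.
  apply: sbump_out => //; rewrite ltNge; apply/negP => H; apply: nz; exists (x z); last exact: yx.
  by rewrite /K /=; move: H r0; lra.
have sf q : smooth_at M q f.
  have [[z Kz <-]|/f0 nq] := pselect ((y @` K) q); last first.
    by apply: (smooth_at_near (smooth_at_cst q 0)); apply: filterS nq => z ->.
  have [[w Ww xw] _] := Hr0 z Kz.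
  have Wyz : W (y z) by rewrite -xw yx.
  apply/(sm _ f Wyz); rewrite -{1}xw yx // xw.
  apply: (@Coo_at_near _ _ z (sbump (x p) r)); first exact: Coo_at_sbump.
  have xWz : (x @` W) z by exists w.
  by apply: filterS (open_nbhs_nbhs (conj oxW xWz)) => _ [w' Ww' <-] /=; rewrite yx // fW.
exists r, (SmoothFun (smooth_inP sf)); split=> // q.
have [[z Kz <-]|nq] := pselect ((y @` K) q); last by right; exact: f0.
by left; exists z.
Qed.

Lemma manifold_bump p U : open U -> U p -> exists rho : smoothFun M,
  (\forall q \near p, rho q = 1) /\ (forall q, U q \/ \forall z \near q, rho z = 0).
Proof.
move=> oU Up; have [W [x [y [Wp ch]]]] := manifold_chart p.
have [r [rho [r0 Hr rW r0']]] := chart_bump ch Wp oU Up.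
have [[oW oxW] yx cx cy sm] := ch.
exists rho; split.
  have nb := cx p Wp _ (sbump_near (x p) r0).
  by apply: filterS2 (open_nbhs_nbhs (conj oW Wp)) nb => q Wq /=; rewrite rW.
by move=> q; have [[z /Hr[_ Uz] ->]|] := r0' q; [left|right].
Qed.

Lemma smooth_extend_on p U f : open U -> U p -> (forall q, U q -> smooth_at M q f) ->
  exists F : smoothFun M, \forall q \near p, F q = f q.
Proof.
move=> oU Up sf; have [rho [r1 r0]] := manifold_bump oU Up.
have sF q : smooth_at M q ((rho : M -> R) * f).
  have [Uq|z] := r0 q; first by apply: smooth_atM; [exact: smoothFun_at|exact: sf].
  by apply: (smooth_at_near (smooth_at_cst q 0)); apply: filterS z => z; rewrite !fctE => ->; rewrite mul0r.
by exists (SmoothFun (smooth_inP sF)); apply: filterS r1 => q /=; rewrite !fctE => ->; rewrite mul1r.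
Qed.

(** Tangent vectors act on global functions only; this provides global representatives of germs. *)
Lemma smooth_extend p f : smooth_at M p f ->
  exists F : smoothFun M, \forall q \near p, F q = f q.
Proof.
move=> /smooth_at_nbhs H; have : nbhs p (fun q => smooth_at M q f) := H; rewrite nbhsE => -[U [oU Up] HU].
exact: (smooth_extend_on oU Up).
Qed.

Lemma tangent_addr p (v : tangent M p) (f h : smoothFun M) : v (f + h) = v f + v h.
Proof. by rewrite -[f]scale1r tangent_linear mul1r scale1r. Qed.

Lemma tangent_zero p (v : tangent M p) : v 0 = 0.
Proof. by apply: (addrI (v 0)); rewrite -tangent_addr !addr0. Qed.

Lemma tangent_scale p (v : tangent M p) (a : R) (f : smoothFun M) : v (a *: f) = a * v f.
Proof. by rewrite -[a *: f]addr0 tangent_linear tangent_zero addr0. Qed.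

Lemma tangent_opp p (v : tangent M p) (f : smoothFun M) : v (- f) = - v f.
Proof. by rewrite -scaleN1r tangent_scale mulN1r. Qed.

Lemma smooth_oneE p : (1 : smoothFun M) p = 1.
Proof. by []. Qed.

Lemma tangent_one p (v : tangent M p) : v 1 = 0.
Proof.
have := tangent_leibniz v 1 1; rewrite mulr1 smooth_oneE mulr1 mul1r => /eqP.
by rewrite -subr_eq0 opprD addrA subrr add0r oppr_eq0 => /eqP.
Qed.

Lemma tangent_sum p (v : tangent M p) I (s : seq I) (f : I -> smoothFun M) :
  v (\sum_(i <- s) f i) = \sum_(i <- s) v (f i).
Proof. by elim/big_rec2: _ => [|i a b _ <-]; rewrite ?tangent_zero ?tangent_addr. Qed.

Lemma smooth_sumE I (s : seq I) (f : I -> smoothFun M) p :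
  (\sum_(i <- s) f i) p = \sum_(i <- s) f i p.
Proof. by elim/big_rec2: _ => // i a b _ <-. Qed.

Lemma tangent_local p (v : tangent M p) (f h : smoothFun M) :
  (\forall q \near p, f q = h q) -> v f = v h.
Proof.
move=> H; have : nbhs p (fun q => f q = h q) := H; rewrite nbhsE => -[U [oU Up] HU].
have [rho [r1 r0]] := manifold_bump oU Up.
have E : rho * (f - h) = 0.
  apply: smoothFun_eqP => q; rewrite !smoothE; have [Uq|z] := r0 q; first by rewrite (HU q Uq) subrr mulr0.
  by rewrite (nbhs_singleton z) mul0r.
have := tangent_leibniz v rho (f - h); rewrite E tangent_zero !smoothE (HU p Up) subrr mulr0 add0r.
rewrite (nbhs_singleton r1) mul1r tangent_addr tangent_opp => /esym/eqP; by rewrite subr_eq0 => /eqP.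
Qed.

Definition rowf {N} (F : 'I_N -> smoothFun M) q : 'rV[R]_N := \row_k F k q.

Lemma rowf_continuous N (F : 'I_N -> smoothFun M) : continuous (rowf F).
Proof.
move=> p; apply: (@row_cvgP _ _ _ (nbhs p)) => j; under eq_fun do rewrite mxE; rewrite mxE.
exact: smooth_at_continuous (smoothFun_at _ _).
Qed.

Lemma smooth_at_rowf N (F : 'I_N -> smoothFun M) (Phi : 'rV[R]_N -> R) p :
  Coo_at (rowf F p) Phi -> smooth_at M p (fun q => Phi (rowf F q)).
Proof.
apply: (@smooth_at_rowcomp p N (rowf F)) => k.
by under eq_fun do rewrite mxE; exact: smoothFun_at.
Qed.

(** Apply the derivation to Hadamard's expansion: constants are killed, and in each product the
    factor vanishing at [p] leaves only its own derivative times a partial of [Phi]. *)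
Lemma tangent_chain p (v : tangent M p) N (F : 'I_N -> smoothFun M) (Phi : 'rV[R]_N -> R) (f : smoothFun M) :
  Coo_at (rowf F p) Phi -> (\forall q \near p, f q = Phi (rowf F q)) ->
  v f = \sum_k 'D_(ebase k) Phi (rowf F p) * v (F k).
Proof.
move=> CP fP; have [h Hh E] := hadamard CP.
have /choice[H HH] : forall k, exists H : smoothFun M, \forall q \near p, H q = h k (rowf F q).
  by move=> k; apply: smooth_extend; apply: smooth_at_rowf; have [] := Hh k.
pose e1 : smoothFun M := 1.
have E2 : \forall q \near p, f q = ((Phi (rowf F p) *: e1 + \sum_k (F k - F k p *: e1) * H k) : smoothFun M) q.
  have nH : \forall q \near p, forall k, H k q = h k (rowf F q).
    by apply: (@filter_forall _ _ (fun k q => H k q = h k (rowf F q)) (nbhs p)).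
  have nE : \forall q \near p, Phi (rowf F q) = Phi (rowf F p) + \sum_i (rowf F q 0 i - rowf F p 0 i) * h i (rowf F q).
    exact: (@rowf_continuous _ F p _ E).
  apply: filterS3 fP nH nE => q -> Hq ->; rewrite !smoothE smooth_sumE; congr (_ + _).
    by rewrite /e1 smooth_oneE /GRing.scale /= mulr1.
  apply: eq_bigr => k _; rewrite !smoothE Hq !mxE /e1 smooth_oneE /GRing.scale /= mulr1.
  by [].
have ve : v e1 = 0 by exact: tangent_one.
rewrite (tangent_local v E2) tangent_addr tangent_scale ve mulr0 add0r tangent_sum.
apply: eq_bigr => k _; rewrite tangent_leibniz.
have -> : (F k - F k p *: e1) p = 0.
  by rewrite !smoothE /e1 smooth_oneE /GRing.scale /= mulr1 subrr.
rewrite mul0r addr0 tangent_addr tangent_opp tangent_scale ve mulr0 subr0 mulrC; congr (_ * _).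
by rewrite (nbhs_singleton (HH k)); have [] := Hh k.
Qed.

End Manifold.

(** * Coordinate systems with globally defined coordinate fields *)

Section Frames.
Context {R : realType} {M : smoothSpace R} {d : nat}.
Hypothesis hM : is_manifold d M.
Implicit Types (p q : M) (U W : set M).

(** The cutoff [rho] makes the partial derivative, extended by 0 off the chart, a derivation of the
    global algebra. *)
Lemma chart_vfield U (x : M -> 'rV[R]_d) y (rho : smoothFun M) k : is_chart U x y ->
  (forall q, U q \/ \forall z \near q, rho z = 0) ->
  exists E : vfield M, forall f q, U q -> E f q = rho q * 'D_(ebase k) (f \o y) (x q).
Proof.
move=> [[oU oxU] yx cx cy sm] r0.
have Cf (f : smoothFun M) q : U q -> Coo_at (x q) (f \o y).
  by move=> Uq; apply/(sm q f Uq); exact: smoothFun_at.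
pose F (f : smoothFun M) (q : M) : R := if pselect (U q) then rho q * 'D_(ebase k) (f \o y) (x q) else 0.
have FU f q : U q -> F f q = rho q * 'D_(ebase k) (f \o y) (x q) by rewrite /F; case: pselect.
have FU' f q : ~ U q -> F f q = 0 by rewrite /F; case: pselect.
have sF f q : smooth_at M q (F f).
  have [Uq|z] := r0 q; last first.
    apply: (smooth_at_near (smooth_at_cst q 0)); apply: filterS z => z z0.
    by have [/FU ->|/FU' ->] := pselect (U z); rewrite ?z0 ?mul0r.
  apply/(sm _ _ Uq); apply: (@Coo_at_near _ _ _ ((rho \o y) * 'D_(ebase k) (f \o y))).
    by apply: Coo_atM; [exact: Cf|exact/Coo_at_derive/Cf].
  have xUq : (x @` U) (x q) by exists q.
  by apply: filterS (open_nbhs_nbhs (conj oxU xUq)) => _ [w Uw <-]; rewrite !fctE /= yx // FU.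
have eP : ((fun f => SmoothFun (smooth_inP (sF f))) : smoothFun M -> (smoothFun M)^o) \in @vfield_pred R M.
  rewrite inE; split=> [a f h|f h]; apply: smoothFun_eqP => q; rewrite !smoothE /=.
    have [Uq|nU] := pselect (U q); last by rewrite !FU' // mulr0 addr0.
    rewrite !FU //; have df : derivable (f \o y) (x q) (ebase k) by apply: Coo_at_derivable; exact: Cf.
    have dh : derivable (h \o y) (x q) (ebase k) by apply: Coo_at_derivable; exact: Cf.
    have -> : 'D_(ebase k) ((a *: f + h : smoothFun M) \o y) (x q) = a *: 'D_(ebase k) (f \o y) (x q) + 'D_(ebase k) (h \o y) (x q).
      rewrite -deriveZ // -deriveD //; exact: derivableZ.
    by rewrite /GRing.scale /=; ring.
  have [Uq|nU] := pselect (U q); last by rewrite !FU' // mul0r mulr0 addr0.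
  rewrite !FU //; have df : derivable (f \o y) (x q) (ebase k) by apply: Coo_at_derivable; exact: Cf.
    have dh : derivable (h \o y) (x q) (ebase k) by apply: Coo_at_derivable; exact: Cf.
  have -> : 'D_(ebase k) ((f * h : smoothFun M) \o y) (x q) = f q *: 'D_(ebase k) (h \o y) (x q) + h q *: 'D_(ebase k) (f \o y) (x q).
    transitivity ('D_(ebase k) ((f \o y) * (h \o y)) (x q)); first by [].
    by rewrite deriveM //= yx.
  by rewrite /GRing.scale /=; ring.
by exists (VField eP) => f q Uq; exact: FU.
Qed.

(* Coordinates X centred at p on W, with inverse y, extended to global
   functions, and coordinate fields E. *)
Definition coord_system p (r : R) W (X : 'I_d -> smoothFun M) (y : 'rV[R]_d -> M) (E : 'I_d -> vfield M) :=
  [/\ [/\ 0 < r, open W, W p & rowf X p = 0],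
      forall q, W q -> `|rowf X q| < r /\ y (rowf X q) = q,
      forall z, `|z| < r -> [/\ W (y z), rowf X (y z) = z, {for z, continuous y}
        & forall f, smooth_at M (y z) f <-> Coo_at z (f \o y)],
      forall q f k, W q -> E k f q = 'D_(ebase k) (f \o y) (rowf X q)
    & forall q (v : tangent M q) f, W q -> v f = \sum_k v (X k) * E k f q].

Lemma open_rowf_lt W N (X : 'I_N -> smoothFun M) (r : R) : open W -> open (W `&` [set q | `|rowf X q| < r]).
Proof.
move=> oW; apply: openI => //; apply: (@open_comp _ _ (rowf X) [set z : 'rV[R]_N | `|z| < r]).
  by move=> q _; exact: (rowf_continuous hM).
exact: open_norm_lt.
Qed.

Lemma coord_system_shrink p r r' W X y E : 0 < r' <= r ->
  coord_system p r W X y E -> coord_system p r' (W `&` [set q | `|rowf X q| < r']) X y E.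
Proof.
move=> /andP[r0 rr] [[_ oW Wp Xp] H1 H2 H3 H4]; split.
- split=> //; last by split=> //=; rewrite Xp normr0.
  exact: open_rowf_lt.
- by move=> q [Wq /= qr]; have [] := H1 q Wq.
- move=> z zr; have [h1 h2 h3 h4] := H2 z (lt_le_trans zr rr); split=> //; split=> //=.
  by rewrite h2.
- by move=> q f k [Wq _]; exact: H3.
- by move=> q v f [Wq _]; exact: H4.
Qed.

(** [W] is taken where the cutoff is 1 and the extended functions agree with the translated
    coordinates, so the global objects are genuine coordinates there; [tangent_chain] then expands
    every tangent vector. *)
Lemma coord_system_exists p U0 : open U0 -> U0 p ->
  exists r W X y E, coord_system p r W X y E /\ W `<=` U0.
Proof.
move=> oU0 U0p; have [U [x [y [Up ch]]]] := manifold_chart hM p.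
have [[oU oxU] yx cx cy sm] := ch.
have [rho [r1 r0]] := manifold_bump hM oU Up.
have /choice[E HE] : forall k, exists E : vfield M, forall f q, U q -> E f q = rho q * 'D_(ebase k) (f \o y) (x q).
  by move=> k; exact: chart_vfield ch r0.
have /choice[X HX] : forall k, exists X : smoothFun M, \forall q \near p, X q = x q 0 k - x p 0 k.
  move=> k; apply: (smooth_extend_on hM oU Up) => q Uq; apply/(sm _ _ Uq).
  apply: (@Coo_at_near _ _ _ (fun z : 'rV[R]_d => z 0 k - x p 0 k)).
    by apply: Coo_atB; [exact: Coo_at_coord|exact: Coo_at_cst].
  have xUq : (x @` U) (x q) by exists q.
  by apply: filterS (open_nbhs_nbhs (conj oxU xUq)) => _ [w Uw <-] /=; rewrite yx.
have : \forall q \near p, U0 q /\ U q /\ rho q = 1 /\ forall k, X k q = x q 0 k - x p 0 k.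
  have nX : \forall q \near p, forall k, X k q = x q 0 k - x p 0 k.
    exact: (@filter_forall _ _ (fun k q => X k q = x q 0 k - x p 0 k) (nbhs p)).
  have nU : nbhs p U by exact: open_nbhs_nbhs.
  have nU0 : nbhs p U0 by exact: open_nbhs_nbhs.
  by apply: filterS2 (filterI nU0 nU) (filterI r1 nX) => q [? ?] [? ?].
move=> H; have : nbhs p (fun q => U0 q /\ U q /\ rho q = 1 /\ forall k, X k q = x q 0 k - x p 0 k) := H.
rewrite nbhsE => -[W1 [oW1 W1p] HW1].
have rX q : W1 q -> rowf X q = x q - x p.
  by move=> /HW1[_ [_ [_ Hq]]]; apply/rowP => k; rewrite !mxE Hq.
have xUp : (x @` U) (x p) by exists p.
have [r rr0 Hr] : exists2 r : R, 0 < r & forall z, `|z - x p| < r -> (x @` U) z /\ W1 (y z).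
  have nW : nbhs (y (x p)) W1 by rewrite yx //; exact: open_nbhs_nbhs.
  have : nbhs (x p) ((x @` U) `&` (y @^-1` W1)).
    by apply: filterI; [exact: open_nbhs_nbhs|exact: (cy _ xUp _ nW)].
  move=> /nbhs_ballP[r /= r00 Hr]; exists r => // z zr; apply: Hr.
  by rewrite -ball_normE /= distrC.
pose Y z := y (z + x p).
have Yz z : `|z| < r -> [/\ (x @` U) (z + x p), W1 (Y z) & x (Y z) = z + x p].
  move=> zr; have [|[w Uw xw] h2] := Hr (z + x p); first by rewrite addrK.
  by split=> //; [exists w|rewrite /Y -xw yx].
have Csh (F : 'rV[R]_d -> R) (a b : 'rV[R]_d) : Coo_at (b + a) F -> Coo_at b (fun z => F (z + a)).
  move=> CF; apply: (@Coo_at_rowcomp R _ _ (fun z => z + a) F) => // k.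
  by under eq_fun do rewrite mxE; apply: Coo_atD; [exact: Coo_at_coord|exact: Coo_at_cst].
have smY z f : `|z| < r -> smooth_at M (Y z) f <-> Coo_at z (f \o Y).
  move=> zr; have [[w Uw xw] h2 h3] := Yz z zr.
  have UY : U (Y z) by rewrite /Y -xw yx.
  split=> [/(sm _ f UY)|]; rewrite ?h3; first exact: (Csh (f \o y) (x p)).
  move=> C; apply/(sm _ f UY); rewrite h3.
  have := Csh (f \o Y) (- x p) (z + x p); rewrite addrK => /(_ C).
  by under eq_fun do rewrite /= /Y subrK.
have DY (f : smoothFun M) k q : W1 q -> `|rowf X q| < r -> 'D_(ebase k) (f \o Y) (rowf X q) = 'D_(ebase k) (f \o y) (x q).
  move=> W1q _; rewrite (rX q W1q) /derive.
  rewrite (_ : (fun h : R => h^-1 *: ((f \o Y \o shift (x q - x p)) (h *: ebase k) - (f \o Y) (x q - x p)))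
    = (fun h : R => h^-1 *: ((f \o y \o shift (x q)) (h *: ebase k) - (f \o y) (x q)))) //.
  by apply/funext => h; rewrite /= /Y addrA !subrK.
have HE1 q f k : W1 q -> `|rowf X q| < r -> E k f q = 'D_(ebase k) (f \o Y) (rowf X q).
  move=> W1q qr; have [_ [Uq [rq _]]] := HW1 q W1q.
  by rewrite HE // rq mul1r DY.
pose W := W1 `&` [set q | `|rowf X q| < r].
have oW : open W.
  exact: open_rowf_lt.
have yX q : W1 q -> Y (rowf X q) = q.
  by move=> W1q; have [_ [Uq _]] := HW1 q W1q; rewrite (rX q W1q) /Y subrK yx.
have Xp : rowf X p = 0 by rewrite rX // subrr.
exists r, W, X, Y, E; split; last by move=> q [/HW1[]].
split.
- by split=> //; split; rewrite //= Xp normr0.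
- by move=> q [W1q /= qr]; split=> //; exact: yX.
- move=> z zr; have [h1 h2 h3] := Yz z zr; have E1 : rowf X (Y z) = z by rewrite rX // h3 addrK.
  split=> //; first by split=> //=; rewrite E1.
    apply: (@continuous_comp _ _ _ (fun z : 'rV[R]_d => z + x p) y z); last exact: cy.
    apply: (@row_cvgP _ _ _ (nbhs z)) => k; apply: Coo_at_continuous.
    by under eq_fun do rewrite mxE; apply: Coo_atD; [exact: Coo_at_coord|exact: Coo_at_cst].
  by move=> f; exact: smY.
- by move=> q f k [W1q qr]; exact: HE1.
- move=> q v f [W1q qr].
  have Cf : Coo_at (rowf X q) (f \o Y).
    by apply/(smY _ f qr); rewrite (yX q W1q); exact: smoothFun_at.
  rewrite (@tangent_chain _ _ _ hM _ v _ X (f \o Y) f Cf).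
    by apply: eq_bigr => k _; rewrite HE1 // mulrC.
  have Wq : W q by [].
  by apply: filterS (open_nbhs_nbhs (conj oW Wq)) => w [W1w _] /=; rewrite yX.
Qed.

Section CoordinateFields.
Variables (p : M) (r : R) (W : set M) (X : 'I_d -> smoothFun M) (y : 'rV[R]_d -> M) (E : 'I_d -> vfield M).
Hypothesis CS : coord_system p r W X y E.

Lemma coord_field q i k : W q -> E k (X i) q = (k == i)%:R.
Proof.
have [[r0 oW Wp Xp] H1 H2 H3 H4] := CS; move=> Wq; rewrite H3 //.
have [qr yq] := H1 q Wq.
have N : \forall z \near rowf X q, (z : 'rV[R]_d) 0 i = (X i \o y) z.
  apply: filterS (open_nbhs_nbhs (conj (@open_norm_lt _ _ r) qr)) => z /= zr.
  by have [_ + _ _] := H2 z zr; move=> /rowP/(_ i); rewrite mxE.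
have [_ D] := is_derive_coord (rowf X q) (ebase k) i.
rewrite -(near_eq_derive _ N) D.
by rewrite mxE eqxx eq_sym.
Qed.

Lemma coord_field_lie i j q : W q -> vfield_at (lie (E i) (E j)) q = 0.
Proof.
have [[r0 oW Wp Xp] H1 H2 H3 H4] := CS; move=> Wq.
have z0 k : lie (E i) (E j) (X k) q = 0.
  have loc (a b c : 'I_d) : E a (E b (X c)) q = 0.
    rewrite -[LHS]/(vfield_at (E a) q (E b (X c))).
    rewrite (tangent_local hM _ (_ : \forall z \near q, E b (X c) z = ((b == c)%:R *: (1 : smoothFun M) : smoothFun M) z)).
      by rewrite tangent_scale tangent_one mulr0.
    apply: filterS (open_nbhs_nbhs (conj oW Wq)) => z Wz; rewrite coord_field // smoothE smooth_oneE.
    by rewrite /GRing.scale /= mulr1.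
  by change (E i (E j (X k)) q - E j (E i (X k)) q = 0); rewrite !loc subrr.
apply: val_inj; apply/funext => f; rewrite /= -[LHS]/(vfield_at (lie (E i) (E j)) q f) H4 // big1 // => k _.
by rewrite -[X in X * _]/(lie (E i) (E j) (X k) q) z0 mul0r.
Qed.

Lemma tangent_coord q (v : tangent M q) : W q -> v = \sum_k v (X k) *: vfield_at (E k) q.
Proof.
have [_ _ _ _ H4] := CS; move=> Wq; apply: val_inj; apply/funext => f.
rewrite -[LHS]/(v f) H4 //.
have -> (w : tangent M q) : val w f = w f by [].
have S I (s : seq I) (w : I -> tangent M q) : (\sum_(k <- s) w k) f = \sum_(k <- s) w k f.
  by elim: s => [|i s IH]; rewrite ?big_nil ?big_cons // -IH.
by rewrite S.
Qed.

End CoordinateFields.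
End Frames.

(** The traces on A of balls with rational centres, not necessarily in A, and radii 1/(k+1) form a
    base. *)
Lemma embedded_second_countable {R : realType} N (A : set 'rV[R]_N) : @second_countable (embedded A).
Proof.
pose b (qk : 'rV[rat]_N * nat) : set (embedded A) :=
  [set x : embedded A | `|(set_val x : 'rV[R]_N) - map_mx ratr qk.1| < qk.2.+1%:R^-1].
have vc : continuous (set_val : embedded A -> 'rV[R]_N) by exact: initial_continuous.
have ob qk : open (b qk).
  rewrite /b; set c := map_mx _ _; set e := _^-1.
  have -> : [set x : embedded A | `|(set_val x : 'rV[R]_N) - c| < e] = (set_val : embedded A -> 'rV[R]_N) @^-1` (fun z => `|z - c| < e) by [].
  apply: open_comp => [x _|]; first exact: vc.
  have cc : continuous ((fun z => z - c) : 'rV[R]_N -> 'rV[R]_N).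
    by move=> z; apply: (@cvgB _ _ _ (nbhs z)); [exact: cvg_id|exact: cvg_cst].
  have := @open_comp _ _ ((fun z => z - c) : 'rV[R]_N -> 'rV[R]_N) [set z : 'rV[R]_N | `|z| < e] (fun z _ => cc z).
  by apply; exact: open_norm_lt.
exists (range b); first exact: sub_countable (card_image_le _ _) (countableP _).
split=> [_ [qk _ <-] //|x U]; rewrite nbhsE => -[V [oV Vx] VU].
have [W oW WV] : exists2 W : set 'rV[R]_N, open W & set_val @^-1` W = V by exact: oV.
have Wx : nbhs (set_val x : 'rV[R]_N) W by apply: open_nbhs_nbhs; split=> //; rewrite -WV in Vx.
have [e /= e0 He] := (nbhs_ballP _ _).1 Wx.
have [k ke] : exists k : nat, k.+1%:R^-1 < e / 2.
  have [k _ Hk] := near_infty_natSinv_lt (PosNum (divr_gt0 e0 (ltr0n R 2))).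
  by exists k; apply: Hk => /=.
set d := k.+1%:R^-1 in ke; have d0 : 0 < d by rewrite invr_gt0 ltr0n.
have Hq : forall i : 'I_N, exists q : rat, `|(set_val x : 'rV[R]_N) 0 i - ratr q| < d / 2.
  move=> i; have [q] := @rat_in_itvoo R ((set_val x : 'rV[R]_N) 0 i - d / 2) ((set_val x : 'rV[R]_N) 0 i + d / 2) ltac:(lra).
  by rewrite in_itv /= => /andP[h1 h2]; exists q; rewrite ltr_norml; apply/andP; split; lra.
have [q q_x] := choice Hq.
have nq : `|(set_val x : 'rV[R]_N) - map_mx ratr (\row_i q i)| <= d / 2.
  by apply: row_normP => [|i]; [lra|rewrite !mxE; exact: ltW].
exists (b (\row_i q i, k)); first by split; [exists (\row_i q i, k)|rewrite /b /= -/d; lra].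
move=> y /= by'; apply: VU; rewrite -WV; apply: He; rewrite -ball_normE /= distrC.
have -> : (set_val y : 'rV[R]_N) - set_val x = (set_val y - map_mx ratr (\row_i q i)) - (set_val x - map_mx ratr (\row_i q i)).
  by rewrite opprB addrA subrK.
by apply: le_lt_trans (ler_normB _ _) _; rewrite /b /= -/d in by'; lra.
Qed.

(** * Developing maps and their continuation *)

(* A subset of R^N with charts c, a family s of left inverses defined on the
   open sets O, and a group G of affine isometries preserving it, given by
   pairs (C, w) acting by x |-> x C + w. *)
Definition aff {R : realType} {N} (A : 'M[R]_N * 'rV[R]_N) (x : 'rV[R]_N) : 'rV[R]_N := x *m A.1 + A.2.

Record model (R : realType) (d N : nat) := Model {
  mpts : set 'rV[R]_N;
  mI : Type;
  mc : mI -> 'rV[R]_d -> 'rV[R]_N;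
  ms : mI -> 'rV[R]_N -> 'rV[R]_d;
  mO : mI -> set 'rV[R]_N;
  mG : set ('M[R]_N * 'rV[R]_N);
  m_c : forall i z, [/\ mpts (mc i z), mO i (mc i z), ms i (mc i z) = z
                      & forall k, Coo_at z (fun z => mc i z 0 k)];
  m_s : forall i x, mO i x -> (forall k, Coo_at x (fun x => ms i x 0 k)) /\
                              (mpts x -> mc i (ms i x) = x);
  m_O : forall i, open (mO i);
  m_cover : forall x, mpts x -> exists i, mO i x;
  m_base : exists2 x, mpts x & forall i, mO i x;
  m_conn : forall i j, connected [set z | mO j (mc i z)];
  m_rigid : forall i (z : 'rV[R]_d) A A', (\forall w \near z, aff A (mc i w) = aff A' (mc i w)) -> A = A';
  m_orth : forall A, mG A -> A.1 *m A.1^T = 1%:M;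
  m_Gset : forall A x, mG A -> mpts x -> mpts (aff A x);
  m_Gid : exists2 A, mG A & forall x, aff A x = x;
  m_Ginv : forall A, mG A -> exists2 B, mG B & forall x, aff B (aff A x) = x /\ aff A (aff B x) = x;
  m_Gcomp : forall A B, mG A -> mG B -> exists2 C, mG C & forall x, aff C x = aff A (aff B x)
}.

Section DevelopingCharts.
Context {R : realType} {M : smoothSpace R} {d N : nat} (X : model R d N).
Hypothesis hM : is_manifold d M.
Variable g : riemannian M.
Variable dev : ('I_N -> smoothFun M) -> set M -> Prop.

(** A (G, X)-structure on M: local maps into the model space through which g is induced from the
    Euclidean metric, any two differing locally by an element of [mG X]. *)
Definition developing : Prop :=
  [/\ forall Psi U, dev Psi U -> open U /\ forall q, U q -> mpts X (rowf Psi q) /\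
        forall u v : tangent M q, riem_at g q u v = \sum_k u (Psi k) * v (Psi k),
      forall p, exists Psi U, dev Psi U /\ U p
    & forall Psi U Psi' U' q, dev Psi U -> dev Psi' U' -> U q -> U' q ->
        exists2 A, mG X A & \forall w \near q, rowf Psi' w = aff A (rowf Psi w)].

Hypothesis hdev : developing.

(* A developing map that is a diffeomorphism of U onto c_i(B(z0, r)). *)
Definition dchart (Psi : 'I_N -> smoothFun M) (U : set M) (i : mI X) (z0 : 'rV[R]_d) (r : R) (om : 'rV[R]_d -> M) :=
  [/\ 0 < r, open U /\ exists2 U', dev Psi U' & U `<=` U',
      forall z, `|z - z0| < r -> [/\ U (om z), rowf Psi (om z) = mc i z, {for z, continuous om}
        & forall f, smooth_at M (om z) f -> Coo_at z (f \o om)]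
    & forall q, U q -> [/\ mpts X (rowf Psi q), mO i (rowf Psi q), `|ms i (rowf Psi q) - z0| < r
        & om (ms i (rowf Psi q)) = q]].

(** The inverse function theorem for the developing map read in a model chart. A vector in the
    kernel of its Jacobian annihilates every [Psi k], so it has length 0 for g and vanishes. *)
Lemma dev_chart p : exists Psi U i z0 r om, dchart Psi U i z0 r om /\ U p.
Proof.
have [d1 d2 _] := hdev; have [Psi [U0 [dP U0p]]] := d2 p.
have [oU0 HU0] := d1 _ _ dP.
have [r [W [x [y [E [CS WU0]]]]]] := coord_system_exists hM oU0 U0p.
have [[r0 oW Wp xp] H1 H2 H3 H4] := CS.
have [Xp gP] := HU0 p U0p; have [i Oi] := m_cover Xp.
pose f z : 'rV[R]_d := ms i (rowf Psi (y z)).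
have yp : y 0 = p by rewrite -xp; have [_ ->] := H1 p Wp.
have n0 : `|0 : 'rV[R]_d| < r by rewrite normr0.
have [_ _ cy0 smy0] := H2 0 n0.
have sms j : smooth_at M p (fun q => ms i (rowf Psi q) 0 j).
  by apply: (smooth_at_rowf hM (Phi := fun x => ms i x 0 j)); have [] := m_s Oi.
have Cf j : Coo_at 0 (fun z => f z 0 j).
  by have := sms j; rewrite -{1}yp => /(smy0 (fun q => ms i (rowf Psi q) 0 j)).
have /choice[F HF] : forall j, exists F : smoothFun M, \forall q \near p, F q = ms i (rowf Psi q) 0 j.
  by move=> j; exact: (smooth_extend hM (sms j)).
have nO : \forall q \near p, U0 q /\ mO i (rowf Psi q).
  apply: filterI; first exact: open_nbhs_nbhs.
  have nOx : nbhs (rowf Psi p) (mO i) by apply: open_nbhs_nbhs; split=> //; exact: m_O.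
  exact: (@rowf_continuous _ _ _ hM _ Psi p _ nOx).
have nF : \forall q \near p, rowf F q = ms i (rowf Psi q).
  have : \forall q \near p, forall j, F j q = ms i (rowf Psi q) 0 j.
    exact: (@filter_forall _ _ (fun j q => F j q = ms i (rowf Psi q) 0 j) (nbhs p)).
  by apply: filterS => q Hq; apply/rowP => j; rewrite mxE.
have Uj : jac f 0 \in unitmx.
  rewrite -row_free_unit -kermx_eq0; apply/eqP/row_matrixP => a; rewrite row0.
  set v := row a _; have vJ : v *m jac f 0 = 0 by rewrite /v -row_mul mulmx_ker row0.
  pose V : tangent M p := \sum_k v 0 k *: vfield_at (E k) p.
  have VE h : V h = \sum_k v 0 k * E k h p.
    rewrite /V; elim: (index_enum _) => [|b s IH]; first by rewrite !big_nil.
    by rewrite !big_cons -IH.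
  have Vx k : V (x k) = v 0 k.
    rewrite VE (bigD1 k) //= (coord_field CS) // eqxx mulr1 big1 ?addr0 // => b /negbTE bk.
    by rewrite (coord_field CS) // bk mulr0.
  have VF j : V (F j) = 0.
    transitivity ((v *m jac f 0) 0 j); last by rewrite vJ mxE.
    rewrite VE [RHS]mxE.
    apply: eq_bigr => k _; congr (_ * _); rewrite H3 // xp mxE.
    apply: near_eq_derive; have := HF j; rewrite -{1}yp => HFy.
    by apply: filterS (near_comp cy0 HFy) => z.
  have VPsi k : V (Psi k) = 0.
    have [_ _ _ Cc] := m_c i (rowf F p).
    rewrite (tangent_chain hM V (F := F) (Cc k)).
      by rewrite big1 // => j _; rewrite VF mulr0.
    apply: filterS2 nO nF => q [U0q Oq] ->; have [Xq _] := HU0 q U0q.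
    by have [_ ->] := m_s Oq; rewrite ?mxE.
  have V0 : V = 0.
    apply/eqP; apply: contraT => /(riem_pos g); rewrite gP big1 ?ltxx // => k _.
    by rewrite VPsi mul0r.
  by apply/rowP => k; rewrite -Vx V0 mxE.
have nW : nbhs (0 : 'rV[R]_d) [set z | `|z| < r /\ mO i (rowf Psi (y z)) /\ U0 (y z)].
  have n1 : nbhs (0 : 'rV[R]_d) [set z | `|z| < r] by apply: open_nbhs_nbhs; split=> //; exact: open_norm_lt.
  rewrite -yp in nO; have n2 := cy0 _ nO.
  by apply: filterS2 n1 n2 => z zr [? ?].
have [rho [h [B [rho0 [oB B0] BW Hh HB]]]] := inverse_function Cf Uj nW.
pose U := W `&` [set q | B (rowf x q)].
exists Psi, U, i, (f 0), rho, (y \o h); split; last by split=> //=; rewrite xp.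
split=> //.
- split; last by exists U0 => // q [/WU0].
  apply: openI => //; apply: (@open_comp _ _ (rowf x) B) => // q _.
  exact: (rowf_continuous hM).
- move=> z zr; have [Bz fz Ch] := Hh z zr; have [hr [Oy U0y]] := BW _ Bz.
  have [h1 h2 h3 h4] := H2 _ hr.
  have ch : {for z, continuous h}.
    by apply: (@row_cvgP _ _ _ (nbhs z)) => j; exact: (Coo_at_continuous (Ch j)).
  split.
  + by split=> //=; rewrite h2.
  + have [Xq _] := HU0 _ U0y; have [_ /(_ Xq) <-] := m_s Oy.
    by rewrite -[ms i _]/(f (h z)) fz.
  + by apply: continuous_comp; [exact: ch|exact: h3].
  + by move=> F' /h4 CF'; exact: (Coo_at_rowcomp Ch CF').
- move=> q [Wq Bq]; have [qr yq] := H1 q Wq; have [_ [Oy U0y]] := BW _ Bq.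
  have [Xq _] := HU0 q (WU0 q Wq); have [fr hf] := HB _ Bq.
  rewrite yq in Oy; split=> //; first by rewrite -{1}yq.
  by rewrite /= -{1}yq -[ms i _]/(f (rowf x q)) hf.
Qed.

End DevelopingCharts.

(** * Local inverses of developing maps along a map into the model *)

Section Admissible.
Context {R : realType} {M : smoothSpace R} {d N : nat} (X : model R d N).
Hypothesis hM : is_manifold d M.
Variable g : riemannian M.
Variable dev : ('I_N -> smoothFun M) -> set M -> Prop.
Hypothesis hdev : developing X g dev.

Lemma aff_continuous (A : 'M[R]_N * 'rV[R]_N) : continuous (aff A).
Proof.
move=> x; apply: (@row_cvgP _ _ _ (nbhs x)) => j; apply: Coo_at_continuous.
under eq_fun do rewrite !mxE; apply: Coo_atD; last exact: Coo_at_cst.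
apply: Coo_at_sum => i.
by apply: (@Coo_atM _ _ _ (fun x : 'rV[R]_N => x 0 i) (cst (A.1 i j))); [exact: Coo_at_coord|exact: Coo_at_cst].
Qed.

Lemma dchart_inj Psi U (i : mI X) z0 r om q q' : dchart dev Psi U i z0 r om -> U q -> U q' ->
  rowf Psi q = rowf Psi q' -> q = q'.
Proof.
move=> [_ _ _ H] /H[_ _ _ e1] /H[_ _ _ e2] E.
by rewrite -e1 E e2.
Qed.

Variables (T : topologicalType) (e : T -> 'rV[R]_N).
Hypothesis ce : continuous e.
Hypothesis eX : forall t, mpts X (e t).
Hypothesis e_rigid : forall (t : T) A A', (\forall w \near t, aff A (e w) = aff A' (e w)) -> A = A'.

(** Near [t], [F] followed by a developing map is [e] followed by an isometry of the model. The
    parameter space is kept general: coordinate spaces serve for the continuation, the model space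
    itself for the covering. *)
Definition adm (F : T -> M) (t : T) : Prop := {for t, continuous F} /\
  exists Psi U A, [/\ dev Psi U, U (F t), mG X A & \forall w \near t, rowf Psi (F w) = aff A (e w)].

Lemma adm_dev F t Psi U : adm F t -> dev Psi U -> U (F t) ->
  exists2 A, mG X A & \forall w \near t, U (F w) /\ rowf Psi (F w) = aff A (e w).
Proof.
move=> [cF [Psi' [U' [A [dP' U't GA E]]]]] dP Ut; have [d1 _ d3] := hdev.
have [B GB EB] := d3 _ _ _ _ _ dP' dP U't Ut; have [C GC HC] := m_Gcomp GB GA.
exists C => //; have [oU _] := d1 _ _ dP.
have n1 : \forall w \near t, U (F w) by apply: cF; exact: open_nbhs_nbhs.
have n2 : \forall w \near t, rowf Psi (F w) = aff B (rowf Psi' (F w)) by exact: cF EB.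
by apply: filterS3 E n1 n2 => w E1 Uw ->; rewrite E1 HC.
Qed.

Section Chart.
Variables (Psi : 'I_N -> smoothFun M) (U : set M) (i : mI X) (z0 : 'rV[R]_d) (r : R) (om : 'rV[R]_d -> M).
Hypothesis ch : dchart dev Psi U i z0 r om.

Lemma adm_dchart F t : adm F t -> U (F t) ->
  exists2 A, mG X A & \forall w \near t, U (F w) /\ rowf Psi (F w) = aff A (e w).
Proof.
have [r0 [oU [U' dP UU']] om1 om2] := ch => aF Ut.
have [A GA E] := adm_dev aF dP (UU' _ Ut); exists A => //.
have n1 : \forall w \near t, U (F w) by apply: (aF.1); exact: open_nbhs_nbhs.
by apply: filterS2 E n1 => w [].
Qed.

(** Composing with the inverse [om] of the chart yields an admissible germ with the prescribed
    isometry [A], as soon as the two sides match at one point. *)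
Lemma local_adm A t q : mG X A -> U q -> aff A (e t) = rowf Psi q ->
  om (ms i (aff A (e t))) = q /\
  \forall w \near t, [/\ adm (fun w => om (ms i (aff A (e w)))) w, U (om (ms i (aff A (e w))))
     & rowf Psi (om (ms i (aff A (e w)))) = aff A (e w)].
Proof.
have [r0 [oU [U' dP UU']] om1 om2] := ch => GA Uq Et.
have [Xq Oq mr omq] := om2 _ Uq; split; first by rewrite Et.
pose V := [set w | mO i (aff A (e w)) /\ `|ms i (aff A (e w)) - z0| < r].
have cA w : {for w, continuous (fun w => aff A (e w))}.
  by apply: continuous_comp; [exact: ce|exact: aff_continuous].
have cms w : mO i (aff A (e w)) -> {for w, continuous (fun w => ms i (aff A (e w)))}.
  move=> Ow; apply: (@continuous_comp _ _ _ (fun w => aff A (e w)) (ms i)); first exact: cA.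
  apply: (@row_cvgP _ _ _ (nbhs (aff A (e w)))) => j; apply: Coo_at_continuous.
  by have [] := m_s Ow.
have VV w : V w -> nbhs w V.
  move=> [Ow rw].
  have n1 : nbhs w (fun w => mO i (aff A (e w))) by apply: cA; apply: open_nbhs_nbhs; split=> //; exact: m_O.
  have n2 : nbhs w (fun w => `|ms i (aff A (e w)) - z0| < r).
    have oB : open [set z : 'rV[R]_d | `|z - z0| < r].
      rewrite (_ : mkset _ = ball z0 r); first exact: ball_open.
      by apply/seteqP; split=> y /=; rewrite -ball_normE /= distrC.
    have nB : nbhs (ms i (aff A (e w))) [set z : 'rV[R]_d | `|z - z0| < r] by exact: open_nbhs_nbhs.
    exact: (cms w Ow _ nB).
  exact: filterI.
have HV w : V w -> U (om (ms i (aff A (e w)))) /\ rowf Psi (om (ms i (aff A (e w)))) = aff A (e w).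
  move=> [Ow rw]; have [h1 h2 _ _] := om1 _ rw; split=> //; rewrite h2.
  by have [_ ->] := m_s Ow; last exact: m_Gset.
have Vt : V t by rewrite /V /= Et.
apply: filterS (VV t Vt) => w Vw; have [Uw Ew] := HV w Vw; split=> //; split.
  apply: (@continuous_comp _ _ _ (fun w => ms i (aff A (e w))) om); first exact: cms Vw.1.
  by have [_ _ h _] := om1 _ Vw.2.
exists Psi, U', A; split=> //; first exact: UU'.
by apply: filterS (VV w Vw) => w' /HV[].
Qed.

Lemma adm_formula F t A : {for t, continuous F} -> U (F t) -> (\forall w \near t, rowf Psi (F w) = aff A (e w)) ->
  \forall w \near t, F w = om (ms i (aff A (e w))).
Proof.
have [r0 [oU _] om1 om2] := ch => cF Ut E.
have n1 : \forall w \near t, U (F w) by apply: cF; exact: open_nbhs_nbhs.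
by apply: filterS2 E n1 => w <- /om2[_ _ _ ->].
Qed.

End Chart.

Lemma adm_eq F F' t : adm F t -> (\forall w \near t, F w = F' w) -> adm F' t.
Proof.
move=> [cF [Psi [U [A [dP Ut GA E]]]]] H; have e1 := nbhs_singleton H; split.
  rewrite /prop_for /continuous_at -e1; apply: cvg_trans cF; apply: near_eq_cvg.
  exact: H.
exists Psi, U, A; split=> //; first by rewrite -e1.
by apply: filterS2 E H => w <- ->.
Qed.

Lemma adm_nbhs F t : adm F t -> \forall w \near t, adm F w.
Proof.
move=> aF; have [Psi [U [i [z0 [r [om [ch Ut]]]]]]] := dev_chart hM hdev (F t).
have [A GA E] := adm_dchart ch aF Ut.
have E' : \forall w \near t, rowf Psi (F w) = aff A (e w) by apply: filterS E => w [].
have [_ N1] := local_adm ch GA Ut (esym (nbhs_singleton E')).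
have N2 := adm_formula ch aF.1 Ut E'.
have : nbhs t (fun w => F w = om (ms i (aff A (e w)))) := N2.
rewrite nbhsE => -[V [oV Vt] HV].
apply: filterS2 N1 (open_nbhs_nbhs (conj oV Vt)) => w [aw _ _] Vw.
apply: adm_eq aw _; apply: filterS (open_nbhs_nbhs (conj oV Vw)) => w' /HV ->.
by [].
Qed.

(** The set where the germs agree is open. At a limit point the values agree by separation, and
    [e_rigid] identifies the two isometries at a nearby point of the set, so the set is closed in
    [C]. *)
Lemma adm_uniq (C : set T) F F' t0 : connected C -> C t0 ->
  (forall t, C t -> adm F t) -> (forall t, C t -> adm F' t) ->
  (\forall w \near t0, F w = F' w) -> forall t, C t -> \forall w \near t, F w = F' w.
Proof.
move=> cC C0 aF aF' E0; pose B := [set t : T | \forall w \near t, F w = F' w].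
have oB : open B.
  rewrite openE => t Bt; have : nbhs t (fun w => F w = F' w) := Bt.
  rewrite nbhsE => -[V [oV Vt] HV]; apply: filterS (open_nbhs_nbhs (conj oV Vt)) => w Vw.
  by apply: filterS (open_nbhs_nbhs (conj oV Vw)) => w' /HV.
have clB t : C t -> closure B t -> B t.
  move=> Ct cl; have a := aF t Ct; have a' := aF' t Ct.
  have [hausM _ _] := hM.
  have Ett : F t = F' t.
    apply: hausM => A1 A2 nA1 nA2.
    have [w [Bw [A1w A2w]]] := cl _ (filterI (near_comp a.1 nA1) (near_comp a'.1 nA2)).
    by exists (F w); split=> //; rewrite (nbhs_singleton Bw).
  have [Psi [U [i [z0 [r [om [ch Ut]]]]]]] := dev_chart hM hdev (F t).
  have [A GA E] := adm_dchart ch a Ut.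
  have Ut' : U (F' t) by rewrite -Ett.
  have [A' GA' E'] := adm_dchart ch a' Ut'.
  have : nbhs t (fun w => (U (F w) /\ rowf Psi (F w) = aff A (e w)) /\ (U (F' w) /\ rowf Psi (F' w) = aff A' (e w))).
    exact: filterI.
  rewrite nbhsE => -[V [oV Vt] HV].
  have [w [Bw Vw]] := cl _ (open_nbhs_nbhs (conj oV Vt)).
  have AA' : A = A'.
    apply: (@e_rigid w); have Bw' : \forall w' \near w, F w' = F' w' := Bw.
    by apply: filterS2 Bw' (open_nbhs_nbhs (conj oV Vw)) => w' Ew /HV[[_ <-] [_ <-]]; rewrite Ew.
  rewrite /B /=; apply: filterS (open_nbhs_nbhs (conj oV Vt)) => w' /HV[[Uw Ew] [Uw' Ew']].
  by apply: (dchart_inj ch) => //; rewrite Ew Ew' AA'.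
have H := cC (C `&` B) _ _ _.
have {H} <- : C `&` B = C.
  apply: H; first by exists t0.
  - by exists B.
  - exists (closure B); first exact: closed_closure.
    by apply/seteqP; split=> t [Ct Bt]; split=> //; [exact: subset_closure|exact: clB].
by move=> t [].
Qed.

(** The same open and closed argument for the isometry that expresses [F] in a fixed developing
    chart. *)
Lemma adm_const (C : set T) F Psi U A t0 : connected C -> C t0 -> dev Psi U ->
  (forall t, C t -> adm F t /\ U (F t)) -> mG X A -> (\forall w \near t0, rowf Psi (F w) = aff A (e w)) ->
  forall t, C t -> \forall w \near t, rowf Psi (F w) = aff A (e w).
Proof.
move=> cC C0 dP aF GA E0; pose B := [set t : T | \forall w \near t, rowf Psi (F w) = aff A (e w)].
have oB : open B.
  rewrite openE => t Bt; have : nbhs t (fun w => rowf Psi (F w) = aff A (e w)) := Bt.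
  rewrite nbhsE => -[V [oV Vt] HV]; apply: filterS (open_nbhs_nbhs (conj oV Vt)) => w Vw.
  by apply: filterS (open_nbhs_nbhs (conj oV Vw)) => w' /HV.
have clB t : C t -> closure B t -> B t.
  move=> Ct cl; have [a Ut] := aF t Ct; have [A' GA' E'] := adm_dev a dP Ut.
  have : nbhs t (fun w => U (F w) /\ rowf Psi (F w) = aff A' (e w)) := E'.
  rewrite nbhsE => -[V [oV Vt] HV].
  have [w [Bw Vw]] := cl _ (open_nbhs_nbhs (conj oV Vt)).
  have AA' : A = A'.
    apply: (@e_rigid w); have Bw' : \forall w' \near w, rowf Psi (F w') = aff A (e w') := Bw.
    by apply: filterS2 Bw' (open_nbhs_nbhs (conj oV Vw)) => w' Ew /HV[_ <-]; rewrite Ew.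
  by rewrite /B /=; apply: filterS (open_nbhs_nbhs (conj oV Vt)) => w' /HV[_ ->]; rewrite AA'.
have H := cC (C `&` B) _ _ _.
have {H} E : C `&` B = C.
  apply: H; first by exists t0.
  - by exists B.
  - exists (closure B); first exact: closed_closure.
    by apply/seteqP; split=> t [Ct Bt]; split=> //; [exact: subset_closure|exact: clB].
by move=> t; rewrite -E => -[].
Qed.

End Admissible.

Lemma compact_bound {R : realType} (T : topologicalType) (A : set T) (f : T -> R) : compact A ->
  (forall x, A x -> {for x, continuous f}) -> exists K, forall x, A x -> `|f x| <= K.
Proof.
move=> cA cf.
have /compact_near_coveringP /(_ _ \oo (fun (n : nat) x => `|f x| <= n%:R)) H := cA.
have [|n _ Hn] := H _; last by exists n%:R => x Ax; exact: Hn (leqnn n) x Ax.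
move=> x Ax; have n1 : \forall y \near x, `|f y| <= `|f x| + 1.
  have /cvgrPdist_le/(_ 1 ltr01) := cf x Ax; apply: filterS => y Hy.
  rewrite -[f y](subrK (f x)) addrC; apply: le_trans (ler_normD _ _) _.
  by rewrite lerD2l distrC.
have n2 : \forall n \near \oo, `|f x| + 1 <= n%:R by exact: nbhs_infty_ger.
by exists ([set y | `|f y| <= `|f x| + 1], [set n | `|f x| + 1 <= n%:R]) => // -[y m] /= [a b]; exact: le_trans a b.
Qed.

(** * Smooth curves, their lengths and Lipschitz functions *)

Section Curves.
Context {R : realType} {M : smoothSpace R} {d : nat}.
Hypothesis hM : is_manifold d M.
Implicit Types (p q : M) (U W : set M).

Definition curve_at (c : R -> M) (t : R) : Prop := {for t, continuous c} /\
  forall f, smooth_at M (c t) f -> Coo_at (t : R^o) (f \o c : R^o -> R).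

Lemma curve_at_near (c c' : R -> M) (t : R) : (\forall s \near t, c s = c' s) -> curve_at c t -> curve_at c' t.
Proof.
move=> H [cc sc]; have e1 := nbhs_singleton H; split.
  rewrite /prop_for /continuous_at -e1; apply: cvg_trans cc; apply: near_eq_cvg; exact: H.
move=> f; rewrite -e1 => /sc C; apply: (@Coo_at_near R R^o t (f \o c) (f \o c') C).
by apply: filterS H => s /= ->.
Qed.

Lemma curve_of (c : R -> M) : (forall t, curve_at c t) -> exists c' : curve M, smoothMap_val c' = c.
Proof.
move=> H; have sc : smooth_on setT (c : smoothV R^o -> M).
  by move=> t _; have [cc sc] := H t; split.
by exists (SmoothMap sc).
Qed.

Lemma curve_at_comp (c : R -> M) (s : R -> R) t : curve_at c (s t) -> Coo_at (t : R^o) (s : R^o -> R) ->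
  curve_at (c \o s) t.
Proof.
move=> [cc sc] Cs; split; first by apply: continuous_comp; [exact: (Coo_at_continuous Cs)|exact: cc].
by move=> f /sc Cf; exact: (@Coo_at_comp1 R R^o s (f \o c) t Cs Cf).
Qed.

Lemma curve_at_affine (c : R -> M) (a b t : R) : curve_at c (a * t + b) -> curve_at (fun s => c (a * s + b)) t.
Proof.
move=> H; apply: (@curve_at_comp c (fun s => a * s + b)) => //.
apply: Coo_atD; last exact: Coo_at_cst.
by apply: (@Coo_atM _ R^o _ (cst a) id); [exact: Coo_at_cst|exact: Coo_at_id].
Qed.

Lemma curve_at_chart n (y : 'rV[R]_n -> M) (a b : 'rV[R]_n) (t : R) :
  {for a + smoothstep t *: b, continuous y} ->
  (forall f, smooth_at M (y (a + smoothstep t *: b)) f -> Coo_at (a + smoothstep t *: b) (f \o y)) ->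
  curve_at (fun s => y (a + smoothstep s *: b)) t.
Proof.
move=> cy sy; have C j : Coo_at (t : R^o) ((fun s => (a + smoothstep s *: b) 0 j) : R^o -> R).
  under eq_fun do rewrite !mxE; apply: Coo_atD; first exact: Coo_at_cst.
  by apply: (@Coo_atM _ R^o _ smoothstep (cst (b 0 j))); [exact: Coo_at_smoothstep|exact: Coo_at_cst].
split.
  apply: (@continuous_comp _ _ _ (fun s => a + smoothstep s *: b) y); last exact: cy.
  by apply: (@row_cvgP _ _ _ (nbhs t)) => j; exact: (Coo_at_continuous (C j)).
move=> f /sy Cf; exact: (@Coo_at_rowcomp R R^o n (fun s => a + smoothstep s *: b) (f \o y) t).
Qed.

(* A smooth path from p to q that rests near its endpoints. *)
Definition joined p q := exists c : R -> M, [/\ forall t, curve_at c t,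
  forall t, t <= 1/3 -> c t = p & forall t, 2/3 <= t -> c t = q].

Lemma joined_sym p q : joined p q -> joined q p.
Proof.
move=> [c [sc c0 c1]]; exists (fun t => c ((-1) * t + 1)); split.
- by move=> t; exact: curve_at_affine.
- by move=> t t0; apply: c1; lra.
- by move=> t t0; apply: c0; lra.
Qed.

Lemma joined_trans p q w : joined p q -> joined q w -> joined p w.
Proof.
move=> [c [sc c0 c1]] [e [se e0 e1]].
(* The first piece rests until 1/3 and is at q from 7/18 on; the second stays at q until 5/9 and
   rests from 11/18 on. Hence both are constant around the junction 1/2. *)
pose f t := if t <= 1/2 then c (6 * t + (- 5 / 3)) else e (6 * t + (- 3)).
exists f; split; last first.
- move=> t t0; rewrite /f ifF; first by apply: e1; lra.
  by apply/negbTE; rewrite -ltNge; lra.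
- by move=> t t0; rewrite /f ifT; [apply: c0; lra|lra].
move=> t; have [t0|t0|t0] := ltgtP t (1/2).
- apply: (@curve_at_near (fun t => c (6 * t + (- 5 / 3)))); last exact: curve_at_affine.
  have N : nbhs t [set s : R | s < 1/2] by apply: open_nbhs_nbhs; split=> //; exact: open_lt.
  by apply: filterS N => s /= s0; rewrite /f ltW.
- apply: (@curve_at_near (fun t => e (6 * t + (- 3)))); last exact: curve_at_affine.
  have N : nbhs t [set s : R | 1/2 < s] by apply: open_nbhs_nbhs; split=> //; exact: open_gt.
  by apply: filterS N => s /= s0; rewrite /f leNgt s0.
- apply: (@curve_at_near (fun t => c (6 * t + (- 5 / 3)))); last exact: curve_at_affine.
  have N1 : nbhs t [set s : R | s < 5/9] by apply: open_nbhs_nbhs; split=> /=; [exact: open_lt|lra].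
  have N2 : nbhs t [set s : R | 7/18 < s] by apply: open_nbhs_nbhs; split=> /=; [exact: open_gt|lra].
  apply: filterS2 N1 N2 => s /= s1 s2; rewrite /f; case: ifP => // _.
  by rewrite c1 ?e0 //; lra.
Qed.

Lemma joined_near p : \forall q \near p, joined p q.
Proof.
have [r [W [x [y [E [CS _]]]]]] := @coord_system_exists _ _ _ hM p setT openT I.
have [[r0 oW Wp xp] H1 H2 H3 H4] := CS.
have n0 : `|0 : 'rV[R]_d| < r by rewrite normr0.
apply: filterS (open_nbhs_nbhs (conj oW Wp)) => q Wq; have [qr yq] := H1 q Wq.
pose c t := y (0 + smoothstep t *: rowf x q).
have cc t : curve_at c t.
  have H : `|0 + smoothstep t *: rowf x q| < r.
    rewrite add0r; apply: le_lt_trans qr; apply: segment_norm.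
    by rewrite /smoothstep divr_ge0 ?flat_ge0 ?(ltW (smoothstep_den t)) //= ler_pdivrMr ?smoothstep_den // mul1r lerDl flat_ge0.
  have [_ _ h3 h4] := H2 _ H.
  by apply: curve_at_chart => // f /h4.
exists (fun t => c (3 * t + -1)); split.
- by move=> t; exact: curve_at_affine.
- by move=> t t0; rewrite /c smoothstep_le0 ?scale0r ?addr0 -?xp ?(H1 p Wp).2 //; lra.
- by move=> t t0; rewrite /c smoothstep_ge1 ?scale1r ?add0r ?yq //; lra.
Qed.

(** The infimum in [riem_dist] is thus over a nonempty set, so a small distance provides a short
    curve. *)
Lemma smooth_path p q : is_connected M -> exists c : curve M, c 0 = p /\ c 1 = q.
Proof.
move=> [_ conn]; pose A := [set q | joined p q].
have Ap : A p by exact: nbhs_singleton (joined_near p).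
have oA : open A.
  by rewrite openE => w Aw; apply: filterS (joined_near w) => w' ww'; exact: joined_trans Aw ww'.
have clA : closed A.
  move=> w cl; have [w' [Aw' ww']] := cl _ (joined_near w).
  by apply: joined_trans Aw' _; exact: joined_sym.
have E : A = setT.
  apply: conn; first by exists p.
  - by exists A => //; rewrite setTI.
  - by exists A => //; rewrite setTI.
have [c [sc c0 c1]] : A q by rewrite E.
have [c' Ec] := curve_of sc; exists c'; rewrite Ec c0 ?c1 //; lra.
Qed.

Section Length.
Variable g : riemannian M.
Hypothesis flatg : forall p, exists N : nat, exists Psi : 'I_N -> smoothFun M,
  \forall q \near p, forall u v : tangent M q, riem_at g q u v = \sum_k u (Psi k) * v (Psi k).

Definition speed (c : curve M) (t : R) : R := Num.sqrt (riem_at g (c t) (velocity c t) (velocity c t)).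

Lemma curve_smooth_at (c : curve M) (t : R) f : smooth_at M (c t) f -> Coo_at (t : R^o) (f \o c : R^o -> R).
Proof. by move: (@smoothMapP _ _ _ c t I) => [_]; apply. Qed.

Lemma velocityE (c : curve M) (t : R) (f : smoothFun M) :
  is_derive t (1 : R) (f \o c : R -> R) (velocity c t f).
Proof.
have D : derivable (f \o c : R^o -> R) (t : R^o) (1 : R^o).
  apply: Coo_at_derivable; apply: curve_smooth_at; exact: smoothFun_at.
exact: DeriveDef.
Qed.

(** Smoothness of a metric is stated on vector fields, while a velocity is not the restriction of
    one; locally g is a sum of squares of differentials, which makes the speed explicit. *)
Lemma speed_continuous c (t : R) : {for t, continuous (speed c)}.
Proof.
have [N [Psi HP]] := flatg (c t).
have cc : {for (t : R), continuous (smoothMap_val c)} by have [] := @smoothMapP _ _ _ c t I.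
have E : \forall s \near t, speed c s = Num.sqrt (\sum_k ('D_(1 : R^o) (Psi k \o c : R^o -> R) s) ^+ 2).
  apply: filterS (near_comp cc HP) => s Hs; rewrite /speed Hs; congr Num.sqrt; exact: eq_bigr.
rewrite /prop_for /continuous_at (nbhs_singleton E).
apply: cvg_trans (_ : (fun s => Num.sqrt (\sum_k ('D_(1 : R^o) (Psi k \o c : R^o -> R) s) ^+ 2)) @ t --> _).
  by apply: near_eq_cvg; apply: filterS E => s ->.
apply: (@continuous_comp _ _ _ (fun s : R => \sum_k ('D_(1 : R^o) (Psi k \o c : R^o -> R) s) ^+ 2) Num.sqrt); last exact: sqrt_continuous.
apply: (@Coo_at_continuous R R^o); apply: (@Coo_at_sum R R^o) => k.
have C : Coo_at (t : R^o) ('D_(1 : R^o) (Psi k \o c : R^o -> R)).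
  apply: Coo_at_derive; apply: curve_smooth_at; exact: smoothFun_at.
exact: (Coo_atM C C).
Qed.

Lemma curve_lengthE c : exists2 L : R -> R,
  forall t : R, 0 <= t <= 1 -> is_derive t (1 : R) L (speed c t) & curve_length g c = L 1 - L 0.
Proof.
have D := @prim_derive R (speed c) (fun t _ => @speed_continuous c t).
exists (prim (speed c)) => //.
have cL t : 0 <= t <= 1 -> {for t, continuous (prim (speed c))}.
  by move=> /D; exact: derivable_continuous1.
rewrite /curve_length /Rintegral (_ : (\int[_]_(x in _) _)%E = ((prim (speed c) 1)%:E - (prim (speed c) 0)%:E)%E) //.
apply: (@continuous_FTC2 R (speed c) (prim (speed c)) 0 1 ltr01).
- by apply: continuous_subspaceT => t; exact: speed_continuous.
- split.
  + by move=> t; rewrite in_itv /= => /andP[t0 t1]; have [] := D t _; rewrite ?ltW.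
  + apply: cvg_at_right_filter; apply: cL; rewrite lexx ler01 //.
  + apply: cvg_at_left_filter; apply: cL; rewrite lexx ler01 //.
- move=> t; rewrite in_itv /= => /andP[t0 t1]; rewrite derive1E.
  by have [] := D t _; rewrite ?ltW.
Qed.

Lemma curve_length_le c K : (forall t : R, 0 <= t <= 1 -> speed c t <= K) -> curve_length g c <= K.
Proof.
move=> H; have [L DL ->] := curve_lengthE c.
have [c0 c01 ->] := MVT_is_derive ler01 DL.
by rewrite subr0 mulr1; exact: H.
Qed.

Lemma curve_length_ge0 c : 0 <= curve_length g c.
Proof.
have [L DL ->] := curve_lengthE c; have [c0 c01 ->] := MVT_is_derive ler01 DL.
by rewrite subr0 mulr1 sqrtr_ge0.
Qed.

Lemma lipschitz_curve (rho : smoothFun M) K :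
  (forall q (v : tangent M q), `|v rho| <= K * Num.sqrt (riem_at g q v v)) ->
  forall c : curve M, `|rho (c 1) - rho (c 0)| <= K * curve_length g c.
Proof.
move=> HK c; have [L DL ->] := curve_lengthE c.
have key (s : R) : s = 1 \/ s = -1 -> s * (rho (c 1) - rho (c 0)) <= K * (L 1 - L 0).
  move=> s1; have D (t : R) : 0 <= t <= 1 -> is_derive t (1 : R) (fun t => K * L t - s * rho (c t))
      (K * speed c t - s * velocity c t rho).
    by move=> t01; apply: is_deriveB; [exact: (@is_deriveZ R _ _ _ _ _ _ _ (DL t t01))|exact: (@is_deriveZ R _ _ _ _ _ _ _ (velocityE c t rho))].
  have [t t01] := MVT_is_derive ler01 D; rewrite subr0 mulr1 => E.
  have : 0 <= K * speed c t - s * velocity c t rho.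
    rewrite subr_ge0; apply: le_trans (HK _ (velocity c t)).
    by case: s1 => ->; rewrite ?mul1r ?mulN1r ?ler_norm // -normrN ler_norm.
  by rewrite -E; lra.
have k1 := key 1 (or_introl erefl); have k2 := key (-1) (or_intror erefl).
by rewrite ler_norml; move: k1 k2; lra.
Qed.

End Length.
End Curves.

Lemma convex_connected {R : realType} (V : normedModType R) (C : set V) (x0 : V) : C x0 ->
  (forall x (t : R), C x -> 0 <= t <= 1 -> C (t *: (x - x0) + x0)) -> connected C.
Proof.
move=> C0 HC.
have -> : C = \bigcup_(x in C) ((fun t : R => t *: (x - x0) + x0) @` `[0, 1]).
  apply/seteqP; split=> [x Cx|_ [x Cx [t + <-]]].
    by exists x => //; exists 1; rewrite ?scale1r ?subrK //= in_itv /= ler01 lexx.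
  by rewrite /= in_itv /=; exact: HC.
apply: bigcup_connected.
  by exists x0 => x Cx; exists 0; rewrite ?scale0r ?add0r //= in_itv /= ler01 lexx.
move=> x Cx; apply: connected_continuous_connected; first exact: segment_connected.
apply: continuous_subspaceT => t; apply: cvgD; last exact: cvg_cst.
by apply: cvgZ; [exact: cvg_id|exact: cvg_cst].
Qed.

(** * Metric estimates for developing charts *)

Section Continuation.
Context {R : realType} {M : smoothSpace R} {d N : nat} (X : model R d N).
Hypothesis hM : is_manifold d M.
Hypothesis hconn : is_connected M.
Variable g : riemannian M.
Hypothesis complete : is_complete g.
Variable dev : ('I_N -> smoothFun M) -> set M -> Prop.
Hypothesis hdev : developing X g dev.

Lemma dev_flatg (p : M) : exists N : nat, exists Psi : 'I_N -> smoothFun M,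
  \forall q \near p, forall u v : tangent M q, riem_at g q u v = \sum_k u (Psi k) * v (Psi k).
Proof.
have [d1 d2 _] := hdev; have [Psi [U [dP Up]]] := d2 p; have [oU HU] := d1 _ _ dP.
by exists N, Psi; apply: filterS (open_nbhs_nbhs (conj oU Up)) => q /HU[].
Qed.

Lemma dchart_is_chart Psi U (i : mI X) z0 r om : dchart dev Psi U i z0 r om ->
  is_chart U (fun q => ms i (rowf Psi q)) om.
Proof.
move=> [r0 [oU _] om1 om2].
have cms q : U q -> {for q, continuous (fun q => ms i (rowf Psi q))}.
  move=> /om2[_ Oq _ _]; apply: (@continuous_comp _ _ _ (rowf Psi) (ms i)); first exact: (rowf_continuous hM).
  apply: (@row_cvgP _ _ _ (nbhs (rowf Psi q))) => j; apply: Coo_at_continuous.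
  by have [] := m_s Oq.
have im : (fun q => ms i (rowf Psi q)) @` U = [set z : 'rV[R]_d | `|z - z0| < r].
  apply/seteqP; split=> [_ [q /om2[_ _ + _] <-] //|z /= zr].
  by have [h1 h2 _ _] := om1 z zr; exists (om z) => //; rewrite h2; have [_ _ ->] := m_c i z.
split=> //.
- split=> //; rewrite im (_ : mkset _ = ball z0 r); first exact: ball_open.
  by apply/seteqP; split=> y /=; rewrite -ball_normE /= distrC.
- by move=> q /om2[].
- by move=> z; rewrite im => /om1[].
- move=> q f Uq; have [_ Oq mr omq] := om2 q Uq; split.
    by move=> sf; have [_ _ _] := om1 _ mr; apply; rewrite omq.
  move=> C; have C' := smooth_at_rowcomp hM (p := q) (F := fun q => ms i (rowf Psi q)) _ C.
  apply: (smooth_at_near (C' _)).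
    by move=> k; apply: (smooth_at_rowf hM (Phi := fun x => ms i x 0 k)); have [] := m_s Oq.
  by apply: filterS (open_nbhs_nbhs (conj oU Uq)) => w /om2[_ _ _] /= ->.
Qed.

(** It compares distance and topology: a point joined to [q] by a curve with K times its length
    below 1 lies in [U]. For the bound, the partials of the bump are bounded on a compact ball, and
    each [v (Psi k)] is at most the length of v. *)
Lemma lipschitz_bump q U : open U -> U q -> exists rho : smoothFun M, exists K : R, [/\ 0 <= K, rho q = 1,
  forall w, ~ U w -> rho w = 0
  & forall w (v : tangent M w), `|v rho| <= K * Num.sqrt (riem_at g w v v)].
Proof.
move=> oU Uq; have [d1 _ _] := hdev.
have [Psi [W [i [z0 [r0 [om [ch Wq]]]]]]] := dev_chart hM hdev q.
have [r [rho [r_gt0 Hr rW r0']]] := chart_bump hM (dchart_is_chart ch) Wq oU Uq.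
have [_ [oW [U' dP WU']] om1 om2] := ch; have [oU' HU'] := d1 _ _ dP.
set xq := ms i (rowf Psi q) in Hr rW r0'.
pose Phi (x : 'rV[R]_N) : R := sbump xq r (ms i x).
have CPhi x : mO i x -> Coo_at x Phi.
  move=> Ox; apply: (@Coo_at_rowcomp R _ _ (ms i) (sbump xq r)); last exact: Coo_at_sbump.
  by have [] := m_s Ox.
have /choice[K HK] : forall k, exists K : R, forall z : 'rV[R]_d, [set z | `|z - xq| <= 2 * r] z ->
    `|'D_(ebase k) Phi (mc i z)| <= K.
  move=> k; apply: (@compact_bound _ _ _ (fun z => 'D_(ebase k) Phi (mc i z))); first exact: compact_sup_ball.
  move=> z _; have [_ Oz _ Cz] := m_c i z; apply: (@continuous_comp _ _ _ (mc i) ('D_(ebase k) Phi)).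
    by apply: (@row_cvgP _ _ _ (nbhs z)) => j; exact: (Coo_at_continuous (Cz j)).
  by apply: Coo_at_continuous; apply: Coo_at_derive; exact: CPhi.
have K0 k : 0 <= K k by apply: le_trans (HK k xq _); rewrite //= subrr normr0 mulr_ge0 // ltW.
exists rho, (\sum_k K k); split.
- exact: sumr_ge0.
- by rewrite rW // -/xq (nbhs_singleton (sbump_near xq r_gt0)).
- move=> w nU; have [[z /Hr[_ Uz] E]|/nbhs_singleton //] := r0' w.
  by case: nU; rewrite E.
- move=> w v; have [[z zr E]|n0] := r0' w; last first.
    rewrite (tangent_local hM v (h := 0)); last by apply: filterS n0 => z ->.
    by rewrite tangent_zero normr0 mulr_ge0 ?sqrtr_ge0 // sumr_ge0.
  have [[q' Wq' Eq'] _] := Hr z zr.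
  have [_ Oq' mr omq'] := om2 q' Wq'.
  have Ww : W w by rewrite E -Eq' omq'.
  have [Xw Ow mw omw] := om2 w Ww; have [_ gw] := HU' w (WU' w Ww).
  have zE : rowf Psi w = mc i z.
    by have [_ /(_ Xw) <-] := m_s Ow; congr mc; rewrite E -Eq' omq'.
  rewrite (tangent_chain hM v (F := Psi) (Phi := Phi)); last 2 first.
  + exact: CPhi.
  + by apply: filterS (open_nbhs_nbhs (conj oW Ww)) => w' /rW ->.
  apply: le_trans (ler_norm_sum _ _ _) _; rewrite mulr_suml; apply: ler_sum => k _.
  rewrite normrM ler_pM // ?zE; first exact: HK.
  rewrite -sqrtr_sqr; apply: ler_wsqrtr; rewrite gw (bigD1 k) //= -expr2 lerDl sumr_ge0 // => j _.
  by rewrite -expr2 sqr_ge0.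
Qed.

Variable e : 'rV[R]_d -> 'rV[R]_N.
Hypothesis Ce : forall z k, Coo_at z (fun z => e z 0 k).
Hypothesis eX : forall z, mpts X (e z).
Hypothesis e_rigid : forall (z : 'rV[R]_d) A A', (\forall w \near z, aff A (e w) = aff A' (e w)) -> A = A'.
Local Notation adm := (adm X dev e).

Let ce : continuous e.
Proof. by move=> z; apply: (@row_cvgP _ _ _ (nbhs z)) => j; exact: (Coo_at_continuous (Ce z j)). Qed.

Lemma adm_smooth F z f : adm F z -> smooth_at M (F z) f -> Coo_at z (f \o F).
Proof.
move=> aF sf; have [Psi [U [i [z0 [r [om [ch Uz]]]]]]] := dev_chart hM hdev (F z).
have [A GA E] := adm_dchart hdev ch aF Uz.
have E' : \forall w \near z, rowf Psi (F w) = aff A (e w) by apply: filterS E => w [].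
have N2 := adm_formula ch aF.1 Uz E'.
have [_ _ om1 om2] := ch; have [_ Oq mr omq] := om2 _ Uz.
have Ez := nbhs_singleton E'.
apply: (@Coo_at_near _ _ z (fun w => f (om (ms i (aff A (e w)))))); last by apply: filterS N2 => w /= ->.
have CA k : Coo_at z (fun w => aff A (e w) 0 k).
  under eq_fun do rewrite !mxE; apply: Coo_atD; last exact: Coo_at_cst.
  apply: Coo_at_sum => j; apply: (@Coo_atM _ _ _ (fun w => e w 0 j) (cst (A.1 j k))); [exact: Ce|exact: Coo_at_cst].
apply: (@Coo_at_rowcomp R _ _ (fun w => ms i (aff A (e w))) (f \o om)).
  move=> k; apply: (@Coo_at_rowcomp R _ _ (fun w => aff A (e w)) (fun x => ms i x 0 k)) => //.
  by rewrite -Ez; have [] := m_s Oq.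
by rewrite -Ez; have [_ _ _] := om1 _ mr; apply; rewrite omq.
Qed.

Lemma dot_orth (A : 'M[R]_N * 'rV[R]_N) (w : 'rV[R]_N) : mG X A -> dot (w *m A.1) (w *m A.1) = dot w w.
Proof.
move=> /m_orth oA; have dotmx (a b : 'rV[R]_N) : dot a b = (a *m b^T) 0 0.
  by rewrite mxE; apply: eq_bigr => i _; rewrite mxE.
by rewrite !dotmx trmx_mul mulmxA -(mulmxA w) oA mulmx1.
Qed.

(** Running through the segment with [smoothstep] gives a curve defined and smooth on the whole
    line. Isometries of the model have orthogonal linear parts, so its speed is that of the image
    under [e]. *)
Lemma segment_curve F (a v : 'rV[R]_d) : (forall t : R, 0 <= t <= 1 -> adm F (t *: v + a)) ->
  exists c : curve M, [/\ c 0 = F a, c 1 = F (v + a)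
   & forall s : R, exists2 t : R, 0 <= t <= 1
     & speed g c s = `|'D_(1 : R^o) (smoothstep : R^o -> R) s| * Num.sqrt (\sum_k ('D_v (fun z => e z 0 k) (t *: v + a)) ^+ 2)].
Proof.
move=> aF; have s01 (s : R) : 0 <= smoothstep s <= 1.
  by rewrite /smoothstep divr_ge0 ?flat_ge0 ?(ltW (smoothstep_den s)) //= ler_pdivrMr ?smoothstep_den // mul1r lerDl flat_ge0.
have cc (t : R) : curve_at (fun s => F (a + smoothstep s *: v)) t.
  have aFt : adm F (a + smoothstep t *: v) by rewrite addrC; exact: aF.
  by apply: curve_at_chart; [exact: aFt.1|move=> f sf; exact: adm_smooth].
have [c Ec] := curve_of cc; exists c; rewrite Ec smoothstep_le0 // smoothstep_ge1 // scale0r addr0 scale1r addrC; split=> // s.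
exists (smoothstep s) => //; set y := smoothstep s *: v + a.
have aFy : adm F y by exact: aF.
have [d1 d2 _] := hdev; have [Psi [U [dP Uy]]] := d2 (F y); have [oU HU] := d1 _ _ dP.
have [A GA EA] := adm_dev hdev aFy dP Uy.
have cE : smoothMap_val c s = F y by rewrite Ec addrC.
have [_ gy] := HU _ Uy; rewrite /speed.
pose w : 'rV[R]_N := \row_k ('D_v (fun z => e z 0 k) y * 'D_(1 : R^o) (smoothstep : R^o -> R) s).
have dsm : is_derive s (1 : R) (smoothstep : R -> R) ('D_(1 : R^o) (smoothstep : R^o -> R) s).
  by apply: DeriveDef => //; apply: (@Coo_at_derivable R R^o); exact: Coo_at_smoothstep.
have dw k : is_derive s (1 : R) (fun s => e (smoothstep s *: v + a) 0 k) (w 0 k).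
  rewrite mxE; apply: (@is_derive1_comp R (fun t => e (t *: v + a) 0 k) smoothstep) => //.
  by apply: (@is_derive_line R _ _ (fun z => e z 0 k)); exact: Coo_at_derivable.
have vE k : velocity c s (Psi k) = (w *m A.1) 0 k.
  have [_ <-] := velocityE c s (Psi k).
  have D : is_derive s (1 : R) (fun s => aff A (e (smoothstep s *: v + a)) 0 k) ((w *m A.1) 0 k).
    under eq_fun do rewrite !mxE; rewrite mxE -[X in is_derive _ _ _ X]addr0; apply: is_deriveD.
    apply: is_derive_sumr => j; rewrite mulrC; under eq_fun do rewrite mulrC.
    exact: (is_deriveZ _ (dw j)).
  have [_ <-] := D; apply: near_eq_derive.
  have cs : {for s, continuous (fun s : R => smoothstep s *: v + a)}.
    apply: cvgD; last exact: cvg_cst.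
    by apply: cvgZ; [exact: (derivable_continuous1 dsm)|exact: cvg_cst].
  apply: filterS (near_comp cs EA) => t [_ <-]; rewrite mxE /= Ec addrC.
  by [].
have -> : riem_at g (c s) (velocity c s) (velocity c s) = \sum_k velocity c s (Psi k) * velocity c s (Psi k).
  by have [_ ->] := HU (c s) (eq_ind_r U Uy cE).
have -> : \sum_k velocity c s (Psi k) * velocity c s (Psi k) = dot w w.
  by rewrite -(dot_orth w GA); apply: eq_bigr => k _; rewrite vE.
rewrite -sqrtr_sqr -sqrtrM ?sqr_ge0 // mulr_sumr; congr Num.sqrt; apply: eq_bigr => k _.
by rewrite mxE; ring.
Qed.

End Continuation.

Lemma ratio01 {R : realType} (a b : R) : 0 <= a <= b -> 0 < b -> 0 <= a / b <= 1.
Proof. by move=> /andP[a0 ab] b0; rewrite divr_ge0 ?(ltW b0) //= ler_pdivrMr // mul1r. Qed.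

(** * Continuation along rays in a complete manifold *)

Section ContinuationStep.
Context {R : realType} {M : smoothSpace R} {d N : nat} (X : model R d N).
Hypothesis hM : is_manifold d M.
Hypothesis hconn : is_connected M.
Variable g : riemannian M.
Hypothesis complete : is_complete g.
Variable dev : ('I_N -> smoothFun M) -> set M -> Prop.
Hypothesis hdev : developing X g dev.
Variable e : 'rV[R]_d -> 'rV[R]_N.
Hypothesis Ce : forall z k, Coo_at z (fun z => e z 0 k).
Hypothesis eX : forall z, mpts X (e z).
Hypothesis e_rigid : forall (z : 'rV[R]_d) A A', (\forall w \near z, aff A (e w) = aff A' (e w)) -> A = A'.
Local Notation adm := (adm X dev e).

Let ce : continuous e.
Proof. by move=> z; apply: (@row_cvgP _ _ _ (nbhs z)) => j; exact: (Coo_at_continuous (Ce z j)). Qed.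

Definition tube (z : 'rV[R]_d) (r : R) : set 'rV[R]_d := [set y | exists2 t : R, 0 <= t <= 1 & `|y - t *: z| < r].

Variable F0 : 'rV[R]_d -> M.
Hypothesis adm0 : adm F0 0.

(* F continues the germ of F0 at the origin along the segment from 0 to z. *)
Definition continues (z : 'rV[R]_d) (F : 'rV[R]_d -> M) : Prop :=
  (exists2 r : R, 0 < r & forall y, tube z r y -> adm F y) /\ \forall y \near (0 : 'rV[R]_d), F y = F0 y.

Lemma continues_adm z F (t : R) : continues z F -> 0 <= t <= 1 -> adm F (t *: z).
Proof. by move=> [[r r0 H] _] t01; apply: H; exists t; rewrite ?subrr ?normr0. Qed.

Lemma continues0 : exists F, continues 0 F.
Proof.
exists F0; split; last exact: filterE.
have /nbhs_ballP[r /= r0 H] := adm_nbhs hM hdev ce eX adm0.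
exists r => // y [t _]; rewrite scaler0 subr0 => yr; apply: H.
by rewrite -ball_normE /= sub0r normrN.
Qed.

Lemma continues_shrink z F (s : R) : continues z F -> 0 <= s <= 1 -> continues (s *: z) F.
Proof.
move=> [[r r0 H] H0] /andP[s0 s1]; split=> //; exists r => // y [t /andP[t0 t1]]; rewrite scalerA => yr.
by apply: H; exists (t * s) => //; rewrite mulr_ge0 // mulr_ile1.
Qed.

Lemma continues_near z F : continues z F -> \forall w \near z, continues w F.
Proof.
move=> [[r r0 H] H0]; have r2 : 0 < r / 2 by rewrite divr_gt0.
apply: filterS (nbhsx_ballx z _ r2) => w; rewrite -ball_normE /= => zw; split=> //.
exists (r / 2) => // y [t /andP[t0 t1] yr]; apply: H; exists t; first by rewrite t0.
apply: le_lt_trans (ler_distD (t *: w) _ _) _; rewrite [r]splitr ltrD //.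
rewrite -scalerBr normrZ ger0_norm // distrC; apply: le_lt_trans zw; exact: ler_piMl.
Qed.

Lemma segment_set_connected (a b : R) (z : 'rV[R]_d) : a <= b -> connected [set y | exists2 t : R, a <= t <= b & y = t *: z].
Proof.
move=> ab; apply: (@convex_connected R _ _ (a *: z)); first by exists a; rewrite ?lexx.
move=> _ u [t /andP[ta tb] ->] /andP[u0 u1]; exists (u * (t - a) + a).
  have h1 : 0 <= u * (t - a) by rewrite mulr_ge0 // subr_ge0.
  have h2 : u * (t - a) <= t - a by rewrite ler_piMl // subr_ge0.
  by move: h1 h2 tb; lra.
by rewrite -scalerBl scalerA -scalerDl.
Qed.

Lemma continues_agree z F F' (t : R) : continues z F -> continues z F' -> 0 <= t <= 1 ->
  \forall w \near t *: z, F w = F' w.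
Proof.
move=> hF hF' t01.
apply: (adm_uniq hM hdev e_rigid (@segment_set_connected 0 1 z ler01) (t0 := 0)); last by exists t.
- by exists 0; rewrite ?lexx ?ler01 ?scale0r.
- by move=> _ [s s01 ->]; exact: continues_adm.
- by move=> _ [s s01 ->]; exact: continues_adm.
- by move: hF hF' => [_ h1] [_ h2]; apply: filterS2 h1 h2 => w -> ->.
Qed.

Section Limit.
Variable z : 'rV[R]_d.
Hypothesis Hz : forall t : R, 0 <= t < 1 -> exists F, continues (t *: z) F.

Let Ft_ex : exists Ft : R -> 'rV[R]_d -> M, forall t : R, 0 <= t < 1 -> continues (t *: z) (Ft t).
Proof.
have H : forall t : R, exists F, 0 <= t < 1 -> continues (t *: z) F.
  by move=> t; case: (pselect (0 <= t < 1)) => [/Hz[F HF]|n]; [exists F|exists F0].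
by have [Ft HFt] := choice H; exists Ft.
Qed.

Let Ft := projT1 (cid Ft_ex).
Let FtP (t : R) : 0 <= t < 1 -> continues (t *: z) (Ft t) := projT2 (cid Ft_ex) t.
Let gam (t : R) := Ft t (t *: z).

Let Ft_agree (s t T : R) : 0 <= s <= t -> t <= T < 1 -> \forall w \near s *: z, Ft T w = Ft t w.
Proof.
move=> /andP[s0 st] /andP[tT T1].
have [t0|t0] := eqVneq t 0.
  have -> : s = 0 by apply/eqP; rewrite eq_le s0 andbT -t0.
  have TT : 0 <= T < 1 by rewrite T1 (le_trans (le_trans s0 st)).
  rewrite scale0r; have [_ h1] := FtP TT.
  have [_ h2] : continues (t *: z) (Ft t) by apply: FtP; rewrite t0 lexx ltr01.
  by apply: filterS2 h1 h2 => w -> ->.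
have tp : 0 < t by rewrite lt_def t0 (le_trans s0).
have hT : continues (t *: z) (Ft T).
  have -> : t *: z = (t / T) *: (T *: z) by rewrite scalerA divfK // gt_eqF // (lt_le_trans tp).
  apply: continues_shrink; first by apply: FtP; rewrite T1 (le_trans (ltW tp)).
  by apply: ratio01; rewrite ?(ltW tp) // (lt_le_trans tp).
have ht : continues (t *: z) (Ft t) by apply: FtP; rewrite (ltW tp) (le_lt_trans tT).
have -> : s *: z = (s / t) *: (t *: z) by rewrite scalerA divfK.
apply: continues_agree => //.
by apply: ratio01; rewrite ?s0.
Qed.

Let FtE (t T : R) : 0 <= t <= T -> T < 1 -> Ft T (t *: z) = gam t.
Proof.
move=> /andP[t0 tT] T1; apply: (nbhs_singleton (@Ft_agree t t T _ _)); first by rewrite t0 lexx.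
by rewrite tT.
Qed.

Let Ft_adm (t T : R) : 0 <= t <= T -> T < 1 -> adm (Ft T) (t *: z).
Proof.
move=> /andP[t0 tT] T1; have [T0|T0] := eqVneq T 0.
  have t00 : t = 0 by apply/eqP; rewrite eq_le t0 andbT -T0.
  rewrite t00 -[0 *: z](_ : 1 *: (T *: z) = _); last by rewrite T0 !scale0r scaler0.
  by apply: continues_adm; [apply: FtP; rewrite T1 T0 lexx|rewrite lexx ler01].
have Tp : 0 < T by rewrite lt_def T0 (le_trans t0).
have -> : t *: z = (t / T) *: (T *: z) by rewrite scalerA divfK.
apply: continues_adm; first by apply: FtP; rewrite T1 ltW.
by apply: ratio01; rewrite ?t0.
Qed.

(** The Lipschitz constant is a bound for the derivative of [smoothstep] times a bound for the speed
    of [e] on the segment. *)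
Let gam_curve : exists2 K : R, 0 <= K & forall t t' : R, 0 <= t < 1 -> 0 <= t' < 1 ->
  exists c : curve M, [/\ c 0 = gam t, c 1 = gam t' & curve_length g c <= K * `|t' - t|].
Proof.
have [S HS] : exists S, forall s, `[0, 1]%classic s -> `|'D_(1 : R^o) (smoothstep : R^o -> R) s| <= S.
  apply: compact_bound; first exact: segment_compact.
  move=> s _; apply: (@Coo_at_continuous R R^o); apply: Coo_at_derive; exact: Coo_at_smoothstep.
have [B HB] : exists B, forall s : R, `[0, 1]%classic s -> `|Num.sqrt (\sum_k ('D_z (fun w => e w 0 k) (s *: z)) ^+ 2)| <= B.
  apply: (@compact_bound _ _ _ (fun s : R => Num.sqrt (\sum_k ('D_z (fun w => e w 0 k) (s *: z)) ^+ 2))); first exact: segment_compact.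
  move=> s _; have cz : {for s, continuous (fun s : R => s *: z)} by apply: cvgZ; [exact: cvg_id|exact: cvg_cst].
  apply: (@continuous_comp _ _ _ (fun s : R => s *: z) (fun y => Num.sqrt (\sum_k ('D_z (fun w => e w 0 k) y) ^+ 2))); first exact: cz.
  apply: (@continuous_comp _ _ _ (fun y => \sum_k ('D_z (fun w => e w 0 k) y) ^+ 2) Num.sqrt); last exact: sqrt_continuous.
  apply: Coo_at_continuous; apply: Coo_at_sum => k.
  by apply: (@Coo_atM _ _ _ ('D_z (fun w => e w 0 k)) ('D_z (fun w => e w 0 k))); apply: Coo_at_derive; exact: Ce.
have i01 (s : R) : 0 <= s <= 1 -> `[0, 1]%classic s by rewrite /= in_itv.
have S0 : 0 <= S by apply: le_trans (HS 0 (i01 0 _)) => //; rewrite lexx ler01.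
have B0 : 0 <= B by apply: le_trans (HB 0 (i01 0 _)) => //; rewrite lexx ler01.
exists (S * B); first exact: mulr_ge0.
move=> t t' /andP[t0 t1] /andP[t0' t1']; pose T := Num.max t t'.
have T1 : T < 1 by rewrite gt_max t1.
have tT : t <= T by rewrite le_max lexx.
have tT' : t' <= T by rewrite le_max lexx orbT.
have mid (s : R) : 0 <= s <= 1 -> 0 <= s * (t' - t) + t <= T.
  move=> /andP[s0 s1]; have -> : s * (t' - t) + t = (1 - s) * t + s * t' by ring.
  rewrite addr_ge0 ?mulr_ge0 ?subr_ge0 //=.
  have h1 : (1 - s) * t <= (1 - s) * T by rewrite ler_wpM2l // subr_ge0.
  have h2 : s * t' <= s * T by rewrite ler_wpM2l.
  by move: h1 h2; lra.
have lineE (s : R) : s *: ((t' - t) *: z) + t *: z = (s * (t' - t) + t) *: z by rewrite scalerA -scalerDl.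
have aS (s : R) : 0 <= s <= 1 -> adm (Ft T) (s *: ((t' - t) *: z) + t *: z).
  by move=> s01; rewrite lineE; apply: Ft_adm => //; exact: mid.
have [c [c0 c1 cs]] := segment_curve hM hdev Ce aS.
exists c; split.
- by rewrite c0 FtE // t0.
- by rewrite c1 -scalerDl subrK FtE // t0'.
apply: (curve_length_le (dev_flatg hdev)) => s s01; have [u u01 ->] := cs s; rewrite lineE -mulrA ler_pM ?sqrtr_ge0 //.
  exact: HS (i01 s s01).
have -> : \sum_k ('D_((t' - t) *: z) (fun w => e w 0 k) ((u * (t' - t) + t) *: z)) ^+ 2
   = (t' - t) ^+ 2 * \sum_k ('D_z (fun w => e w 0 k) ((u * (t' - t) + t) *: z)) ^+ 2.
  rewrite mulr_sumr; apply: eq_bigr => k _.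
  have [_ ->] := @is_derive_scale R _ (fun w => e w 0 k) ((u * (t' - t) + t) *: z) z (t' - t) (Ce _ _).
  by rewrite exprMn.
rewrite sqrtrM ?sqr_ge0 // sqrtr_sqr mulrC ler_wpM2r //.
apply: le_trans (ler_norm _) _; apply: HB; apply: i01.
by have /andP[-> /le_trans-> //] := mid u u01; exact: ltW.
Qed.

Let tau (n : nat) : R := 1 - n.+1%:R^-1.

Let tau01 n : 0 <= tau n < 1.
Proof. by rewrite /tau subr_ge0 invf_le1 ?ltr0n // ler1n /= ltrBlDr ltrDl invr_gt0 ltr0n. Qed.

Let dist_le p q (c : curve M) : c 0 = p -> c 1 = q -> riem_dist g p q <= curve_length g c.
Proof.
move=> c0 c1; apply: ge_inf; last by exists c.
by exists 0 => _ [c' _ ->]; exact: (curve_length_ge0 (dev_flatg hdev)).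
Qed.

Let tauK (K e0 : R) : 0 <= K -> 0 < e0 -> exists2 k, K * (1 - tau k) < e0 & forall t, 0 <= t < 1 -> tau k <= t ->
  forall s, 0 <= s < 1 -> tau k <= s -> K * `|t - s| < e0.
Proof.
move=> K0 e00; have eK : 0 < e0 / (K + 1) by rewrite divr_gt0 // ltr_wpDl.
have [k _ Hk] := near_infty_natSinv_lt (PosNum eK); have /= := Hk k (leqnn k) => H.
have Kk : K * (1 - tau k) < e0.
  rewrite /tau subKr; apply: (@le_lt_trans _ _ ((K + 1) * k.+1%:R^-1)); first by rewrite ler_wpM2r ?invr_ge0 // lerDl.
  by rewrite mulrC -ltr_pdivlMr // ltr_wpDl.
exists k => // t /andP[_ t1] kt s /andP[_ s1] ks.
apply: le_lt_trans Kk; rewrite ler_wpM2l // ler_norml.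
by move: kt ks t1 s1; lra.
Qed.

Let tau_ge k n : (k <= n)%N -> tau k <= tau n.
Proof. by move=> kn; rewrite lerB // lef_pV2 ?posrE ?ltr0n // ler_nat. Qed.

(** Completeness gives a limit of the points [gam (tau n)] for the distance; [lipschitz_bump] turns
    it into a limit of the whole curve for the topology. *)
Lemma gam_limit : exists q : M, forall U : set M, open U -> U q ->
  exists n, forall t : R, 0 <= t < 1 -> tau n <= t -> U (gam t).
Proof.
have [K K0 HK] := gam_curve.
have [|q Hq] := @complete (fun n => gam (tau n)).
  move=> e0 e00; have [k _ Hk] := tauK K0 e00; exists k => i j ki kj.
  have [c [c0 c1 cl]] := HK _ _ (tau01 i) (tau01 j).
  apply: le_lt_trans (dist_le c0 c1) _; apply: le_lt_trans cl _.
  by apply: Hk; rewrite ?tau01 ?tau_ge.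
exists q => U oU Uq; have [rho [L [L0 rq rU Hrho]]] := lipschitz_bump hM hdev oU Uq.
(* Curves of length below this bound join [gam (tau n)] to [q] and to [gam t]. Along each [rho]
   changes by less than 1/2, so it is not 0 at [gam t]. *)
have L1 : 0 < (2 * (L + 1))^-1 by rewrite invr_gt0 mulr_gt0 // ltr_wpDl.
have Lb (x : R) : x < (2 * (L + 1))^-1 -> 0 <= x -> L * x < 1 / 2.
  move=> xl x0; apply: (@le_lt_trans _ _ ((L + 1) * x)); first by rewrite ler_wpM2r // lerDl.
  have -> : 1 / 2 = (L + 1) * (2 * (L + 1))^-1 :> R by field; rewrite gt_eqF // ltr_wpDl.
  by rewrite ltr_pM2l // ltr_wpDl.
have [k _ Hk] := tauK K0 L1.
have [n0 _ Hn0] : \forall n \near \oo, riem_dist g (gam (tau n)) q < (2 * (L + 1))^-1.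
  by move/cvgrPdist_lt: Hq => /(_ _ L1); apply: filterS => n; rewrite sub0r normrN; apply: le_lt_trans; exact: ler_norm.
pose n := maxn k n0; exists n => t t01 nt.
have [_ [c1 [c10 c11] ->] cl1] : exists2 l, [set l | exists2 c : curve M, c 0 = gam (tau n) /\ c 1 = q & l = curve_length g c] l & l < (2 * (L + 1))^-1.
  apply: inf_lt; last by apply: Hn0; rewrite /= leq_maxr.
  by have [c [h0 h1]] := smooth_path hM (gam (tau n)) q hconn; exists (curve_length g c); exists c.
have [c2 [c20 c21 cl2]] := HK _ _ (tau01 n) t01.
have l0 c : 0 <= curve_length g c by exact: (curve_length_ge0 (dev_flatg hdev)).
have b1 := lipschitz_curve (dev_flatg hdev) Hrho c1.
have b2 := lipschitz_curve (dev_flatg hdev) Hrho c2.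
have e1 := Lb _ cl1 (l0 c1).
have e2 : L * curve_length g c2 < 1 / 2.
  apply: Lb => //; apply: le_lt_trans cl2 _; apply: Hk; rewrite ?tau01 ?tau_ge ?leq_maxl //.
  by apply: le_trans nt; rewrite tau_ge ?leq_maxl.
case: (pselect (U (gam t))) => // /rU r0.
move: b1 b2 e1 e2; rewrite c10 c11 c20 c21 r0 rq !ler_norml => /andP[_ h1] /andP[h2 _]; lra.
Qed.

(** Near the end of the segment a single isometry [A] expresses the continuation in a chart at the
    limit point; [local_adm] with this [A] extends it past [z]. *)
Lemma continues_limit : exists F, continues z F.
Proof.
have [q Hq] := gam_limit.
have [Psi [U [i [z0 [r [om [ch Uq]]]]]]] := dev_chart hM hdev q.
have [r0 [oU [U' dP UU']] om1 om2] := ch.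
have [n0 Hn0] := Hq U oU Uq; set t0 := tau n0 in Hn0.
have /andP[t00 t01] : 0 <= t0 < 1 by exact: tau01.
have Ug : U (gam t0) by apply: Hn0; rewrite // t00.
have a0 : adm (Ft t0) (t0 *: z) by apply: Ft_adm; rewrite ?t00 ?lexx.
have [A GA EA] := adm_dchart hdev ch a0 Ug.
(* From [t0] on the curve stays in the chart domain, so [adm_const] keeps the isometry [A]
   constant. *)
have germ (T : R) : t0 <= T < 1 -> \forall w \near T *: z, rowf Psi (Ft T w) = aff A (e w).
  move=> /andP[T0 T1].
  apply: (adm_const hdev e_rigid (@segment_set_connected t0 T z T0) (t0 := t0 *: z) _ dP _ GA).
  - by exists t0; rewrite ?lexx.
  - move=> _ [s /andP[s0 sT] ->]; have s00 := le_trans t00 s0.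
    split; first by apply: Ft_adm; rewrite ?s00.
    by apply: UU'; rewrite FtE ?s00 //; apply: Hn0; rewrite // s00 (le_lt_trans sT).
  - have := @Ft_agree t0 t0 T; rewrite t00 lexx T0 T1 => /(_ isT isT) H.
    by apply: filterS2 EA H => w [_ <-] ->.
  - by exists T; rewrite ?lexx ?T0.
have Eq : aff A (e z) = rowf Psi q.
  have lim1 : (fun n => rowf Psi (gam (tau n))) @ \oo --> rowf Psi q.
    move=> B nB; have := near_comp (@rowf_continuous _ _ _ hM _ Psi q) nB.
    move=> nB'; have : nbhs q (fun w => B (rowf Psi w)) := nB'; rewrite nbhsE => -[V [oV Vq] HV].
    have [n Hn] := Hq V oV Vq; exists n => // k /= nk; apply: HV; apply: Hn => //; exact: tau_ge.
  have lim2 : (fun n => rowf Psi (gam (tau n))) @ \oo --> aff A (e z).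
    have lt : (fun n => tau n *: z) @ \oo --> z.
      rewrite -[X in _ --> X]scale1r; apply: cvgZ; last exact: cvg_cst.
      rewrite -[X in _ --> X]subr0; apply: cvgB; first exact: cvg_cst.
      apply/cvgrPdist_lt => e0 e00; have := near_infty_natSinv_lt (PosNum e00).
      by apply: filterS => n; rewrite sub0r normrN ger0_norm // invr_ge0.
    have lA : (fun n => aff A (e (tau n *: z))) @ \oo --> aff A (e z).
      apply: (@continuous_cvg _ _ _ _ _ _ (fun y => aff A (e y))) lt.
      by apply: (@continuous_comp _ _ _ e (aff A)); [exact: ce|exact: aff_continuous].
    apply: cvg_trans lA; apply: near_eq_cvg; exists n0 => // n /= nn0.
    by rewrite -(nbhs_singleton (germ (tau n) _)) // tau_ge //; have /andP[] := tau01 n.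
  exact: (cvg_unique (@norm_hausdorff _ _) lim2 lim1).
have [F1q F1near] := local_adm ce eX ch GA Uq Eq.
set F1 := (fun w : 'rV[R]_d => om (ms i (aff A (e w)))) in F1near.
have /nbhs_ballP[r1 /= r10 Hr1] := F1near.
have r12 : 0 < r1 / 2 by rewrite divr_gt0.
(* So close to 1 that the ball of radius [r1] about [z] contains the rest of the segment together
   with its neighbourhood of radius [r3]. *)
have [t1 /andP[t10 t11] t1z] : exists2 t1 : R, t0 <= t1 < 1 & (1 - t1) * `|z| < r1 / 2.
  have [k Hk _] := tauK (normr_ge0 z) r12; exists (tau (maxn n0 k)).
    by rewrite tau_ge ?leq_maxl //; have /andP[] := tau01 (maxn n0 k).
  apply: le_lt_trans Hk; rewrite mulrC ler_wpM2l // lerD2l lerN2.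
  by apply: tau_ge; exact: leq_maxr.
have t1p : 0 <= t1 by exact: le_trans t10.
have [[r2 r20 Hr2] H0] : continues (t1 *: z) (Ft t1) by apply: FtP; rewrite t1p.
pose r3 := Num.min r2 (r1 / 2); have r30 : 0 < r3 by rewrite lt_min r20.
have Htube y : tube (t1 *: z) r3 y -> adm (Ft t1) y.
  by move=> [t tt yt]; apply: Hr2; exists t => //; apply: lt_le_trans yt _; rewrite ge_min lexx.
have oT : open (tube (t1 *: z) r3).
  have -> : tube (t1 *: z) r3 = \bigcup_(t in [set t : R | 0 <= t <= 1]) ball (t *: (t1 *: z)) r3.
    by apply/seteqP; split=> y [t tt]; rewrite -?ball_normE /= => yt; exists t => //; rewrite -?ball_normE /= distrC.
  by apply: bigcup_open => t _; exact: ball_open.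
have agree y : tube (t1 *: z) r3 y -> ball z r1 y -> Ft t1 y = F1 y.
  pose C := tube (t1 *: z) r3 `&` ball z r1; move=> Ty By.
  have z1 : C (t1 *: z).
    split; first by exists 1; rewrite ?lexx ?ler01 // scale1r subrr normr0.
    rewrite -ball_normE /= -[X in `|X - _|]scale1r -scalerBl normrZ ger0_norm ?subr_ge0 ?(ltW t11) //.
    by apply: lt_trans t1z _; move: r10; lra.
  (* The intersection of tube and ball is star-shaped about [t1 *: z], where the germs agree;
     uniqueness spreads the agreement over all of it. *)
  have cC : connected C.
    apply: (@convex_connected R _ _ (t1 *: z)) => // x u [[t /andP[ta tb] xt] Bx] /andP[u0 u1]; split.
      exists (u * (t - 1) + 1).
        have h1 : u * (1 - t) <= 1 - t by rewrite ler_piMl // subr_ge0.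
        have h2 : 0 <= u * (1 - t) by rewrite mulr_ge0 // subr_ge0.
        by move: h1 h2 ta; lra.
      have -> : u *: (x - t1 *: z) + t1 *: z - (u * (t - 1) + 1) *: (t1 *: z) = u *: (x - t *: (t1 *: z)).
        move: (t1 *: z) => w; apply/rowP => k; rewrite !mxE; ring.
      by rewrite normrZ ger0_norm //; apply: le_lt_trans xt; exact: ler_piMl.
    move: Bx; rewrite -!ball_normE /= => Bx.
    have -> : z - (u *: (x - t1 *: z) + t1 *: z) = u *: (z - x) + (1 - u) *: (z - t1 *: z).
      move: (t1 *: z) => w; apply/rowP => k; rewrite !mxE; ring.
    apply: le_lt_trans (ler_normD _ _) _; rewrite !normrZ (ger0_norm u0) (ger0_norm (_ : 0 <= 1 - u)) ?subr_ge0 //.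
    have Bz : `|z - t1 *: z| < r1 by case: z1 => _; rewrite -ball_normE.
    have [->|un] := eqVneq u 0; first by rewrite mul0r add0r subr0 mul1r.
    have up : 0 < u by rewrite lt_def un.
    have h1 : u * `|z - x| < u * r1 by rewrite ltr_pM2l.
    have h2 : (1 - u) * `|z - t1 *: z| <= (1 - u) * r1 by rewrite ler_wpM2l ?subr_ge0 // ltW.
    by move: h1 h2; lra.
  apply: (nbhs_singleton (adm_uniq hM hdev e_rigid cC z1 _ _ _ (conj Ty By))).
  - by move=> w [/Htube].
  - by move=> w [_ /Hr1[]].
  - have g1 := germ t1; rewrite t10 t11 in g1; have := g1 isT => {}g1.
    have a1 : adm (Ft t1) (t1 *: z) by apply: Ft_adm; rewrite ?t1p ?lexx.
    apply: (adm_formula ch a1.1 _ g1).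
    by rewrite -/(gam t1); apply: Hn0; rewrite // t1p.
pose F y := if pselect (tube (t1 *: z) r3 y) then Ft t1 y else F1 y.
have FT y : tube (t1 *: z) r3 y -> F y = Ft t1 y by rewrite /F; case: pselect.
have FB y : ball z r1 y -> F y = F1 y.
  by move=> By; rewrite /F; case: pselect => // Ty; exact: agree.
exists F; split; last first.
  have n0T : tube (t1 *: z) r3 0 by exists 0; rewrite ?lexx ?ler01 // scale0r subrr normr0.
  by apply: filterS2 H0 (open_nbhs_nbhs (conj oT n0T)) => w <- /FT.
exists r3 => // y [t /andP[ta tb] yt].
have [tt1|tt1] := leP t t1.
  have Ty : tube (t1 *: z) r3 y.
    have [t1e|t1n] := eqVneq t1 0.
      exists 0; rewrite ?lexx ?ler01 // scale0r; move: yt.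
      by have -> : t = 0; [apply/eqP; rewrite eq_le ta andbT -t1e|rewrite scale0r].
    have t1pp : 0 < t1 by rewrite lt_def t1n.
    exists (t / t1); first by apply: ratio01; rewrite ?ta.
    by rewrite scalerA divfK.
  apply: (adm_eq (Htube y Ty)); apply: filterS (open_nbhs_nbhs (conj oT Ty)) => w /FT ->.
  by [].
have By : ball z r1 y.
  rewrite -ball_normE /=; apply: le_lt_trans (ler_distD (t *: z) _ _) _.
  rewrite -[X in `|X - t *: z|]scale1r -scalerBl normrZ ger0_norm ?subr_ge0 // distrC.
  have h1 : (1 - t) * `|z| <= (1 - t1) * `|z| by rewrite ler_wpM2r // lerD2l lerN2 ltW.
  have h2 : r3 <= r1 / 2 by rewrite ge_min lexx orbT.
  by move: h1 h2 t1z yt; rewrite -[`|y - _|]normrN opprB; lra.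
have [aF1 _ _] := Hr1 y By.
have oB : open (ball z r1) by exact: ball_open.
by apply: (adm_eq aF1); apply: filterS (open_nbhs_nbhs (conj oB By)) => w /FB ->.
Qed.

End Limit.

(** The supremum of the reachable parameters is reached by [continues_limit] and, were it below 1,
    exceeded by [continues_near]. *)
Lemma continues_all z : exists F, continues z F.
Proof.
pose S := [set s : R | 0 <= s <= 1 /\ exists F, continues (s *: z) F].
have S0 : S 0 by split; [rewrite lexx ler01|rewrite scale0r; exact: continues0].
have ubS : ubound S 1 by move=> s [/andP[]].
have hS : has_sup S by split; [exists 0|exists 1].
set s1 := sup S; have s1le : s1 <= 1 by apply: sup_le_ub => //; exists 0.
have s1ge : 0 <= s1 by apply: ub_le_sup => //; exists 1.
have below (s : R) : 0 <= s < s1 -> exists F, continues (s *: z) F.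
  move=> /andP[s0 ss1]; have ps : 0 < s1 - s by rewrite subr_gt0.
  have [s' [/andP[s'0 s'1] [F HF]]] := sup_adherent ps hS.
  rewrite -/s1 subKr => ss'; exists F.
  have s'p : 0 < s' by exact: le_lt_trans ss'.
  have -> : s *: z = (s / s') *: (s' *: z) by rewrite scalerA divfK // gt_eqF.
  by apply: continues_shrink => //; rewrite divr_ge0 // ler_pdivrMr // mul1r ltW.
have [F HF] : exists F, continues (s1 *: z) F.
  have [->|s1n] := eqVneq s1 0; first by rewrite scale0r; exact: continues0.
  have s1p : 0 < s1 by rewrite lt_def s1n.
  apply: continues_limit => t /andP[ta tb]; rewrite scalerA; apply: below.
  by rewrite mulr_ge0 //= gtr_pMl.
have [s11|s11] := eqVneq s1 1; first by exists F; rewrite -[z]scale1r -s11.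
have s1lt : s1 < 1 by rewrite lt_neqAle s11.
have cz : {for s1, continuous (fun s : R => s *: z)} by apply: cvgZ; [exact: cvg_id|exact: cvg_cst].
have n1 := near_comp cz (continues_near HF).
have n2 : \forall s \near s1, s < 1 by exact: (open_nbhs_nbhs (conj (@open_lt R 1) s1lt)).
have /nbhs_ballP[r /= r0 Hr] : nbhs s1 (fun s : R => continues (s *: z) F /\ s < 1) by exact: filterI.
have [|h1 h2] := Hr (s1 + r / 2).
  by rewrite -ball_normE /= opprD addrA subrr sub0r normrN gtr0_norm ?divr_gt0 //; move: r0; lra.
have : s1 + r / 2 <= s1.
  apply: ub_le_sup; first by exists 1.
  by split; [rewrite (ltW h2) andbT addr_ge0 // divr_ge0 // ltW|exists F].
by move: r0; lra.
Qed.

(** The value at [z] is that of the continuation along the ray to [z]. One continuation also serves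
    all neighbouring rays, so the diagonal function is locally one of them. *)
Lemma continuation : exists2 F : 'rV[R]_d -> M, forall z, adm F z & \forall y \near (0 : 'rV[R]_d), F y = F0 y.
Proof.
have /choice[Fz HF] := continues_all.
have key z : \forall w \near z, Fz w w = Fz z w.
  have nz := continues_near (HF z); apply: filterS nz => w hw.
  have := continues_agree (HF w) hw (_ : 0 <= (1 : R) <= 1); rewrite scale1r ler01 lexx => /(_ isT).
  exact: nbhs_singleton.
exists (fun z => Fz z z).
  move=> z; have a : adm (Fz z) z by rewrite -[X in adm _ X]scale1r; apply: continues_adm; [exact: HF|rewrite ler01 lexx].
  by apply: (adm_eq a); apply: filterS (key z) => w ->.
by have [_ h] := HF 0; apply: filterS2 (key 0) h => w -> ->.
Qed.

End ContinuationStep.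

(** * The model as a connected manifold *)

Section ModelSpace.
Context {R : realType} {d N : nat} (X : model R d N).
Notation E := (embedded (mpts X)).

Lemma embedded_val_continuous {n} (A : set 'rV[R]_n) : continuous (set_val : embedded A -> 'rV[R]_n).
Proof. exact: initial_continuous. Qed.

Lemma embedded_continuous {n} (A : set 'rV[R]_n) (T : topologicalType) (f : T -> embedded A) t :
  {for t, continuous (fun w => set_val (f w) : 'rV[R]_n)} -> {for t, continuous f}.
Proof.
move=> cf B; rewrite nbhsE => -[V [oV Vt] VB]; case: oV => C oC EC.
have nC : nbhs (set_val (f t) : 'rV[R]_n) C by apply: open_nbhs_nbhs; split=> //; move: Vt; rewrite -EC.
by apply: filterS (near_comp cf nC) => w Cw; apply: VB; rewrite -EC.
Qed.

Lemma embedded_hausdorff {n} (A : set 'rV[R]_n) : hausdorff_space (embedded A).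
Proof.
move=> x y H; apply: set_val_inj; apply: (@norm_hausdorff _ 'rV[R]_n) => B C nB nC.
have [w [Bw Cw]] := H _ _ (near_comp (@embedded_val_continuous _ A x) nB) (near_comp (@embedded_val_continuous _ A y) nC).
by exists (set_val w).
Qed.

Definition mpoint (x : 'rV[R]_N) (Xx : mpts X x) : E := SigSub (mem_set Xx).

Lemma mpointE x (Xx : mpts X x) : set_val (mpoint Xx) = x.
Proof. by []. Qed.

Definition mchart (i : mI X) (z : 'rV[R]_d) : E := let: And4 h _ _ _ := m_c i z in mpoint h.

Lemma mchartE i z : set_val (mchart i z) = mc i z.
Proof. by rewrite /mchart; case: (m_c i z). Qed.

Lemma mc_continuous (i : mI X) : continuous (mc i).
Proof.
move=> z; apply: (@row_cvgP _ _ _ (nbhs z)) => j; apply: Coo_at_continuous.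
by have [_ _ _] := m_c i z.
Qed.

Lemma mchart_continuous i : continuous (mchart i).
Proof.
move=> z; apply: embedded_continuous.
rewrite (_ : (fun w => set_val (mchart i w)) = mc i); first exact: mc_continuous.
by apply/funext => w; rewrite mchartE.
Qed.

Lemma ms_continuous (i : mI X) (x : E) : mO i (set_val x) -> {for x, continuous (fun y : E => ms i (set_val y))}.
Proof.
move=> Ox; apply: (@continuous_comp _ _ _ (set_val : E -> 'rV[R]_N) (ms i)); first exact: embedded_val_continuous.
apply: (@row_cvgP _ _ _ (nbhs (set_val x : 'rV[R]_N))) => j; apply: Coo_at_continuous.
by have [] := m_s Ox.
Qed.

Lemma mchartK i (x : E) : mO i (set_val x) -> mchart i (ms i (set_val x)) = x.
Proof.
move=> Ox; apply: set_val_inj; rewrite mchartE; have [_ ->] := m_s Ox => //; exact: set_valP.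
Qed.

Lemma mO_open (i : mI X) : open [set x : E | mO i (set_val x)].
Proof.
apply: (@open_comp _ _ (set_val : E -> 'rV[R]_N) (mO i)); last exact: m_O.
by move=> x _; exact: embedded_val_continuous.
Qed.

Lemma model_is_chart i : is_chart [set x : E | mO i (set_val x)] (fun x : E => ms i (set_val x)) (mchart i).
Proof.
have im : (fun x : E => ms i (set_val x)) @` [set x : E | mO i (set_val x)] = setT.
  apply/seteqP; split=> // z _; exists (mchart i z); rewrite /= mchartE; first by have [] := m_c i z.
  by have [_ _ ->] := m_c i z.
split.
- by split; [exact: mO_open|rewrite im; exact: openT].
- by move=> x; exact: mchartK.
- by move=> x; exact: ms_continuous.
- by move=> z _; exact: mchart_continuous.
- move=> x f Ox; have [Cs _] := m_s Ox; split.
    move=> [F CF fF]; have [_ _ _ Cc] := m_c i (ms i (set_val x)).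
    have e1 : mc i (ms i (set_val x)) = set_val x by have [_ ->] := m_s Ox => //; exact: set_valP.
    apply: (@Coo_at_near _ _ _ (F \o mc i)); first by apply: Coo_at_rowcomp => //; rewrite e1.
    have c' : {for ms i (set_val x), continuous (mchart i)} by exact: mchart_continuous.
    have H' : nbhs (mchart i (ms i (set_val x))) (fun q => f q = F (set_val q)) by rewrite mchartK.
    by apply: filterS (near_comp c' H') => w /= ->; rewrite mchartE.
  move=> C; exists (fun y => f (mchart i (ms i y))); first exact: (@Coo_at_rowcomp R _ _ (ms i) (f \o mchart i)).
  by apply: filterS (open_nbhs_nbhs (conj (mO_open i) Ox)) => q Oq; rewrite mchartK.
Qed.

Lemma model_manifold : is_manifold d E.
Proof.
split.
- exact: embedded_hausdorff.
- exact: embedded_second_countable.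
- move=> x; have [i Ox] := m_cover (set_valP x).
  by exists [set x : E | mO i (set_val x)], (fun x : E => ms i (set_val x)), (mchart i); split=> //; exact: model_is_chart.
Qed.

Lemma model_connected : is_connected E.
Proof.
have [b Xb Ob] := m_base X; split; first by exists (mpoint Xb).
have -> : [set: E] = \bigcup_(i in [set: mI X]) (mchart i @` setT).
  apply/seteqP; split=> // x _; have [i Ox] := m_cover (set_valP x).
  by exists i => //; exists (ms i (set_val x)) => //; exact: mchartK.
apply: bigcup_connected.
  by exists (mpoint Xb) => i _; exists (ms i b) => //; apply: (@mchartK i (mpoint Xb)); exact: Ob.
move=> i _; apply: connected_continuous_connected.
  by apply: (@convex_connected R _ setT 0) => //.
by apply: continuous_subspaceT; exact: mchart_continuous.
Qed.

End ModelSpace.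

(** * The covering map from the model to M *)

Section DevelopedCovering.
Context {R : realType} {M : smoothSpace R} {d N : nat} (X : model R d N).
Hypothesis hM : is_manifold d M.
Hypothesis hconn : is_connected M.
Variable g : riemannian M.
Hypothesis complete : is_complete g.
Variable dev : ('I_N -> smoothFun M) -> set M -> Prop.
Hypothesis hdev : developing X g dev.
Notation E := (embedded (mpts X)).
Let val_E : E -> 'rV[R]_N := set_val.

Lemma adm_comp (T T' : topologicalType) (e : T -> 'rV[R]_N) (e' : T' -> 'rV[R]_N) (h : T' -> T) (F : T -> M) t A :
  mG X A -> {for t, continuous h} -> adm X dev e F (h t) -> (\forall w \near t, e (h w) = aff A (e' w)) ->
  adm X dev e' (F \o h) t.
Proof.
move=> GA ch [cF [Psi [U [B [dP Ut GB HB]]]]] He; split; first exact: continuous_comp.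
have [C GC HC] := m_Gcomp GB GA; exists Psi, U, C; split=> //.
by apply: filterS2 He (near_comp ch HB) => w Ew /= ->; rewrite Ew HC.
Qed.

Lemma chart_continuation (j : mI X) (F0 : 'rV[R]_d -> M) (z : 'rV[R]_d) : adm X dev (mc j) F0 z ->
  exists2 F : 'rV[R]_d -> M, forall w, adm X dev (mc j) F w & \forall w \near z, F w = F0 w.
Proof.
move=> a0; have [I0 GI HI] := m_Gid X.
pose e (w : 'rV[R]_d) := mc j (w + z).
have csh (a w : 'rV[R]_d) : {for w, continuous (fun w : 'rV[R]_d => w + a)}.
  apply: (@row_cvgP _ _ _ (nbhs w)) => k; apply: Coo_at_continuous; under eq_fun do rewrite mxE.
  by apply: Coo_atD; [exact: Coo_at_coord|exact: Coo_at_cst].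
have Ce w k : Coo_at w (fun w => e w 0 k).
  have [_ _ _ Cc] := m_c j (w + z).
  apply: (@Coo_at_rowcomp R _ _ (fun w => w + z) (fun w => mc j w 0 k)); last exact: Cc.
  by move=> i; under eq_fun do rewrite mxE; apply: Coo_atD; [exact: Coo_at_coord|exact: Coo_at_cst].
have eX w : mpts X (e w) by have [] := m_c j (w + z).
have er (w : 'rV[R]_d) A A' : (\forall y \near w, aff A (e y) = aff A' (e y)) -> A = A'.
  move=> H; apply: (@m_rigid _ _ _ X j (w + z)).
  have H' : nbhs ((w + z) + (- z)) (fun y => aff A (e y) = aff A' (e y)) by rewrite addrK.
  by apply: filterS (near_comp (csh (- z) (w + z)) H') => y; rewrite /e subrK.
have a1 : adm X dev e (F0 \o (fun w => w + z)) 0.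
  apply: (adm_comp (e := mc j) GI (csh z 0)) => /=; first by rewrite add0r.
  by apply: filterE => w; rewrite HI.
have [F aF F0E] := continuation hM hconn complete hdev Ce eX er a1.
exists (F \o (fun w => w - z)).
  move=> w; apply: (adm_comp (e := e) GI (csh (- z) w) (aF _)).
  by apply: filterE => y; rewrite HI /e subrK.
have H' : nbhs (z + (- z)) (fun y => F y = F0 (y + z)) by rewrite subrr.
by apply: filterS (near_comp (csh (- z) z) H') => y /= ->; rewrite subrK.
Qed.

(** Every chart contains the base point, so the same germ is continued in all of them. Overlaps are
    connected, hence [adm_uniq] makes the continuations agree on them and they glue. *)
Lemma global_adm : exists F : E -> M, forall x, adm X dev val_E F x.
Proof.
have [I0 GI HI] := m_Gid X; have [b Xb Ob] := m_base X.
have [[p _] _] := hconn.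
have [Psi [U [i [z0 [r [om [ch Up]]]]]]] := dev_chart hM hdev p.
have [r0 [oU [U' dP UU']] om1 om2] := ch; have [Xp Op mp omp] := om2 p Up.
have mcX (j : mI X) z : mpts X (mc j z) by have [] := m_c j z.
have e1 : aff I0 (mc i (ms i (rowf Psi p))) = rowf Psi p by rewrite HI; have [_ ->] := m_s Op.
have [_ N1] := local_adm (@mc_continuous _ _ _ X i) (mcX i) ch GI Up e1.
have [a1 _ _] := nbhs_singleton N1.
have [Fi aFi _] := chart_continuation a1.
have tr (j k : mI X) z : mO k (mc j z) -> {for z, continuous (fun w => ms k (mc j w))}.
  move=> Oz; apply: (@continuous_comp _ _ _ (mc j) (ms k)); first exact: mc_continuous.
  apply: (@row_cvgP _ _ _ (nbhs (mc j z))) => l; apply: Coo_at_continuous.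
  by have [] := m_s Oz.
have nO (j k : mI X) z : mO k (mc j z) -> \forall w \near z, mO k (mc j w).
  by move=> Oz; apply: (near_comp (@mc_continuous _ _ _ X j z)); apply: open_nbhs_nbhs; split=> //; exact: m_O.
have back (j k : mI X) z : mO k (mc j z) -> mc k (ms k (mc j z)) = mc j z.
  by move=> Oz; have [_ ->] := m_s Oz.
have adm_tr (j k : mI X) F z : mO k (mc j z) -> adm X dev (mc k) F (ms k (mc j z)) ->
    adm X dev (mc j) (F \o (fun w => ms k (mc j w))) z.
  move=> Oz aF; apply: (adm_comp GI (tr j k z Oz) aF).
  by apply: filterS (nO j k z Oz) => w Ow; rewrite HI back.
have bj (j : mI X) : mc j (ms j b) = b by have [_ ->] := m_s (Ob j).
have HFs_ex : forall j : mI X, exists F : 'rV[R]_d -> M, (forall w, adm X dev (mc j) F w) /\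
    \forall w \near ms j b, F w = Fi (ms i (mc j w)).
  move=> j; have [|F aF EF] := @chart_continuation j (Fi \o (fun w => ms i (mc j w))) (ms j b).
    by apply: adm_tr => //; rewrite bj.
  by exists F.
have [Fs HFs] := choice HFs_ex.
have agree j k z : mO k (mc j z) -> Fs j z = Fs k (ms k (mc j z)).
  move=> Oz.
  have Ob' : mO k (mc j (ms j b)) by rewrite bj.
  suff H : \forall w \near z, Fs j w = (Fs k \o (fun w => ms k (mc j w))) w by exact: (nbhs_singleton H).
  apply: (adm_uniq hM hdev (@m_rigid _ _ _ X j) (@m_conn _ _ _ X j k) (t0 := ms j b)) => //.
  - by move=> w _; exact: (HFs j).1.
  - by move=> w Ow; apply: adm_tr => //; exact: (HFs k).1.
  - have H' : nbhs (ms k (mc j (ms j b))) (fun w => Fs k w = Fi (ms i (mc k w))) by rewrite bj; exact: (HFs k).2.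
    apply: filterS3 (HFs j).2 (near_comp (tr j k _ Ob') H') (nO j k _ Ob') => w -> /= -> Ow; by rewrite back.
have idx_ex : forall x : E, exists i : mI X, mO i (set_val x).
  by move=> x; exact: m_cover (set_valP x).
have [idx Hidx] := choice idx_ex.
exists (fun x => Fs (idx x) (ms (idx x) (set_val x))) => x.
set j := idx x; have Oj : mO j (set_val x) by exact: Hidx.
have a2 : adm X dev val_E (Fs j \o (fun y : E => ms j (set_val y))) x.
  apply: (adm_comp GI (ms_continuous Oj) ((HFs j).1 _)).
  apply: filterS (open_nbhs_nbhs (conj (mO_open j) Oj)) => y Oy.
  by rewrite HI; have [_ ->] := m_s Oy => //; exact: set_valP.
apply: (adm_eq a2); apply: filterS (open_nbhs_nbhs (conj (mO_open j) Oj)) => y Oy /=.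
have yj : mc j (ms j (set_val y)) = set_val y by have [_ ->] := m_s Oy => //; exact: set_valP.
by rewrite (agree j (idx y)) yj //; exact: Hidx.
Qed.

Lemma adm_embedded_smooth F (x : E) f : adm X dev val_E F x -> smooth_at M (F x) f -> smooth_at E x (f \o F).
Proof.
move=> aF sf; have [Psi [U [i [z0 [r [om [ch Ux]]]]]]] := dev_chart hM hdev (F x).
have [A GA HA] := adm_dchart hdev ch aF Ux.
have HA' : \forall w \near x, rowf Psi (F w) = aff A (val_E w) by apply: filterS HA => w [].
have N2 := adm_formula ch aF.1 Ux HA'.
have [_ _ om1 om2] := ch; have [_ Oq mr omq] := om2 _ Ux.
have Ex := nbhs_singleton HA'.
exists (fun y => f (om (ms i (aff A y)))); last by apply: filterS N2 => w /= ->.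
have CA k : Coo_at (set_val x : 'rV[R]_N) (fun w => aff A w 0 k).
  under eq_fun do rewrite !mxE; apply: Coo_atD; last exact: Coo_at_cst.
  apply: Coo_at_sum => j; apply: (@Coo_atM _ _ _ (fun w : 'rV[R]_N => w 0 j) (cst (A.1 j k))); [exact: Coo_at_coord|exact: Coo_at_cst].
apply: (@Coo_at_rowcomp R _ _ (fun w => ms i (aff A w)) (f \o om)).
  move=> k; apply: (@Coo_at_rowcomp R _ _ (aff A) (fun x => ms i x 0 k)) => //.
  by rewrite -Ex; have [] := m_s Oq.
by rewrite -Ex; have [_ _ _] := om1 _ mr; apply; rewrite omq.
Qed.

Lemma global_map : exists F : smoothMap E M, forall x, adm X dev val_E F x.
Proof.
have [F aF] := global_adm.
have sF : smooth_on setT (F : E -> M).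
  by move=> x _; split; [exact: (aF x).1|move=> f; exact: adm_embedded_smooth].
by exists (SmoothMap sF).
Qed.

Lemma map_isometric (F : smoothMap E M) : (forall x, adm X dev val_E F x) ->
  forall x (u v : tangent E x), induced_metric u v = riem_at g (F x) (tmap F u) (tmap F v).
Proof.
move=> aF x u v; have [cF [Psi [U [A [dP Ux GA HA]]]]] := aF x; have [d1 _ _] := hdev.
have [oU HU] := d1 _ _ dP; have [_ ->] := HU _ Ux.
pose uc (w : tangent E x) : 'rV[R]_N := \row_k w (coord_fun (mpts X) k).
have tE (w : tangent E x) k : tmap F w (Psi k) = (uc w *m A.1) 0 k.
  rewrite -[LHS]/(w (pullback F (Psi k))).
  pose e1 : smoothFun E := 1.
  rewrite (tangent_local (model_manifold X) w (h := \sum_i A.1 i k *: coord_fun (mpts X) i + A.2 0 k *: e1)).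
    rewrite tangent_addr tangent_scale (tangent_one w : w e1 = 0) mulr0 addr0 tangent_sum mxE.
    by apply: eq_bigr => i _; rewrite tangent_scale mxE mulrC.
  apply: filterS HA => y /rowP/(_ k); rewrite !mxE => Ey.
  rewrite -[LHS]/(Psi k (F y)) Ey !smoothE smooth_sumE /e1 smooth_oneE /GRing.scale /= mulr1; congr (_ + _).
  by apply: eq_bigr => i _; exact: mulrC.
have -> : \sum_k tmap F u (Psi k) * tmap F v (Psi k) = dot (uc u *m A.1) (uc v *m A.1).
  by apply: eq_bigr => k _; rewrite !tE.
have dotmx (a b : 'rV[R]_N) : dot a b = (a *m b^T) 0 0.
  by rewrite mxE; apply: eq_bigr => i _; rewrite mxE.
rewrite dotmx trmx_mul mulmxA -(mulmxA (uc u)) (m_orth GA) mulmx1 -dotmx.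
by apply: eq_bigr => k _; rewrite !mxE.
Qed.

Section Sheets.
Variable F : smoothMap E M.
Hypothesis aF : forall x, adm X dev val_E F x.

Let cF x : {for x, continuous (F : E -> M)}. Proof. exact: (aF x).1. Qed.

Lemma locally_injective (x : E) : exists V : set E, nbhs x V /\ forall y y', V y -> V y' -> F y = F y' -> y = y'.
Proof.
have [_ [Psi [U [A [dP Ux GA HA]]]]] := aF x; have [B GB HB] := m_Ginv GA.
exists (fun w => rowf Psi (F w) = aff A (val_E w)); split=> // y y' Ey Ey' E1.
apply: set_val_inj; rewrite -(HB (set_val y)).1 -(HB (set_val y')).1.
by rewrite -[aff A (set_val y)]Ey -[aff A (set_val y')]Ey' E1.
Qed.

(** The fixed value [x0] off [U] makes sections that agree on [U] equal as functions, so that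
    sections can index the sheets of the covering. *)
Definition section_on (U : set M) (x0 : E) (s : M -> E) : Prop :=
  [/\ smooth_on U s, forall q, U q -> F (s q) = q & forall q, ~ U q -> s q = x0].

Lemma section_uniq U x0 s s' q : connected U -> open U -> section_on U x0 s -> section_on U x0 s' ->
  U q -> s q = s' q -> s = s'.
Proof.
move=> cU oU [ss sF s0] [ss' sF' s0'] Uq Eq.
pose B := [set w | U w /\ s w = s' w].
have nB w : B w -> nbhs w B.
  move=> [Uw Ew]; have [V [nV HV]] := locally_injective (s w).
  have n1 := near_comp (ss w Uw).1 nV.
  have nV' : nbhs (s' w) V by rewrite -Ew.
  have n2 := near_comp (ss' w Uw).1 nV'.
  apply: filterS3 n1 n2 (open_nbhs_nbhs (conj oU Uw)) => y Vy Vy' Uy; split=> //.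
  by apply: HV => //; rewrite sF ?sF'.
have oB : open B by rewrite openE => w; exact: nB.
have clB w : U w -> closure B w -> B w.
  move=> Uw cl; split=> //; apply: (@embedded_hausdorff R N (mpts X)) => A1 A2 n1 n2.
  have [y [[Uy Ey] [A1y A2y]]] := cl _ (filterI (near_comp (ss w Uw).1 n1) (near_comp (ss' w Uw).1 n2)).
  by exists (s y); split=> //; rewrite Ey.
have EB : B = U.
  apply: cU; first by exists q.
  - by exists B => //; apply/seteqP; split=> w []; [move=> ? ?; split|].
  - exists (closure B); first exact: closed_closure.
    apply/seteqP; split=> w; first by move=> Bw; split; [exact: Bw.1|exact: subset_closure].
    by move=> [Uw cw]; exact: clB.
apply/funext => w; have [Uw|nU] := pselect (U w); last by rewrite s0 ?s0'.
by have [] : B w by rewrite EB.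
Qed.

Lemma section_open U x0 s : open U -> section_on U x0 s -> open (s @` U).
Proof.
move=> oU [ss sF s0]; rewrite openE => _ [q Uq <-].
have [V [nV HV]] := locally_injective (s q).
have nU : nbhs q (fun w => U w /\ V (s w)).
  by apply: filterI; [exact: open_nbhs_nbhs|exact: near_comp (ss q Uq).1 nV].
have nU' : nbhs (F (s q)) (fun w => U w /\ V (s w)) by rewrite sF.
apply: filterS2 nV (near_comp (@cF (s q)) nU') => y Vy [Uy Vsy].
by exists (F y) => //; apply: HV => //; rewrite sF.
Qed.

(** If [A] expresses [F] near [x] and [B] inverts [A], the section is [B] after the developing map.
    In model coordinates [F] after it and [om] are both admissible on a ball and agree near one
    point, hence everywhere. *)
Lemma section_exists (Psi : 'I_N -> smoothFun M) U (i : mI X) z0 r om (x x0 : E) :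
  dchart dev Psi U i z0 r om -> U (F x) -> exists2 s, section_on U x0 s & s (F x) = x.
Proof.
move=> ch Ux; have [r0 [oU [U' dP UU']] om1 om2] := ch.
have [A GA HA] := adm_dchart hdev ch (aF x) Ux; have [B GB HB] := m_Ginv GA.
have [I0 GI HI] := m_Gid X.
have kX z : mpts X (aff B (mc i z)) by apply: m_Gset => //; have [] := m_c i z.
pose k z : E := mpoint (kX z).
have ck : continuous k.
  move=> z; apply: embedded_continuous; apply: (@continuous_comp _ _ _ (mc i) (aff B)); first exact: mc_continuous.
  exact: aff_continuous.
have [_ _ _ omx] := om2 _ Ux; set z1 := ms i (rowf Psi (F x)) in omx.
have cz z : U (om z) -> `|z - z0| < r -> rowf Psi (om z) = mc i z by move=> _ /om1[].
have xE := (nbhs_singleton HA).2; have [Xq Oq mq _] := om2 _ Ux.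
have kz1 : k z1 = x.
  apply: set_val_inj; rewrite /k mpointE /z1; have [_ ->] := m_s Oq => //.
  by rewrite xE (HB _).1.
have Fk z : `|z - z0| < r -> F (k z) = om z.
  move=> zr; pose D := [set z : 'rV[R]_d | `|z - z0| < r].
  have D1 : D z1 by [].
  have oD : open D.
    rewrite (_ : D = ball z0 r); first exact: ball_open.
    by apply/seteqP; split=> y /=; rewrite /D -ball_normE /= distrC.
  have cD : connected D.
    apply: (@convex_connected R _ D z0); first by rewrite /D /= subrr normr0.
    move=> y t Dy t01; rewrite /D /= addrK; apply: le_lt_trans Dy; exact: segment_norm.
  have admk w : adm X dev (mc i) (F \o k) w.
    by apply: (adm_comp GB (ck w) (aF (k w))); exact: filterE.
  have admo w : D w -> adm X dev (mc i) om w.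
    move=> Dw; have [h1 h2 h3 h4] := om1 w Dw; split=> //; exists Psi, U', I0; split=> //; first exact: UU'.
    by apply: filterS (open_nbhs_nbhs (conj oD Dw)) => y /om1[_ ->]; rewrite HI.
  apply: (nbhs_singleton (adm_uniq hM hdev (@m_rigid _ _ _ X i) cD D1 (fun w _ => admk w) admo _ (zr : D z))).
  have HA' : nbhs (k z1) (fun w => U (F w) /\ rowf Psi (F w) = aff A (val_E w)) by rewrite kz1.
  apply: filterS2 (near_comp (ck z1) HA') (open_nbhs_nbhs (conj oD D1)) => w [Uw Ew] Dw.
  have [h1 h2 _ _] := om1 w Dw; apply: (dchart_inj ch) => //; rewrite /= Ew h2.
  by rewrite /val_E /k mpointE (HB _).2.
have sX q : mpts X (if pselect (U q) then aff B (rowf Psi q) else set_val x0).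
  by case: (pselect (U q)) => [Uq|_] /=; [have [h _ _ _] := om2 _ Uq; exact: (m_Gset GB h)|exact: set_valP].
pose s q : E := mpoint (sX q).
have sU q : U q -> set_val (s q) = aff B (rowf Psi q) by rewrite /s mpointE; case: pselect.
have sk q : U q -> s q = k (ms i (rowf Psi q)).
  move=> Uq; apply: set_val_inj; rewrite sU // /k mpointE; have [h1 h2 _ _] := om2 q Uq.
  by have [_ ->] := m_s h2.
exists s; last by rewrite sk.
split.
- move=> q Uq; have cs : {for q, continuous s}.
    apply: embedded_continuous; rewrite /prop_for /continuous_at sU //.
    have cA : {for q, continuous (fun q => aff B (rowf Psi q))}.
      by apply: continuous_comp; [exact: (rowf_continuous hM)|exact: aff_continuous].
    apply: cvg_trans cA; apply: near_eq_cvg.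
    by apply: filterS (open_nbhs_nbhs (conj oU Uq)) => w /sU ->.
  split=> // f [Phi CPhi fPhi].
  apply: (@smooth_at_near _ _ q (fun w => Phi (aff B (rowf Psi w)))).
    apply: (smooth_at_rowf hM (Phi := fun y => Phi (aff B y))).
    apply: (@Coo_at_rowcomp R _ _ (aff B) Phi); last by rewrite -sU.
    move=> l; under eq_fun do rewrite !mxE; apply: Coo_atD; last exact: Coo_at_cst.
    apply: Coo_at_sum => j; apply: (@Coo_atM _ _ _ (fun w : 'rV[R]_N => w 0 j) (cst (B.1 j l))); [exact: Coo_at_coord|exact: Coo_at_cst].
  by apply: filterS2 (near_comp cs fPhi) (open_nbhs_nbhs (conj oU Uq)) => w /= -> Uw; rewrite sU.
- by move=> q Uq; rewrite sk //; have [_ _ h3 h4] := om2 q Uq; rewrite Fk.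
- by move=> q nU; apply: set_val_inj; rewrite /s mpointE; case: pselect.
Qed.

Lemma map_surjective q : exists x, F x = q.
Proof.
have [[p0 _] conn] := hconn; have [b Xb _] := m_base X; pose x0 : E := mpoint Xb.
pose A := [set q | exists x, F x = q].
have key p : exists U, [/\ open U, U p & forall q, U q -> A q -> U `<=` A].
  have [Psi [U [i [z0 [r [om [ch Up]]]]]]] := dev_chart hM hdev p.
  have [_ [oU _] _ _] := ch; exists U; split=> // q' Uq [x Fx] w Uw.
  have [|s [_ sF _] _] := @section_exists Psi U i z0 r om x x0 ch; first by rewrite Fx.
  by exists (s w); exact: sF.
have oA : open A.
  rewrite openE => p Ap; have [U [oU Up HU]] := key p.
  by apply: filterS (open_nbhs_nbhs (conj oU Up)) => w; exact: (HU p).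
have clA : closed A.
  move=> p cl; have [U [oU Up HU]] := key p.
  have [w [Aw Uw]] := cl _ (open_nbhs_nbhs (conj oU Up)); exact: (HU w).
have EA : A = setT.
  apply: conn; first by exists (F x0); exists x0.
  - by exists A => //; rewrite setTI.
  - by exists A => //; rewrite setTI.
by have : A q by rewrite EA.
Qed.

(** Over a developing chart the sheets are the images of all sections; a common point of two images
    forces the sections to be equal, since the domain is connected. *)
Lemma map_covering : is_covering F.
Proof.
split; first exact: map_surjective.
move=> p; have [Psi [U [i [z0 [r [om [ch Up]]]]]]] := dev_chart hM hdev p.
have [r0 [oU _] om1 om2] := ch; have [b Xb _] := m_base X; pose x0 : E := mpoint Xb.
have cU : connected U.
  have -> : U = om @` [set z : 'rV[R]_d | `|z - z0| < r].
    apply/seteqP; split=> [q /om2[_ _ h1 h2]|_ [z /om1[h _ _ _] <-] //].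
    by exists (ms i (rowf Psi q)).
  apply: connected_continuous_connected.
    apply: (@convex_connected R _ _ z0); first by rewrite /= subrr normr0.
    move=> y t Dy t01; rewrite /= addrK; apply: le_lt_trans Dy; exact: segment_norm.
  by apply: continuous_in_subspaceT => z; rewrite inE => /om1[].
exists U, {s : M -> E | section_on U x0 s}, (fun s => sval s @` U), sval; split=> //.
- apply/seteqP; split=> [x /= Ux|x [[s [ss sF s0]] _ [q Uq <-]] /=]; last by rewrite sF.
  have [s Hs sx] := section_exists x0 ch Ux.
  by exists (exist _ s Hs) => //; exists (F x).
- move=> [s Hs] [s' Hs'] [x [[q Uq /= sq] [q' Uq' /= sq']]].
  have E1 : q = q' by case: Hs => _ h _; case: Hs' => _ h' _; rewrite -(h q Uq) -(h' q' Uq') sq sq'.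
  have ss' : s = s' by apply: (section_uniq cU oU Hs Hs' Uq); rewrite sq E1.
  by subst s'; congr exist; exact: Prop_irrelevance.
- by move=> [s Hs]; exact: section_open Hs.
- move=> [s [ss sF s0]]; split=> //=.
    by move=> y Uy; split; [exists y|exact: sF].
  by move=> _ [q Uq <-]; rewrite sF.
Qed.

End Sheets.

End DevelopedCovering.

(** * The splitting of the tangent spaces *)

Section SymplecticBasis.
Context {R : realType} {d : nat}.

Definition bform (Om : 'M[R]_d) (x y : 'rV[R]_d) : R := (x *m Om *m y^T) 0 0.

Lemma bform_addl Om x y z : bform Om (x + y) z = bform Om x z + bform Om y z.
Proof. by rewrite /bform !mulmxDl mxE. Qed.
Lemma bform_scalel Om a x z : bform Om (a *: x) z = a * bform Om x z.
Proof. by rewrite /bform -!scalemxAl mxE. Qed.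
Lemma bform_addr Om x y z : bform Om z (x + y) = bform Om z x + bform Om z y.
Proof. by rewrite /bform linearD /= mulmxDr mxE. Qed.
Lemma bform_scaler Om a x z : bform Om z (a *: x) = a * bform Om z x.
Proof. by rewrite /bform linearZ /= -scalemxAr mxE. Qed.

Lemma bform_delta Om i j : bform Om (delta_mx 0 i) (delta_mx 0 j) = Om i j.
Proof. by rewrite /bform -rowE trmx_delta -colE !mxE. Qed.

(* x_0, x_1, x_2, ... is a sequence of hyperbolic pairs for the form B. *)
Definition hyperbolic k {V : Type} (B : V -> V -> R) (x : 'I_k -> V) : Prop :=
  forall i j : 'I_k, B (x i) (x j) =
    if (~~ odd i) && (j == i.+1 :> nat) then 1 else
    if (~~ odd j) && (i == j.+1 :> nat) then -1 else 0.

Lemma hyperbolic_pair (Om : 'M[R]_d) : Om^T = - Om -> (0 < \rank Om)%N ->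
  exists e f, [/\ forall x y, bform Om x y = - bform Om y x, forall x, bform Om x x = 0,
    bform Om e f = 1 & bform Om f e = -1].
Proof.
move=> skew rk.
have skewE x y : bform Om x y = - bform Om y x.
  by rewrite /bform -[x *m Om *m y^T]trmxK mxE !trmx_mul trmxK skew mulNmx mulmxN mulmxA mxE.
have diag x : bform Om x x = 0 by have := skewE x x; lra.
have [a [b ab]] : exists a b, Om a b != 0.
  apply: contrapT => H; move: rk; rewrite (_ : Om = 0) ?mxrank0 //.
  apply/matrixP => a b; rewrite mxE; apply/eqP; apply: contrapT => /negP ab.
  by apply: H; exists a, b.
have ef : bform Om (delta_mx 0 a) ((Om a b)^-1 *: delta_mx 0 b) = 1.
  by rewrite bform_scaler bform_delta mulVf.
by exists (delta_mx 0 a), ((Om a b)^-1 *: delta_mx 0 b); split=> //; rewrite skewE ef.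
Qed.

(** Symplectic Gram-Schmidt: splitting off one hyperbolic pair lowers the rank by at most 2. *)
Lemma hyperbolic_exists m (Om : 'M[R]_d) : Om^T = - Om -> (m * 2 < \rank Om)%N ->
  exists x : 'I_(m.+1 * 2) -> 'rV[R]_d, hyperbolic (bform Om) x.
Proof.
elim: m Om => [|m IH] Om skew rk; have [e [f [skewE diag ef fe]]] := hyperbolic_pair skew (leq_ltn_trans (leq0n _) rk).
  exists (fun i => if (i == 0 :> nat) then e else f) => i j.
  by case: i j => [[|[|[]]] //= ?] [[|[|[]]] //= ?]; rewrite ?diag ?ef ?fe.
(* The projection along the span of [e] and [f] onto its [Om]-orthogonal complement, acting on row
   vectors. *)
pose Pi : 'M[R]_d := 1%:M - (Om *m f^T) *m e + (Om *m e^T) *m f.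
have PiE x : x *m Pi = x - bform Om x f *: e + bform Om x e *: f.
  rewrite /Pi mulmxDr mulmxBr mulmx1 !mulmxA; congr (_ - _ + _).
    by rewrite -[X in _ = X *: _]/((x *m Om *m f^T) 0 0) -mul_scalar_mx -mx11_scalar.
  by rewrite -[X in _ = X *: _]/((x *m Om *m e^T) 0 0) -mul_scalar_mx -mx11_scalar.
have Pe x : bform Om (x *m Pi) e = 0.
  by rewrite PiE !bform_addl -scaleNr !bform_scalel fe diag; ring.
have Pf x : bform Om (x *m Pi) f = 0.
  by rewrite PiE !bform_addl -scaleNr !bform_scalel ef diag; ring.
have PP x y : bform Om (x *m Pi) (y *m Pi) = bform Om (x *m Pi) y.
  by rewrite [in LHS](PiE y) !bform_addr -scaleNr !bform_scaler Pe Pf; ring.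
pose Om' := Pi *m Om *m Pi^T.
have Om'E x y : bform Om' x y = bform Om (x *m Pi) (y *m Pi).
  by rewrite /bform /Om' trmx_mul !mulmxA.
have E' : Om' = Pi *m Om.
  apply/matrixP => i j; rewrite -[LHS]bform_delta -[RHS]bform_delta Om'E PP /bform.
  by rewrite !mulmxA.
have [||y Hy] := IH Om'.
- by rewrite /Om' !trmx_mul trmxK skew mulNmx mulmxN mulmxA.
- have D : Om = Om' + (Om *m f^T *m e *m Om - Om *m e^T *m f *m Om).
    by rewrite E' /Pi mulmxDl mulmxBl mul1mx; apply/matrixP => i j; rewrite !mxE; ring.
  have r1 (u : 'cV[R]_d) (v : 'rV[R]_d) : (\rank (u *m v *m Om) <= 1)%N.
    by apply: leq_trans (mxrankM_maxl _ _) _; apply: leq_trans (mxrankM_maxr _ _) _; exact: rank_leq_row.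
  have r2 : (\rank (Om *m f^T *m e *m Om - Om *m e^T *m f *m Om)%R <= 2)%N.
    apply: leq_trans (mxrank_add _ _) _; rewrite mxrank_opp -[2%N]/(1 + 1)%N.
    by apply: leq_add; exact: r1.
  have := leq_trans rk (leq_trans (_ : \rank Om <= _)%N (mxrank_add Om' (Om *m f^T *m e *m Om - Om *m e^T *m f *m Om))).
  rewrite -D leqnn => /(_ isT) H; have := leq_trans H (leq_add (leqnn _) r2).
  by lia.
pose x (i : 'I_(m.+2 * 2)) : 'rV[R]_d := match fintype.split (i : 'I_(2 + m.+1 * 2)) with
  | inl i => if i == 0 :> nat then e else f | inr i => y i *m Pi end.
exists x => i j; rewrite /x.
have Pe' z : bform Om e (z *m Pi) = 0 by rewrite skewE Pe oppr0.
have Pf' z : bform Om f (z *m Pi) = 0 by rewrite skewE Pf oppr0.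
case: (fintype.splitP (i : 'I_(2 + m.+1 * 2))) => [i'|i'] Ei; case: (fintype.splitP (j : 'I_(2 + m.+1 * 2))) => [j'|j'] Ej.
- have -> : (i : nat) = i' by []. have -> : (j : nat) = j' by [].
  by case: i' j' {Ei Ej} => [[|[|[]]] //= ?] [[|[|[]]] //= ?]; rewrite ?diag ?ef ?fe.
- rewrite (_ : (i : nat) = i') // (_ : (j : nat) = 2 + j')%N //.
  by case: i' {Ei} => [[|[|[]]] //= ?]; rewrite ?Pe' ?Pf' /= ?andbF.
- rewrite (_ : (i : nat) = 2 + i')%N // (_ : (j : nat) = j') //.
  by case: j' {Ej} => [[|[|[]]] //= ?]; rewrite ?Pe ?Pf /= ?andbF.
- rewrite (_ : (i : nat) = 2 + i')%N // (_ : (j : nat) = 2 + j')%N //.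
  by rewrite -Om'E Hy !oddD /= -!addnS !eqn_add2l.
Qed.

End SymplecticBasis.

(** Exchanges the positions 0, 1 with a, a + 1. Working on naturals isolates the parity and
    successor facts from the arithmetic of ordinals. *)
Definition pair_swap (a x : nat) : nat :=
  if x == 0%N then a else if x == a then 0%N else if x == 1%N then a.+1 else if x == a.+1 then 1%N else x.

Lemma pair_swap_odd a x : ~~ odd a -> (1 < a)%N -> odd (pair_swap a x) = odd x.
Proof.
rewrite /pair_swap => oa a1; case: eqP => [->|_]; first by rewrite (negbTE oa).
case: eqP => [->|_]; first by rewrite (negbTE oa).
by case: eqP => [->|_]; [|case: eqP => [->|_]]; rewrite //= oa.
Qed.

Lemma pair_swapK a : (1 < a)%N -> cancel (pair_swap a) (pair_swap a).
Proof.
rewrite /pair_swap => a1 x.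
case: (x =P 0%N) => [->|x0]; first by rewrite eqxx; case: eqP => // h; lia.
case: (x =P a) => [->|xa]; first by [].
case: (x =P 1%N) => [->|x1]; last case: (x =P a.+1) => [->|xa1].
- rewrite eqxx; do 3!(case: eqP => [|_]; first by lia); by [].
- by case: (1%N =P a) => // h; lia.
- by case: (x =P 0%N) => // _; case: (x =P a) => // _; case: (x =P 1%N) => // _; case: (x =P a.+1).
Qed.

Lemma pair_swap_succ (a x y : nat) : ~~ odd a -> (1 < a)%N -> ~~ odd x ->
  (y == x.+1) = (pair_swap a y == (pair_swap a x).+1).
Proof.
move=> oa a1 ox; have <- : pair_swap a x.+1 = (pair_swap a x).+1.
  have x1 : x <> 1%N by move=> x1; rewrite x1 in ox.
  have xa1 : x <> a.+1 by move=> xa; rewrite xa /= oa in ox.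
  have xa : x.+1 <> a by move=> xa'; rewrite -xa' /= ox in oa.
  rewrite /pair_swap /= eqSS; case: (x.+1 =P a) => // _.
  case: (x =P 0%N) => // x0; case: (x =P 1%N) => // _.
  rewrite eqSS; case: (x =P a) => // _.
  by case: (x =P a.+1).
by rewrite (inj_eq (can_inj (pair_swapK a1))).
Qed.

(** * Powers of d alpha on hyperbolic sequences *)

Section WedgePowers.
Context {R : realType} {M : smoothSpace R}.

Lemma wedge_perm k l (w : Defs.form M k) (t : Defs.form M l) (X : 'I_(k + l) -> vfield M) (u : 'S_(k + l)) :
  wedge w t (fun i => X (u i)) = ((-1) ^+ u : R) *: wedge w t X.
Proof.
rewrite /wedge scalerA mulrC -scalerA; congr (_ *: _).
rewrite (reindex_inj (mulIg u^-1%g)) scaler_sumr; apply: eq_bigr => s _ /=.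
rewrite odd_permM odd_permV signr_addb mulrC -scalerA; congr (_ *: _).
by congr (_ *: (w _ * t _)); apply/funext => i; rewrite permM permKV.
Qed.

Lemma dpow_perm (a : oneform M) k (X : 'I_(k * 2) -> vfield M) (u : 'S_(k * 2)) :
  dpow a (fun i => X (u i)) = ((-1) ^+ u : R) *: dpow a X.
Proof.
case: k X u => [|k] X u; last exact: wedge_perm.
by rewrite (_ : u = 1%g) ?odd_perm1 ?scale1r //; apply/permP => -[].
Qed.

Lemma perm_fix2 k (s : 'S_(2 + k)) : s (lshift k ord0) = lshift k ord0 -> s (lshift k ord_max) = lshift k ord_max ->
  exists t : 'S_k, (s : bool) = t /\ forall j, s (rshift 2 j) = rshift 2 (t j).
Proof.
move=> s0 s1.
have l0 (j : 'I_k) : rshift 2 j = lift ord0 (lift ord0 j) :> 'I_k.+2 by apply: val_inj.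
have H (j : 'I_k) : exists i : 'I_k, s (rshift 2 j) = rshift 2 i.
  case: (fintype.splitP (s (rshift 2 j))) => [i Ei|i Ei]; last by exists i; apply: val_inj.
  have [E|E] : s (rshift 2 j) = s (lshift k ord0) \/ s (rshift 2 j) = s (lshift k ord_max).
  - by case: i Ei => [[|[|[]]] //= ?] Ei; [left; rewrite s0|right; rewrite s1]; apply: val_inj.
  - by move/perm_inj: E => /(congr1 val).
  - by move/perm_inj: E => /(congr1 val).
have [f Hf] := choice H.
have fI : injective f by move=> i j E; have := Hf i; rewrite E -Hf => /perm_inj/rshift_inj.
exists (perm fI); split; last by move=> j; rewrite permE.
have -> : s = lift_perm ord0 ord0 (lift_perm ord0 ord0 (perm fI)).
  apply/permP => i; case: (unliftP ord0 i) => [j ->|->]; last first.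
    by rewrite lift_perm_id; apply: (etrans (congr1 s _) (etrans s0 _)); apply: val_inj.
  rewrite lift_perm_lift; case: (unliftP ord0 j) => [j' ->|->].
    by rewrite lift_perm_lift permE -!l0.
  by rewrite lift_perm_id; apply: (etrans (congr1 s _) (etrans s1 _)); apply: val_inj.
by rewrite !odd_lift_perm.
Qed.

(** No cancellation occurs in the sum over permutations: a nonzero term pairs the first two slots
    with a hyperbolic pair, moving that pair to the front is even, and the rest is positive by
    induction. This is how vanishing powers of d alpha bound its rank. *)
Lemma dpow_hyperbolic (a : oneform M) k (X : 'I_(k * 2) -> vfield M) p :
  hyperbolic (fun X Y => dext a X Y p) X -> 0 < dpow a X p.
Proof.
elim: k X => [|k IH] X HX; first by rewrite smooth_oneE.
set B := (fun X Y => dext a X Y p) in HX.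
pose term (s : 'S_(2 + k * 2)) : R := (-1) ^+ s *
  (B (X (s (lshift _ ord0))) (X (s (lshift _ ord_max))) * dpow a (fun j => X (s (rshift 2 j))) p).
have -> : dpow a X p = (2 + k * 2)`!%:R^-1 * \sum_s term s.
  transitivity ((((2 + k * 2)`!%:R^-1 : R) *: (\sum_(s : 'S_(2 + k * 2)) ((-1) ^+ s : R) *:
    (dext a (X (s (lshift _ ord0))) (X (s (lshift _ ord_max))) * dpow a (fun j => X (s (rshift 2 j)))) : smoothFun M)) p) => //.
  rewrite smooth_scaleE (smooth_sumE (M := M)); congr (_ * _).
rewrite mulr_gt0 ?invr_gt0 ?ltr0n ?fact_gt0 //.
have pos1 (s : 'S_(2 + k * 2)) : ~~ odd (s (lshift _ ord0)) -> s (lshift _ ord_max) = (s (lshift _ ord0)).+1 :> nat ->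
    0 < term s.
  move=> ev s1; set i0 := s (lshift _ ord0); set i1 := s (lshift _ ord_max).
  pose z0 : 'I_(2 + k * 2) := lshift _ ord0; pose z1 : 'I_(2 + k * 2) := lshift _ ord_max.
  have z01 : z0 != z1 by [].
  have i01 : i0 != i1 by rewrite (inj_eq perm_inj).
  have [tau [tz0 [tz1 [taue tauH]]]] : exists tau : 'S_(2 + k * 2), tau z0 = i0 /\ tau z1 = i1 /\
      (tau : bool) = false /\ forall i : 'I_(2 + k * 2), odd (tau i : nat) = odd i /\ (~~ odd i -> forall j : 'I_(2 + k * 2), ((j : nat) == (i : nat).+1) = ((tau j : nat) == (tau i : nat).+1)).
    have a0 : ~~ odd i0 by [].
    have a1 : i1 = i0.+1 :> nat by [].
    have [i00|i00] := eqVneq (i0 : nat) 0.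
      have e0 : z0 = i0 by apply: val_inj.
      have e1 : z1 = i1 by apply: val_inj; rewrite /= a1 i00.
      exists 1%g; rewrite !perm1 odd_perm1; do !split=> //; rewrite perm1 //.
      by move=> _ j; rewrite perm1.
    have n1 : (1 < i0)%N by move: a0 i00; case: (i0 : nat) => [|[]].
    (* Exchanging a pair with the first one takes two transpositions, so the sign is unaffected. *)
    pose tau := (tperm z0 i0 * tperm z1 i1)%g.
    have tauE i : tau i = (if i == z0 then i0 else if i == i0 then z0 else if i == z1 then i1 else if i == i1 then z1 else i).
      have d1 : i0 != z1 by rewrite -val_eqE /=; lia.
      have d2 : z0 != i1 by rewrite -val_eqE /= a1.
      rewrite permM; have [->|h1] := eqVneq i z0; first by rewrite tpermL tpermD // eq_sym.
      have [->|h2] := eqVneq i i0; first by rewrite tpermR tpermD // eq_sym.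
      rewrite [tperm z0 i0 i]tpermD 1?eq_sym //.
      have [->|h3] := eqVneq i z1; first by rewrite tpermL.
      have [->|h4] := eqVneq i i1; first by rewrite tpermR.
      by rewrite tpermD // eq_sym.
    exists tau; split; first by rewrite tauE eqxx.
    split; first by rewrite tauE (negbTE (_ : z1 != z0)) // -(val_eqE z1 i0) /= ifN ?eqxx //; lia.
    split.
      have nz0 : z0 != i0 by rewrite eq_sym; exact: i00.
      have nz1 : z1 != i1 by apply/eqP => /(congr1 (@nat_of_ord _)); rewrite a1 => -[] /esym/eqP; rewrite (negbTE i00).
      rewrite /tau odd_permM odd_tperm odd_tperm nz0 nz1; exact: erefl.
    have tv i : tau i = pair_swap i0 i :> nat.
      by rewrite tauE /pair_swap -!(val_eqE i) /= a1; do !case: ifP.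
    move=> i; split; first by rewrite tv pair_swap_odd.
    by move=> oi j; rewrite !tv; exact: pair_swap_succ.
  have HY : hyperbolic B (fun j : 'I_(k * 2) => X (tau (rshift 2 j))).
    move=> i j; rewrite HX; have [od1 h1] := tauH (rshift 2 i); have [od2 h2] := tauH (rshift 2 j).
    rewrite od1 od2 /= !negbK.
    have [oi|oi] := boolP (odd i); have [oj|oj] := boolP (odd j); rewrite //= ?andbF.
    - by rewrite -h2 /= ?negbK // !eqSS.
    - by rewrite -h1 /= ?negbK // !eqSS.
    - by rewrite -h1 /= ?negbK // -h2 /= ?negbK // !eqSS.
  have [t [ot Ht]] : exists t : 'S_(k * 2), ((s * tau^-1)%g : bool) = t /\ forall j, (s * tau^-1)%g (rshift 2 j) = rshift 2 (t j).
    apply: perm_fix2; rewrite permM; [rewrite -/i0 -tz0|rewrite -/i1 -tz1]; exact: permK.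
  have sE j : s (rshift 2 j) = tau (rshift 2 (t j)) by rewrite -Ht permM permKV.
  have os : (s : bool) = t by rewrite -ot odd_permM odd_permV taue addbF.
  rewrite /term (_ : (fun j => X (s (rshift 2 j))) = (fun j => (fun j => X (tau (rshift 2 j))) (t j))); last first.
    by apply/funext => j; rewrite sE.
  rewrite (dpow_perm a (fun j => X (tau (rshift 2 j))) t) smooth_scaleE os HX ev s1 eqxx /= mul1r mulrA -expr2 sqrr_sign mul1r.
  exact: IH.
have nonneg s : 0 <= term s.
  have [z|nz] := eqVneq (B (X (s (lshift _ ord0))) (X (s (lshift _ ord_max)))) 0; first by rewrite /term z mul0r mulr0.
  have := HX (s (lshift _ ord0)) (s (lshift _ ord_max)); case: ifP => [/andP[ev /eqP E] _|_].
    by apply: ltW; exact: pos1.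
  case: ifP => [/andP[ev /eqP E] B1|_ B0]; last by rewrite B0 eqxx in nz.
  (* A reversed pair costs one sign from the skew form and one from this transposition; they
     cancel. *)
  pose u : 'S_(2 + k * 2) := (tperm (lshift _ ord0) (lshift _ ord_max) * s)%g.
  have u0 : u (lshift _ ord0) = s (lshift _ ord_max) by rewrite permM tpermL.
  have u1 : u (lshift _ ord_max) = s (lshift _ ord0) by rewrite permM tpermR.
  have -> : term s = term u.
    rewrite /term u0 u1 (HX (s (lshift _ ord_max))) ev E eqxx /= B1 odd_mul_tperm.
    rewrite (_ : (fun j => X (u (rshift 2 j))) = (fun j => X (s (rshift 2 j)))).
      have -> : (lshift (k * 2) ord0 != lshift (k * 2) ord_max :> 'I_(2 + k * 2)) = true by [].
      by rewrite addTb signrN mulN1r mul1r mulrN mulNr.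
    by apply/funext => j; rewrite permM tpermD //.
  by apply: ltW; apply: pos1; rewrite ?u0 ?u1.
rewrite (bigD1 1%g) //= ltr_pwDl //; last by apply: sumr_ge0.
by apply: pos1; rewrite !perm1.
Qed.

End WedgePowers.

(** * Consequences of normality for both Reeb fields *)

Section ContactMetric.
Context {R : realType} {M : smoothSpace R}.
Variables (m n : nat) (a1 a2 : oneform M) (Z1 Z2 : vfield M) (phi : tensor11 M) (g : riemannian M).
Variable D : vfield M -> vfield M -> vfield M.
Hypothesis LC : levi_civita g D.
Hypothesis lsym : forall W X Y Z,
  D W (curvature D X Y Z) - curvature D (D W X) Y Z - curvature D X (D W Y) Z - curvature D X Y (D W Z) = 0.
Hypothesis mcp : metric_contact_pair m n a1 a2 Z1 Z2 phi g.
Hypothesis nrm : normal_structure a1 a2 Z1 Z2 phi.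
Local Notation gp := (gpr g).
Local Notation rot := (rotop D).

Let cps : contact_pair_structure m n a1 a2 Z1 Z2 phi. Proof. by case: mcp. Qed.
Let reeb : reeb_fields a1 a2 Z1 Z2. Proof. by case: cps. Qed.
Let phi2 X : tensor11_app phi (tensor11_app phi X) = - X + oneform_app a1 X *: Z1 + oneform_app a2 X *: Z2.
Proof. by case: cps. Qed.
Let phiZ : tensor11_app phi Z1 = 0 /\ tensor11_app phi Z2 = 0. Proof. by case: cps. Qed.
Let compat X Y : riem_app g X (tensor11_app phi Y) = dext a1 X Y + dext a2 X Y. Proof. by case: mcp. Qed.
Let dual X : riem_app g X Z1 = oneform_app a1 X /\ riem_app g X Z2 = oneform_app a2 X. Proof. by case: mcp. Qed.

Lemma reeb_const (X : vfield M) : [/\ X (oneform_app a1 Z1) = 0, X (oneform_app a2 Z1) = 0,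
  X (oneform_app a1 Z2) = 0 & X (oneform_app a2 Z2) = 0].
Proof. by have [[-> ->] [-> ->] _ _] := reeb; rewrite !vfield_one !vfield_zero. Qed.

(** Normality at the two Reeb fields gives phi^2 [Z1, Z2] = 0, and the vanishing of d alpha_i on
    them removes the Reeb components of the bracket. *)
Lemma lie_reeb : lie Z1 Z2 = 0.
Proof.
have [_ _ d1 d2] := reeb; have [_ e1 e2 e3] := reeb_const Z1; have [f1 f2 _ _] := reeb_const Z2.
have z a : dext a Z1 Z2 = 0 -> Z1 (oneform_app a Z2) = 0 -> Z2 (oneform_app a Z1) = 0 -> oneform_app a (lie Z1 Z2) = 0.
  move=> h h1 h2; move: h; rewrite /dext h1 h2 subrr add0r => /eqP.
  by rewrite scaler_eq0 invr_eq0 pnatr_eq0 /= oppr_eq0 => /eqP.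
have := nrm Z1 Z2; rewrite /nijenhuis phiZ.1 phiZ.2 !lie0 (lie_skew 0 Z1) lie0 oppr0 !tensor0 (d1 Z2).1 (d2 Z2).1.
rewrite !mul0rn !scale0r !subr0 !addr0 phi2 (z a1 (d1 Z2).1 e2 f1) (z a2 (d2 Z2).1 e3 f2) !scale0r !addr0.
by move=> /eqP; rewrite oppr_eq0 => /eqP.
Qed.

Lemma killing1 p (X Y : vfield M) : gp p (D X Z1) Y + gp p (D Y Z1) X = 0.
Proof.
have [_ _ d1 d2] := reeb.
apply: (reeb_killing LC reeb phi2 phiZ nrm compat dual phiZ.1) => [Y'|X'|].
- by split; [exact: (d1 Y').1|exact: (d2 Y').1].
- by have [] := reeb_const X'.
- by split; [apply: vfield_eqP => f q; rewrite /= subrr|exact: lie_reeb].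
Qed.

Lemma killing2 p (X Y : vfield M) : gp p (D X Z2) Y + gp p (D Y Z2) X = 0.
Proof.
have [_ _ d1 d2] := reeb.
apply: (reeb_killing LC reeb phi2 phiZ nrm compat dual phiZ.2) => [Y'|X'|].
- by split; [exact: (d1 Y').2|exact: (d2 Y').2].
- by have [] := reeb_const X'.
- by split; [rewrite lie_skew lie_reeb oppr0|apply: vfield_eqP => f q; rewrite /= subrr].
Qed.

(** For a Killing field the two covariant derivative terms of d alpha are equal, and the factor 1/2
    in [dext] compensates the doubling. *)
Lemma dext_rot (a : oneform M) (Z X Y : vfield M) :
  (forall (p : M) (X Y : vfield M), gp p (D X Z) Y + gp p (D Y Z) X = 0) ->
  (forall X : vfield M, riem_app g X Z = oneform_app a X) -> dext a X Y = riem_app g X (rot Z Y).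
Proof.
move=> kil du; apply: smoothFun_eqP => p; rewrite -[RHS]/(gp p X (rot Z Y)) /dext smoothE.
rewrite -!du !smoothE !(metricD LC) -[riem_app g (lie X Y) Z p]/(gp p (lie X Y) Z) (torsion LC) gpDl gpNl /rotop gpNr.
have := kil p X Y; rewrite (gpC g p (D X Z) Y) (gpC g p (D Y Z) X); lra.
Qed.

Lemma dext_rot1 X Y : dext a1 X Y = riem_app g X (rot Z1 Y).
Proof. by apply: dext_rot; [exact: killing1|move=> ?; exact: (dual _).1]. Qed.
Lemma dext_rot2 X Y : dext a2 X Y = riem_app g X (rot Z2 Y).
Proof. by apply: dext_rot; [exact: killing2|move=> ?; exact: (dual _).2]. Qed.

Lemma rot_sum X : tensor11_app phi X = rot Z1 X + rot Z2 X.
Proof.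
apply: (@gp_inj _ _ g) => p W; rewrite gpDl ![gp p _ W]gpC -[LHS]/(riem_app g W _ p) compat.
by rewrite dext_rot1 dext_rot2.
Qed.

Lemma reeb_orthonormal3 p : [/\ gp p Z1 Z1 = 1, gp p Z1 Z2 = 0 & gp p Z2 Z2 = 1].
Proof. by have [] := reeb_orthonormal reeb dual p. Qed.

Lemma reeb_unit p (X : vfield M) : [/\ gp p (D X Z1) Z1 = 0, gp p (D X Z2) Z2 = 0 & gp p (D X Z1) Z2 = - gp p Z1 (D X Z2)].
Proof.
have [e1 e2 e3 e4] := reeb_const X.
have z (f : smoothFun M) : f = 0 -> f p = 0 by move=> ->.
have h1 := metricD LC p X Z1 Z1; have h2 := metricD LC p X Z2 Z2; have h3 := metricD LC p X Z1 Z2.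
rewrite (dual _).1 (z _ e1) (gpC g p Z1) in h1; rewrite (dual _).2 (z _ e4) (gpC g p Z2) in h2.
rewrite (dual _).2 (z _ e2) in h3.
by split; lra.
Qed.

Lemma rot_reeb : [/\ rot Z1 Z1 = 0, rot Z1 Z2 = 0, rot Z2 Z1 = 0 & rot Z2 Z2 = 0].
Proof.
have E : D Z1 Z2 = D Z2 Z1 by apply/eqP; rewrite -subr_eq0 -(torsion LC) lie_reeb.
have D21 : D Z2 Z1 = 0.
  apply: (@gp_inj _ _ g) => p W; rewrite gp0l.
  have h1 := killing1 p Z2 W; have h2 := killing2 p Z1 W; have [_ _ h3] := reeb_unit p W.
  rewrite E in h2; have h4 := gpC g p Z1 (D W Z2); lra.
have D11 : D Z1 Z1 = 0.
  by apply: (@gp_inj _ _ g) => p W; rewrite gp0l; have h1 := killing1 p Z1 W; have [h3 _ _] := reeb_unit p W; lra.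
have D22 : D Z2 Z2 = 0.
  by apply: (@gp_inj _ _ g) => p W; rewrite gp0l; have h1 := killing2 p Z2 W; have [_ h3 _] := reeb_unit p W; lra.
by rewrite /rotop D11 D21 E D21 D22 oppr0.
Qed.

Lemma rot_square (X : vfield M) : rot Z1 (rot Z1 X + rot Z2 X) + rot Z2 (rot Z1 X + rot Z2 X)
  = - X + riem_app g X Z1 *: Z1 + riem_app g X Z2 *: Z2.
Proof. by rewrite -!rot_sum phi2 (dual X).1 (dual X).2. Qed.

End ContactMetric.

(** * Orthonormal bases for positive definite matrices *)

Section Orthonormalization.
Context {R : realType}.

Definition posdef d (G : 'M[R]_d) : Prop := G^T = G /\ forall x : 'rV[R]_d, x != 0 -> 0 < (x *m G *m x^T) 0 0.

(** Cholesky's induction: the Schur complement [T] of the first diagonal entry is again positive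
    definite, as seen on vectors whose first coordinate is completed so as to be orthogonal to the
    first basis vector. *)
Lemma posdef_orthonormal r (S : 'M[R]_r) : posdef S -> exists L : 'M[R]_r, L *m S *m L^T = 1%:M.
Proof.
elim: r S => [|r IH] S [symS posS]; first by exists 0; apply/matrixP => -[].
pose S' : 'M[R]_(1 + r) := S.
have symb : S'^T = S' by exact: symS.
pose s := ulsubmx S'; pose b := ursubmx S'; pose C := drsubmx S'.
have SE : S' = block_mx s b b^T C.
  rewrite -[LHS]submxK; congr block_mx; rewrite -[in LHS]symb.
  by rewrite /b trmx_ursub.
have posS' (x : 'rV[R]_(1 + r)) : x != 0 -> 0 < (x *m block_mx s b b^T C *m x^T) 0 0 by rewrite -SE; exact: posS.
have symC : C^T = C by rewrite /C trmx_drsub symb.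
have sE : s = (s 0 0)%:M by exact: mx11_scalar.
have s0 : 0 < s 0 0.
  have := posS' (row_mx 1%:M 0); rewrite mul_row_block tr_row_mx mul_row_col.
  rewrite !mul1mx !mul0mx !addr0 trmx0 mulmx0 addr0 trmx1 mulmx1; apply.
  by apply/eqP => /(congr1 (fun x : 'rV_(1+r) => lsubmx x 0 0)); rewrite row_mxKl linear0 !mxE /= => /eqP; rewrite oner_eq0.
pose a := s 0 0; pose T := C - a^-1 *: (b^T *m b).
have [L HL] : exists L : 'M[R]_r, L *m T *m L^T = 1%:M.
  apply: IH; split=> [|x x0]; first by rewrite /T linearB linearZ /= trmx_mul trmxK symC.
  pose y := - a^-1 *: (x *m b^T).
  have := posS' (row_mx y x); rewrite mul_row_block tr_row_mx mul_row_col.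
  have -> : y *m s + x *m b^T = 0.
    rewrite sE -/a mul_mx_scalar /y scalerA mulrN mulfV ?gt_eqF // scaleN1r addNr //.
  have -> : y *m b + x *m C = x *m T.
    by rewrite /T /y mulmxBr -scalemxAl -scalemxAr mulmxA scaleNr addrC.
  rewrite mul0mx add0r; apply.
  apply/eqP => /(congr1 (fun z : 'rV_(1+r) => rsubmx z)); rewrite row_mxKr linear0 => xz.
  by rewrite xz eqxx in x0.
pose c := Num.sqrt a.
suff [L' HL'] : exists L' : 'M[R]_(1 + r), L' *m block_mx s b b^T C *m L'^T = 1%:M by exists L'; rewrite -/S' SE.
exists (block_mx (c^-1)%:M 0 (- a^-1 *: (L *m b^T)) L).
rewrite tr_block_mx !mulmx_block !mul0mx !addr0 !trmx0 !mulmx0 !addr0.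
have ca : c * c = a by rewrite /c -expr2 sqr_sqrtr // ltW.
have c0 : c != 0 by rewrite /c gt_eqF // sqrtr_gt0.
have e0 : - a^-1 *: (L *m b^T) *m s + L *m b^T = 0.
  by rewrite sE -/a mul_mx_scalar scalerA mulrN mulfV ?gt_eqF // scaleN1r addNr.
rewrite e0 !mul0mx !add0r.
have e1 : - a^-1 *: (L *m b^T) *m b + L *m C = L *m T.
  by rewrite /T mulmxBr scaleNr mulNmx -scalemxAl -scalemxAr mulmxA addrC.
rewrite e1 HL.
have e2 : (c^-1)%:M *m s *m ((c^-1)%:M)^T = 1%:M :> 'M[R]_1.
  rewrite tr_scalar_mx sE -/a -!scalar_mxM; congr (_%:M).
  by rewrite -ca; field.
have e3 : (c^-1)%:M *m s *m (- a^-1 *: (L *m b^T))^T + (c^-1)%:M *m b *m L^T = 0.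
  rewrite sE -/a -scalar_mxM linearZ /= trmx_mul trmxK !mul_scalar_mx -scalerA -scalemxAl scalerA scalerA.
  by rewrite mulrN mulfK ?gt_eqF // scaleNr addNr.
by rewrite e2 e3 -scalar_mx_block.
Qed.

Lemma subspace_orthonormal d (G K : 'M[R]_d) r : posdef G -> \rank K = r ->
  exists B : 'M[R]_(r, d), B *m G *m B^T = 1%:M /\ (B :=: K)%MS.
Proof.
move=> [sG pG] <-; have [B [Bf BK]] : exists B : 'M[R]_(\rank K, d), row_free B /\ (B :=: K)%MS.
  by exists (row_base K); split; [exact: row_base_free|exact: eq_row_base].
have [|L HL] := @posdef_orthonormal _ (B *m G *m B^T).
  split=> [|x x0]; first by rewrite !trmx_mul trmxK sG mulmxA.
  have -> : x *m (B *m G *m B^T) *m x^T = (x *m B) *m G *m (x *m B)^T by rewrite trmx_mul !mulmxA.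
  apply: pG; apply/eqP => xB; move/eqP: x0; apply.
  by apply: (row_free_inj Bf); rewrite xB mul0mx.
exists (L *m B); split; first by rewrite trmx_mul !mulmxA -HL !mulmxA.
have uL : L \in unitmx by have := mulmx1_unit HL; rewrite unitmx_mul => -[/andP[]].
by apply: eqmx_trans BK; apply: eqmxMfull; rewrite row_full_unit.
Qed.

End Orthonormalization.

(** * Characteristic subspaces at a point and their dimensions *)

Section Splitting.
Context {R : realType} {M : smoothSpace R}.
Variables (d m n : nat) (a1 a2 : oneform M) (Z1 Z2 : vfield M) (phi : tensor11 M) (g : riemannian M).
Variable D : vfield M -> vfield M -> vfield M.
Hypothesis LC : levi_civita g D.
Local Notation gp := (gpr g).
Local Notation rot := (rotop D).
Hypothesis kil1 : forall (p : M) (X Y : vfield M), gp p (D X Z1) Y + gp p (D Y Z1) X = 0.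
Hypothesis kil2 : forall (p : M) (X Y : vfield M), gp p (D X Z2) Y + gp p (D Y Z2) X = 0.
Hypothesis dext1 : forall X Y : vfield M, dext a1 X Y = riem_app g X (rot Z1 Y).
Hypothesis dext2 : forall X Y : vfield M, dext a2 X Y = riem_app g X (rot Z2 Y).
Hypothesis phi_rot : forall X : vfield M, tensor11_app phi X = rot Z1 X + rot Z2 X.
Hypothesis square : forall X : vfield M, rot Z1 (rot Z1 X + rot Z2 X) + rot Z2 (rot Z1 X + rot Z2 X)
  = - X + riem_app g X Z1 *: Z1 + riem_app g X Z2 *: Z2.
Hypothesis dual : forall X : vfield M, riem_app g X Z1 = oneform_app a1 X /\ riem_app g X Z2 = oneform_app a2 X.
Hypothesis deg1 : forall X : 'I_(m.+1 * 2) -> vfield M, dpow a1 X = 0.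
Hypothesis deg2 : forall X : 'I_(n.+1 * 2) -> vfield M, dpow a2 X = 0.
Hypothesis dec : decomposable a1 a2 phi.

Section Pointwise.
Variables (p : M) (r : R) (W : set M) (x : 'I_d -> smoothFun M) (y : 'rV[R]_d -> M) (E : 'I_d -> vfield M).
Hypothesis CS : coord_system p r W x y E.

Let Wp : W p. Proof. by case: CS => -[]. Qed.

Definition comps (Y : vfield M) : 'rV[R]_d := \row_k Y (x k) p.
Definition of_comps (v : 'rV[R]_d) : vfield M := \sum_k (v 0 k *: (1 : smoothFun M)) *: E k.

Lemma comps_add Y Y' : comps (Y + Y') = comps Y + comps Y'.
Proof. by apply/rowP => k; rewrite !mxE. Qed.
Lemma comps_opp Y : comps (- Y) = - comps Y.
Proof. by apply/rowP => k; rewrite !mxE. Qed.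
Lemma comps_scale f Y : comps (f *: Y) = f p *: comps Y.
Proof. by apply/rowP => k; rewrite !mxE. Qed.

Lemma compsK v : comps (of_comps v) = v.
Proof.
have c0 : comps 0 = 0 by apply/rowP => k; rewrite !mxE.
have cs : comps (of_comps v) = \sum_k comps ((v 0 k *: (1 : smoothFun M)) *: E k).
  by rewrite /of_comps; apply: (big_morph comps comps_add c0).
rewrite cs [RHS]row_sum_delta; apply: eq_bigr => k _; rewrite comps_scale smoothE smooth_oneE mulr1.
by congr (_ *: _); apply/rowP => l; rewrite !mxE (coord_field CS) // eqxx eq_sym.
Qed.

Lemma comps_inj Y Y' : comps Y = comps Y' -> vfield_at Y p = vfield_at Y' p.
Proof.
move=> e; apply/val_inj/funext => f; have [_ _ _ _ H] := CS.
rewrite /= -[LHS]/(vfield_at Y p f) -[RHS]/(vfield_at Y' p f) !(H p) //; apply: eq_bigr => k _; congr (_ * _).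
by have := congr1 (fun v : 'rV[R]_d => v 0 k) e; rewrite !mxE.
Qed.

Lemma gp_comps Y Y' V : comps Y = comps Y' -> gp p Y V = gp p Y' V.
Proof. by move=> /comps_inj e; rewrite /gpr /= e. Qed.

Lemma gp_comps0 Y : (forall V, gp p Y V = 0) -> comps Y = 0.
Proof.
move=> H; have [z|nz] := eqVneq (vfield_at Y p) 0.
  by apply/rowP => k; rewrite !mxE; have := congr1 (fun v : tangent M p => v (x k)) z.
by have := riem_pos g nz; rewrite -[riem_at _ _ _ _]/(gp p Y Y) H ltxx.
Qed.

(** Tensoriality: a function on fields that depends only on the value at [p] is computed on the
    coordinate fields, which turns tensors into matrices. *)
Lemma tensorial_expand (B : vfield M -> R) Y : (forall Y Y', B (Y + Y') = B Y + B Y') ->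
  (forall f Y, B (f *: Y) = f p * B Y) -> (forall Y Y', comps Y = comps Y' -> B Y = B Y') ->
  B Y = \sum_k comps Y 0 k * B (E k).
Proof.
move=> BD BZ Be; rewrite (Be Y (of_comps (comps Y))) ?compsK //.
have B0 : B 0 = 0 by rewrite -(scale0r (0 : vfield M)) BZ mul0r.
rewrite [in LHS]/of_comps (big_morph B BD B0); apply: eq_bigr => k _.
by rewrite BZ smoothE smooth_oneE mulr1.
Qed.

Definition gram : 'M[R]_d := \matrix_(k, l) gp p (E k) (E l).

Lemma gp_gram Y V : gp p Y V = (comps Y *m gram *m (comps V)^T) 0 0.
Proof.
rewrite (tensorial_expand (B := fun Y => gp p Y V)); [|by move=> ? ?; rewrite gpDl|by move=> ? ?; rewrite gpZl|by move=> ? ? e; exact: gp_comps].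
rewrite -mulmxA !mxE; apply: eq_bigr => k _; congr (_ * _).
rewrite (tensorial_expand (B := fun V => gp p (E k) V)); [|by move=> ? ?; rewrite gpDr|by move=> ? ?; rewrite gpZr|by move=> ? ? e; rewrite !(gpC g p (E k)); exact: gp_comps].
by rewrite !mxE; apply: eq_bigr => l _; rewrite !mxE mulrC.
Qed.

Lemma gram_posdef : posdef gram.
Proof.
split=> [|v v0]; first by apply/matrixP => k l; rewrite !mxE gpC.
rewrite -[v]compsK -gp_gram; apply: riem_pos; apply/eqP => z; move/eqP: v0; apply.
rewrite -[v]compsK; apply/rowP => k; rewrite !mxE.
by have := congr1 (fun v : tangent M p => v (x k)) z.
Qed.

Lemma gram_unit : gram \in unitmx.
Proof.
rewrite -row_free_unit; apply: inj_row_free => v vG; have [//|v0] := eqVneq v 0.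
by have := gram_posdef.2 v v0; rewrite vG mul0mx mxE ltxx.
Qed.

Section Rotation.
Variables (a : oneform M) (Z : vfield M) (k : nat).
Hypothesis kil : forall (p : M) (X Y : vfield M), gp p (D X Z) Y + gp p (D Y Z) X = 0.
Hypothesis dextE : forall X Y : vfield M, dext a X Y = riem_app g X (rot Z Y).
Hypothesis deg : forall X : 'I_(k.+1 * 2) -> vfield M, dpow a X = 0.

Lemma gp_rotop X Y : gp p (rot Z X) Y = - gp p X (rot Z Y).
Proof. by have := kil p X Y; rewrite /rotop !gpE (gpC g p X); lra. Qed.

Definition rotmx : 'M[R]_d := \matrix_(i, j) rot Z (E i) (x j) p.

Lemma comps_rot Y : comps (rot Z Y) = comps Y *m rotmx.
Proof.
apply/rowP => j; rewrite !mxE (tensorial_expand (B := fun Y => rot Z Y (x j) p)).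
- by apply: eq_bigr => i _; rewrite !mxE.
- by move=> ? ?; rewrite (rotopD LC).
- by move=> ? ?; rewrite (rotopZ LC).
move=> A B AB; suff : comps (rot Z A - rot Z B) = 0.
  by move=> /(congr1 (fun v : 'rV[R]_d => v 0 j)); rewrite comps_add comps_opp [LHS]mxE [X in _ + X]mxE [RHS]mxE => /eqP;
    rewrite subr_eq0 /comps !mxE => /eqP.
by apply: gp_comps0 => V; rewrite gpDl gpNl !gp_rotop (gp_comps _ AB) subrr.
Qed.

Definition annmx : 'cV[R]_d := \col_i gp p (E i) Z.

Lemma gp_annmx Y : gp p Y Z = (comps Y *m annmx) 0 0.
Proof.
rewrite (tensorial_expand (B := fun Y => gp p Y Z)); [|by move=> ? ?; rewrite gpDl|by move=> ? ?; rewrite gpZl|by move=> ? ? e; exact: gp_comps].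
by rewrite [RHS]mxE; apply: eq_bigr => i _; rewrite [annmx _ _]mxE.
Qed.

(** A larger rank would give k + 1 hyperbolic pairs for d alpha at p, on which its power of exponent
    k + 1 is positive by [dpow_hyperbolic]. *)
Lemma rank_rotmx : (\rank rotmx <= k * 2)%N.
Proof.
pose Om : 'M[R]_d := gram *m rotmx^T.
have OmE v w : bform Om v w = dext a (of_comps v) (of_comps w) p.
  rewrite dextE -[RHS]/(gp p _ _) gp_gram comps_rot !compsK /bform /Om trmx_mul.
  by rewrite !mulmxA.
have skew : Om^T = - Om.
  apply/matrixP => i j; rewrite mxE [RHS]mxE.
  have e (u v : 'I_d) : Om u v = bform Om (delta_mx 0 u) (delta_mx 0 v).
    by rewrite /bform -rowE trmx_delta -colE !mxE.
  rewrite !e !OmE !dextE -[LHS]/(gp p (of_comps (delta_mx 0 j)) (rot Z (of_comps (delta_mx 0 i)))).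
  by rewrite gpC gp_rotop.
have rk : (\rank rotmx <= \rank Om)%N.
  rewrite -mxrank_tr; have -> : rotmx^T = invmx gram *m Om by rewrite /Om mulKmx // gram_unit.
  exact: mxrankM_maxr.
apply: leq_trans rk _; rewrite leqNgt; apply/negP => /(hyperbolic_exists skew)[u Hu].
have := @dpow_hyperbolic R M a k.+1 (fun i => of_comps (u i)) p.
rewrite deg ltxx => F; suff : false by []; apply: F => i j; rewrite -OmE; exact: Hu.
Qed.

(** Its row space is the tangent space of the characteristic foliation in coordinates. *)
Definition charmx : 'M[R]_d := kermx (row_mx rotmx annmx).

Lemma charmxP (v : 'rV[R]_d) : reflect (v *m rotmx = 0 /\ v *m annmx = 0) (v <= charmx)%MS.
Proof.
apply: (iffP sub_kermxP) => [|[vF vA]]; rewrite mul_mx_row; last by rewrite vF vA row_mx0.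
by move/eqP; rewrite row_mx_eq0 => /andP[/eqP -> /eqP ->].
Qed.

Lemma rank_charmx : (d <= \rank charmx + (k * 2 + 1))%N.
Proof.
rewrite mxrank_ker; have h : (\rank (row_mx rotmx annmx) <= k * 2 + 1)%N.
  rewrite -mxrank_tr tr_row_mx -addsmxE; apply: leq_trans (mxrank_adds_leqif _ _).1 _.
  by rewrite !mxrank_tr leq_add ?rank_rotmx ?rank_leq_col.
by apply: leq_trans (leq_add (leqnn _) h); rewrite subnK // rank_leq_row.
Qed.

Lemma charmx_charac (v : 'rV[R]_d) : (forall X : vfield M, riem_app g X Z = oneform_app a X) ->
  (v <= charmx)%MS -> charac a (vfield_at (of_comps v) p).
Proof.
move=> du /charmxP[vF vA]; split.
  by rewrite -[LHS]/(oneform_app a (of_comps v) p) -du -[LHS]/(gp p _ Z) gp_annmx compsK vA mxE.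
move=> X Y e; rewrite dextE -[LHS]/(gp p X (rot Z Y)); apply/eqP; rewrite -oppr_eq0 -gp_rotop; apply/eqP.
have cX : comps X = v.
  rewrite -[RHS]compsK; apply/rowP => j; rewrite !mxE.
  by have := congr1 (fun v : tangent M p => v (x j)) e.
rewrite (@gp_comps _ 0) ?gp0l // comps_rot cX vF; apply/rowP => j; by rewrite !mxE.
Qed.

Lemma charac_charmx Y : (forall X : vfield M, riem_app g X Z = oneform_app a X) ->
  charac a (vfield_at Y p) -> (comps Y <= charmx)%MS.
Proof.
move=> du [h1 h2]; apply/charmxP; split.
  rewrite -comps_rot; apply: gp_comps0 => V; rewrite gp_rotop.
  by rewrite -[gp p Y _]/(riem_app g Y (rot Z V) p) -dextE h2 // oppr0.
apply/rowP => j; rewrite ord1 -gp_annmx mxE.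
by rewrite -[LHS]/(riem_app g Y Z p) du.
Qed.

End Rotation.

Hypothesis dE : d = (m * 2 + n * 2 + 2)%N.
Let F1 := rotmx Z1. Let F2 := rotmx Z2. Let K1 := charmx Z1. Let K2 := charmx Z2.

Let square_comps (v : 'rV[R]_d) : (v *m F1 + v *m F2) *m F1 + (v *m F1 + v *m F2) *m F2
  = - v + (v *m annmx Z1) 0 0 *: comps Z1 + (v *m annmx Z2) 0 0 *: comps Z2.
Proof.
have := congr1 comps (square (of_comps v)).
rewrite !comps_add !(comps_rot kil1) !(comps_rot kil2) !comps_add (comps_rot kil1) (comps_rot kil2).
by rewrite !comps_scale comps_opp compsK -!/(gp p _ _) !gp_annmx !compsK.
Qed.

Let capK : (K1 :&: K2 = 0)%MS.
Proof.
apply/eqP/rowV0P => v; rewrite sub_capmx => /andP[/charmxP[f1 e1] /charmxP[f2 e2]].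
have := square_comps v; rewrite /F1 /F2 f1 f2 e1 e2 !addr0 !mul0mx addr0 !mxE !scale0r !addr0.
by move/esym/eqP; rewrite oppr_eq0 => /eqP.
Qed.

(** The two spaces meet in 0, and the lower bounds of [rank_charmx] already add up to [d], so both
    are equalities. *)
Lemma charmx_rank : \rank K1 = (n * 2 + 1)%N /\ \rank K2 = (m * 2 + 1)%N.
Proof.
have r1 := rank_charmx kil1 dext1 deg1; have r2 := rank_charmx kil2 dext2 deg2.
have := mxrank_sum_cap K1 K2; rewrite capK mxrank0 addn0 => e.
have := rank_leq_row (K1 + K2)%MS; rewrite e -/K1 -/K2 in r1 r2 *.
by move=> h; lia.
Qed.

Lemma char_split (v : 'rV[R]_d) : exists v1 v2 : 'rV[R]_d, [/\ v = v1 + v2, (v1 <= K1)%MS & (v2 <= K2)%MS].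
Proof.
have [k1 k2] := charmx_rank; have := mxrank_sum_cap K1 K2; rewrite capK mxrank0 addn0 k1 k2 => e.
have full : (v <= K1 + K2)%MS by apply: submx_full; rewrite /row_full e dE; apply/eqP; lia.
by move/sub_addsmxP: full => [[u w] /= ->]; exists (u *m K1), (w *m K2); rewrite !submxMl.
Qed.

Let phi_comps Y : comps (tensor11_app phi Y) = comps Y *m F1 + comps Y *m F2.
Proof. by rewrite phi_rot comps_add (comps_rot kil1) (comps_rot kil2). Qed.

Let charac_phi (a : oneform M) Y : charac a (vfield_at Y p) ->
  (forall v : tangent M p, charac a v -> charac a (tensor11_at phi p v)) -> charac a (vfield_at (tensor11_app phi Y) p).
Proof.
move=> h H; have -> : vfield_at (tensor11_app phi Y) p = tensor11_at phi p (vfield_at Y p) by apply/val_inj/funext.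
exact: H.
Qed.

(** On [K1] the first rotation vanishes, so phi is the second one; decomposability keeps its image
    in [K1], where the first rotation vanishes again. The same holds on [K2], and the two spaces
    span. *)
Lemma cross_comps (v : 'rV[R]_d) : v *m F2 *m F1 = 0 /\ v *m F1 *m F2 = 0.
Proof.
have [v1 [v2 [-> h1 h2]]] := char_split v.
have du1 X := (dual X).1; have du2 X := (dual X).2.
have c1 := charac_charmx kil1 dext1 du1 (charac_phi (charmx_charac kil1 dext1 du1 h1) (fun v => (dec v).1)).
have c2 := charac_charmx kil2 dext2 du2 (charac_phi (charmx_charac kil2 dext2 du2 h2) (fun v => (dec v).2)).
have [z1 _] := charmxP _ _ h1; have [z2 _] := charmxP _ _ h2.
rewrite phi_comps compsK z1 add0r in c1; rewrite phi_comps compsK z2 addr0 in c2.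
have [y1 _] := charmxP _ _ c1; have [y2 _] := charmxP _ _ c2.
by rewrite !mulmxDl z1 z2 y1 y2 !mul0mx !addr0.
Qed.

(** The projection attached to [Z1] has range [K2], the characteristic space of the other form:
    there alpha_2 and the second rotation vanish, and the formula for phi^2 makes the projection the
    identity. The frame is orthonormal at [p] only. *)
Lemma adapted_frame : exists b : 'I_(m * 2 + 1) -> vfield M,
  (forall i j, gp p (b i) (b j) = (i == j)%:R) /\
  (forall Y V, gp p (factor_proj g D Z1 Y) V = \sum_i gp p Y (b i) * gp p V (b i)).
Proof.
have [B [BB BK]] := subspace_orthonormal gram_posdef charmx_rank.2.
pose Pv (v : 'rV[R]_d) : 'rV[R]_d := (v *m annmx Z1) 0 0 *: comps Z1 - v *m F1 *m F1.
have PE Y : comps (factor_proj g D Z1 Y) = Pv (comps Y).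
  by rewrite /factor_proj comps_add comps_scale comps_opp !(comps_rot kil1) -/(gp p Y Z1) gp_annmx.
have PvD v w : Pv (v + w) = Pv v + Pv w.
  by rewrite /Pv !mulmxDl mxE scalerDl opprD addrACA.
have P1 (v : 'rV[R]_d) : (v <= K1)%MS -> Pv v = 0.
  by move=> /charmxP[f a]; rewrite /Pv /F1 f a mul0mx mxE scale0r subr0.
have P2 (v : 'rV[R]_d) : (v <= K2)%MS -> Pv v = v.
  move=> /charmxP[f a]; have f' : v *m F2 = 0 := f; have := square_comps v; rewrite f' a addr0 (cross_comps v).2 addr0 [(0 : 'M[R]_1) 0 0]mxE scale0r addr0.
  by move=> e; rewrite /Pv e opprD opprK addrCA subrr addr0.
have ortho (v w : 'rV[R]_d) : (v <= K1)%MS -> (w <= K2)%MS -> v *m gram *m w^T = 0.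
  move=> hv hw; apply/matrixP => i j; rewrite !ord1 [RHS]mxE -[v]compsK -[w]compsK -gp_gram.
  rewrite gpC (@gp_comps _ (factor_proj g D Z1 (of_comps w))); last by rewrite PE compsK P2.
  rewrite (factor_proj_sym kil1) gpC (@gp_comps _ 0) ?gp0l // PE compsK P1 //.
  by apply/rowP => l; rewrite !mxE.
have bK (b : 'I_(m * 2 + 1)) : (row b B <= K2)%MS by rewrite -BK row_sub.
have vB (v : 'rV[R]_d) (i : 'I_(m * 2 + 1)) : (v *m gram *m (row i B)^T) 0 0 = (v *m gram *m B^T) 0 i.
  by rewrite mxE [RHS]mxE; apply: eq_bigr => j _; congr (_ * _); rewrite !mxE.
have gpB (Y : vfield M) (i : 'I_(m * 2 + 1)) : gp p Y (of_comps (row i B)) = (comps Y *m gram *m B^T) 0 i.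
  by rewrite gp_gram compsK vB.
exists (fun i => of_comps (row i B)); split=> [i j|Y V].
  by rewrite gpB compsK -!row_mul BB !mxE.
have [v1 [v2 [vE h1 h2]]] := char_split (comps Y).
rewrite gp_gram PE vE PvD P1 // P2 // add0r.
have /submxP[u uE] : (v2 <= B)%MS by rewrite BK.
have uB (i : 'I_(m * 2 + 1)) : gp p Y (of_comps (row i B)) = u 0 i.
  rewrite gpB vE uE !mulmxDl [LHS]mxE -vB ortho // [X in X + _]mxE add0r -!mulmxA (mulmxA B) BB.
  by rewrite mulmx1.
transitivity (\sum_i u 0 i * (B *m gram *m (comps V)^T) i 0).
  by rewrite uE -2!(mulmxA u) [LHS]mxE.
apply: eq_bigr => i _; rewrite uB; congr (_ * _).
have -> : B *m gram *m (comps V)^T = (comps V *m gram *m B^T)^T.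
  by rewrite !trmx_mul trmxK gram_posdef.1 mulmxA.
by rewrite mxE gpB.
Qed.

End Pointwise.
End Splitting.

(** * Local parallel sections and developing functions *)

Section LocalCalculus.
Context {R : realType} (d : nat) (M : smoothSpace R).
Hypothesis hM : is_manifold d M.

Lemma derive_partials N (f : 'rV[R]_N -> R) x v : Coo_at x f -> 'D_v f x = \sum_k v 0 k * 'D_(ebase k) f x.
Proof.
move=> Cf; have Dk k : is_derive x v (fun z : 'rV[R]_N => z 0 k) (v 0 k).
  have E : (fun h : R => h^-1 *: (((fun z : 'rV[R]_N => z 0 k) \o shift x) (h *: v) - x 0 k)) @ 0^' --> v 0 k.
    apply: (@cvg_trans _ (cst (v 0 k) @ (0 : R)^')); last exact: cvg_cst.
    apply: near_eq_cvg; apply: filterS (nbhs_dnbhs_neq (0 : R)) => h h0 /=.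
    by rewrite !mxE addrK /GRing.scale /= mulrA mulVf // mul1r.
  by apply: DeriveDef; [apply/cvg_ex; exists (v 0 k)|exact: cvg_lim E].
have [|||_ e] := @is_derive_rowcomp R 'rV[R]_N N (fun z => z) f x v.
- by move=> j; have [] := Dk j.
- by apply: filterS (Coo_at_nbhs Cf) => z Cz j; exact: Coo_at_derivable.
- by move=> j; apply: Coo_at_continuous; exact: Coo_at_derive.
by rewrite -[LHS]/('D_v (f \o (fun z => z)) x) e; apply: eq_bigr => k _; rewrite derive_val.
Qed.

Section Coordinates.
Variables (p : M) (r : R) (W : set M) (X : 'I_d -> smoothFun M) (y : 'rV[R]_d -> M) (E : 'I_d -> vfield M).
Hypothesis CS : coord_system p r W X y E.

Lemma coord_Coo (f : smoothFun M) z : `|z| < r -> Coo_at z (f \o y).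
Proof.
have [_ _ H2 _ _] := CS; move=> zr; have [_ _ _ sm] := H2 z zr.
by apply/sm; exact: smoothFun_at.
Qed.

Lemma coord_derive (f : smoothFun M) (h : 'rV[R]_d -> R) q k : W q -> (\forall q' \near q, f q' = h (rowf X q')) ->
  E k f q = 'D_(ebase k) h (rowf X q).
Proof.
have [[r0 oW Wp Xp] H1 H2 H3 H4] := CS; move=> Wq fh; have [qr yq] := H1 q Wq.
rewrite H3 //; apply: near_eq_derive.
have [_ _ cy _] := H2 _ qr; have fh' : nbhs (y (rowf X q)) (fun q' => f q' = h (rowf X q')) by rewrite yq.
have nr : nbhs (rowf X q) [set z : 'rV[R]_d | `|z| < r] by apply: open_nbhs_nbhs; split=> //; exact: open_norm_lt.
by apply: filterS2 (near_comp cy fh') nr => z /= -> zr; have [_ ->] := H2 z zr.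
Qed.

(** [flat_solution] in the coordinate ball with A = - Gam; the hypothesis on coordinate fields is
    its flatness condition, extended bilinearly from basis directions. *)
Lemma flat_functions_small (kap : R) N (Gam : 'I_d -> 'I_N -> 'I_N -> smoothFun M) (c : 'rV[R]_N) :
  (forall i j a b q, W q -> E i (Gam j a b) q + \sum_c Gam j a c q * Gam i c b q
                         = E j (Gam i a b) q + \sum_c Gam i a c q * Gam j c b q) ->
  (forall i a b q, W q -> `|Gam i a b q| <= kap) -> N%:R * (d%:R * r * kap) <= 2^-1 ->
  exists u : 'I_N -> smoothFun M, (forall a, u a p = c 0 a) /\
    \forall q \near p, W q /\ forall i b, E i (u b) q + \sum_a u a q * Gam i a b q = 0.
Proof.
move=> flat bGam small; have [[r0 oW Wp Xp] H1 H2 H3 H4] := CS.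
pose A (i : 'I_d) (z : 'rV[R]_d) : 'M[R]_N := \matrix_(a, b) - Gam i a b (y z).
pose B : set 'rV[R]_d := [set z : 'rV[R]_d | `|z| < r].
have oB : open B by exact: open_norm_lt.
have AE i a b : (fun z => A i z a b) = (fun z => - (Gam i a b \o y) z) by apply/funext => z; rewrite mxE.
have atA i a b z : B z -> Coo_at z (fun z => A i z a b) by move=> Bz; rewrite AE; apply: Coo_atN; exact: coord_Coo.
have smA i a b : Coo B (fun z => A i z a b) by move=> k; apply: Coo_at_Ck => // z Bz; exact: atA.
have DA i j a b z : B z -> 'D_(ebase j) (fun z => A i z a b) z = - E j (Gam i a b) (y z).
  move=> Bz; have [Wz Xz _ _] := H2 z Bz; rewrite AE deriveN; last by apply: Coo_at_derivable; exact: coord_Coo.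
  by rewrite H3 // Xz.
have flatA x u v : B x -> conn A u x *m conn A v x + dconn A u v x = conn A v x *m conn A u x + dconn A v u x.
  move=> Bx; have [Wx Xx _ _] := H2 x Bx; apply/matrixP => a b.
  have P s t : (conn A s x *m conn A t x + dconn A s t x) a b =
      \sum_i \sum_j s 0 i * t 0 j * (\sum_c A i x a c * A j x c b - E i (Gam j a b) (y x)).
    rewrite mxE [X in X + _]mxE (dconnE (r := r)) //.
    transitivity (\sum_i \sum_j s 0 i * t 0 j * \sum_c A i x a c * A j x c b + \sum_i \sum_j s 0 i * t 0 j * - E i (Gam j a b) (y x)).
      congr (_ + _).
        under eq_bigr => c0 _ do rewrite !connE mulr_suml.
        rewrite exchange_big; apply: eq_bigr => i _.
        under eq_bigr => c0 _ do rewrite mulr_sumr.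
        rewrite exchange_big; apply: eq_bigr => j _; rewrite mulr_sumr; apply: eq_bigr => c0 _; ring.
      rewrite exchange_big; apply: eq_bigr => j _; rewrite derive_partials; last exact: atA.
      rewrite mulr_sumr; apply: eq_bigr => i _; rewrite DA //; ring.
    rewrite -big_split; apply: eq_bigr => i _; rewrite -big_split; apply: eq_bigr => j _ /=; ring.
  rewrite !P exchange_big; apply: eq_bigr => i _; apply: eq_bigr => j _; rewrite (mulrC (u 0 j)); congr (_ * _).
  have := flat i j a b (y x) Wx.
  have S s t : \sum_c A s x a c * A t x c b = \sum_c Gam s a c (y x) * Gam t c b (y x).
    by apply: eq_bigr => c0 _; rewrite !mxE mulrNN.
  by rewrite !S; lra.
have bA i x a b : B x -> `|A i x a b| <= kap.
  by move=> Bx; rewrite mxE normrN; apply: bGam; have [] := H2 x Bx.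
have [u [u0 uB uD]] := flat_solution r0 smA flatA bA small c.
have uC k : Coo B (fun y => u y 0 k) by exact: (flat_smooth r0 smA bA uB uD).
have su k q : W q -> smooth_at M q (fun q => u (rowf X q) 0 k).
  move=> Wq; apply: (smooth_at_rowf hM (F := X) (Phi := fun z => u z 0 k)).
  by exists B; split; [exact: oB|have [] := H1 q Wq|exact: uC].
have F_ex k : exists F : smoothFun M, \forall q \near p, F q = u (rowf X q) 0 k.
  exact: (smooth_extend_on hM oW Wp (su k)).
have [F HF] := choice F_ex; exists F; split=> [a|].
  by rewrite (nbhs_singleton (HF a)) Xp u0.
have HF' : \forall q \near p, forall k, F k q = u (rowf X q) 0 k by exact: (@filter_forall M 'I_N _ (nbhs p)).
have : nbhs p (fun q => forall k, F k q = u (rowf X q) 0 k) := HF'; rewrite nbhsE => -[Q [oQ Qp] HQ].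
apply: filterS2 (open_nbhs_nbhs (conj oQ Qp)) (open_nbhs_nbhs (conj oW Wp)) => q Qq Wq; split=> // i b.
have nb : \forall q' \near q, F b q' = u (rowf X q') 0 b by apply: filterS (open_nbhs_nbhs (conj oQ Qq)) => q' /HQ.
have [qr yq] := H1 q Wq.
have dd := uD (rowf X q) (ebase i) b qr.
rewrite (coord_derive (h := fun z => u z 0 b) i Wq nb) derive_val mxE -big_split big1 // => a _ /=.
rewrite (HQ q Qq) connE (bigD1 i) //= big1 => [|j ji]; last by rewrite /ebase mxE eqxx (negbTE ji) mul0r.
by rewrite /ebase mxE !eqxx mul1r addr0 mxE yq mulrN addNr.
Qed.

End Coordinates.

(** The bound [kap] is fixed by the values of [Gam] at [p], so shrinking the coordinate ball reaches
    the smallness required by [flat_functions_small]. *)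
Lemma flat_functions p r W X y E N (Gam : 'I_d -> 'I_N -> 'I_N -> smoothFun M) (c : 'rV[R]_N) :
  coord_system p r W X y E ->
  (forall i j a b q, W q -> E i (Gam j a b) q + \sum_c Gam j a c q * Gam i c b q
                         = E j (Gam i a b) q + \sum_c Gam i a c q * Gam j c b q) ->
  exists u : 'I_N -> smoothFun M, (forall a, u a p = c 0 a) /\
    \forall q \near p, W q /\ forall i b, E i (u b) q + \sum_a u a q * Gam i a b q = 0.
Proof.
move=> CS flat; have [[r0 oW Wp Xp] H1 H2 H3 H4] := CS.
pose kap : R := \sum_i \sum_a \sum_b (`|Gam i a b p| + 1).
have kap0 : 0 <= kap by do 3!(apply: sumr_ge0 => ? _); apply: addr_ge0.
have Hk : \forall q \near p, forall iab : 'I_d * ('I_N * 'I_N), `|Gam iab.1 iab.2.1 iab.2.2 q| <= kap.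
  apply: (@filter_forall M ('I_d * ('I_N * 'I_N))%type _ (nbhs p)) => -[i [a b]] /=.
  have h : `|Gam i a b p| + 1 <= kap.
    rewrite /kap (bigD1 i) //= (bigD1 a) //= (bigD1 b) //= -!(addrA (`|Gam i a b p| + 1)) lerDl.
    do !apply: addr_ge0; do ?[apply: sumr_ge0 => ? _]; do ?[apply: sumr_ge0 => ? _]; do ?[apply: sumr_ge0 => ? _]; exact: addr_ge0.
  have cG : {for p, continuous (Gam i a b)} by apply: (smooth_at_continuous hM); exact: smoothFun_at.
  have n1 : nbhs (Gam i a b p) [set t : R | `|t| < `|Gam i a b p| + 1].
    apply: (@cvgr_norm_lt _ _ _ (nbhs (Gam i a b p)) _ id) => //; first exact: cvg_id.
    by rewrite ltrDl.
  by apply: filterS (near_comp cG n1) => q /= hq; apply: le_trans h; exact: ltW.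
have : nbhs p (fun q => forall iab : 'I_d * ('I_N * 'I_N), `|Gam iab.1 iab.2.1 iab.2.2 q| <= kap) := Hk.
rewrite nbhsE => -[Q [oQ Qp] HQ].
have y0 : y 0 = p by rewrite -Xp; have [_ ->] := H1 p Wp.
have cy : {for (0 : 'rV[R]_d), continuous y} by have [] := H2 0; rewrite ?normr0.
have nO : nbhs (0 : 'rV[R]_d) (fun z => Q (y z)) by apply: near_comp cy _; rewrite y0; apply: open_nbhs_nbhs.
have [e /= e0 He] := (nbhs_ballP _ _).1 nO.
pose K : R := N%:R * d%:R * kap; have K0 : 0 <= K by rewrite !mulr_ge0.
have K1 : 0 < 2 * (K + 1) by lra.
pose s := Num.min (Num.min r e) (2 * (K + 1))^-1.
have s0 : 0 < s by rewrite /s !lt_min r0 e0 invr_gt0.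
have sr : s <= r by rewrite /s !ge_min lexx.
have se : s <= e by rewrite /s !ge_min lexx orbT.
have sk : s <= (2 * (K + 1))^-1 by rewrite /s ge_min lexx orbT.
have CS' := coord_system_shrink hM (introT andP (conj s0 sr)) CS.
have [|||u [u0 Hu]] := @flat_functions_small p s _ X y E CS' kap N Gam c.
- by move=> i j a b q [Wq _]; exact: flat.
- move=> i a b q [Wq qs]; have [_ yq] := H1 q Wq.
  apply: (HQ q _ (i, (a, b))); rewrite -yq; apply: He.
  by rewrite -ball_normE /= sub0r normrN; apply: lt_le_trans se.
- rewrite (_ : _ * _ = s * K); last by rewrite /K; ring.
  apply: le_trans (ler_wpM2r K0 sk) _; rewrite mulrC ler_pdivrMr //.
  lra.
by exists u; split=> //; apply: filterS Hu => q [[Wq _] h].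
Qed.

Lemma flat_functions_fin p r W X y E (I : finType) (Gam : 'I_d -> I -> I -> smoothFun M) (c : I -> R) :
  coord_system p r W X y E ->
  (forall i j a b q, W q -> E i (Gam j a b) q + \sum_c Gam j a c q * Gam i c b q
                         = E j (Gam i a b) q + \sum_c Gam i a c q * Gam j c b q) ->
  exists u : I -> smoothFun M, (forall a, u a p = c a) /\
    \forall q \near p, W q /\ forall i b, E i (u b) q + \sum_a u a q * Gam i a b q = 0.
Proof.
move=> CS flat; have S (F : I -> R) : \sum_a F a = \sum_(k < #|I|) F (enum_val k) by rewrite -big_enum_val.
have [|u [u0 Hu]] := @flat_functions p r W X y E #|I| (fun i a b => Gam i (enum_val a) (enum_val b)) (\row_k c (enum_val k)) CS.
  by move=> i j a b q Wq; have := flat i j (enum_val a) (enum_val b) q Wq; rewrite !S.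
exists (fun a => u (enum_rank a)); split=> [a|]; first by rewrite u0 mxE enum_rankK.
apply: filterS Hu => q [Wq h]; split=> // i b; rewrite S -[RHS](h i (enum_rank b)) enum_rankK; congr (_ + _).
by apply: eq_bigr => k _; rewrite enum_valK.
Qed.

Lemma locally_constant (f : smoothFun M) p : (\forall q \near p, forall v : tangent M q, v f = 0) ->
  \forall q \near p, f q = f p.
Proof.
move=> H; have : nbhs p (fun q => forall v : tangent M q, v f = 0) := H; rewrite nbhsE => -[Q [oQ Qp] HQ].
have [r [W [X [y [E [CS WQ]]]]]] := coord_system_exists hM oQ Qp.
have [[r0 oW Wp Xp] H1 H2 H3 H4] := CS.
apply: filterS (open_nbhs_nbhs (conj oW Wp)) => q Wq; have [qr yq] := H1 q Wq.
have y0 : y 0 = p by rewrite -Xp; have [_ ->] := H1 p Wp.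
have [|xi Hxi e] := @increment_partials R d (f \o y) 0 (rowf X q).
  by move=> z j; rewrite !subr0 => zr; apply: Coo_at_derivable; apply: (coord_Coo CS); exact: le_lt_trans qr.
apply/eqP; rewrite -subr_eq0 -{1}yq -{1}y0 [X in X == _]e big1 // => j _.
have zr : `|xi j| < r by have := Hxi j; rewrite !subr0 => h; exact: le_lt_trans qr.
have [Wz Xz _ _] := H2 (xi j) zr.
have := H3 (y (xi j)) f j Wz; rewrite Xz => <-.
by rewrite -[E j f _]/(vfield_at (E j) (y (xi j)) f) (HQ _ (WQ _ Wz)) mulr0.
Qed.

Lemma connection_local (g : riemannian M) (D : vfield M -> vfield M -> vfield M) (X Y Y' : vfield M) p :
  levi_civita g D -> (\forall q \near p, vfield_at Y q = vfield_at Y' q) ->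
  vfield_at (D X Y) p = vfield_at (D X Y') p.
Proof.
move=> LC H; have : nbhs p (fun q => vfield_at Y q = vfield_at Y' q) := H; rewrite nbhsE => -[Q [oQ Qp] HQ].
have [rho [r1 r0]] := manifold_bump hM oQ Qp.
have z : rho *: Y = rho *: Y'.
  apply: vfield_eqP => f q; rewrite !vfieldZ !smoothE; have [/HQ e|/nbhs_singleton ->] := r0 q; last by rewrite !mul0r.
  by have := congr1 (fun v : tangent M q => v f) e => /= ->.
have e := congr1 (D X) z; rewrite !(DZr LC) in e.
have Xr : X rho p = 0 by rewrite -[LHS]/(vfield_at X p rho) (@tangent_local _ _ _ hM p _ rho 1) ?tangent_one.
have rp : rho p = 1 by exact: nbhs_singleton r1.
apply/val_inj/funext => f; have := congr1 (fun V : vfield M => V f p) e.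
by rewrite !vfieldD !vfieldZ !smoothE Xr rp !mul0r !mul1r !add0r.
Qed.

Lemma connection_locall (g : riemannian M) (D : vfield M -> vfield M -> vfield M) (X Y : vfield M) p :
  levi_civita g D -> (\forall q \near p, vfield_at X q = 0) -> vfield_at (D X Y) p = 0.
Proof.
move=> LC H; have : nbhs p (fun q => vfield_at X q = 0) := H; rewrite nbhsE => -[Q [oQ Qp] HQ].
have [rho [r1 r0]] := manifold_bump hM oQ Qp.
have z : rho *: X = 0.
  apply: vfield_eqP => f q; rewrite !vfieldZ !smoothE; have [/HQ e|/nbhs_singleton ->] := r0 q; last by rewrite !mul0r.
  by have := congr1 (fun v : tangent M q => v f) e => /= ->; rewrite mulr0.
have e := congr1 (fun X => D X Y) z; rewrite (DZl LC) (D0l LC) in e.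
have rp : rho p = 1 by exact: nbhs_singleton r1.
apply/val_inj/funext => f; have := congr1 (fun V : vfield M => V f p) e.
by rewrite !vfieldZ !smoothE rp !mul1r.
Qed.

End LocalCalculus.

(** * The flat connection on pairs of functions and vector fields *)

Section Parallel.
Context {R : realType} (d : nat) (M : smoothSpace R).
Hypothesis hM : is_manifold d M.
Variables (g : riemannian M) (D : vfield M -> vfield M -> vfield M).
Hypothesis LC : levi_civita g D.
Local Notation gp := (gpr g).
Local Notation Rm := (curvature D).

Lemma gp_at_inj p (U V : vfield M) : (forall W, gp p U W = gp p V W) -> vfield_at U p = vfield_at V p.
Proof.
move=> H; apply/eqP; rewrite -subr_eq0; apply/eqP.
have [//|/(riem_pos g)] := eqVneq (vfield_at U p - vfield_at V p) 0.
have -> : vfield_at U p - vfield_at V p = vfield_at (U - V) p by apply/val_inj/funext.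
by rewrite -[riem_at _ _ _ _]/(gp p (U - V) (U - V)) gpDl gpNl H subrr ltxx.
Qed.

Lemma gp_at p (U U' V : vfield M) : vfield_at U p = vfield_at U' p -> gp p U V = gp p U' V.
Proof. by move=> e; rewrite /gpr /= e. Qed.

Lemma gp_coord p r W (X : 'I_d -> smoothFun M) y E q (U V : vfield M) : coord_system p r W X y E -> W q ->
  gp q U V = \sum_k U (X k) q * gp q (E k) V.
Proof.
move=> CS Wq.
have -> : gp q U V = gp q (\sum_k U (X k) *: E k) V.
  apply: gp_at; rewrite (tangent_coord CS (vfield_at U q) Wq).
  rewrite (big_morph (fun U => vfield_at U q) (fun A B => vfield_atD A B q) (vfield_at0 q)).
  by apply: eq_bigr => k _; rewrite vfield_atZ.
rewrite (big_morph (fun U => gp q U V) (fun A B => gpDl g q A B V) (gp0l g q V)).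
by apply: eq_bigr => k _; rewrite gpZl.
Qed.

Variables P1 P2 : vfield M -> vfield M.
Hypothesis sym1 : forall p X Y, gp p (P1 X) Y = gp p X (P1 Y).
Hypothesis sym2 : forall p X Y, gp p (P2 X) Y = gp p X (P2 Y).
Hypothesis par1 : forall X Y, D X (P1 Y) = P1 (D X Y).
Hypothesis par2 : forall X Y, D X (P2 Y) = P2 (D X Y).
Hypothesis idem1 : forall X, P1 (P1 X) = P1 X.
Hypothesis idem2 : forall X, P2 (P2 X) = P2 X.
Hypothesis orth12 : forall X, P1 (P2 X) = 0.
Hypothesis orth21 : forall X, P2 (P1 X) = 0.
Hypothesis sum12 : forall X, P1 X + P2 X = X.
Hypothesis curv1 : forall Y W X, Rm Y W (P1 X) = riem_app g W (P1 X) *: P1 Y - riem_app g Y (P1 X) *: P1 W.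
Hypothesis curv2 : forall Y W X, Rm Y W (P2 X) = riem_app g W (P2 X) *: P2 Y - riem_app g Y (P2 X) *: P2 W.

(** Parallelism at [q], with the symmetric projections moved to the second argument and the vector
    equation tested against all fields. *)
Definition parallel_at q (f h : smoothFun M) (Y : vfield M) : Prop := forall V : vfield M,
  [/\ V f q = gp q V (P1 Y), V h q = gp q V (P2 Y)
    & forall W, gp q (D V Y) W = - f q * gp q (P1 V) W - h q * gp q (P2 V) W].

Section Existence.
Variables (p : M) (r : R) (W : set M) (X : 'I_d -> smoothFun M) (y : 'rV[R]_d -> M) (E : 'I_d -> vfield M).
Hypothesis CS : coord_system p r W X y E.

(** The components of a section: [true] for f, [false] for h, and the d coordinates of Y. *)
Let idx := (bool + 'I_d)%type.
Let triple := (smoothFun M * smoothFun M * vfield M)%type.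

Let comp (t : triple) (b : idx) : smoothFun M :=
  match b with inl true => t.1.1 | inl false => t.1.2 | inr k => t.2 (X k) end.
Let tau (a : idx) : triple :=
  match a with inl true => (1, 0, 0) | inl false => (0, 1, 0) | inr k => (0, 0, E k) end.
Let nabla (V : vfield M) (t : triple) : triple :=
  (V t.1.1 - riem_app g (P1 V) t.2, V t.1.2 - riem_app g (P2 V) t.2, D V t.2 + t.1.1 *: P1 V + t.1.2 *: P2 V).
Let Gam i a b := comp (nabla (E i) (tau a)) b.

Let oW : open W. Proof. by case: CS => -[]. Qed.

Let D_coord i (Y : vfield M) l q : W q ->
  D (E i) Y (X l) q = E i (Y (X l)) q + \sum_k Y (X k) q * D (E i) (E k) (X l) q.
Proof.
move=> Wq; have loc : vfield_at (D (E i) Y) q = vfield_at (D (E i) (\sum_k Y (X k) *: E k)) q.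
  apply: (connection_local hM _ LC); apply: filterS (open_nbhs_nbhs (conj oW Wq)) => z Wz.
  rewrite (tangent_coord CS (vfield_at Y z) Wz).
  rewrite (big_morph (fun U => vfield_at U z) (fun A B => vfield_atD A B z) (vfield_at0 z)).
  by apply: eq_bigr => k _; rewrite vfield_atZ.
have := congr1 (fun v : tangent M q => v (X l)) loc => /= ->.
rewrite (big_morph (D (E i)) (DDr LC (E i)) (D0r LC (E i))).
rewrite (big_morph (fun U : vfield M => U (X l) q) (fun A B : vfield M => erefl) erefl).
under eq_bigr => k _ do rewrite (DZr LC) vfieldD !vfieldZ !smoothE.
rewrite big_split /=; congr (_ + _).
rewrite (bigD1 l) //= (coord_field CS) // eqxx mulr1 big1 ?addr0 // => k kl.
by rewrite (coord_field CS) // (negbTE kl) mulr0.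
Qed.

Let comp_f V t q : comp (nabla V t) (inl true) q = V t.1.1 q - gp q (P1 V) t.2. Proof. by []. Qed.
Let comp_h V t q : comp (nabla V t) (inl false) q = V t.1.2 q - gp q (P2 V) t.2. Proof. by []. Qed.
Let comp_Y V t l q : comp (nabla V t) (inr l) q =
  D V t.2 (X l) q + t.1.1 q * P1 V (X l) q + t.1.2 q * P2 V (X l) q.
Proof. by []. Qed.
Let smooth0 q : (0 : smoothFun M) q = 0. Proof. by []. Qed.
Let gam_f i (s : bool) q : Gam i (inl s) (inl true) q = 0.
Proof.
rewrite /Gam comp_f; case: s; [change (E i 1 q - gp q (P1 (E i)) 0 = 0)|change (E i 0 q - gp q (P1 (E i)) 0 = 0)];
  by rewrite ?vfield_one ?vfield_zero gp0r subr0 smooth0.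
Qed.
Let gam_h i (s : bool) q : Gam i (inl s) (inl false) q = 0.
Proof.
rewrite /Gam comp_h; case: s; [change (E i 0 q - gp q (P2 (E i)) 0 = 0)|change (E i 1 q - gp q (P2 (E i)) 0 = 0)];
  by rewrite ?vfield_one ?vfield_zero gp0r subr0 smooth0.
Qed.
Let gam_fk i k q : Gam i (inr k) (inl true) q = - gp q (P1 (E i)) (E k).
Proof.
by rewrite /Gam comp_f; change (E i 0 q - gp q (P1 (E i)) (E k) = - gp q (P1 (E i)) (E k)); rewrite vfield_zero smooth0 sub0r.
Qed.
Let gam_hk i k q : Gam i (inr k) (inl false) q = - gp q (P2 (E i)) (E k).
Proof.
by rewrite /Gam comp_h; change (E i 0 q - gp q (P2 (E i)) (E k) = - gp q (P2 (E i)) (E k)); rewrite vfield_zero smooth0 sub0r.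
Qed.
Let gam_Y1 i l q : Gam i (inl true) (inr l) q = P1 (E i) (X l) q.
Proof.
rewrite /Gam comp_Y; change (D (E i) 0 (X l) q + 1 * P1 (E i) (X l) q + 0 * P2 (E i) (X l) q = P1 (E i) (X l) q).
by rewrite (D0r LC) vfield0 smooth0 add0r mul1r mul0r addr0.
Qed.
Let gam_Y2 i l q : Gam i (inl false) (inr l) q = P2 (E i) (X l) q.
Proof.
rewrite /Gam comp_Y; change (D (E i) 0 (X l) q + 0 * P1 (E i) (X l) q + 1 * P2 (E i) (X l) q = P2 (E i) (X l) q).
by rewrite (D0r LC) vfield0 smooth0 add0r mul1r mul0r add0r.
Qed.
Let gam_Yk i k l q : Gam i (inr k) (inr l) q = D (E i) (E k) (X l) q.
Proof.
rewrite /Gam comp_Y; change (D (E i) (E k) (X l) q + 0 * P1 (E i) (X l) q + 0 * P2 (E i) (X l) q = D (E i) (E k) (X l) q).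
by rewrite !mul0r !addr0.
Qed.

Let expansion i t b q : W q ->
  comp (nabla (E i) t) b q = E i (comp t b) q + \sum_c comp t c q * Gam i c b q.
Proof.
move=> Wq; transitivity (E i (comp t b) q + (comp t (inl true) q * Gam i (inl true) b q +
    comp t (inl false) q * Gam i (inl false) b q + \sum_k t.2 (X k) q * Gam i (inr k) b q)); last first.
  by rewrite big_sumType big_bool.
case: b => [[]|l].
- rewrite comp_f !gam_f !mulr0 !add0r gpC (gp_coord _ _ CS Wq) -sumrN; congr (_ + _); apply: eq_bigr => k _.
  by rewrite gam_fk mulrN (gpC g q (E k)).
- rewrite comp_h !gam_h !mulr0 !add0r gpC (gp_coord _ _ CS Wq) -sumrN; congr (_ + _); apply: eq_bigr => k _.
  by rewrite gam_hk mulrN (gpC g q (E k)).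
have e4 : \sum_k t.2 (X k) q * Gam i (inr k) (inr l) q = \sum_k t.2 (X k) q * D (E i) (E k) (X l) q.
  by apply: eq_bigr => k _; rewrite gam_Yk.
have fin (F H P Q e s s' dd u v : R) : u = P -> v = Q -> dd = e + s -> s' = s ->
  dd + F * P + H * Q = e + (F * u + H * v + s') by move=> -> -> -> ->; ring.
exact: (fin (t.1.1 q) (t.1.2 q) _ _ _ _ _ _ _ _ (gam_Y1 i l q) (gam_Y2 i l q) (D_coord i t.2 l Wq) e4).
Qed.

(** Coordinate fields commute, so the function components cancel by zero torsion and symmetry; in
    the vector component the curvature of the two factors cancels exactly against the added
    terms. *)
Let flat i j t b q : W q -> comp (nabla (E i) (nabla (E j) t)) b q = comp (nabla (E j) (nabla (E i) t)) b q.
Proof.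
move=> Wq; set A := E i; set B := E j; have lz : vfield_at (lie A B) q = 0 by exact: (coord_field_lie hM CS).
have lzN : \forall z \near q, vfield_at (lie A B) z = 0.
  by apply: filterS (open_nbhs_nbhs (conj oW Wq)) => z Wz; exact: (coord_field_lie hM CS).
have gl V : gp q (lie A B) V = 0 by rewrite (@gp_at q _ 0 V) ?gp0l // lz vfield_at0.
have tor V : gp q (D A B) V = gp q (D B A) V.
  by have := gl V; rewrite (torsion LC) gpDl gpNl => /eqP; rewrite subr_eq0 => /eqP.
have P12 U V : gp q (P1 U) (P2 V) = 0 by rewrite sym1 orth12 gp0r.
have P21 U V : gp q (P2 U) (P1 V) = 0 by rewrite sym2 orth21 gp0r.
have bl f : A (B f) q = B (A f) q.
  by apply/eqP; rewrite -subr_eq0; apply/eqP; exact: (congr1 (fun v : tangent M q => v f) lz).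
case: t => -[f h] Y.
have t1 V : gp q (P1 (D A B)) V = gp q (P1 (D B A)) V by rewrite !sym1 tor.
have t2 V : gp q (P2 (D A B)) V = gp q (P2 (D B A)) V by rewrite !sym2 tor.
case: b => [[]|l].
- change (A (B f - riem_app g (P1 B) Y) q - gp q (P1 A) (D B Y + f *: P1 B + h *: P2 B) =
          B (A f - riem_app g (P1 A) Y) q - gp q (P1 B) (D A Y + f *: P1 A + h *: P2 A)).
  rewrite !vfield_addr !vfield_opp !smooth_addE !smooth_oppE bl !(metricD LC) !par1 !gpDr !gpZr !P12 t1.
  by rewrite (gpC g q (P1 A) (P1 B)); ring.
- change (A (B h - riem_app g (P2 B) Y) q - gp q (P2 A) (D B Y + f *: P1 B + h *: P2 B) =
          B (A h - riem_app g (P2 A) Y) q - gp q (P2 B) (D A Y + f *: P1 A + h *: P2 A)).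
  rewrite !vfield_addr !vfield_opp !smooth_addE !smooth_oppE bl !(metricD LC) !par2 !gpDr !gpZr !P21 t2.
  by rewrite (gpC g q (P2 A) (P2 B)); ring.
suff e : vfield_at (nabla A (nabla B (f, h, Y))).2 q = vfield_at (nabla B (nabla A (f, h, Y))).2 q.
  exact: (congr1 (fun v : tangent M q => v (X l)) e).
apply: gp_at_inj => V.
change (gp q (D A (D B Y + f *: P1 B + h *: P2 B) + (B f - riem_app g (P1 B) Y) *: P1 A + (B h - riem_app g (P2 B) Y) *: P2 A) V =
        gp q (D B (D A Y + f *: P1 A + h *: P2 A) + (A f - riem_app g (P1 A) Y) *: P1 B + (A h - riem_app g (P2 A) Y) *: P2 B) V).
have dl : gp q (D (lie A B) Y) V = 0.
  by rewrite (@gp_at q _ 0 V) ?gp0l // vfield_at0; exact: (connection_locall hM Y LC lzN).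
have cu : gp q (Rm A B Y) V = gp q B (P1 Y) * gp q (P1 A) V - gp q A (P1 Y) * gp q (P1 B) V
    + (gp q B (P2 Y) * gp q (P2 A) V - gp q A (P2 Y) * gp q (P2 B) V).
  by rewrite -[in LHS](sum12 Y) (Rm_addr LC) curv1 curv2 !gpDl !gpNl !gpZl.
rewrite /curvature !gpDl !gpNl dl subr0 in cu.
rewrite !(DDr LC) !(DZr LC) !par1 !par2 !gpDl !gpZl !smooth_addE !smooth_oppE t1 t2.
rewrite -!sym1 -!sym2 in cu.
rewrite -[riem_app g (P1 A) Y q]/(gp q (P1 A) Y) -[riem_app g (P1 B) Y q]/(gp q (P1 B) Y).
rewrite -[riem_app g (P2 A) Y q]/(gp q (P2 A) Y) -[riem_app g (P2 B) Y q]/(gp q (P2 B) Y).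
by move: cu => /eqP; rewrite -subr_eq0 => /eqP cu; apply/eqP; rewrite -subr_eq0; apply/eqP; rewrite -[RHS]cu; ring.
Qed.

Lemma parallel_exists (f0 h0 : R) (Y0 : vfield M) : exists (f h : smoothFun M) (Y : vfield M),
  [/\ f p = f0, h p = h0, vfield_at Y p = vfield_at Y0 p & \forall q \near p, parallel_at q f h Y].
Proof.
have Wp : W p by case: CS => -[].
have [|u [u0 Hu]] := flat_functions_fin hM (Gam := Gam) (fun a : idx => match a with inl true => f0 | inl false => h0 | inr k => Y0 (X k) p end) CS.
  move=> i j a b q Wq.
  have e i' j' : E i' (Gam j' a b) q + \sum_c Gam j' a c q * Gam i' c b q = comp (nabla (E i') (nabla (E j') (tau a))) b q.
    exact: (esym (expansion i' (nabla (E j') (tau a)) b Wq)).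
  exact: (etrans (e i j) (etrans (flat i j (tau a) b Wq) (esym (e j i)))).
pose f := u (inl true); pose h := u (inl false); pose Y : vfield M := \sum_k u (inr k) *: E k.
have YX k q : W q -> Y (X k) q = u (inr k) q.
  move=> Wq; rewrite /Y (big_morph (fun U : vfield M => U (X k) q) (fun A B : vfield M => erefl) erefl).
  rewrite (bigD1 k) // big1 => [|l lk].
    by change (u (inr k) q * E k (X k) q + 0 = u (inr k) q); rewrite (coord_field CS) // eqxx mulr1 addr0.
  by change (u (inr l) q * E l (X k) q = 0); rewrite (coord_field CS) // (negbTE lk) mulr0.
exists f, h, Y; split.
- by rewrite /f u0.
- by rewrite /h u0.
- rewrite (tangent_coord CS (vfield_at Y p) Wp) (tangent_coord CS (vfield_at Y0 p) Wp).
  by apply: eq_bigr => k _; congr (_ *: _); rewrite -[LHS]/(Y (X k) p) YX // u0.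
pose t : triple := (f, h, Y).
have Ht : \forall q \near p, W q /\ forall i b, comp (nabla (E i) t) b q = 0.
  have H' : \forall q \near p, W q /\ forall i b, E i (u b) q + \sum_a u a q * Gam i a b q = 0 by exact: Hu.
  apply: filterS H' => q [Wq Hq]; split=> // i b.
  have cu c z : W z -> comp t c z = u c z by move=> Wz; case: c => [[]|k] //; exact: YX.
  have e1 : E i (comp t b) q = E i (u b) q.
    rewrite -[LHS]/(vfield_at (E i) q (comp t b)) -[RHS]/(vfield_at (E i) q (u b)); apply: (tangent_local hM).
    by apply: filterS (open_nbhs_nbhs (conj oW Wq)) => z; exact: cu.
  have e2 : \sum_c comp t c q * Gam i c b q = \sum_c u c q * Gam i c b q by apply: eq_bigr => c _; rewrite cu.
  exact: (etrans (expansion i t b Wq) (etrans (congr2 +%R e1 e2) (Hq i b))).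
apply: filterS Ht => q [Wq Hq] V.
have VE (T : tangent M q) (f' : smoothFun M) : T f' = \sum_k T (X k) * E k f' q.
  by have [_ _ _ _ H] := CS; exact: H.
have z3 i : vfield_at (nabla (E i) t).2 q = 0.
  rewrite (tangent_coord CS (vfield_at (nabla (E i) t).2 q) Wq) big1 // => k _.
  have z : vfield_at (nabla (E i) t).2 q (X k) = 0 := Hq i (inr k).
  by rewrite z scale0r.
split.
- rewrite -[LHS]/(vfield_at V q f) VE (gp_coord V (P1 Y) CS Wq); apply: eq_bigr => k _; congr (_ * _).
  have z : E k f q - gp q (P1 (E k)) Y = 0 := Hq k (inl true).
  by move/eqP: z; rewrite subr_eq0 => /eqP ->; rewrite sym1.
- rewrite -[LHS]/(vfield_at V q h) VE (gp_coord V (P2 Y) CS Wq); apply: eq_bigr => k _; congr (_ * _).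
  have z : E k h q - gp q (P2 (E k)) Y = 0 := Hq k (inl false).
  by move/eqP: z; rewrite subr_eq0 => /eqP ->; rewrite sym2.
move=> U.
have key i : gp q (D (E i) Y) U = - f q * gp q (E i) (P1 U) - h q * gp q (E i) (P2 U).
  have := @gp_at q _ 0 U (etrans (z3 i) (esym (vfield_at0 q))); rewrite gp0l /= !gpDl !gpZl !sym1 !sym2; lra.
pose L : vfield M := V - \sum_k V (X k) *: E k.
have Lz : \forall z \near q, vfield_at L z = 0.
  apply: filterS (open_nbhs_nbhs (conj oW Wq)) => z Wz.
  rewrite /L vfield_atD (tangent_coord CS (vfield_at V z) Wz) -scaleN1r vfield_atZ.
  rewrite (big_morph (fun U => vfield_at U z) (fun A B => vfield_atD A B z) (vfield_at0 z)).
  rewrite (_ : (-1 : smoothFun M) z = -1) // scaleN1r.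
  by apply/eqP; rewrite subr_eq0; apply/eqP; apply: eq_bigr => k _; rewrite vfield_atZ.
have e1 := connection_locall hM Y LC Lz.
have -> : gp q (D V Y) U = \sum_k V (X k) q * gp q (D (E k) Y) U.
  have := @gp_at q _ 0 U (etrans e1 (esym (vfield_at0 q))); rewrite gp0l /L (DDl LC) (DNl LC) gpDl gpNl => /eqP.
  rewrite subr_eq0 => /eqP ->.
  rewrite (big_morph (fun U => D U Y) (fun A B => DDl LC A B Y) (D0l LC Y)).
  rewrite (big_morph (fun V => gp q V U) (fun A B => gpDl g q A B U) (gp0l g q U)).
  by apply: eq_bigr => k _; rewrite (DZl LC) gpZl.
rewrite !sym1 !sym2 (gp_coord V (P1 U) CS Wq) (gp_coord V (P2 U) CS Wq) !mulr_sumr -sumrB.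
by apply: eq_bigr => k _; rewrite key; ring.
Qed.

End Existence.
End Parallel.

(** * Developing functions of one factor *)

Section FactorCoordinates.
Context {R : realType} (d : nat) (M : smoothSpace R).
Hypothesis hM : is_manifold d M.
Variables (g : riemannian M) (D : vfield M -> vfield M -> vfield M).
Hypothesis LC : levi_civita g D.
Local Notation gp := (gpr g).

Lemma tangent_extend p (v : tangent M p) : exists V : vfield M, vfield_at V p = v.
Proof.
have [r [W [X [y [E [CS _]]]]]] := coord_system_exists hM (@openT M) (I : setT p).
have Wp : W p by case: CS => -[].
exists (\sum_k (v (X k) *: (1 : smoothFun M)) *: E k).
rewrite [RHS](tangent_coord CS v Wp).
rewrite (big_morph (fun U => vfield_at U p) (fun A B => vfield_atD A B p) (vfield_at0 p)).
by apply: eq_bigr => k _; rewrite vfield_atZ smooth_scaleE smooth_oneE mulr1.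
Qed.

Lemma locally_constant_vfield (f : smoothFun M) p : (\forall q \near p, forall V : vfield M, V f q = 0) ->
  \forall q \near p, f q = f p.
Proof.
move=> H; apply: (locally_constant hM); apply: filterS H => q Hq v.
by have [V <-] := tangent_extend v; exact: Hq.
Qed.

Section SphereFactor.
Variables P1 P2 : vfield M -> vfield M.
Hypothesis sym1 : forall p X Y, gp p (P1 X) Y = gp p X (P1 Y).
Hypothesis sym2 : forall p X Y, gp p (P2 X) Y = gp p X (P2 Y).
Hypothesis par1 : forall X Y, D X (P1 Y) = P1 (D X Y).
Hypothesis par2 : forall X Y, D X (P2 Y) = P2 (D X Y).
Hypothesis idem1 : forall X, P1 (P1 X) = P1 X.
Hypothesis idem2 : forall X, P2 (P2 X) = P2 X.
Hypothesis orth12 : forall X, P1 (P2 X) = 0.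
Hypothesis orth21 : forall X, P2 (P1 X) = 0.
Hypothesis sum12 : forall X, P1 X + P2 X = X.
Hypothesis curv1 : forall Y W X, curvature D Y W (P1 X) = riem_app g W (P1 X) *: P1 Y - riem_app g Y (P1 X) *: P1 W.
Hypothesis curv2 : forall Y W X, curvature D Y W (P2 X) = riem_app g W (P2 X) *: P2 Y - riem_app g Y (P2 X) *: P2 W.
Variable k : nat.
Hypothesis frame : forall p, exists b : 'I_k -> vfield M, (forall i j, gp p (b i) (b j) = (i == j)%:R) /\
  (forall Y V, gp p (P1 Y) V = \sum_i gp p Y (b i) * gp p V (b i)).

(** k + 1 parallel sections of the first block, of rank k + 1, orthonormal for the fibre metric f f'
    + g(Y, Y'). The last three clauses are the dual orthonormality relations: position on the unit
    sphere, tangency and the induced metric. *)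
Definition sphere_dev_at q (f : 'I_k.+1 -> smoothFun M) (Y : 'I_k.+1 -> vfield M) : Prop :=
  [/\ forall a (V : vfield M), V (f a) q = gp q V (Y a),
      forall a (V W : vfield M), gp q (D V (Y a)) W = - f a q * gp q (P1 V) W,
      forall a (V : vfield M), gp q (P1 (Y a)) V = gp q (Y a) V,
      forall a b, f a q * f b q + gp q (Y a) (Y b) = (a == b)%:R
    & [/\ \sum_a f a q ^+ 2 = 1, forall V : vfield M, \sum_a f a q * gp q V (Y a) = 0
      & forall V V' : vfield M, \sum_a gp q V (Y a) * gp q V' (Y a) = gp q (P1 V) V']].

Definition sphere_dev (f : 'I_k.+1 -> smoothFun M) (U : set M) : Prop :=
  open U /\ exists Y, forall q, U q -> sphere_dev_at q f Y.

(** In the basis formed by 1 and the frame, the sections are the rows of a square matrix with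
    orthonormal rows; its columns are then orthonormal too. *)
Lemma parseval q (f : 'I_k.+1 -> smoothFun M) (Y : 'I_k.+1 -> vfield M) :
  (forall a (V : vfield M), gp q (P1 (Y a)) V = gp q (Y a) V) ->
  (forall a b, f a q * f b q + gp q (Y a) (Y b) = (a == b)%:R) ->
  [/\ \sum_a f a q ^+ 2 = 1, forall V : vfield M, \sum_a f a q * gp q V (Y a) = 0
      & forall V V' : vfield M, \sum_a gp q V (Y a) * gp q V' (Y a) = gp q (P1 V) V'].
Proof.
move=> PY on; have [b [bb Pb]] := frame q.
pose C : 'M[R]_k.+1 := \matrix_(a, c) if unlift ord0 c is Some i then gp q (Y a) (b i) else f a q.
have C0 a : C a ord0 = f a q by rewrite mxE unlift_none.
have Ci a i : C a (lift ord0 i) = gp q (Y a) (b i) by rewrite mxE liftK.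
have CC : C *m C^T = 1%:M.
  apply/matrixP => a c; transitivity (\sum_e C a e * C c e).
    by rewrite mxE; apply: eq_bigr => e _; rewrite [(C^T) _ _]mxE.
  rewrite big_ord_recl !C0 [RHS]mxE -on -(PY a) Pb; congr (_ + _).
  by apply: eq_bigr => i _; rewrite !Ci.
have CtC := mulmx1C CC.
pose w V : 'cV[R]_k.+1 := \col_c if unlift ord0 c is Some i then gp q V (b i) else 0.
have w0 V : w V ord0 0 = 0 by rewrite mxE unlift_none.
have wi V i : w V (lift ord0 i) 0 = gp q V (b i) by rewrite mxE liftK.
have Cw V a : gp q V (Y a) = (C *m w V) a 0.
  rewrite gpC -PY Pb [RHS]mxE big_ord_recl w0 mulr0 add0r; apply: eq_bigr => i _.
  by rewrite Ci wi.
have sumE (u v : 'cV[R]_k.+1) : \sum_a (C *m u) a 0 * (C *m v) a 0 = \sum_c u c 0 * v c 0.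
  transitivity (((C *m u)^T *m (C *m v)) 0 0); first by rewrite mxE; apply: eq_bigr => a _; rewrite [(_^T) _ _]mxE.
  by rewrite trmx_mul mulmxA -(mulmxA u^T) CtC mulmx1 mxE; apply: eq_bigr => a _; rewrite [(_^T) _ _]mxE.
have fE a : f a q = (C *m delta_mx ord0 0 : 'cV[R]_k.+1) a 0 by rewrite -colE mxE C0.
split=> [|V|V V'].
- under eq_bigr => a _ do rewrite expr2 fE.
  by rewrite sumE (bigD1 ord0) //= big1 => [|c c0]; rewrite !mxE ?(negbTE c0) ?eqxx /= ?mulr1 ?addr0 ?mul0r.
- under eq_bigr => a _ do rewrite fE Cw.
  rewrite sumE (bigD1 ord0) //= big1 => [|c c0]; first by rewrite w0 mulr0 addr0.
  by rewrite !mxE (negbTE c0) mul0r.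
under eq_bigr => a _ do rewrite !Cw.
by rewrite sumE big_ord_recl w0 mul0r add0r Pb; apply: eq_bigr => i _; rewrite !wi.
Qed.

(** The initial values are (1, 0) and (0, b_i), with h = 0. Parallel transport preserves the fibre
    metric of each block, so orthonormality persists and the second block stays 0. *)
Lemma sphere_dev_exists p : exists f U, sphere_dev f U /\ U p.
Proof.
have [r [W [X [y [E [CS _]]]]]] := coord_system_exists hM (@openT M) (I : setT p).
have [b [bb Pb]] := frame p.
pose Y0 (a : 'I_k.+1) : vfield M := if unlift ord0 a is Some i then b i else 0.
have [Y00 Y0i] : Y0 ord0 = 0 /\ forall i, Y0 (lift ord0 i) = b i by rewrite /Y0 unlift_none; split=> // i; rewrite liftK.
have ex a := parallel_exists hM LC sym1 sym2 par1 par2 orth12 orth21 sum12 curv1 curv2 CS ((a == ord0 :> 'I_k.+1)%:R) 0 (Y0 a).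
have [f Hf] := choice ex; have [h Hh] := choice Hf; have [Y HY] := choice Hh; clear Hf Hh ex.
have P1b i V : gp p (P1 (b i)) V = gp p (b i) V.
  rewrite Pb (bigD1 i) //= big1 => [|j ji]; first by rewrite bb eqxx mul1r addr0 gpC.
  by rewrite bb eq_sym (negbTE ji) mul0r.
have P2E q A V : gp q (P2 A) V = gp q A V - gp q (P1 A) V by rewrite -[in X in X - _](sum12 A) gpDl addrAC subrr add0r.
have P12 q U V : gp q (P1 U) (P2 V) = 0 by rewrite sym1 orth12 gp0r.
have par : \forall q \near p, forall a, parallel_at g D P1 P2 q (f a) (h a) (Y a).
  by apply: (@filter_forall M 'I_k.+1 _ (nbhs p)) => a; have [] := HY a.
(* [F] and [H] are the fibre metrics of the two blocks on these sections; both are locally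
   constant. *)
pose F a c : smoothFun M := f a * f c + riem_app g (P1 (Y a)) (Y c).
pose H a : smoothFun M := h a * h a + riem_app g (P2 (Y a)) (Y a).
have FN : \forall q \near p, forall ac : 'I_k.+1 * 'I_k.+1, F ac.1 ac.2 q = F ac.1 ac.2 p.
  apply: (@filter_forall M ('I_k.+1 * 'I_k.+1)%type _ (nbhs p)) => -[a c]; change (\forall z \near p, F a c z = F a c p).
  apply: locally_constant_vfield; apply: filterS par => q Hq V.
  have [v1 _ v3] := Hq a V; have [w1 _ w3] := Hq c V.
  have e1 := v3 (P1 (Y c)); have e2 := w3 (P1 (Y a)).
  rewrite sym1 idem1 sym2 orth21 gp0r in e1; rewrite sym1 idem1 sym2 orth21 gp0r in e2.
  rewrite vfield_addr vfield_leibniz !smooth_addE !smooth_mulE v1 w1 (metricD LC) par1 sym1 e1 (gpC g q (P1 (Y a))) e2; ring.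
have HN : \forall q \near p, forall a, H a q = H a p.
  apply: (@filter_forall M 'I_k.+1 _ (nbhs p)) => a.
  apply: locally_constant_vfield; apply: filterS par => q Hq V; have [_ v2 v3] := Hq a V.
  have e1 := v3 (P2 (Y a)); rewrite sym1 orth12 gp0r sym2 idem2 in e1.
  rewrite vfield_addr vfield_leibniz !smooth_addE !smooth_mulE v2 (metricD LC) par2 sym2 e1 (gpC g q (P2 (Y a))) e1; ring.
have YY0 a V : gp p (Y a) V = gp p (Y0 a) V by apply: gp_at; have [] := HY a.
have P1Y0 a V : gp p (P1 (Y0 a)) V = gp p (Y0 a) V.
  rewrite /Y0; case: (unlift ord0 a) => [i|]; first exact: P1b.
  by rewrite sym1 !gp0l.
have Fp a c : F a c p = (a == c)%:R.
  rewrite -[LHS]/(f a p * f c p + gp p (P1 (Y a)) (Y c)) sym1 YY0 -sym1 P1Y0 gpC YY0.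
  have [-> _ _ _] := HY a; have [-> _ _ _] := HY c.
  case: (unliftP ord0 a) => [i|] ->; case: (unliftP ord0 c) => [j|] ->; rewrite ?Y00 ?Y0i ?gp0l ?gp0r ?eqxx ?mul1r ?mul0r ?mulr0 ?addr0 ?add0r //.
    by rewrite bb (inj_eq (@lift_inj _ ord0)) eq_sym.
have Hp a : H a p = 0.
  rewrite -[LHS]/(h a p * h a p + gp p (P2 (Y a)) (Y a)) sym2 YY0 -sym2 P2E P1Y0 subrr addr0.
  by have [_ -> _ _] := HY a; rewrite mulr0.
have main : \forall q \near p, sphere_dev_at q f Y.
  apply: filterS3 par FN HN => q Hq Fq Hq0.
  have hz a : h a q = 0 /\ forall V : vfield M, gp q (P2 (Y a)) V = 0.
    have e : h a q * h a q + gp q (P2 (Y a)) (P2 (Y a)) = 0.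
      by rewrite -sym2 idem2; have := Hq0 a; rewrite Hp.
    have n1 : 0 <= gp q (P2 (Y a)) (P2 (Y a)).
      have [z|nz] := eqVneq (vfield_at (P2 (Y a)) q) 0; last by apply: ltW; exact: (riem_pos g nz).
      by rewrite (@gp_at _ _ g q _ 0) ?gp0l // z vfield_at0.
    have n2 : 0 <= h a q * h a q by rewrite -expr2 sqr_ge0.
    have h0 : h a q * h a q = 0 by lra.
    split=> [|V]; first by apply/eqP; rewrite -sqrf_eq0 expr2 h0.
    rewrite (@gp_at _ _ g q _ 0) ?gp0l // vfield_at0.
    have [//|nz] := eqVneq (vfield_at (P2 (Y a)) q) 0.
    exfalso; have := riem_pos g nz; rewrite -[riem_at _ _ _ _]/(gp q (P2 (Y a)) (P2 (Y a))); lra.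
  have PY a V : gp q (P1 (Y a)) V = gp q (Y a) V by have := P2E q (Y a) V; rewrite (hz a).2; lra.
  have on a c : f a q * f c q + gp q (Y a) (Y c) = (a == c)%:R by rewrite -Fp -(Fq (a, c)) -PY.
  split=> // [a V|a V W'|]; last exact: parseval.
    by have [-> _ _] := Hq a V; rewrite gpC PY gpC.
  by have [_ _ ->] := Hq a V; rewrite (hz a).1 mul0r subr0.
have : nbhs p (fun q => sphere_dev_at q f Y) := main.
rewrite nbhsE => -[U [oU Up] HU].
by exists f, U; split=> //; split=> //; exists Y.
Qed.

(** The fibre products of two orthonormal parallel frames are locally constant and form the
    orthogonal transition matrix. *)
Lemma sphere_dev_trans f U f' U' q : sphere_dev f U -> sphere_dev f' U' -> U q -> U' q ->
  exists2 C : 'M[R]_k.+1, C *m C^T = 1%:M & \forall z \near q, rowf f' z = rowf f z *m C.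
Proof.
move=> [oU [Y HY]] [oU' [Y' HY']] Uq Uq'.
pose c a b : smoothFun M := f a * f' b + riem_app g (Y a) (Y' b).
have NU : nbhs q U by exact: open_nbhs_nbhs.
have NU' : nbhs q U' by exact: open_nbhs_nbhs.
have cN : \forall z \near q, forall ab : 'I_k.+1 * 'I_k.+1, c ab.1 ab.2 z = c ab.1 ab.2 q.
  apply: (@filter_forall M ('I_k.+1 * 'I_k.+1)%type _ (nbhs q)) => -[a b]; change (\forall z \near q, c a b z = c a b q).
  apply: locally_constant_vfield; apply: filterS2 NU NU' => z Uz Uz' V.
  have [v1 v2 v3 _ _] := HY z Uz; have [w1 w2 w3 _ _] := HY' z Uz'.
  rewrite /c vfield_addr vfield_leibniz !smooth_addE !smooth_mulE v1 w1 (metricD LC) v2 (gpC g z (Y a)) w2.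
  have e1 : gp z (P1 V) (Y' b) = gp z V (Y' b) by rewrite sym1 gpC w3 gpC.
  have e2 : gp z (P1 V) (Y a) = gp z V (Y a) by rewrite sym1 gpC v3 gpC.
  by rewrite e1 e2; ring.
exists (\matrix_(a, b) c a b q).
  have [v1 v2 v3 v4 [v5 v6 v7]] := HY q Uq; have [w1 w2 w3 w4 [w5 w6 w7]] := HY' q Uq'.
  apply/matrixP => a b; rewrite [LHS]mxE [RHS]mxE -v4 -(v3 a) -w7.
  transitivity (\sum_e (f a q * f b q * f' e q ^+ 2 + f a q * (f' e q * gp q (Y b) (Y' e)) + f b q * (f' e q * gp q (Y a) (Y' e))
     + gp q (Y a) (Y' e) * gp q (Y b) (Y' e))).
    have cE a' e' : c a' e' q = f a' q * f' e' q + gp q (Y a') (Y' e') by [].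
    apply: eq_bigr => e _; rewrite ![in LHS]mxE !cE; ring.
  by rewrite !big_split /= -!mulr_sumr w5 !w6 !mulr0 !addr0 mulr1.
apply: filterS3 NU NU' cN => z Uz Uz' cz; apply/rowP => b.
have [v1 v2 v3 v4 [v5 v6 v7]] := HY z Uz.
rewrite !mxE; transitivity (\sum_a (f' b z * f a z ^+ 2 + f a z * gp z (Y' b) (Y a))).
  by rewrite big_split /= -mulr_sumr v5 v6 mulr1 addr0.
apply: eq_bigr => a _; rewrite !mxE -(cz (a, b)) -[(c _ _) z]/(f a z * f' b z + gp z (Y a) (Y' b)) (gpC g z (Y a)); ring.
Qed.

End SphereFactor.

Lemma line_dev_exists (a : oneform M) p : (forall X Y, dext a X Y = 0) ->
  exists t U, (open U /\ forall q, U q -> forall V : vfield M, V t q = oneform_app a V q) /\ U p.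
Proof.
move=> da; have [r [W [X [y [E [CS _]]]]]] := coord_system_exists hM (@openT M) (I : setT p).
(* A primitive as a flat system of rank two: the [true] component is constant, equal to 1, and the
   [false] component t satisfies dt = a; closedness of [a] is flatness. *)
pose Gam (i : 'I_d) (s t : bool) : smoothFun M := if s && ~~ t then - oneform_app a (E i) else 0.
have G0 i s t q : ~~ (s && ~~ t) -> Gam i s t q = 0 by rewrite /Gam => /negbTE ->.
have [|u [u0 Hu]] := flat_functions_fin hM (Gam := Gam) (fun s : bool => s%:R) CS.
  move=> i j s t q Wq.
  have z i' j' : \sum_c Gam j' s c q * Gam i' c t q = 0.
    have h1 : Gam j' s true q = 0 by apply: G0; rewrite andbF.
    have h2 : Gam i' false t q = 0 by exact: G0.
    by rewrite big_bool h1 h2 mul0r mulr0; exact: addr0.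
  rewrite !z !addr0 /Gam; case: (s && ~~ t); last by rewrite !vfield_zero.
  rewrite !vfield_opp !smooth_oppE; congr (- _).
  have := congr1 (fun f : smoothFun M => 2 * f q) (da (E i) (E j)).
  rewrite /dext smooth_scaleE !smooth_addE !smooth_oppE mulrA mulfV // mul1r.
  have -> : oneform_app a (lie (E i) (E j)) q = 0.
    by rewrite /= (coord_field_lie hM CS) // linear0.
  by rewrite subr0 (_ : (0 : smoothFun M) q = 0) // mulr0 => /eqP; rewrite subr_eq0 => /eqP.
have expand (b : bool) : \forall q \near p, forall V : vfield M, V (u b) q = (~~ b)%:R * (u true q * oneform_app a V q).
  apply: filterS Hu => q [Wq Hq] V.
  have [_ _ _ _ H4] := CS; rewrite -[LHS]/(vfield_at V q (u b)) (H4 q _ _ Wq).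
  have aV : oneform_app a V q = \sum_k V (X k) q * oneform_app a (E k) q.
    rewrite /= (tangent_coord CS (vfield_at V q) Wq) linear_sum; apply: eq_bigr => k _.
    by rewrite linearZ.
  rewrite aV !mulr_sumr; apply: eq_bigr => k _.
  have h2 : Gam k false b q = 0 by exact: G0.
  have -> : E k (u b) q = - (u true q * Gam k true b q).
    apply/eqP; rewrite -addr_eq0; apply/eqP; rewrite -[RHS](Hq k b) big_bool h2 mulr0; congr (_ + _).
    exact: (esym (addr0 _)).
  rewrite -[vfield_at V q (X k)]/(V (X k) q); clear h2; case: b.
    by rewrite (G0 k true true) // mulr0 oppr0 mulr0 mul0r.
  have -> : Gam k true false q = - (oneform_app a (E k) q) by [].
  by rewrite mul1r; ring.
have u1 : \forall q \near p, u true q = 1.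
  have := locally_constant_vfield (f := u true) (p := p); rewrite u0; apply.
  by apply: filterS (expand true) => q H V; rewrite H mul0r.
have N : \forall q \near p, forall V : vfield M, V (u false) q = oneform_app a V q.
  by apply: filterS2 u1 (expand false) => q e H V; rewrite H e !mul1r.
have : nbhs p (fun q => forall V : vfield M, V (u false) q = oneform_app a V q) := N.
rewrite nbhsE => -[U [oU Up] HU].
by exists (u false), U.
Qed.

End FactorCoordinates.

(** * The model spaces *)

(* A factor of the model space; its isometries are the maps x |-> x C + w with
   C orthogonal and w in the group fW of admissible translations. *)
Record isofactor (R : realType) (d N : nat) := Factor {
  fpts : set 'rV[R]_N;
  fI : Type;
  fc : fI -> 'rV[R]_d -> 'rV[R]_N;
  fs : fI -> 'rV[R]_N -> 'rV[R]_d;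
  fO : fI -> set 'rV[R]_N;
  fW : set 'rV[R]_N;
  f_c : forall i z, [/\ fpts (fc i z), fO i (fc i z), fs i (fc i z) = z
                      & forall k, Coo_at z (fun z => fc i z 0 k)];
  f_s : forall i x, fO i x -> (forall k, Coo_at x (fun x => fs i x 0 k)) /\
                              (fpts x -> fc i (fs i x) = x);
  f_O : forall i, open (fO i);
  f_cover : forall x, fpts x -> exists i, fO i x;
  f_base : exists2 x, fpts x & forall i, fO i x;
  f_conn : forall i j, connected [set z | fO j (fc i z)];
  f_span : forall i (z : 'rV[R]_d) (c : 'rV[R]_N) (e : R), (\forall w \near z, dot (fc i w) c + e = 0) -> c = 0 /\ e = 0;
  f_W0 : fW 0;
  f_WM : forall (C : 'M[R]_N) u v, fW u -> fW v -> fW (u *m C + v);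
  f_Wset : forall (C : 'M[R]_N) w x, C *m C^T = 1%:M -> fW w -> fpts x -> fpts (x *m C + w)
}.

(** * Products of model factors *)

Section ProductModel.
Context {R : realType} {d1 N1 d2 N2 : nat} (X1 : isofactor R d1 N1) (X2 : isofactor R d2 N2).

Lemma dot_row_mx (a c : 'rV[R]_N1) (b e : 'rV[R]_N2) : dot (row_mx a b) (row_mx c e) = dot a c + dot b e.
Proof.
rewrite /dot big_split_ord /=; congr (_ + _); apply: eq_bigr => i _.
  by rewrite !row_mxEl.
by rewrite !row_mxEr.
Qed.

Lemma connected_block_set n1 n2 (A : set 'rV[R]_n1) (B : set 'rV[R]_n2) :
  connected A -> connected B -> connected (block_set A B).
Proof.
move=> cA cB; have [->|/set0P[a Aa]] := eqVneq A set0.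
  rewrite (_ : block_set set0 B = set0); first exact: connected0.
  by apply/seteqP; split=> x // [].
have row_cont (f : 'rV[R]_n1 -> 'rV[R]_n1) (h : 'rV[R]_n1 -> 'rV[R]_n2) : continuous f -> continuous h ->
    continuous (fun t => row_mx (f t) (h t)) by exact: row_mx_continuous.
have row_cont' (f : 'rV[R]_n2 -> 'rV[R]_n1) (h : 'rV[R]_n2 -> 'rV[R]_n2) : continuous f -> continuous h ->
    continuous (fun t => row_mx (f t) (h t)) by exact: row_mx_continuous.
have [->|/set0P[b Bb]] := eqVneq B set0.
  rewrite (_ : block_set A set0 = set0); first exact: connected0.
  by apply/seteqP; split=> x // [].
pose S y : set 'rV[R]_(n1 + n2) := (fun x => row_mx x y) @` A.
pose T : set 'rV[R]_(n1 + n2) := (fun y => row_mx a y) @` B.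
have cT : connected T.
  apply: connected_continuous_connected cB _; apply: continuous_subspaceT.
  have cc : continuous ((fun _ => a) : 'rV[R]_n2 -> 'rV[R]_n1) by exact: cst_continuous.
  by apply: (row_cont' _ _ cc) => x; exact: cvg_id.
have cS y : connected (S y).
  apply: connected_continuous_connected cA _; apply: continuous_subspaceT.
  have cc : continuous ((fun _ => y) : 'rV[R]_n1 -> 'rV[R]_n2) by exact: cst_continuous.
  by apply: (row_cont _ _ _ cc) => x; exact: cvg_id.
have -> : block_set A B = \bigcup_(y in B) (T `|` S y).
  apply/seteqP; split=> [x [h1 h2]|x [y By [[y' By' <-]|[x' Ax' <-]]]].
  - by exists (rsubmx x) => //; right; exists (lsubmx x) => //; rewrite hsubmxK.
  - by split; rewrite ?row_mxKl ?row_mxKr.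
  - by split; rewrite ?row_mxKl ?row_mxKr.
apply: bigcup_connected; first by exists (row_mx a b) => y By; left; exists b.
move=> y By; apply: connectedU => //.
by exists (row_mx a y); split; [exists y|exists a].
Qed.

Let Coo_l n1 n2 (z : 'rV[R]_(n1 + n2)) (f : 'rV[R]_n1 -> R) : Coo_at (lsubmx z) f -> Coo_at z (fun z => f (lsubmx z)).
Proof.
move=> Cf; apply: (@Coo_at_linear_comp R 'rV[R]_(n1 + n2) 'rV[R]_n1 (fun z => lsubmx z) f z) => //; last exact: lsubmx_continuous.
by move=> h x y; rewrite linearP.
Qed.
Let Coo_r n1 n2 (z : 'rV[R]_(n1 + n2)) (f : 'rV[R]_n2 -> R) : Coo_at (rsubmx z) f -> Coo_at z (fun z => f (rsubmx z)).
Proof.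
move=> Cf; apply: (@Coo_at_linear_comp R 'rV[R]_(n1 + n2) 'rV[R]_n2 (fun z => rsubmx z) f z) => //; last exact: rsubmx_continuous.
by move=> h x y; rewrite linearP.
Qed.

Let pts := block_set (fpts X1) (fpts X2).
Let c (ij : fI X1 * fI X2) (z : 'rV[R]_(d1 + d2)) : 'rV[R]_(N1 + N2) := row_mx (fc ij.1 (lsubmx z)) (fc ij.2 (rsubmx z)).
Let s (ij : fI X1 * fI X2) (x : 'rV[R]_(N1 + N2)) : 'rV[R]_(d1 + d2) := row_mx (fs ij.1 (lsubmx x)) (fs ij.2 (rsubmx x)).
Let O (ij : fI X1 * fI X2) : set 'rV[R]_(N1 + N2) := block_set (fO ij.1) (fO ij.2).

Definition block_iso (A1 : 'M[R]_N1 * 'rV[R]_N1) (A2 : 'M[R]_N2 * 'rV[R]_N2) : 'M[R]_(N1 + N2) * 'rV[R]_(N1 + N2) :=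
  (block_mx A1.1 0 0 A2.1, row_mx A1.2 A2.2).
Definition factor_iso N d (X : isofactor R d N) (A : 'M[R]_N * 'rV[R]_N) : Prop := A.1 *m A.1^T = 1%:M /\ fW X A.2.
Let G : set ('M[R]_(N1 + N2) * 'rV[R]_(N1 + N2)) :=
  [set A | exists A1 A2, [/\ factor_iso X1 A1, factor_iso X2 A2 & A = block_iso A1 A2]].

Lemma aff_block A1 A2 x y : aff (block_iso A1 A2) (row_mx x y) = row_mx (aff A1 x) (aff A2 y).
Proof. by rewrite /aff /block_iso /= mul_row_block !mulmx0 addr0 add0r add_row_mx. Qed.

Let aff_blockE A1 A2 x : aff (block_iso A1 A2) x = row_mx (aff A1 (lsubmx x)) (aff A2 (rsubmx x)).
Proof. by rewrite -aff_block hsubmxK. Qed.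

Lemma factor_iso_comp N d (X : isofactor R d N) A B : factor_iso X A -> factor_iso X B ->
  factor_iso X (B.1 *m A.1, B.2 *m A.1 + A.2) /\ forall x, aff (B.1 *m A.1, B.2 *m A.1 + A.2) x = aff A (aff B x).
Proof.
move=> [a1 a2] [b1 b2]; split=> [|x]; last by rewrite /aff /= mulmxDl mulmxA addrA.
by split; [rewrite /= trmx_mul mulmxA -(mulmxA B.1) a1 mulmx1|exact: f_WM].
Qed.

Lemma factor_iso_inv N d (X : isofactor R d N) A : factor_iso X A ->
  exists2 B, factor_iso X B & forall x, aff B (aff A x) = x /\ aff A (aff B x) = x.
Proof.
(* The translation of the inverse is written in the shape u C + v for which [f_WM] gives
   membership. *)
move=> [a1 a2]; have a1' := mulmx1C a1; exists (A.1^T, A.2 *m (- A.1^T) + 0).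
  by split; [rewrite /= trmxK|apply: f_WM => //; exact: f_W0].
move=> x; rewrite /aff /= addr0 mulmxN; split.
  by rewrite mulmxDl -mulmxA a1 mulmx1 addrK.
by rewrite mulmxDl mulNmx -!mulmxA a1' !mulmx1 subrK.
Qed.

Lemma product_span ij (z : 'rV[R]_(d1 + d2)) (v : 'rV[R]_(N1 + N2)) (e : R) :
  (\forall w \near z, dot (c ij w) v + e = 0) -> v = 0 /\ e = 0.
Proof.
move=> H; have H' : \forall w \near z, dot (fc ij.1 (lsubmx w)) (lsubmx v) + (dot (fc ij.2 (rsubmx w)) (rsubmx v) + e) = 0.
  by apply: filterS H => w; rewrite -{1}(hsubmxK v) /c dot_row_mx addrA.
have c1 : continuous ((fun w => row_mx w (rsubmx z)) : 'rV[R]_d1 -> 'rV[R]_(d1 + d2)).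
  have cc : continuous ((fun _ => rsubmx z) : 'rV[R]_d1 -> 'rV[R]_d2) by exact: cst_continuous.
  by apply: (row_mx_continuous _ cc) => x; exact: cvg_id.
have c2 : continuous ((fun w => row_mx (lsubmx z) w) : 'rV[R]_d2 -> 'rV[R]_(d1 + d2)).
  have cc : continuous ((fun _ => lsubmx z) : 'rV[R]_d2 -> 'rV[R]_d1) by exact: cst_continuous.
  by apply: (row_mx_continuous cc) => x; exact: cvg_id.
have [v1 e1] : lsubmx v = 0 /\ dot (fc ij.2 (rsubmx z)) (rsubmx v) + e = 0.
  apply: (f_span (i := ij.1) (z := lsubmx z)); have := near_comp (@c1 (lsubmx z)); rewrite /= hsubmxK => /(_ _ H').
  by apply: filterS => w; rewrite row_mxKl row_mxKr.
have [v2 e2] : rsubmx v = 0 /\ dot (fc ij.1 (lsubmx z)) (lsubmx v) + e = 0.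
  apply: (f_span (i := ij.2) (z := rsubmx z)); have := near_comp (@c2 (rsubmx z)); rewrite /= hsubmxK => /(_ _ H').
  by apply: filterS => w; rewrite row_mxKl row_mxKr addrCA.
rewrite v1 dot0r add0r in e2; split=> //.
by rewrite -(hsubmxK v) v1 v2 row_mx0.
Qed.

Definition prod_model : model R (d1 + d2) (N1 + N2).
Proof.
refine (@Model R (d1 + d2) (N1 + N2) pts (fI X1 * fI X2)%type c s O G _ _ _ _ _ _ _ _ _ _ _ _).
- move=> [i j] z; have [p1 o1' s1 C1] := f_c i (lsubmx z); have [p2 o2' s2 C2] := f_c j (rsubmx z).
  split; rewrite /pts /c /O /s /block_set /= ?row_mxKl ?row_mxKr ?s1 ?s2 ?hsubmxK //.
  move=> k; rewrite -(fintype.splitK k) /unsplit; case: (fintype.split k) => l.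
    by under eq_fun do rewrite row_mxEl; exact: (Coo_l (C1 l)).
  by under eq_fun do rewrite row_mxEr; exact: (Coo_r (C2 l)).
- move=> [i j] x [hO1 hO2]; have [C1 K1] := f_s hO1; have [C2 K2] := f_s hO2; split=> [k|[P1 P2]].
    rewrite /s -(fintype.splitK k) /unsplit; case: (fintype.split k) => l.
      by under eq_fun do rewrite row_mxEl; exact: (Coo_l (C1 l)).
    by under eq_fun do rewrite row_mxEr; exact: (Coo_r (C2 l)).
  by rewrite /c /s /= row_mxKl row_mxKr K1 // K2 // hsubmxK.
- move=> [i j]; have -> : O (i, j) = (fun x => lsubmx x) @^-1` fO i `&` (fun x => rsubmx x) @^-1` fO j by [].
  apply: openI.
    by apply: (@open_comp _ _ (fun x : 'rV[R]_(N1 + N2) => lsubmx x)); [move=> x _; exact: lsubmx_continuous|exact: f_O].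
  by apply: (@open_comp _ _ (fun x : 'rV[R]_(N1 + N2) => rsubmx x)); [move=> x _; exact: rsubmx_continuous|exact: f_O].
- move=> x [P1 P2]; have [i O1] := f_cover P1; have [j O2] := f_cover P2; by exists (i, j).
- have [x1 P1 O1] := f_base X1; have [x2 P2 O2] := f_base X2; exists (row_mx x1 x2).
    by split; rewrite ?row_mxKl ?row_mxKr.
  by move=> [i j]; split; rewrite /= ?row_mxKl ?row_mxKr.
- move=> [i j] [i' j'].
  have -> : [set z | O (i', j') (c (i, j) z)] = block_set [set z | fO i' (fc i z)] [set z | fO j' (fc j z)].
    by apply/seteqP; split=> z; rewrite /O /c /block_set /= row_mxKl row_mxKr.
  by apply: connected_block_set; exact: f_conn.
(* Each column of A - A' with the matching entry of v - v' defines an affine function vanishing on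
   an open piece of the model, so [product_span] applies column by column. *)
- move=> ij z [A v] [A' v'] H.
  have col l : (row l (A - A')^T = 0) /\ (v - v') 0 l = 0.
    apply: (product_span (ij := ij) (z := z)); apply: filterS H => w /(congr1 (fun x : 'rV[R]_(N1 + N2) => x 0 l)).
    rewrite /aff /= !mxE => e; apply/eqP; rewrite /dot.
    have -> : \sum_i c ij w 0 i * row l (A - A')^T 0 i = \sum_i c ij w 0 i * A i l - \sum_i c ij w 0 i * A' i l.
      by rewrite -sumrB; apply: eq_bigr => i _; rewrite !mxE mulrBr.
    by move: e; set a := \sum_i _; set b := \sum_i _ => e; apply/eqP; lra.
  congr pair.
    apply/matrixP => k l; apply/eqP; rewrite -subr_eq0; apply/eqP.
    by have [/(congr1 (fun x : 'rV[R]_(N1 + N2) => x 0 k))] := col l; rewrite !mxE.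
  apply/rowP => l; apply/eqP; rewrite -subr_eq0; apply/eqP.
  by have [_] := col l; rewrite !mxE.
- move=> _ [A1 [A2 [[a1 _] [a2 _] ->]]].
  by rewrite /block_iso /= tr_block_mx !trmx0 mulmx_block !mulmx0 !mul0mx !addr0 !add0r a1 a2 -scalar_mx_block.
- move=> _ x [A1 [A2 [[a1 w1] [a2 w2] ->]]] [P1 P2]; rewrite aff_blockE.
  by split; rewrite ?row_mxKl ?row_mxKr; exact: f_Wset.
- exists (block_iso (1%:M, 0) (1%:M, 0)) => [|x].
    exists (1%:M, 0), (1%:M, 0).
    by split; rewrite // /factor_iso /= trmx1 mulmx1; split=> //; exact: f_W0.
  by rewrite aff_blockE /aff /= !mulmx1 !addr0 hsubmxK.
- move=> _ [A1 [A2 [g1 g2 ->]]]; have [B1 h1 k1] := factor_iso_inv g1; have [B2 h2 k2] := factor_iso_inv g2.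
  exists (block_iso B1 B2) => [|x]; first by exists B1, B2.
  rewrite !aff_blockE !row_mxKl !row_mxKr (k1 (lsubmx x)).1 (k1 (lsubmx x)).2 (k2 (rsubmx x)).1 (k2 (rsubmx x)).2.
  by rewrite hsubmxK.
- move=> _ _ [A1 [A2 [g1 g2 ->]]] [B1 [B2 [h1 h2 ->]]].
  have [k1 e1] := factor_iso_comp g1 h1; have [k2 e2] := factor_iso_comp g2 h2.
  exists (block_iso (B1.1 *m A1.1, B1.2 *m A1.1 + A1.2) (B2.1 *m A2.1, B2.2 *m A2.1 + A2.2)) => [|x].
    by exists (B1.1 *m A1.1, B1.2 *m A1.1 + A1.2), (B2.1 *m A2.1, B2.2 *m A2.1 + A2.2).
  by rewrite !aff_blockE !row_mxKl !row_mxKr e1 e2.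
Defined.

End ProductModel.

Section LineFactor.
Context {R : realType}.

Lemma line_span (z c : 'rV[R]_1) (e : R) : (\forall w \near z, dot w c + e = 0) -> c = 0 /\ e = 0.
Proof.
move=> H; have H0 : dot z c + e = 0 by exact: nbhs_singleton H.
have [e0 /= e00 He] := (nbhs_ballP _ _).1 H.
pose s := e0 / 2 / (`|c| + 1); have c1 : 0 < `|c| + 1 by rewrite ltr_wpDl.
have s0 : 0 < s by rewrite !divr_gt0.
have H1 : dot (z + s *: c) c + e = 0.
  apply: He; rewrite -ball_normE /= opprD addrA subrr add0r normrN normrZ gtr0_norm //.
  rewrite /s mulrAC -mulrA; apply: (@le_lt_trans _ _ (e0 / 2)); last by lra.
  have q1 : `|c| / (`|c| + 1) <= 1 by rewrite ler_pdivrMr // mul1r lerDl.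
  by rewrite -[leRHS]mulr1 ler_wpM2l // divr_ge0 // ltW.
have cc : dot c c = 0.
  have e1 : s * dot c c = 0 by move: H1; rewrite dotDl dotZl; lra.
  by move/eqP: e1; rewrite mulf_eq0 gt_eqF //= => /eqP.
have c0 := dot_eq0 cc; split=> //; by move: H0; rewrite c0 dot0r add0r.
Qed.

Definition line_factor : isofactor R 1 1.
Proof.
refine (@Factor R 1 1 [set: 'rV[R]_1] unit (fun _ z => z) (fun _ x => x) (fun _ => [set: 'rV[R]_1]) [set: 'rV[R]_1] _ _ _ _ _ _ _ _ _ _).
- by move=> i z; split=> // k; exact: Coo_at_coord.
- by move=> i x _; split=> // k; exact: Coo_at_coord.
- by move=> _; exact: openT.
- by move=> x _; exists tt.
- by exists 0.
- by move=> _ _; apply: (@convex_connected R 'rV[R]_1 _ 0).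
- by move=> _ z c e; exact: line_span.
- by [].
- by [].
- by [].
Defined.

End LineFactor.

Lemma costereo_entry {R : realType} n (q w : 'rV[R]_n) j :
  costereo q w 0 j = (dot w w + 1)^-1 * (2 * w 0 j + (dot w w - 1) * q 0 j).
Proof. by rewrite /costereo !mxE. Qed.
Lemma stereo_entry {R : realType} n (q x : 'rV[R]_n) j : stereo q x 0 j = (1 - dot x q)^-1 * (x 0 j - dot x q * q 0 j).
Proof. by rewrite /stereo !mxE. Qed.

(** * The sphere with two stereographic charts *)

Section SphereFactor.
Context {R : realType} (k : nat).
Hypothesis k2 : (2 < k)%N.
Local Notation V := ('rV[R]_(1 + k)).

Let e0 (b : bool) : V := row_mx ((-1) ^+ b)%:M 0.
Let emb (z : 'rV[R]_k) : V := row_mx 0 z.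

Let dot_block (a c : 'rV[R]_1) (b e : 'rV[R]_k) : dot (row_mx a b) (row_mx c e) = dot a c + dot b e.
Proof. exact: dot_row_mx. Qed.
Let dot1 (a c : 'rV[R]_1) : dot a c = a 0 0 * c 0 0.
Proof. by rewrite /dot big_ord1. Qed.

Let e0_unit b : dot (e0 b) (e0 b) = 1.
Proof. by rewrite /e0 dot_block dot1 !mxE /= dot0r addr0 mulr1n -expr2 sqrr_sign. Qed.
Let emb_orth z b : dot (emb z) (e0 b) = 0.
Proof. by rewrite /emb /e0 dot_block dot1 mxE mul0r dot0r addr0. Qed.
Let emb_dot z : dot (emb z) (emb z) = dot z z.
Proof. by rewrite /emb dot_block dot1 mxE mul0r add0r. Qed.

Let c b z : V := costereo (e0 b) (emb z).
Let s b (x : V) : 'rV[R]_k := rsubmx (stereo (e0 b) x).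
Let O b : set V := [set x | dot x (e0 b) != 1].

Let e0N b b' : e0 b' = if b == b' then e0 b else - e0 b.
Proof. by case: b b' => -[]; rewrite /e0 // ?expr0 ?expr1 opp_row_mx ?oppr0 ?scalar_mxN ?opprK -?rmorphN ?opprK. Qed.

Let c_dot b z : dot (c b z) (e0 b) = (dot z z - 1) / (dot z z + 1).
Proof. by rewrite /c /costereo dotZl dotDl !dotZl emb_orth emb_dot e0_unit mulr0 add0r mulr1 mulrC. Qed.

Let c_O b b' z : O b' (c b z) <-> b = b' \/ z != 0.
Proof.
have d1 := dot1_gt0 z; rewrite /O /= (e0N b b').
have [<-|bb] := eqVneq b b'.
  split=> _; first by left.
  rewrite c_dot; apply/eqP => /(congr1 (fun x => x * (dot z z + 1))); rewrite mulfVK ?gt_eqF // mul1r; lra.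
rewrite dotNr c_dot -mulNr opprB; have -> : ((1 - dot z z) / (dot z z + 1) != 1) = (z != 0).
  apply/idP/idP; apply: contra => /eqP h; apply/eqP.
    by rewrite h dot0r subr0 add0r divr1.
  apply: dot_eq0; have := congr1 (fun x => x * (dot z z + 1)) h; rewrite mulfVK ?gt_eqF // mul1r; lra.
split=> [h|[h|//]]; first by right.
by rewrite h eqxx in bb.
Qed.

Let emb_stereo b (x : V) : emb (s b x) = stereo (e0 b) x.
Proof.
rewrite /emb /s -[RHS]hsubmxK; congr row_mx; apply/rowP => j; rewrite ord1 [LHS]mxE.
have := stereo_orth x (e0_unit b); rewrite -{1}[stereo _ _]hsubmxK /e0 dot_block dot0r addr0 dot1.
rewrite [(_%:M) 0 0]mxE eqxx mulr1n => /eqP; rewrite mulf_eq0 signr_eq0 orbF => /eqP /esym.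
by move=> ->.
Qed.

Let stereoc b z : s b (c b z) = z.
Proof.
have d1 := dot1_gt0 z; rewrite /s /stereo c_dot.
have -> : 1 - (dot z z - 1) / (dot z z + 1) = 2 / (dot z z + 1) by field; rewrite gt_eqF.
have rsubZ (a : R) (x : V) : rsubmx (a *: x) = a *: rsubmx x by apply/rowP => j; rewrite !mxE.
have rsubD (x y : V) : rsubmx (x + y) = rsubmx x + rsubmx y by apply/rowP => j; rewrite !mxE.
have re : rsubmx (e0 b) = 0 by rewrite /e0 row_mxKr.
have rc : rsubmx (c b z) = ((dot z z + 1)^-1 * 2) *: z.
  by rewrite /c /costereo emb_dot rsubZ rsubD !rsubZ re scaler0 addr0 /emb row_mxKr scalerA.
rewrite -scaleNr rsubZ rsubD rc rsubZ re scaler0 addr0 scalerA invf_div (_ : _ * _ = 1) ?scale1r //.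
by field; rewrite gt_eqF.
Qed.

Let Coo_dot N (x : 'rV[R]_N) (f h : 'rV[R]_N -> 'rV[R]_(1 + k)) : (forall j, Coo_at x (fun y => f y 0 j)) ->
  (forall j, Coo_at x (fun y => h y 0 j)) -> Coo_at x (fun y => dot (f y) (h y)).
Proof. by move=> Cf Ch; apply: Coo_at_sum => j; apply: Coo_atM. Qed.

Let Coo_emb (z : 'rV[R]_k) j : Coo_at z (fun z => emb z 0 j).
Proof.
rewrite /emb -(fintype.splitK j) /unsplit; case: (fintype.split j) => l.
  by under eq_fun do rewrite row_mxEl mxE; exact: Coo_at_cst.
by under eq_fun do rewrite row_mxEr; exact: Coo_at_coord.
Qed.

Let Coo_c b z j : Coo_at z (fun z => c b z 0 j).
Proof.
rewrite /c; under eq_fun do rewrite costereo_entry.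
have Cd : Coo_at z (fun z => dot (emb z) (emb z)) by apply: Coo_dot => l; exact: Coo_emb.
apply: Coo_atM; first apply: Coo_atV.
- by apply: Coo_atD => //; exact: Coo_at_cst.
- by rewrite gt_eqF // dot1_gt0.
apply: Coo_atD; first by apply: Coo_atM; [exact: Coo_at_cst|exact: Coo_emb].
by apply: Coo_atM; [apply: Coo_atB => //; exact: Coo_at_cst|exact: Coo_at_cst].
Qed.

Let Coo_s b x j : O b x -> Coo_at x (fun x => s b x 0 j).
Proof.
move=> Ox; rewrite /s; under eq_fun do rewrite mxE stereo_entry.
have Cd : Coo_at x (fun x : V => dot x (e0 b)) by apply: Coo_dot => l; [exact: Coo_at_coord|exact: Coo_at_cst].
apply: Coo_atM; first apply: Coo_atV.
- by apply: Coo_atB => //; exact: Coo_at_cst.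
- by rewrite subr_eq0 eq_sym.
by apply: Coo_atB; [exact: Coo_at_coord|apply: Coo_atM => //; exact: Coo_at_cst].
Qed.

(** A union of closed half-spaces without 0, each star-shaped about its normal [v]; they all contain
    [a] because [v] is orthogonal to it, and dimension 3 leaves a normal orthogonal to any further
    point. This is the overlap of the two charts. *)
Lemma connected_punctured n : (2 < n)%N -> connected [set z : 'rV[R]_n | z != 0].
Proof.
move=> n2; have [->|/set0P[a a0]] := eqVneq [set z : 'rV[R]_n | z != 0] set0; first exact: connected0.
pose S (v : 'rV[R]_n) : set 'rV[R]_n := [set y | y != 0 /\ 0 <= dot y v].
have -> : [set z : 'rV[R]_n | z != 0] = \bigcup_(v in [set v | v != 0 /\ dot v a = 0]) S v.
  apply/seteqP; split=> [b /= b0|b [v _ [] //]].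
  have [v [v0 va vb]] := orthogonal_vector a b n2; exists v => //; split=> //.
  by rewrite dotC vb.
apply: bigcup_connected; first by exists a => v [v0 va]; split=> //; rewrite dotC va.
move=> v [v0 va]; have vv := dot_gt0 v0; apply: (@convex_connected R 'rV[R]_n _ v).
  by split=> //; exact: ltW.
move=> y t [y0 yv] /andP[t0 t1].
have e : dot (t *: (y - v) + v) v = t * dot y v + (1 - t) * dot v v by rewrite dotDl dotZl dotDl dotNl; ring.
split; last by rewrite e; apply: addr_ge0; apply: mulr_ge0 => //; rewrite ?subr_ge0 // ltW.
apply/eqP => z; move: e; rewrite z dotC dot0r => e.
have t1' : t = 1.
  apply/eqP; rewrite eq_le t1 /= leNgt; apply/negP => tl.
  have h1 : 0 < (1 - t) * dot v v by rewrite mulr_gt0 // subr_gt0.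
  have h2 : 0 <= t * dot y v by rewrite mulr_ge0.
  lra.
by move: z; rewrite t1' scale1r subrK => z; rewrite z eqxx in y0.
Qed.

(** Multiplied by w.w + 1, the condition is a quadratic polynomial in w vanishing near [z]. Its
    restriction to every line through [z] has zero coefficients: the quadratic one gives al + e = 0,
    the linear one u = 0, the constant one e = 0. *)
Let span b (z : 'rV[R]_k) (v : V) (e : R) : (\forall w \near z, dot (c b w) v + e = 0) -> v = 0 /\ e = 0.
Proof.
move=> H; pose al : R := (-1) ^+ b * v 0 0; pose u : 'rV[R]_k := rsubmx v.
have vE : v = row_mx (v 0 0)%:M u.
  rewrite -[LHS]hsubmxK; congr row_mx; apply/rowP => j; rewrite ord1 !mxE eqxx mulr1n.
  by congr (v _ _); apply: val_inj.
pose f (w : 'rV[R]_k) := 2 * dot w u + (dot w w - 1) * al + e * (dot w w + 1).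
have fE w : dot (c b w) v + e = 0 -> f w = 0.
  have d1 := dot1_gt0 w; rewrite /c /costereo dotZl dotDl !dotZl emb_dot.
  have -> : dot (emb w) v = dot w u by rewrite [in LHS]vE /emb dot_block dot1 mxE mul0r add0r.
  have -> : dot (e0 b) v = al by rewrite [in LHS]vE /e0 dot_block dot1 !mxE eqxx !mulr1n dotC dot0r addr0.
  by move=> /(congr1 (fun x => x * (dot w w + 1))); rewrite mul0r mulrDl mulrAC mulVf ?gt_eqF // mul1r /f; lra.
have F0 : \forall w \near z, f w = 0 by apply: filterS H => w; exact: fE.
have [e1 /= e10 He] := (nbhs_ballP _ _).1 F0.
have line (q : 'rV[R]_k) : exists2 t : R, 0 < t & f (z + t *: q) = 0 /\ f (z - t *: q) = 0.
  have c1 : 0 < `|q| + 1 by rewrite ltr_wpDl.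
  have n1 : e1 / 2 / (`|q| + 1) * `|q| < e1.
    rewrite mulrAC -mulrA; apply: (@le_lt_trans _ _ (e1 / 2)); last by lra.
    have q1 : `|q| / (`|q| + 1) <= 1 by rewrite ler_pdivrMr // mul1r lerDl.
  by rewrite -[leRHS]mulr1 ler_wpM2l // divr_ge0 // ltW.
  have s0 : 0 < e1 / 2 / (`|q| + 1) by rewrite !divr_gt0.
  exists (e1 / 2 / (`|q| + 1)) => //; split; apply: He; rewrite -ball_normE /=.
    by rewrite opprD addrA subrr add0r normrN normrZ gtr0_norm.
  by rewrite opprB addrC subrK normrZ gtr0_norm.
have Fz : f z = 0 by exact: nbhs_singleton F0.
have fq q t : f (z + t *: q) = f z + t * (2 * dot q u + 2 * (al + e) * dot z q) + t ^+ 2 * ((al + e) * dot q q).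
  by rewrite /f !(dotDl, dotDr, dotZl, dotZr) (dotC q z); ring.
have key (q : 'rV[R]_k) : (al + e) * dot q q = 0 /\ 2 * dot q u + 2 * (al + e) * dot z q = 0.
  have [t t0 [h1 h2]] := line q; rewrite fq Fz in h1; rewrite -scaleNr fq Fz in h2.
  have t2 : t ^+ 2 != 0 by rewrite expf_neq0 // gt_eqF.
  split; [apply: (mulfI t2)|apply: (mulfI (lt0r_neq0 t0))]; rewrite mulr0; move: h1 h2; rewrite sqrrN; lra.
have ae : al + e = 0.
  have [h _] := key (delta_mx 0 (Ordinal (ltnW (ltnW k2) : 0 < k)%N)).
  have d0 : delta_mx 0 (Ordinal (ltnW (ltnW k2) : 0 < k)%N) != 0 :> 'rV[R]_k.
    by apply/eqP => /(congr1 (fun x : 'rV[R]_k => x 0 (Ordinal (ltnW (ltnW k2) : 0 < k)%N))); rewrite !mxE !eqxx => /eqP; rewrite oner_eq0.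
  by move/eqP: h; rewrite mulf_eq0 [X in _ || X]gt_eqF ?dot_gt0 // orbF => /eqP.
have u0 : u = 0 by apply: dot_eq0; have [_] := key u; rewrite ae; lra.
have ee : e = 0.
  have : 2 * e = f z by rewrite /f u0 dot0r (_ : al = - e); [ring|lra].
  by rewrite Fz; lra.
have a0 : al = 0 by lra.
split=> //; rewrite vE u0; have -> : v 0 0 = 0 by move/eqP: a0; rewrite mulf_eq0 signr_eq0 => /eqP.
by rewrite -scalemx1 scale0r row_mx0.
Qed.

Let O_open b : open (O b).
Proof.
have -> : O b = (fun x : V => dot x (e0 b)) @^-1` [set t : R | t != 1] by [].
apply: open_comp => [x _|]; last exact: open_neq.
have cc : continuous ((fun=> e0 b) : V -> V) by exact: cst_continuous.
have ci : continuous ((fun x => x) : V -> V) by move=> y; exact: cvg_id.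
exact: (continuous_dot ci cc).
Qed.

Definition sphere_factor : isofactor R k (1 + k).
Proof.
(* The booleans index the two poles; 0 is the only translation, so the isometries of this factor are
   linear. *)
refine (@Factor R k (1 + k) (unit_sphere R k) bool c s O [set 0] _ _ _ _ _ _ _ _ _ _).
- move=> b z; split; [|by apply/c_O; left|exact: stereoc|exact: Coo_c].
  by apply/sphereE; apply: costereo_sphere; [exact: e0_unit|exact: emb_orth].
- move=> b x Ox; split=> [j|/sphereE x1]; first exact: Coo_s.
  by rewrite /c emb_stereo stereoK // e0_unit.
- exact: O_open.
- move=> x _; have [h|h] := eqVneq (dot x (e0 true)) 1; last by exists true.
  by exists false; rewrite /O /= (e0N true false) dotNr h; apply/eqP; lra.
- pose v : 'rV[R]_k := delta_mx 0 (Ordinal (ltnW (ltnW k2) : 0 < k)%N).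
  exists (emb v); last by move=> b; rewrite /O /= emb_orth eq_sym oner_neq0.
  by apply/sphereE; rewrite emb_dot /v /dot (bigD1 (Ordinal (ltnW (ltnW k2) : 0 < k)%N)) //= big1 => [|j /negbTE j0]; rewrite !mxE ?j0 ?eqxx ?mulr1 ?addr0 ?mul0r.
- move=> b b'; have [bb|bb] := eqVneq b b'.
    have -> : [set z | O b' (c b z)] = setT by apply/seteqP; split=> z // _; apply/c_O; left.
    by apply: (@convex_connected R 'rV[R]_k _ 0).
  have -> : [set z | O b' (c b z)] = [set z : 'rV[R]_k | z != 0].
    by apply/seteqP; split=> z; [move/c_O => [h|//]; rewrite h eqxx in bb|move=> h; apply/c_O; right].
  exact: connected_punctured.
- exact: span.
- by [].
- by move=> C u v -> ->; rewrite /= mul0mx addr0.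
- move=> C w x CC -> /sphereE x1; apply/sphereE; rewrite addr0.
  have dE (y : V) : dot y y = (y *m y^T) 0 0 by rewrite mxE; apply: eq_bigr => j _; rewrite mxE.
  by rewrite dE trmx_mul mulmxA -(mulmxA x) CC mulmx1 -dE.
Defined.

End SphereFactor.

(** * The universal covering *)

Section EmbeddedMaps.
Context {R : realType}.

Section LinearMap.
Context {V W : normedModType R} (A : set V) (B : set W) (L : V -> W).
Hypothesis linL : forall (h : R) x y, L (h *: x + y) = h *: L x + L y.
Hypothesis contL : continuous L.
Hypothesis AB : forall x, A x -> B (L x).

Definition emb_fun (x : embedded A) : embedded B := SigSub (mem_set (AB (set_valP x))).

Lemma emb_smooth : smooth_on setT emb_fun.
Proof.
move=> p _; have cp : {for p, continuous emb_fun}.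
  apply: continuous_comp_initial => q.
  apply: (@continuous_comp _ _ _ (set_val : embedded A -> V) L); first exact: initial_continuous.
  exact: contL.
split=> // f [F CF fF]; exists (F \o L); first exact: (Coo_at_linear_comp linL contL).
exact: cp fF.
Qed.

Definition emb_map : smoothMap (embedded A) (embedded B) := SmoothMap emb_smooth.
End LinearMap.

Section BlockIsometry.
Context {k1 k2 : nat} (A : set 'rV[R]_k1) (B : set 'rV[R]_k2).
Local Notation N := (k1 + k2)%N.

Let split_lin (h : R) (x y : 'rV[R]_N) : (lsubmx (h *: x + y), rsubmx (h *: x + y)) =
  h *: (lsubmx x, rsubmx x) + (lsubmx y, rsubmx y) :> 'rV[R]_k1 * 'rV[R]_k2.
Proof. by rewrite !linearP. Qed.
Let split_cont : continuous ((fun x => (lsubmx x, rsubmx x)) : 'rV[R]_N -> 'rV[R]_k1 * 'rV[R]_k2).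
Proof.
move=> x S [[P Q] /= [nP nQ] PQ].
apply: filterS2 (near_comp (@lsubmx_continuous R k1 k2 x) nP) (near_comp (@rsubmx_continuous R k1 k2 x) nQ) => w hP hQ.
exact: (PQ (lsubmx w, rsubmx w) (conj hP hQ)).
Qed.
Let split_in x : block_set A B x -> (A `*` B) (lsubmx x, rsubmx x). Proof. by []. Qed.
Let join_lin (h : R) (x y : 'rV[R]_k1 * 'rV[R]_k2) : row_mx (h *: x + y).1 (h *: x + y).2 =
  h *: row_mx x.1 x.2 + row_mx y.1 y.2.
Proof. by rewrite scale_row_mx add_row_mx. Qed.
Let join_cont : continuous ((fun x => row_mx x.1 x.2) : 'rV[R]_k1 * 'rV[R]_k2 -> 'rV[R]_N).
Proof. by apply: row_mx_continuous => x; [exact: cvg_fst|exact: cvg_snd]. Qed.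
Let join_in x : (A `*` B) x -> block_set A B (row_mx x.1 x.2).
Proof. by move=> [h1 h2]; split; rewrite ?row_mxKl ?row_mxKr. Qed.

(** The model lives in row vectors of length k1 + k2, the product metric on a product of two spaces;
    splitting and joining rows are linear and match the coordinate functions. *)
Lemma block_isometric :
  isometric (@induced_metric R N (block_set A B)) (prod_metric (@induced_metric R k1 A) (@induced_metric R k2 B)).
Proof.
exists (emb_map split_lin split_cont split_in), (emb_map join_lin join_cont join_in); split.
- by move=> x; apply: set_val_inj; exact: hsubmxK.
- by move=> [[x y] h]; apply: set_val_inj; exact: (congr2 pair (row_mxKl x y) (row_mxKr x y)).
set F := emb_map split_lin split_cont split_in.
have cl i : pullback F (pullback (fst_map A B) (coord_fun A i)) = coord_fun (block_set A B) (lshift k2 i).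
  by apply: smoothFun_eqP => x; rewrite -[LHS]/(lsubmx (set_val x : 'rV[R]_N) 0 i) mxE.
have cr i : pullback F (pullback (snd_map A B) (coord_fun B i)) = coord_fun (block_set A B) (rshift k1 i).
  by apply: smoothFun_eqP => x; rewrite -[LHS]/(rsubmx (set_val x : 'rV[R]_N) 0 i) mxE.
move=> p u v; rewrite /prod_metric /induced_metric big_split_ord; congr (_ + _); apply: eq_bigr => i _.
  by rewrite -cl.
by rewrite -cr.
Qed.
End BlockIsometry.

Lemma compact_embedded (V : normedModType R) (A : set V) : compact A -> compact [set: embedded A].
Proof.
move=> cA G PG _; pose H : set_system V := (set_val : embedded A -> V) @ G.
have HA : H A.
  change (G ((set_val : embedded A -> V) @^-1` A)).
  rewrite (_ : _ @^-1` A = setT); first exact: filterT.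
  by apply/seteqP; split=> // x _; exact: set_valP.
have [a [Aa ca]] := cA H _ HA.
pose pa : embedded A := SigSub (mem_set Aa); exists pa; split=> // S T GS; rewrite nbhsE => -[Q [[W oW WO] Opa] OT].
have HS : H (set_val @` S).
  by change (G ((set_val : embedded A -> V) @^-1` (set_val @` S))); apply: filterS GS => x Sx; exists x.
have nW : nbhs a W by apply: open_nbhs_nbhs; split=> //; rewrite -WO in Opa.
by have [_ [[x Sx <-] Wx]] := ca _ _ HS nW; exists x; split=> //; apply: OT; rewrite -WO.
Qed.

End EmbeddedMaps.

(** * The covering with its lifted metric *)

Section UniversalCovering.
Context {R : realType} {M : smoothSpace R} {d N : nat} (X : model R d N).
Local Notation E := (embedded (mpts X)).

Lemma induced_linear p (a : R) (u v w : tangent E p) :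
  induced_metric (a *: u + v) w = a * induced_metric u w + induced_metric v w.
Proof.
rewrite /induced_metric mulr_sumr -big_split; apply: eq_bigr => k _ /=.
by rewrite -[LHS]/((a * u (coord_fun (mpts X) k) + v (coord_fun (mpts X) k)) * w (coord_fun (mpts X) k)) mulrDl mulrA.
Qed.

Lemma induced_sym p (u v : tangent E p) : induced_metric u v = induced_metric v u.
Proof. by apply: eq_bigr => k _; rewrite mulrC. Qed.

(** Every smooth function on the model is locally the restriction of an ambient one, so by
    [tangent_chain] a vector that kills all coordinate functions is 0. *)
Lemma induced_pos p (u : tangent E p) : u != 0 -> 0 < induced_metric u u.
Proof.
move=> u0; rewrite lt_def; apply/andP; split; last by apply: sumr_ge0 => k _; rewrite -expr2 sqr_ge0.
apply: contra u0 => /eqP s0.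
have z k : u (coord_fun (mpts X) k) = 0.
  have n k' : true -> 0 <= u (coord_fun (mpts X) k') * u (coord_fun (mpts X) k') by move=> _; rewrite -expr2 sqr_ge0.
  have s0' : \sum_k' u (coord_fun (mpts X) k') * u (coord_fun (mpts X) k') = 0 := s0.
  have e : u (coord_fun (mpts X) k) * u (coord_fun (mpts X) k) = 0 by apply: (psumr_eq0P n s0').
  by move/eqP: e; rewrite -expr2 sqrf_eq0 => /eqP.
apply/eqP/val_inj/funext => f; have [F CF fF] := smoothFun_at f p.
have rE (q : E) : rowf (coord_fun (mpts X)) q = set_val q by apply/rowP => k; rewrite mxE.
transitivity (\sum_k 'D_(ebase k) F (rowf (coord_fun (mpts X)) p) * u (coord_fun (mpts X) k)).
  apply: (tangent_chain (model_manifold X) u); first by rewrite rE.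
  by apply: filterS fF => q ->; rewrite rE.
by rewrite big1 // => k _; rewrite z mulr0.
Qed.

Lemma induced_smooth (U V : vfield E) :
  (fun p => induced_metric (vfield_at U p) (vfield_at V p)) \in @smooth_pred R E.
Proof.
have -> : (fun p => induced_metric (vfield_at U p) (vfield_at V p)) =
    (\sum_k U (coord_fun (mpts X) k) * V (coord_fun (mpts X) k) : smoothFun E).
  by apply/funext => p; rewrite smooth_sumE.
exact: smoothFunP.
Qed.

Definition induced_riemannian : riemannian E :=
  Riemannian induced_linear induced_sym induced_pos induced_smooth.

Lemma universal_covering (g : riemannian M) dev (S : smoothSpace R) (h : bilinear_field S) :
  is_manifold d M -> is_connected M -> is_complete g -> developing X g dev -> sc_set (mpts X) ->
  isometric (@induced_metric R N (mpts X)) h ->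
  universal_covering_is d g h /\ (compact (mpts X) -> compact [set: M]).
Proof.
move=> hM hconn complete hdev sc iso.
have [F aF] := global_map hM hconn complete hdev.
have cov := map_covering hM hconn hdev aF; split.
  exists E, induced_riemannian, F; split=> //.
  - by split; [exact: model_manifold|exact: model_connected].
  - exact: sc_simply_connected.
  - have iF := map_isometric hdev aF; move=> p u v; exact (iF p u v).
move=> cX; have -> : [set: M] = F @` [set: E].
  by apply/seteqP; split=> q // _; have [x Fx] := cov.1 q; exists x.
apply: continuous_compact; last exact: compact_embedded.
by apply: continuous_subspaceT => x; exact: (smoothMapP F I).1.
Qed.

End UniversalCovering.

Section ProductDevelopment.
Context {R : realType} {M : smoothSpace R} {d1 N1 d2 N2 : nat} (X1 : isofactor R d1 N1) (X2 : isofactor R d2 N2).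
Hypothesis hM : is_manifold (d1 + d2) M.
Variable g : riemannian M.
Variables (P1 P2 : vfield M -> vfield M).
Hypothesis sum12 : forall X, P1 X + P2 X = X.

(** The developing property for the part of the metric selected by [P]; restriction to smaller open
    sets allows the two factors to share a domain. *)
Definition factor_dev (P : vfield M -> vfield M) d N (X : isofactor R d N) (dev : ('I_N -> smoothFun M) -> set M -> Prop) : Prop :=
  [/\ forall f U, dev f U -> open U /\ forall q, U q -> fpts X (rowf f q) /\
        forall V V' : vfield M, \sum_a V (f a) q * V' (f a) q = gpr g q (P V) V',
      forall p, exists f U, dev f U /\ U p,
      forall f U f' U' q, dev f U -> dev f' U' -> U q -> U' q ->
        exists2 A, factor_iso X A & \forall w \near q, rowf f' w = aff A (rowf f w)
    & forall f U U', dev f U -> open U' -> U' `<=` U -> dev f U'].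

Variables (dev1 : ('I_N1 -> smoothFun M) -> set M -> Prop) (dev2 : ('I_N2 -> smoothFun M) -> set M -> Prop).
Hypothesis hdev1 : factor_dev P1 X1 dev1.
Hypothesis hdev2 : factor_dev P2 X2 dev2.

Definition prod_dev (Psi : 'I_(N1 + N2) -> smoothFun M) (U : set M) : Prop :=
  dev1 (fun i => Psi (lshift N2 i)) U /\ dev2 (fun j => Psi (rshift N1 j)) U.

Lemma prod_developing : developing (prod_model X1 X2) g prod_dev.
Proof.
have [a1 b1 c1 e1] := hdev1; have [a2 b2 c2 e2] := hdev2.
have rowE (Psi : 'I_(N1 + N2) -> smoothFun M) q :
    rowf Psi q = row_mx (rowf (fun i => Psi (lshift N2 i)) q) (rowf (fun j => Psi (rshift N1 j)) q).
  apply/rowP => k; rewrite -(fintype.splitK k) /unsplit; case: (fintype.split k) => l.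
    by rewrite row_mxEl !mxE.
  by rewrite row_mxEr !mxE.
split.
- move=> Psi U [D1 D2]; have [oU H1] := a1 _ _ D1; have [_ H2] := a2 _ _ D2; split=> // q Uq.
  have [p1 s1] := H1 q Uq; have [p2 s2] := H2 q Uq; split.
    by rewrite rowE; split; rewrite ?row_mxKl ?row_mxKr.
  move=> u v; have [V Vu] := tangent_extend hM u; have [V' Vv] := tangent_extend hM v.
  rewrite -Vu -Vv big_split_ord -[LHS]/(gpr g q V V') -[in LHS](sum12 V) gpDl -s1 -s2 //.
- move=> p; have [f1 [U1 [D1 Up1]]] := b1 p; have [f2 [U2 [D2 Up2]]] := b2 p.
  have oU : open (U1 `&` U2) by apply: openI; [exact: (a1 _ _ D1).1|exact: (a2 _ _ D2).1].
  exists (fun k => match fintype.split k with inl i => f1 i | inr j => f2 j end), (U1 `&` U2); split=> //.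
  split.
    rewrite (_ : (fun i => _) = f1); first by apply: e1 D1 oU _ => x [].
    by apply/funext => i; rewrite (unsplitK (inl i)).
  rewrite (_ : (fun j => _) = f2); first by apply: e2 D2 oU _ => x [].
  by apply/funext => j; rewrite (unsplitK (inr j)).
move=> Psi U Psi' U' q [D1 D2] [D1' D2'] Uq Uq'.
have [A1 g1 n1] := c1 _ _ _ _ _ D1 D1' Uq Uq'; have [A2 g2 n2] := c2 _ _ _ _ _ D2 D2' Uq Uq'.
exists (block_iso A1 A2); first by exists A1, A2.
by apply: filterS2 n1 n2 => w h1 h2; rewrite rowE (rowE Psi) aff_block h1 h2.
Qed.

End ProductDevelopment.

(** * The parallel splitting defined by the contact pair *)

Section ContactSplitting.
Context {R : realType} {M : smoothSpace R}.
Variables (m n : nat) (a1 a2 : oneform M) (Z1 Z2 : vfield M) (phi : tensor11 M) (g : riemannian M).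
Hypothesis hM : is_manifold (2 * m + 2 * n + 2) M.
Variable D : vfield M -> vfield M -> vfield M.
Hypothesis LC : levi_civita g D.
Hypothesis lsym : forall W X Y Z,
  D W (curvature D X Y Z) - curvature D (D W X) Y Z - curvature D X (D W Y) Z - curvature D X Y (D W Z) = 0.
Hypothesis mcp : metric_contact_pair m n a1 a2 Z1 Z2 phi g.
Hypothesis nrm : normal_structure a1 a2 Z1 Z2 phi.
Hypothesis dec : decomposable a1 a2 phi.
Local Notation gp := (gpr g).
Local Notation rot := (rotop D).

Let cp : contact_pair m n a1 a2. Proof. by case: mcp => -[]. Qed.
Let deg1 (X : 'I_(m.+1 * 2) -> vfield M) : dpow a1 X = 0. Proof. by case: cp. Qed.
Let deg2 (X : 'I_(n.+1 * 2) -> vfield M) : dpow a2 X = 0. Proof. by case: cp. Qed.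
Let dual (X : vfield M) : riem_app g X Z1 = oneform_app a1 X /\ riem_app g X Z2 = oneform_app a2 X. Proof. by case: mcp. Qed.
Let k1 := killing1 LC mcp nrm.
Let k2 := killing2 LC mcp nrm.
Let x1 := dext_rot1 LC mcp nrm.
Let x2 := dext_rot2 LC mcp nrm.
Let rs := rot_sum LC mcp nrm.
Let sq := rot_square LC mcp nrm.
Let dE : (2 * m + 2 * n + 2 = m * 2 + n * 2 + 2)%N. Proof. by rewrite (mulnC 2 m) (mulnC 2 n). Qed.

Let coordsys (p : M) : exists r W (X : 'I_(2 * m + 2 * n + 2) -> smoothFun M) y E, coord_system p r W X y E.
Proof.
have [r [W [X [y [E [CS _]]]]]] := coord_system_exists hM (@openT M) (I : setT p).
by exists r, W, X, y, E.
Qed.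

Lemma rot_cross (X : vfield M) : rot Z1 (rot Z2 X) = 0 /\ rot Z2 (rot Z1 X) = 0.
Proof.
have H p : vfield_at (rot Z1 (rot Z2 X)) p = 0 /\ vfield_at (rot Z2 (rot Z1 X)) p = 0.
  have [r [W [x [y [E CS]]]]] := coordsys p.
  have [c1 c2] := cross_comps LC k1 k2 x1 x2 rs sq dual deg1 deg2 dec CS dE (comps p x X).
  rewrite -(vfield_at0 p); split; apply: (comps_inj CS).
    by rewrite (comps_rot LC CS k1) (comps_rot LC CS k2) c1; apply/rowP => j; rewrite !mxE.
  by rewrite (comps_rot LC CS k2) (comps_rot LC CS k1) c2; apply/rowP => j; rewrite !mxE.
by split; apply: vfield_eqP => f p; [exact: (congr1 (fun v : tangent M p => v f) (H p).1)|
  exact: (congr1 (fun v : tangent M p => v f) (H p).2)].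
Qed.

Let on := reeb_orthonormal3 mcp.
Let on' p : [/\ gp p Z2 Z2 = 1, gp p Z2 Z1 = 0 & gp p Z1 Z1 = 1].
Proof. by have [h1 h2 h3] := on p; split=> //; rewrite gpC. Qed.
Let rr : [/\ rot Z1 Z1 = 0, rot Z1 Z2 = 0, rot Z2 Z1 = 0 & rot Z2 Z2 = 0] := rot_reeb LC mcp nrm.
Let rr' : [/\ rot Z2 Z2 = 0, rot Z2 Z1 = 0, rot Z1 Z2 = 0 & rot Z1 Z1 = 0]. Proof. by case: rr. Qed.
Let cr' (X : vfield M) : rot Z2 (rot Z1 X) = 0 /\ rot Z1 (rot Z2 X) = 0. Proof. by case: (rot_cross X). Qed.
Let sq' (X : vfield M) : rot Z2 (rot Z2 X + rot Z1 X) + rot Z1 (rot Z2 X + rot Z1 X)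
  = - X + riem_app g X Z2 *: Z2 + riem_app g X Z1 *: Z1.
Proof. by rewrite addrC (addrC (rot Z2 X)) sq -!addrA; congr (_ + _); rewrite addrC. Qed.

Definition proj1 := factor_proj g D Z1.
Definition proj2 := factor_proj g D Z2.

Lemma proj_sum X : proj1 X + proj2 X = X.
Proof.
have := sq X; rewrite !(rotopD LC) (rot_cross X).1 (rot_cross X).2 addr0 add0r => e.
rewrite /proj1 /proj2 /factor_proj addrACA -opprD e !opprD opprK.
by apply: (@gp_inj _ _ g) => p W; rewrite !gpE; ring.
Qed.

Lemma proj_sym1 p X Y : gp p (proj1 X) Y = gp p X (proj1 Y). Proof. exact: (factor_proj_sym k1). Qed.
Lemma proj_sym2 p X Y : gp p (proj2 X) Y = gp p X (proj2 Y). Proof. exact: (factor_proj_sym k2). Qed.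
Lemma proj_par1 X Y : D X (proj1 Y) = proj1 (D X Y).
Proof. exact: (D_factor_proj LC lsym k1 k2 rr rot_cross sq). Qed.
Lemma proj_par2 X Y : D X (proj2 Y) = proj2 (D X Y).
Proof. exact: (D_factor_proj LC lsym k2 k1 rr' cr' sq'). Qed.
Lemma proj_idem1 X : proj1 (proj1 X) = proj1 X.
Proof. by apply: (factor_proj_idem LC (Z' := Z2)) => //; exact: rot_cross. Qed.
Lemma proj_idem2 X : proj2 (proj2 X) = proj2 X.
Proof. by apply: (factor_proj_idem LC (Z' := Z1)). Qed.

Lemma proj_orth21 X : proj2 (proj1 X) = 0.
Proof.
by have e := proj_sum (proj1 X); rewrite proj_idem1 in e; apply: (addrI (proj1 X)); rewrite e addr0.
Qed.
Lemma proj_orth12 X : proj1 (proj2 X) = 0.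
Proof. by apply: (@gp_inj _ _ g) => p W; rewrite gp0l proj_sym1 proj_sym2 proj_orth21 gp0r. Qed.
Lemma proj_curv1 Y W X : curvature D Y W (proj1 X) = riem_app g W (proj1 X) *: proj1 Y - riem_app g Y (proj1 X) *: proj1 W.
Proof. exact: (curvature_factor LC lsym k1 k2 rr rot_cross sq). Qed.
Lemma proj_curv2 Y W X : curvature D Y W (proj2 X) = riem_app g W (proj2 X) *: proj2 Y - riem_app g Y (proj2 X) *: proj2 W.
Proof. exact: (curvature_factor LC lsym k2 k1 rr' cr' sq'). Qed.

Lemma proj_frame1 p : exists b : 'I_(2 * m + 1) -> vfield M, (forall i j, gp p (b i) (b j) = (i == j)%:R) /\
  (forall Y V, gp p (proj1 Y) V = \sum_i gp p Y (b i) * gp p V (b i)).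
Proof.
have [r [W [x [y [E CS]]]]] := coordsys p; rewrite (mulnC 2 m).
exact: (adapted_frame LC k1 k2 x1 x2 rs sq dual deg1 deg2 dec CS dE).
Qed.

Lemma proj_frame2 p : exists b : 'I_(2 * n + 1) -> vfield M, (forall i j, gp p (b i) (b j) = (i == j)%:R) /\
  (forall Y V, gp p (proj2 Y) V = \sum_i gp p Y (b i) * gp p V (b i)).
Proof.
have [r [W [x [y [E CS]]]]] := coordsys p; rewrite (mulnC 2 n).
have rs' (X : vfield M) : tensor11_app phi X = rot Z2 X + rot Z1 X by rewrite rs addrC.
have dual' (X : vfield M) : riem_app g X Z2 = oneform_app a2 X /\ riem_app g X Z1 = oneform_app a1 X by case: (dual X).
have dec' : decomposable a2 a1 phi by move=> q v; case: (dec v).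
have dE' : (2 * m + 2 * n + 2 = n * 2 + m * 2 + 2)%N by rewrite dE (addnC (n * 2)%N).
exact: (adapted_frame LC k2 k1 x2 x1 rs' sq' dual' deg2 deg1 dec' CS dE').
Qed.

(** The second factor has rank 1 and contains both [Z2] and the images of the second rotation, which
    are orthogonal to [Z2] and so vanish. *)
Lemma proj_line : n = 0%N -> forall X, proj2 X = riem_app g X Z2 *: Z2 /\ forall Y, dext a2 X Y = 0.
Proof.
move=> n0 X; have z Y : rot Z2 Y = 0.
  apply: (@gp_inj _ _ g) => p W; rewrite gp0l.
  have [b [bb Pb]] := proj_frame2 p.
  have i0 : 'I_(2 * n + 1) by rewrite n0; exact: ord0.
  have iE i : i = i0 by move: (i) (i0); rewrite n0 => u v; rewrite !ord1.
  have P A B : gp p (proj2 A) B = gp p A (b i0) * gp p B (b i0).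
    by rewrite Pb (bigD1 i0) //= big1 ?addr0 // => i; rewrite (iE i) eqxx.
  have [u1 u2 u3] := on p; have [r1 r2 r3 r4] := rr.
  have PZ B : gp p (proj2 Z2) B = gp p Z2 B.
    rewrite /proj2 /factor_proj gpDl gpNl gpZl -/(gp p Z2 Z2) u3 mul1r r4.
    by rewrite /rotop (D0l LC) oppr0 gp0l subr0.
  have PR B : gp p (proj2 (rot Z2 Y)) B = gp p (rot Z2 Y) B.
    rewrite -[in RHS](proj_sum (rot Z2 Y)) gpDl; suff -> : gp p (proj1 (rot Z2 Y)) B = 0 by rewrite add0r.
    rewrite /proj1 /factor_proj gpDl gpNl gpZl (rot_cross Y).1.
    have -> : rot Z1 0 = 0 by rewrite /rotop (D0l LC) oppr0.
    have e : gp p (rot Z2 Y) Z1 = 0 by rewrite (gp_rotop p k2) r3 gp0r oppr0.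
    by rewrite gp0l subr0 -[X in X * _]/(gp p (rot Z2 Y) Z1) e mul0r.
  have e1 := PZ Z2; rewrite P u3 in e1.
  have e2 := PR Z2; rewrite P (gp_rotop p k2 Y Z2) r4 gp0r oppr0 in e2.
  have b0 : gp p Z2 (b i0) != 0 by apply/eqP => h; move: e1; rewrite h mul0r => /eqP; rewrite eq_sym oner_eq0.
  have e3 : gp p (rot Z2 Y) (b i0) = 0 by move/eqP: e2; rewrite mulf_eq0 (negbTE b0) orbF => /eqP.
  by rewrite -PR P e3 mul0r.
split=> [|Y]; first by rewrite /proj2 /factor_proj !z subr0.
by apply: smoothFun_eqP => p; rewrite x2 z; exact: gp0r.
Qed.

End ContactSplitting.

Section Development.
Context {R : realType} {M : smoothSpace R}.
Variables (m n : nat) (a1 a2 : oneform M) (Z1 Z2 : vfield M) (phi : tensor11 M) (g : riemannian M).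
Hypothesis hM : is_manifold (2 * m + 2 * n + 2) M.
Variable D : vfield M -> vfield M -> vfield M.
Hypothesis LC : levi_civita g D.
Hypothesis lsym : forall W X Y Z,
  D W (curvature D X Y Z) - curvature D (D W X) Y Z - curvature D X (D W Y) Z - curvature D X Y (D W Z) = 0.
Hypothesis mcp : metric_contact_pair m n a1 a2 Z1 Z2 phi g.
Hypothesis nrm : normal_structure a1 a2 Z1 Z2 phi.
Hypothesis dec : decomposable a1 a2 phi.
Local Notation P1 := (proj1 Z1 g D).
Local Notation P2 := (proj2 Z2 g D).

Lemma sphere_factor_dev k (k2 : (2 < k)%N) (P P' : vfield M -> vfield M) :
  (forall p X Y, gpr g p (P X) Y = gpr g p X (P Y)) -> (forall p X Y, gpr g p (P' X) Y = gpr g p X (P' Y)) ->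
  (forall X Y, D X (P Y) = P (D X Y)) -> (forall X Y, D X (P' Y) = P' (D X Y)) ->
  (forall X, P (P X) = P X) -> (forall X, P' (P' X) = P' X) ->
  (forall X, P (P' X) = 0) -> (forall X, P' (P X) = 0) -> (forall X, P X + P' X = X) ->
  (forall Y W X, curvature D Y W (P X) = riem_app g W (P X) *: P Y - riem_app g Y (P X) *: P W) ->
  (forall Y W X, curvature D Y W (P' X) = riem_app g W (P' X) *: P' Y - riem_app g Y (P' X) *: P' W) ->
  (forall p, exists b : 'I_k -> vfield M, (forall i j, gpr g p (b i) (b j) = (i == j)%:R) /\
    (forall Y V, gpr g p (P Y) V = \sum_i gpr g p Y (b i) * gpr g p V (b i))) ->
  factor_dev g P (sphere_factor (R := R) k2) (sphere_dev g D P (k := k)).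
Proof.
move=> s1 s2 p1 p2 i1 i2 o12 o21 sum c1 c2 fr; split.
- move=> f U [oU [Y HY]]; split=> // q Uq; have [v1 v2 v3 v4 [v5 v6 v7]] := HY q Uq; split.
    change (\sum_a rowf f q 0 a ^+ 2 = 1); rewrite -v5.
    by apply: eq_bigr => j _; rewrite mxE.
  by move=> V V'; rewrite -v7; apply: eq_bigr => a _; rewrite !v1.
- by move=> p; exact: (sphere_dev_exists hM LC s1 s2 p1 p2 i1 i2 o12 o21 sum c1 c2 fr).
- move=> f U f' U' q D1 D2 Uq Uq'.
  have [C CC N] := sphere_dev_trans hM LC s1 D1 D2 Uq Uq'.
  exists (C, 0); first by split.
  by apply: filterS N => w; rewrite /aff /= addr0.
by move=> f U U' [oU [Y HY]] oU' UU'; split=> //; exists Y => q /UU'; exact: HY.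
Qed.

Definition line_dev (f : 'I_1 -> smoothFun M) (U : set M) : Prop :=
  open U /\ forall q, U q -> forall V : vfield M, V (f 0) q = oneform_app a2 V q.

Lemma line_factor_dev : n = 0%N -> factor_dev g P2 (@line_factor R) line_dev.
Proof.
move=> n0; have dual X : riem_app g X Z2 = oneform_app a2 X by case: mcp => _ _ H; exact: (H X).2.
have PZ X := (proj_line hM LC mcp nrm dec n0 X).1.
split.
- move=> f U [oU HU]; split=> // q Uq; split=> // V V'.
  rewrite big_ord1 !HU // PZ gpZl dual; congr (_ * _).
  by rewrite gpC -dual.
- move=> p; have [t [U [[oU HU] Up]]] := line_dev_exists hM p (fun X Y => (proj_line hM LC mcp nrm dec n0 X).2 Y).
  by exists (fun=> t), U.
- move=> f U f' U' q [oU HU] [oU' HU'] Uq Uq'.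
  exists (1%:M, rowf f' q - rowf f q); first by split; rewrite // trmx1 mulmx1.
  have : \forall z \near q, (f' 0 - f 0) z = (f' 0 - f 0) q.
    apply: (locally_constant_vfield hM).
    apply: filterS2 (open_nbhs_nbhs (conj oU Uq)) (open_nbhs_nbhs (conj oU' Uq')) => z Uz Uz' V.
    by rewrite vfield_addr vfield_opp smooth_addE smooth_oppE HU // HU' // subrr.
  apply: filterS => z; rewrite !smooth_addE !smooth_oppE => e.
  apply/rowP => j; rewrite /aff /= mulmx1 ord1 !mxE; lra.
by move=> f U U' [oU HU] oU' UU'; split=> // q /UU'; exact: HU.
Qed.

End Development.

Lemma compact_sphere_product {R : realType} k1 k2 : compact (block_set (unit_sphere R k1) (unit_sphere R k2)).
Proof.
have cl : closed (block_set (unit_sphere R k1) (unit_sphere R k2)).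
  have closed_sphere N k (L : 'rV[R]_N -> 'rV[R]_k.+1) : continuous L -> closed (L @^-1` unit_sphere R k).
    move=> cL; have -> : L @^-1` unit_sphere R k = (fun x => dot (L x) (L x)) @^-1` [set 1].
      by apply/seteqP; split=> x; [move/sphereE|move=> h; apply/sphereE].
    by apply: closed_comp => [x _|]; [exact: (continuous_dot cL cL)|exact: closed_eq].
  apply: closedI.
    exact: (closed_sphere _ _ _ (@lsubmx_continuous R k1.+1 k2.+1)).
  exact: (closed_sphere _ _ _ (@rsubmx_continuous R k1.+1 k2.+1)).
apply: subclosed_compact cl (@compact_sup_ball R _ 0 1) _ => x [h1 h2] /=.
have le1 k (v : 'rV[R]_k.+1) j : unit_sphere R k v -> `|v 0 j| <= 1.
  move=> h; rewrite -(expr_le1 (n := 2)) // -normrX ger0_norm ?sqr_ge0 // -h (bigD1 j) //= lerDl.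
  by apply: sumr_ge0 => i _; exact: sqr_ge0.
rewrite subr0; apply: row_normP => // j; rewrite -(fintype.splitK j) /unsplit; case: (fintype.split j) => l.
  by have := le1 _ _ l h1; rewrite mxE.
by have := le1 _ _ l h2; rewrite mxE.
Qed.

Theorem theorem3p1 (R : realType) (m n : nat) (M : smoothSpace R)
    (a1 a2 : oneform M) (Z1 Z2 : vfield M) (phi : tensor11 M)
    (g : riemannian M) :
  (1 <= m)%N ->
  is_manifold (2 * m + 2 * n + 2) M -> is_connected M ->
  metric_contact_pair m n a1 a2 Z1 Z2 phi g ->
  normal_structure a1 a2 Z1 Z2 phi ->
  decomposable a1 a2 phi ->
  is_complete g -> locally_symmetric g ->
  (universal_covering_is (2 * m + 2 * n + 2) g
     (prod_metric (sphere_metric R (2 * m + 1)) (sphere_metric R (2 * n + 1)))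
   /\ compact [set: M])
  \/ universal_covering_is (2 * m + 2 * n + 2) g
       (prod_metric (sphere_metric R (2 * m + 1)) (line_metric R)).
Proof.
move=> m1 hM hconn mcp nrm dec complete [D LC lsym].
have k1 : (2 < 2 * m + 1)%N by rewrite addn1 ltnS; exact: (leq_mul (leqnn 2) m1).
have s1 := proj_sym1 LC mcp nrm; have s2 := proj_sym2 LC mcp nrm.
have p1 := proj_par1 hM LC lsym mcp nrm dec; have p2 := proj_par2 hM LC lsym mcp nrm dec.
have i1 := proj_idem1 hM LC mcp nrm dec; have i2 := proj_idem2 hM LC mcp nrm dec.
have o12 := proj_orth12 hM LC mcp nrm dec; have o21 := proj_orth21 hM LC mcp nrm dec.
have sum := proj_sum hM LC mcp nrm dec.
have c1 := proj_curv1 hM LC lsym mcp nrm dec; have c2 := proj_curv2 hM LC lsym mcp nrm dec.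
have f1 := proj_frame1 hM LC mcp nrm dec; have f2 := proj_frame2 hM LC mcp nrm dec.
have d1 := sphere_factor_dev hM LC k1 s1 s2 p1 p2 i1 i2 o12 o21 sum c1 c2 f1.
(* For n = 0 the second factor is one-dimensional and its simply connected model is the line; for n
   >= 1 both spheres have dimension at least 3, as [sphere_factor] requires. *)
have [n0|n0] := posnP n.
  right; have d2 := line_factor_dev hM LC mcp nrm dec n0.
  have dd : (2 * m + 2 * n + 2 = (2 * m + 1) + 1)%N by rewrite n0 addn0 -addnA.
  rewrite dd in hM *.
  have dev := prod_developing hM sum d1 d2.
  apply: (universal_covering hM hconn complete dev _ _).1.
    by apply: sc_block_set; [apply: sc_sphere; exact: ltnW|exact: sc_setT].
  exact: block_isometric.
left; have k2 : (2 < 2 * n + 1)%N by rewrite addn1 ltnS; exact: (leq_mul (leqnn 2) n0).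
have sum' X : proj2 Z2 g D X + proj1 Z1 g D X = X by rewrite addrC; exact: sum.
have d2 := sphere_factor_dev hM LC k2 s2 s1 p2 p1 i2 i1 o21 o12 sum' c2 c1 f2.
have dd : (2 * m + 2 * n + 2 = (2 * m + 1) + (2 * n + 1))%N by rewrite addnACA.
rewrite dd in hM *.
have dev := prod_developing hM sum d1 d2.
have sc : sc_set (block_set (unit_sphere R (2 * m + 1)) (unit_sphere R (2 * n + 1))).
  by apply: sc_block_set; apply: sc_sphere; exact: ltnW.
have [cov comp] := universal_covering hM hconn complete dev sc (block_isometric _ _).
split; first exact: cov.
by apply: comp; exact: compact_sphere_product.
Qed.
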